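(* Let $X_\epsilon$ be the perturbed Duffing oscillator $\dot x=H_y+\epsilon f(x,y,\epsilon)$, $\dot y=-H_x+\epsilon g(x,y,\epsilon)$, $H=\frac{y^2}{2}-\frac{x^2}{2}+\frac{x^4}{4}$, with $f,g$ cubic polynomials in $(x,y)$ with real coefficients depending analytically on $\epsilon$. Suppose that its first Melnikov function $M_1$ associated with the exterior period annulus vanishes identically, and let $$M_2(h)=(4h+1)^{-1}\left[(\alpha_0+4\alpha_1h+\alpha_2h^2)I_0(h)+(\beta_0+4h\beta_1)I_2(h)\right],$$ with real constants $\alpha_0,\alpha_1,\alpha_2,\beta_0,\beta_1$, be the second Melnikov function associated with this annulus, assumed not identically zero. Then the analytic continuation of $M_2$ has at most four zeros in the complex domain $\mathcal{D}=\mathbb{C}\setminus(-\infty,0]$.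
   Context: Exterior period annulus: the family of ovals $\gamma(h)=\{H=h\}$, $h\in(0,+\infty)$, oriented by the flow of $X_0$. Set $I_i(h)=\oint_{\gamma(h)}x^iy\,dx$. The functions $I_i$ extend to single-valued analytic functions on $\mathcal{D}=\mathbb{C}\setminus(-\infty,0]$. The Melnikov functions are the coefficients of the displacement map $P(h,\epsilon)-h=\epsilon M_1(h)+\epsilon^2M_2(h)+\cdots$, where $P$ is the first return map of $X_\epsilon$ on a cross-section parameterized by $h=H$. *)

(* Defs.v *)
(* Stdlib world: concrete reals, with Coquelicot. *)
From Stdlib Require Export Reals List.
From Coquelicot Require Export Coquelicot.

Open Scope R_scope.

Definition H (x y : R) : R := y ^ 2 / 2 - x ^ 2 / 2 + x ^ 4 / 4.

Definition H_x (x y : R) : R := Derive (fun u => H u y) x.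
Definition H_y (x y : R) : R := Derive (fun v => H x v) y.

(* Only the germ at 0 matters: the values of [c] far from 0 are arbitrary. *)
Definition analytic_at_0 (c : R -> R) : Prop :=
  exists (u : nat -> R) (r : R), 0 < r /\
    forall e : R, Rabs e < r -> is_pseries u e (c e).

(* Degree at most three in (x, y); [c i j] is the coefficient of x^i y^j. *)
Definition cubic_perturbation (f : R -> R -> R -> R) : Prop :=
  exists c : nat -> nat -> R -> R,
    (forall i j, (i + j <= 3)%nat -> analytic_at_0 (c i j)) /\
    forall x y e : R,
      f x y e =
        sum_n (fun i => sum_n (fun j => c i j e * x ^ i * y ^ j) (3 - i)) 3.

(* Derivatives are two-sided at 0 and T as well; x and y are arbitrary outside
   a neighbourhood of [0, T], so no global existence is required. *)
Definition integral_curve (U V : R -> R -> R) (x y : R -> R) (T : R) : Prop :=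
  forall t : R, 0 <= t <= T ->
    is_derive x t (U (x t) (y t)) /\ is_derive y t (V (x t) (y t)).

Definition perturbed_curve (f g : R -> R -> R -> R) (e : R) :
    (R -> R) -> (R -> R) -> R -> Prop :=
  integral_curve (fun x y => H_y x y + e * f x y e)
                 (fun x y => - H_x x y + e * g x y e).

(* For h > 0 the level set {H = h} is a single oval, so a closed orbit of the
   Hamiltonian field on it, run through exactly once, parametrizes the whole
   oval with the orientation of the flow. *)
Definition oval_param (h : R) (x y : R -> R) (T : R) : Prop :=
  0 < T /\
  integral_curve H_y (fun u v => - H_x u v) x y T /\
  H (x 0) (y 0) = h /\
  x T = x 0 /\ y T = y 0 /\
  forall t : R, 0 < t < T -> ~ (x t = x 0 /\ y t = y 0).

(* [v] is the integral of x^i y dx along the oval {H = h}. *)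
Definition is_oval_integral (i : nat) (h v : R) : Prop :=
  exists (x y : R -> R) (T : R),
    oval_param h x y T /\
    is_RInt (fun t => x t ^ i * y t * Derive x t) 0 T v.

(* The half-line x = 0, y > 0 is transverse to the Hamiltonian field (x' = y
   there) and meets each exterior oval exactly once; on it H = y^2/2, so H is a
   coordinate with range (0, +oo). *)
Definition on_section (x y : R) : Prop := x = 0 /\ 0 < y.

(* [p] is the value at [h] of the first return map of the perturbed field with
   parameter [e]. *)
Definition first_return (f g : R -> R -> R -> R) (e h p : R) : Prop :=
  exists (x y : R -> R) (T : R),
    0 < T /\
    perturbed_curve f g e x y T /\
    on_section (x 0) (y 0) /\ H (x 0) (y 0) = h /\
    on_section (x T) (y T) /\ H (x T) (y T) = p /\
    forall t : R, 0 < t < T -> ~ on_section (x t) (y t).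

(* P(h,e) - h = e M_1(h) + e^2 M_2(h) + ..., for |e| < d with d depending
   on h; [M 0] plays no role. *)
Definition melnikov_functions (f g : R -> R -> R -> R) (M : nat -> R -> R) :
    Prop :=
  forall h : R, 0 < h ->
    exists d : R, 0 < d /\
      forall e : R, Rabs e < d ->
        exists p : R, first_return f g e h p /\
          is_series (fun k => e ^ S k * M (S k) h) (p - h).

(* The complex plane cut along (-oo, 0]. *)
Definition slit_plane (z : C) : Prop := ~ (Im z = 0 /\ Re z <= 0).

Definition C_differentiable (F : C -> C) (z : C) : Prop :=
  @ex_derive C_AbsRing C_NormedModule F z.

Definition analytic_continuation (m : R -> R) (F : C -> C) : Prop :=
  (forall z : C, slit_plane z -> C_differentiable F z) /\
  (forall h : R, 0 < h -> F (RtoC h) = RtoC (m h)).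

Definition vanishes_to_order (F : C -> C) (z : C) (m : nat) : Prop :=
  exists (G : C -> C) (r : R), 0 < r /\
    forall w : C, Cmod (w - z) < r ->
      C_differentiable G w /\ F w = (Cpow (w - z) m * G w)%C.

(* At most [n] zeros in [D], counted with multiplicity. *)
Definition at_most_zeros (n : nat) (D : C -> Prop) (F : C -> C) : Prop :=
  forall l : list (C * nat),
    NoDup (map fst l) ->
    (forall z m, In (z, m) l -> D z /\ vanishes_to_order F z m) ->
    (list_sum (map snd l) <= n)%nat.

(* Main.v *)
Require Import Defs.
From Stdlib Require Import Lra Lia Psatz FunctionalExtensionality ClassicalEpsilon.
From Stdlib Require FinFun.

(** The second Melnikov function is determined well enough to be continued
explicitly, and the continuation is studied by Cauchy's theorem.

_Form of the function_. Along a curve of the perturbed field the energy changes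
by [e] times the integral of [g dx - f dy]. On the ovals most monomials of this
form are exact: modulo total differentials and multiples of [dH] it is a
combination of [y dx], [x ^ 2 y dx] and [y ^ 3 dx]
([is_derive_primitive]). For [y ^ 2 dx] and [x y ^ 2 dx] this is the energy
relation; for [x y dx] it holds because in the plane of [(x ^ 2 - 1, sqrt 2 y)]
every oval lies on the circle of radius [S = sqrt (1 + 4 h)], and [x y dx] is
given by the polar angle there. As [dH] along a perturbed curve is [e] times
the rate of the energy, [rate_decomposition] expresses the displacement exactly
up to second order. To pass to the limit, integrals over the
perturbed return must tend to integrals over the oval ([average_limit]); for this the
curve is followed in the coordinates level and angle, with
[x = sqrt (1 + S) cos t] on the oval ([return_follows_oval]).

At first order the limit is a combination of three integrals that are linearly
independent as functions of [h] ([first_order_independent]), so [M_1 = 0] makes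
their coefficients vanish at [e = 0]. At second order there remain averages of
monomials, some of them weighted by the polar angle, and recursions between moments
reduce all of them to [mu20] and [mu02], the averages of [x ^ 2] and [y ^ 2]: the
second Melnikov function is [P mu02 + V mu20] with [P] affine
and [V] quadratic in [h] ([second_melnikov_in_module]).

_Zeros_. With [s = sqrt (1 + 4 z)] these functions continue to
[(1 + s) (P (z) D (s) + V (z) N (s))], where [D] and [N] are integrals over the
angle of a root and of an inverse root that are affine in [s] under the root.
For [Im s > 0] the root lies in the first quadrant; hence [D] has no zero and
[kappa = N / D] has negative imaginary part ([period_ratio_im]). Suppose that at
least five zeros are counted in the closed upper half plane, a nonreal zero being
counted together with its conjugate, and let [L] be the product of the
corresponding linear factors. Then [Phi = V (P + V kappa) / L] is
holomorphic in the upper half plane, real on the positive half-line, and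
integrable at zero and at infinity, because [L] has degree at least five. So the
imaginary part of its integral along the upper edge of the cut is zero. But there [V], [P]
and [L] are real and [L] has a constant sign, so that this imaginary part is the integral of
[V ^ 2 Im kappa / L], which does not vanish unless [V = 0]
([contour_contradiction]); and if [V = 0], the only zero is that of [P]
([affine_case]). Thus at most four zeros are counted above the real axis; the
same holds for the reflected function, and the two counts together contain every
zero twice ([period_form_zeros]). *)

(** * Differentiation in the complex plane *)

Lemma derivable_continuous_R (f : R -> R) (t : R) : ex_derive f t -> continuous f t.
Proof. apply (ex_derive_continuous (K := R_AbsRing) (V := R_NormedModule)). Qed.

Lemma continuous_scal_R (k : R) (f : R -> R) (t : R) : continuous f t -> continuous (fun u => k * f u) t.
Proof. apply (continuous_scal_r (K := R_AbsRing) (V := R_NormedModule)). Qed.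

Lemma ex_RInt_continuous_R (f : R -> R) (a b : R) :
  (forall t, Rmin a b <= t <= Rmax a b -> continuous f t) -> ex_RInt f a b.
Proof. apply (ex_RInt_continuous (V := R_CompleteNormedModule)). Qed.

(** The derivative with explicit remainder; it agrees with the derivative of the normed module [C]. *)
Definition cderiv (f : C -> C) (z l : C) : Prop :=
  forall eps, 0 < eps -> exists del, 0 < del /\
    forall w, Cmod (w - z) < del ->
      Cmod (f w - f z - l * (w - z)) <= eps * Cmod (w - z).

Lemma cderiv_is_derive f z l :
  cderiv f z l <-> @is_derive C_AbsRing C_NormedModule f z l.
Proof.
  split.
  - intros Hd. split.
    + apply (is_linear_scal_l (K := C_AbsRing) (V := C_NormedModule)).
    + intros x Hx. apply (is_filter_lim_locally_unique (K := C_AbsRing)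
        (V := AbsRing_NormedModule C_AbsRing)) in Hx. rewrite <- Hx.
      intros eps. destruct (Hd eps (cond_pos eps)) as (del & Hdel & H1).
      exists (mkposreal del Hdel). intros w Hw.
      eapply Rle_trans; [right|exact (H1 w Hw)]. apply (f_equal Cmod).
      unfold minus, plus, opp, scal; simpl. unfold mult; simpl. ring.
  - intros [_ Hd] eps Heps.
    specialize (Hd z (fun P H => H) (mkposreal eps Heps)).
    destruct Hd as [del Hdel]. exists del. split; [apply cond_pos|].
    intros w Hw. eapply Rle_trans; [right|exact (Hdel w Hw)].
    apply (f_equal Cmod).
    unfold minus, plus, opp, scal; simpl. unfold mult; simpl. ring.
Qed.

Lemma C_differentiable_iff f z : C_differentiable f z <-> exists l, cderiv f z l.
Proof.
  split; intros [l Hl]; exists l; apply cderiv_is_derive; exact Hl.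
Qed.

Lemma C_differentiable_locally f g z r : 0 < r ->
  (forall w, Cmod (w - z) < r -> f w = g w) ->
  C_differentiable f z -> C_differentiable g z.
Proof.
  intros Hr Hfg Hf. apply C_differentiable_iff in Hf. destruct Hf as [l Hl].
  apply C_differentiable_iff. exists l. intros eps Heps.
  destruct (Hl eps Heps) as (del & Hdel & H1).
  exists (Rmin del r). split; [apply Rmin_glb_lt; assumption|].
  intros w Hw. pose proof (Rmin_l del r). pose proof (Rmin_r del r).
  rewrite <- !Hfg; [apply H1; lra| |lra].
  replace (z - z)%C with (RtoC 0) by ring. rewrite Cmod_0. exact Hr.
Qed.

Lemma cderiv_lipschitz f z l : cderiv f z l ->
  exists del, 0 < del /\ forall w, Cmod (w - z) < del ->
    Cmod (f w - f z) <= (Cmod l + 1) * Cmod (w - z).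
Proof.
  intros Hl. destruct (Hl 1 Rlt_0_1) as (del & Hdel & H1).
  exists del. split; [exact Hdel|]. intros w Hw. specialize (H1 w Hw).
  replace (f w - f z)%C with ((f w - f z - l * (w - z)) + l * (w - z))%C by ring.
  eapply Rle_trans; [apply Cmod_triangle|]. rewrite Cmod_mult. lra.
Qed.

Lemma C_differentiable_continuous f z : C_differentiable f z ->
  forall eps, 0 < eps -> exists del, 0 < del /\
    forall w, Cmod (w - z) < del -> Cmod (f w - f z) < eps.
Proof.
  intros Hf eps Heps. apply C_differentiable_iff in Hf. destruct Hf as [l Hl].
  destruct (cderiv_lipschitz f z l Hl) as (del & Hdel & H1).
  pose proof (Cmod_ge_0 l).
  exists (Rmin del (eps / (Cmod l + 1))). split.
  { apply Rmin_glb_lt; [exact Hdel|]. apply Rdiv_lt_0_compat; lra. }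
  intros w Hw. pose proof (Rmin_l del (eps / (Cmod l + 1))).
  pose proof (Rmin_r del (eps / (Cmod l + 1))).
  eapply Rle_lt_trans; [apply H1; lra|].
  apply Rlt_le_trans with ((Cmod l + 1) * (eps / (Cmod l + 1))).
  - apply Rmult_lt_compat_l; lra.
  - right. field. lra.
Qed.

Lemma C_differentiable_const c z : C_differentiable (fun _ => c) z.
Proof.
  apply C_differentiable_iff. exists 0%C. intros eps Heps. exists 1. split; [lra|].
  intros w _. replace (c - c - 0 * (w - z))%C with (RtoC 0) by ring.
  rewrite Cmod_0. apply Rmult_le_pos; [lra|apply Cmod_ge_0].
Qed.

Lemma C_differentiable_id z : C_differentiable (fun w => w) z.
Proof.
  apply C_differentiable_iff. exists 1%C. intros eps Heps. exists 1. split; [lra|].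
  intros w _. replace (w - z - 1 * (w - z))%C with (RtoC 0) by ring.
  rewrite Cmod_0. apply Rmult_le_pos; [lra|apply Cmod_ge_0].
Qed.

Lemma C_differentiable_plus f g z : C_differentiable f z -> C_differentiable g z ->
  C_differentiable (fun w => f w + g w)%C z.
Proof.
  intros Hf Hg. apply (ex_derive_plus (K := C_AbsRing) (V := C_NormedModule) f g z Hf Hg).
Qed.

Lemma C_differentiable_minus f g z : C_differentiable f z -> C_differentiable g z ->
  C_differentiable (fun w => f w - g w)%C z.
Proof.
  intros Hf Hg. apply (ex_derive_minus (K := C_AbsRing) (V := C_NormedModule) f g z Hf Hg).
Qed.

Lemma C_differentiable_comp f g z : C_differentiable f (g z) -> C_differentiable g z ->
  C_differentiable (fun w => f (g w)) z.
Proof.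
  intros Hf Hg.
  apply C_differentiable_iff in Hf. destruct Hf as [l Hl].
  apply C_differentiable_iff in Hg. destruct Hg as [k Hk].
  apply C_differentiable_iff. exists (l * k)%C. intros eps Heps.
  destruct (cderiv_lipschitz g z k Hk) as (d1 & Hd1 & H1).
  pose proof (Cmod_ge_0 l). pose proof (Cmod_ge_0 k).
  set (e1 := eps / (2 * (Cmod k + 1))). set (e2 := eps / (2 * (Cmod l + 1))).
  assert (He1 : 0 < e1) by (unfold e1; apply Rdiv_lt_0_compat; lra).
  assert (He2 : 0 < e2) by (unfold e2; apply Rdiv_lt_0_compat; lra).
  destruct (Hl e1 He1) as (d2 & Hd2 & H2).
  destruct (Hk e2 He2) as (d3 & Hd3 & H3).
  assert (Hq : 0 < d2 / (Cmod k + 1)) by (apply Rdiv_lt_0_compat; lra).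
  exists (Rmin (Rmin d1 d3) (d2 / (Cmod k + 1))). split.
  { repeat apply Rmin_glb_lt; assumption. }
  intros w Hw.
  pose proof (Rmin_l (Rmin d1 d3) (d2 / (Cmod k + 1))).
  pose proof (Rmin_r (Rmin d1 d3) (d2 / (Cmod k + 1))).
  pose proof (Rmin_l d1 d3). pose proof (Rmin_r d1 d3).
  specialize (H1 w ltac:(lra)). specialize (H3 w ltac:(lra)).
  assert (Hg : Cmod (g w - g z) < d2).
  { eapply Rle_lt_trans; [exact H1|].
    apply Rlt_le_trans with ((Cmod k + 1) * (d2 / (Cmod k + 1))).
    - apply Rmult_lt_compat_l; lra.
    - right. field. lra. }
  specialize (H2 (g w) Hg).
  replace (f (g w) - f (g z) - l * k * (w - z))%C with
    ((f (g w) - f (g z) - l * (g w - g z)) + l * (g w - g z - k * (w - z)))%C by ring.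
  eapply Rle_trans; [apply Cmod_triangle|]. rewrite Cmod_mult.
  pose proof (Cmod_ge_0 (w - z)).
  assert (E1 : e1 * (Cmod k + 1) = eps / 2) by (unfold e1; field; lra).
  assert (E2 : (Cmod l + 1) * e2 = eps / 2) by (unfold e2; field; lra).
  assert (e1 * Cmod (g w - g z) <= eps / 2 * Cmod (w - z)) by (rewrite <- E1; nra).
  assert (Cmod l * Cmod (g w - g z - k * (w - z)) <= eps / 2 * Cmod (w - z)).
  { rewrite <- E2. apply Rle_trans with (Cmod l * (e2 * Cmod (w - z))); [nra|].
    assert (0 <= e2 * Cmod (w - z)) by nra. nra. }
  lra.
Qed.

Lemma C_differentiable_square z : C_differentiable (fun w => w * w)%C z.
Proof.
  apply C_differentiable_iff. exists (z + z)%C. intros eps Heps. exists eps.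
  split; [exact Heps|]. intros w Hw.
  replace (w * w - z * z - (z + z) * (w - z))%C with ((w - z) * (w - z))%C by ring.
  rewrite Cmod_mult. apply Rmult_le_compat_r; [apply Cmod_ge_0|lra].
Qed.

Lemma C_differentiable_scal c f z : C_differentiable f z ->
  C_differentiable (fun w => c * f w)%C z.
Proof.
  intros Hf. apply (C_differentiable_comp (fun u => c * u)%C f); [|exact Hf].
  apply C_differentiable_iff. exists c. intros eps Heps. exists 1. split; [lra|].
  intros w _. replace (c * w - c * f z - c * (w - f z))%C with (RtoC 0) by ring.
  rewrite Cmod_0. apply Rmult_le_pos; [lra|apply Cmod_ge_0].
Qed.

(** Squares and linear combinations suffice, by polarization. *)
Lemma C_differentiable_mult f g z : C_differentiable f z -> C_differentiable g z ->
  C_differentiable (fun w => f w * g w)%C z.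
Proof.
  intros Hf Hg.
  apply (C_differentiable_locally
    (fun w => / 4 * ((f w + g w) * (f w + g w) - (f w - g w) * (f w - g w)))%C _ z 1).
  - lra.
  - intros w _. field.
  - apply C_differentiable_scal. apply C_differentiable_minus.
    + apply (C_differentiable_comp (fun u => u * u)%C (fun w => f w + g w)%C).
      * apply C_differentiable_square.
      * apply C_differentiable_plus; assumption.
    + apply (C_differentiable_comp (fun u => u * u)%C (fun w => f w - g w)%C).
      * apply C_differentiable_square.
      * apply C_differentiable_minus; assumption.
Qed.

Lemma C_differentiable_pow f z n : C_differentiable f z ->
  C_differentiable (fun w => f w ^ n)%C z.
Proof.
  intros Hf. induction n as [|n IH].
  - exact (C_differentiable_const 1%C z).
  - apply (C_differentiable_mult f (fun w => f w ^ n)%C); assumption.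
Qed.

Lemma C_differentiable_Cinv (z : C) : z <> 0%C -> C_differentiable Cinv z.
Proof.
  intros Hz. apply C_differentiable_iff. exists (- / (z * z))%C. intros eps Heps.
  assert (Hm : 0 < Cmod z) by (apply Cmod_gt_0; exact Hz).
  set (m := Cmod z) in *.
  assert (Hq : 0 < eps * (m * m * m) / 2).
  { apply Rdiv_lt_0_compat; [|lra]. repeat apply Rmult_lt_0_compat; lra. }
  exists (Rmin (m / 2) (eps * (m * m * m) / 2)).
  split; [apply Rmin_glb_lt; lra|].
  intros w Hw.
  pose proof (Rmin_l (m / 2) (eps * (m * m * m) / 2)).
  pose proof (Rmin_r (m / 2) (eps * (m * m * m) / 2)).
  assert (Hwm : m / 2 <= Cmod w).
  { pose proof (Cmod_triangle w (z - w)) as T.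
    replace (w + (z - w))%C with z in T by ring. fold m in T.
    replace (z - w)%C with (- (w - z))%C in T by ring. rewrite Cmod_opp in T. lra. }
  assert (Hw0 : w <> 0%C) by (apply Cmod_gt_0; lra).
  replace (/ w - / z - - / (z * z) * (w - z))%C with
    ((w - z) * (w - z) / (w * (z * z)))%C by (field; split; assumption).
  assert (Hzz : (z * z)%C <> 0%C) by (apply Cmult_neq_0; assumption).
  rewrite Cmod_div by (apply Cmult_neq_0; assumption).
  rewrite !Cmod_mult. fold m. pose proof (Cmod_ge_0 (w - z)).
  unfold Rdiv. rewrite Rmult_assoc, (Rmult_comm eps).
  apply Rmult_le_compat_l; [assumption|].
  assert (P : 0 < Cmod w * (m * m)) by (repeat apply Rmult_lt_0_compat; lra).
  apply Rmult_le_reg_r with (Cmod w * (m * m)); [exact P|].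
  rewrite Rmult_assoc, Rinv_l by lra. rewrite Rmult_1_r.
  assert (0 < m * m) by nra. nra.
Qed.

Lemma C_differentiable_inv f z : C_differentiable f z -> f z <> 0%C ->
  C_differentiable (fun w => / f w)%C z.
Proof.
  intros Hf H0. apply (C_differentiable_comp Cinv f); [|exact Hf].
  apply C_differentiable_Cinv. exact H0.
Qed.

Lemma C_differentiable_div f g z : C_differentiable f z -> C_differentiable g z ->
  g z <> 0%C -> C_differentiable (fun w => f w / g w)%C z.
Proof.
  intros Hf Hg H0. apply (C_differentiable_mult f (fun w => / g w)%C); [exact Hf|].
  apply C_differentiable_inv; assumption.
Qed.

Lemma im_le_Cmod (c : C) : Rabs (Im c) <= Cmod c.
Proof.
  eapply Rle_trans; [|apply Rmax_Cmod]. apply Rmax_r.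
Qed.

Lemma Cmod_le_re_im (c : C) : Cmod c <= Rabs (Re c) + Rabs (Im c).
Proof.
  pose proof (Cmod2_alt c). pose proof (Cmod_ge_0 c).
  pose proof (Rabs_pos (Re c)). pose proof (Rabs_pos (Im c)).
  pose proof (pow2_abs (Re c)). pose proof (pow2_abs (Im c)).
  nra.
Qed.


(** * Cauchy's theorem on rectangles *)

(** Differentiability of [P dx + Q dy] at a point together with closedness there: the same number [p2] is the derivative of [P] along [y] and of [Q] along [x]. *)
Definition closed_form_at (P Q : R -> R -> R) (x y : R) : Prop :=
  exists p1 p2 q2 : R, forall eps, 0 < eps -> exists del, 0 < del /\
    forall u v, Rabs (u - x) < del -> Rabs (v - y) < del ->
      Rabs (P u v - P x y - p1 * (u - x) - p2 * (v - y))
        <= eps * (Rabs (u - x) + Rabs (v - y)) /\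
      Rabs (Q u v - Q x y - p2 * (u - x) - q2 * (v - y))
        <= eps * (Rabs (u - x) + Rabs (v - y)).

Definition rect_int (P Q : R -> R -> R) (a b c d : R) : R :=
  RInt (fun x => P x c - P x d) a b + RInt (fun y => Q b y - Q a y) c d.

Lemma continuous_eps (f : R -> R) (x : R) :
  (forall eps, 0 < eps -> exists del, 0 < del /\
     forall u, Rabs (u - x) < del -> Rabs (f u - f x) < eps) ->
  continuous f x.
Proof.
  intros Hf. apply continuity_pt_filterlim. intros eps Heps.
  destruct (Hf eps Heps) as [del [Hd H1]]. exists del. split; [exact Hd|].
  intros u [_ Hu]. apply H1. exact Hu.
Qed.

Lemma closed_form_continuous P Q x y : closed_form_at P Q x y ->
  forall eps, 0 < eps -> exists del, 0 < del /\
    forall u v, Rabs (u - x) < del -> Rabs (v - y) < del ->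
      Rabs (P u v - P x y) < eps /\ Rabs (Q u v - Q x y) < eps.
Proof.
  intros (p1 & p2 & q2 & Hd) eps Heps.
  destruct (Hd 1 Rlt_0_1) as (d1 & Hd1 & H1).
  set (K := 3 + Rabs p1 + 2 * Rabs p2 + Rabs q2).
  assert (HK : 0 < K) by (unfold K; pose proof (Rabs_pos p1);
    pose proof (Rabs_pos p2); pose proof (Rabs_pos q2); lra).
  exists (Rmin d1 (eps / K)). split.
  { apply Rmin_glb_lt; [exact Hd1|]. apply Rdiv_lt_0_compat; assumption. }
  intros u v Hu Hv.
  pose proof (Rmin_l d1 (eps / K)) as Ml. pose proof (Rmin_r d1 (eps / K)) as Mr.
  destruct (H1 u v) as [HP HQ]; try lra.
  assert (Ku : Rabs (u - x) * K < eps).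
  { apply Rlt_le_trans with (eps / K * K); [|right; field; lra].
    apply Rmult_lt_compat_r; lra. }
  assert (Kv : Rabs (v - y) * K < eps).
  { apply Rlt_le_trans with (eps / K * K); [|right; field; lra].
    apply Rmult_lt_compat_r; lra. }
  pose proof (Rabs_pos (u - x)). pose proof (Rabs_pos (v - y)).
  set (m := Rmax (Rabs (u - x)) (Rabs (v - y))).
  assert (Hm : m * K < eps) by (unfold m; apply Rmax_case; assumption).
  assert (Rabs (u - x) <= m) by apply Rmax_l.
  assert (Rabs (v - y) <= m) by apply Rmax_r.
  assert (G : forall s t, Rabs (s * t) = Rabs s * Rabs t) by apply Rabs_mult.
  assert (F : forall A p q, Rabs (A - p * (u - x) - q * (v - y)) <=
     1 * (Rabs (u - x) + Rabs (v - y)) -> Rabs A <= m * (2 + Rabs p + Rabs q)).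
  { intros A p q HA.
    replace A with ((A - p * (u - x) - q * (v - y)) + (p * (u - x) + q * (v - y))) by ring.
    eapply Rle_trans; [apply Rabs_triang|].
    pose proof (Rabs_triang (p * (u - x)) (q * (v - y))) as T. rewrite !G in T.
    pose proof (Rabs_pos p). pose proof (Rabs_pos q). nra. }
  apply F in HP. apply F in HQ.
  pose proof (Rabs_pos p1). pose proof (Rabs_pos p2). pose proof (Rabs_pos q2).
  unfold K in Hm. split; nra.
Qed.

Lemma RInt_near_const (f : R -> R) (a b k M : R) :
  a <= b -> (forall x, a <= x <= b -> continuous f x) ->
  (forall x, a <= x <= b -> Rabs (f x - k) <= M) ->
  Rabs (RInt f a b - k * (b - a)) <= M * (b - a).
Proof.
  intros Hab Hc HM.
  assert (Hex : ex_RInt f a b).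
  { apply ex_RInt_continuous_R.
    intros z. rewrite Rmin_left, Rmax_right by lra. apply Hc. }
  assert (Hex1 : ex_RInt (fun _ : R => k - M) a b) by apply ex_RInt_const.
  assert (Hex2 : ex_RInt (fun _ : R => k + M) a b) by apply ex_RInt_const.
  pose proof (RInt_le (fun _ => k - M) f a b Hab Hex1 Hex) as L1.
  pose proof (RInt_le f (fun _ => k + M) a b Hab Hex Hex2) as L2.
  rewrite RInt_const in L1. rewrite RInt_const in L2.
  unfold scal in L1, L2; simpl in L1, L2; unfold mult in L1, L2; simpl in L1, L2.
  assert (A1 : (b - a) * (k - M) <= RInt f a b).
  { apply L1. intros x Hx. specialize (HM x). apply Rabs_le_between in HM; lra. }
  assert (A2 : RInt f a b <= (b - a) * (k + M)).
  { apply L2. intros x Hx. specialize (HM x). apply Rabs_le_between in HM; lra. }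
  apply Rabs_le. lra.
Qed.

Lemma nested_intervals (a b : nat -> R) :
  (forall n, a n <= a (S n)) -> (forall n, b (S n) <= b n) ->
  (forall n, a n <= b n) ->
  exists l, forall n, a n <= l <= b n.
Proof.
  intros Ha Hb Hab.
  assert (Hag : forall n k, a n <= a (n + k)%nat).
  { intros n k. induction k; [rewrite Nat.add_0_r; lra|].
    rewrite Nat.add_succ_r. specialize (Ha (n + k)%nat). lra. }
  assert (Hbg : forall n k, b (n + k)%nat <= b n).
  { intros n k. induction k; [rewrite Nat.add_0_r; lra|].
    rewrite Nat.add_succ_r. specialize (Hb (n + k)%nat). lra. }
  assert (Hx : forall n m, a n <= b m).
  { intros n m. pose proof (Hag n m) as A. pose proof (Hbg m n) as B.
    rewrite (Nat.add_comm m n) in B. specialize (Hab (n + m)%nat). lra. }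
  destruct (completeness (fun x => exists n, x = a n)) as [l [Hub Hlub]].
  - exists (b O). intros x [n ->]. apply Hx.
  - exists (a O), O. reflexivity.
  - exists l. intros n. split.
    + apply Hub. exists n. reflexivity.
    + apply Hlub. intros x [m ->]. apply Hx.
Qed.

Section Goursat.
Variables (P Q : R -> R -> R) (a b c d : R).
Hypothesis (Hab : a <= b) (Hcd : c <= d).
Hypothesis (HPQ : forall x y, a <= x <= b -> c <= y <= d -> closed_form_at P Q x y).

Lemma horizontal_continuous x y : a <= x <= b -> c <= y <= d ->
  continuous (fun u => P u y) x.
Proof.
  intros Hx Hy. apply continuous_eps. intros eps Heps.
  destruct (closed_form_continuous P Q x y (HPQ x y Hx Hy) eps Heps) as (del & Hd & H1).
  exists del. split; [exact Hd|]. intros u Hu. apply H1; [exact Hu|].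
  rewrite Rminus_diag_eq, Rabs_R0; auto.
Qed.

Lemma vertical_continuous x y : a <= x <= b -> c <= y <= d ->
  continuous (fun v => Q x v) y.
Proof.
  intros Hx Hy. apply continuous_eps. intros eps Heps.
  destruct (closed_form_continuous P Q x y (HPQ x y Hx Hy) eps Heps) as (del & Hd & H1).
  exists del. split; [exact Hd|]. intros u Hu. apply H1; [|exact Hu].
  rewrite Rminus_diag_eq, Rabs_R0; auto.
Qed.

Lemma horizontal_diff_continuous x y y' : a <= x <= b -> c <= y <= d -> c <= y' <= d ->
  continuous (fun u => P u y - P u y') x.
Proof.
  intros. apply (continuous_minus (fun u => P u y) (fun u => P u y'));
  apply horizontal_continuous; assumption.
Qed.

Lemma vertical_diff_continuous x x' y : a <= x <= b -> a <= x' <= b -> c <= y <= d ->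
  continuous (fun v => Q x v - Q x' v) y.
Proof.
  intros. apply (continuous_minus (fun u => Q x u) (fun u => Q x' u));
  apply vertical_continuous; assumption.
Qed.

Lemma ex_horizontal u v y : a <= u -> u <= v -> v <= b -> c <= y <= d ->
  ex_RInt (fun x => P x y) u v.
Proof.
  intros. apply ex_RInt_continuous_R.
  intros z. rewrite Rmin_left, Rmax_right by lra.
  intros. apply horizontal_continuous; lra.
Qed.

Lemma ex_vertical u v x : c <= u -> u <= v -> v <= d -> a <= x <= b ->
  ex_RInt (fun y => Q x y) u v.
Proof.
  intros. apply ex_RInt_continuous_R.
  intros z. rewrite Rmin_left, Rmax_right by lra.
  intros. apply vertical_continuous; lra.
Qed.

Lemma rect_int_expand a1 b1 c1 d1 :
  a <= a1 -> a1 <= b1 -> b1 <= b -> c <= c1 -> c1 <= d1 -> d1 <= d ->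
  rect_int P Q a1 b1 c1 d1 =
    RInt (fun x => P x c1) a1 b1 - RInt (fun x => P x d1) a1 b1
    + (RInt (fun y => Q b1 y) c1 d1 - RInt (fun y => Q a1 y) c1 d1).
Proof.
  intros. unfold rect_int. f_equal.
  - apply (RInt_minus (V := R_CompleteNormedModule)); apply ex_horizontal; lra.
  - apply (RInt_minus (V := R_CompleteNormedModule)); apply ex_vertical; lra.
Qed.

Lemma rect_int_split4 a1 m b1 c1 n d1 :
  a <= a1 -> a1 <= m -> m <= b1 -> b1 <= b -> c <= c1 -> c1 <= n -> n <= d1 -> d1 <= d ->
  rect_int P Q a1 b1 c1 d1 =
    rect_int P Q a1 m c1 n + rect_int P Q m b1 c1 n
    + rect_int P Q a1 m n d1 + rect_int P Q m b1 n d1.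
Proof.
  intros. rewrite !rect_int_expand by lra.
  assert (X : forall y, c <= y <= d -> RInt (fun x => P x y) a1 b1 =
     RInt (fun x => P x y) a1 m + RInt (fun x => P x y) m b1).
  { intros. symmetry. apply (RInt_Chasles (V := R_CompleteNormedModule));
    apply ex_horizontal; lra. }
  assert (Y : forall x, a <= x <= b -> RInt (fun y => Q x y) c1 d1 =
     RInt (fun y => Q x y) c1 n + RInt (fun y => Q x y) n d1).
  { intros. symmetry. apply (RInt_Chasles (V := R_CompleteNormedModule));
    apply ex_vertical; lra. }
  rewrite !X, !Y by lra. ring.
Qed.

Let w n := (b - a) / 2 ^ n.
Let h n := (d - c) / 2 ^ n.
Let J n (p : R * R) :=
  Rabs (rect_int P Q (fst p) (fst p + w n) (snd p) (snd p + h n)).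

Lemma w_S n : w n = w (S n) + w (S n).
Proof. unfold w. simpl. field. apply pow_nonzero. lra. Qed.
Lemma h_S n : h n = h (S n) + h (S n).
Proof. unfold h. simpl. field. apply pow_nonzero. lra. Qed.
Lemma w_pos n : 0 <= w n.
Proof. unfold w. apply Rmult_le_pos; [lra|]. left. apply Rinv_0_lt_compat, pow_lt; lra. Qed.
Lemma h_pos n : 0 <= h n.
Proof. unfold h. apply Rmult_le_pos; [lra|]. left. apply Rinv_0_lt_compat, pow_lt; lra. Qed.

Lemma subdivide n p :
  a <= fst p -> fst p + w n <= b -> c <= snd p -> snd p + h n <= d ->
  {q | (fst q = fst p \/ fst q = fst p + w (S n)) /\
       (snd q = snd p \/ snd q = snd p + h (S n)) /\ J n p / 4 <= J (S n) q}.
Proof.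
  intros H1 H2 H3 H4.
  pose proof (w_pos (S n)). pose proof (h_pos (S n)).
  pose proof (w_S n) as EW. pose proof (h_S n) as EH.
  pose (p1 := (fst p, snd p)). pose (p2 := (fst p + w (S n), snd p)).
  pose (p3 := (fst p, snd p + h (S n))). pose (p4 := (fst p + w (S n), snd p + h (S n))).
  destruct (Rle_dec (J n p / 4) (J (S n) p1)) as [L1|L1];
    [exists p1; unfold p1; simpl; auto|].
  destruct (Rle_dec (J n p / 4) (J (S n) p2)) as [L2|L2];
    [exists p2; unfold p2; simpl; auto|].
  destruct (Rle_dec (J n p / 4) (J (S n) p3)) as [L3|L3];
    [exists p3; unfold p3; simpl; auto|].
  destruct (Rle_dec (J n p / 4) (J (S n) p4)) as [L4|L4];
    [exists p4; unfold p4; simpl; auto|].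
  exfalso.
  unfold J in L1, L2, L3, L4. simpl in L1, L2, L3, L4.
  assert (E := rect_int_split4 (fst p) (fst p + w (S n)) (fst p + w n)
     (snd p) (snd p + h (S n)) (snd p + h n)).
  rewrite EW, EH in E. rewrite <- !Rplus_assoc in E.
  rewrite EW, EH in L1, L2, L3, L4. rewrite <- !Rplus_assoc in L1, L2, L3, L4.
  specialize (E ltac:(lra) ltac:(lra) ltac:(lra) ltac:(lra) ltac:(lra) ltac:(lra) ltac:(lra) ltac:(lra)).
  rewrite E in L1, L2, L3, L4.
  match type of E with _ = ?A + ?B + ?C + ?D =>
    pose proof (Rabs_triang (A + B + C) D); pose proof (Rabs_triang (A + B) C);
    pose proof (Rabs_triang A B) end.
  lra.
Qed.

(** The corner of the [n]-th rectangle of the bisection; the tests only serve to call [subdivide], they always succeed ([corner_spec]). *)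
Fixpoint corner (n : nat) : R * R :=
  match n with
  | O => (a, c)
  | S k =>
    let p := corner k in
    match Rle_dec a (fst p), Rle_dec (fst p + w k) b,
          Rle_dec c (snd p), Rle_dec (snd p + h k) d with
    | left H1, left H2, left H3, left H4 => proj1_sig (subdivide k p H1 H2 H3 H4)
    | _, _, _, _ => p
    end
  end.

Lemma corner_spec n :
  (a <= fst (corner n) /\ fst (corner n) + w n <= b) /\
  (c <= snd (corner n) /\ snd (corner n) + h n <= d) /\
  J O (a, c) / 4 ^ n <= J n (corner n) /\
  (fst (corner n) <= fst (corner (S n)) <= fst (corner n) + w (S n)) /\
  (snd (corner n) <= snd (corner (S n)) <= snd (corner n) + h (S n)).
Proof.
  assert (Step : forall n,
    (a <= fst (corner n) /\ fst (corner n) + w n <= b) /\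
    (c <= snd (corner n) /\ snd (corner n) + h n <= d) ->
    (fst (corner (S n)) = fst (corner n) \/ fst (corner (S n)) = fst (corner n) + w (S n)) /\
    (snd (corner (S n)) = snd (corner n) \/ snd (corner (S n)) = snd (corner n) + h (S n)) /\
    J n (corner n) / 4 <= J (S n) (corner (S n))).
  { intros k [[A1 A2] [A3 A4]]. simpl corner.
    destruct (Rle_dec a (fst (corner k))) as [B1|]; [|contradiction].
    destruct (Rle_dec (fst (corner k) + w k) b) as [B2|]; [|contradiction].
    destruct (Rle_dec c (snd (corner k))) as [B3|]; [|contradiction].
    destruct (Rle_dec (snd (corner k) + h k) d) as [B4|]; [|contradiction].
    apply (proj2_sig (subdivide k (corner k) B1 B2 B3 B4)). }
  assert (Main : (a <= fst (corner n) /\ fst (corner n) + w n <= b) /\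
    (c <= snd (corner n) /\ snd (corner n) + h n <= d) /\
    J O (a, c) / 4 ^ n <= J n (corner n)).
  { induction n as [|n IH].
    - simpl corner. simpl fst. simpl snd. unfold w, h. simpl. repeat split; lra.
    - destruct IH as (I1 & I2 & I3).
      destruct (Step n (conj I1 I2)) as (S1 & S2 & S3).
      pose proof (w_pos (S n)). pose proof (h_pos (S n)).
      pose proof (w_S n) as EW. pose proof (h_S n) as EH.
      repeat split; try (destruct S1 as [->| ->]; lra);
        try (destruct S2 as [->| ->]; lra).
      eapply Rle_trans; [|exact S3].
      replace (J O (a, c) / 4 ^ S n) with (J O (a, c) / 4 ^ n / 4); [lra|].
      simpl. field. apply pow_nonzero. lra. }
  destruct Main as (M1 & M2 & M3).
  destruct (Step n (conj M1 M2)) as (S1 & S2 & _).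
  pose proof (w_pos (S n)). pose proof (h_pos (S n)).
  split; [exact M1|]. split; [exact M2|]. split; [exact M3|].
  split; [destruct S1 as [->| ->]; lra|destruct S2 as [->| ->]; lra].
Qed.

(** The affine part of a closed form is exact and integrates to zero, so only the remainder counts. *)
Lemma small_rect_bound x y p1 p2 q2 eps a1 b1 c1 d1 :
  0 <= eps ->
  a <= a1 -> a1 <= x -> x <= b1 -> b1 <= b -> c <= c1 -> c1 <= y -> y <= d1 -> d1 <= d ->
  (forall u v, a1 <= u <= b1 -> c1 <= v <= d1 ->
      Rabs (P u v - P x y - p1 * (u - x) - p2 * (v - y))
        <= eps * (Rabs (u - x) + Rabs (v - y)) /\
      Rabs (Q u v - Q x y - p2 * (u - x) - q2 * (v - y))
        <= eps * (Rabs (u - x) + Rabs (v - y))) ->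
  Rabs (rect_int P Q a1 b1 c1 d1) <= 2 * eps * (b1 - a1 + (d1 - c1)) ^ 2.
Proof.
  intros He A1 A2 A3 A4 C1 C2 C3 C4 Hd.
  assert (Bd : forall u v, a1 <= u <= b1 -> c1 <= v <= d1 ->
    eps * (Rabs (u - x) + Rabs (v - y)) <= eps * (b1 - a1 + (d1 - c1))).
  { intros u v Hu Hv. apply Rmult_le_compat_l; [lra|].
    apply Rplus_le_compat; apply Rabs_le; lra. }
  set (L := b1 - a1 + (d1 - c1)) in *.
  assert (I1 : Rabs (RInt (fun x => P x c1 - P x d1) a1 b1 - (- p2 * (d1 - c1)) * (b1 - a1))
    <= (2 * eps * L) * (b1 - a1)).
  { apply RInt_near_const; [lra| |].
    - intros. apply horizontal_diff_continuous; lra.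
    - intros u Hu. destruct (Hd u c1) as [E1 _]; try lra. destruct (Hd u d1) as [E2 _]; try lra.
      pose proof (Bd u c1 Hu ltac:(lra)). pose proof (Bd u d1 Hu ltac:(lra)).
      replace (P u c1 - P u d1 - - p2 * (d1 - c1)) with
        ((P u c1 - P x y - p1 * (u - x) - p2 * (c1 - y)) +
         - (P u d1 - P x y - p1 * (u - x) - p2 * (d1 - y))) by ring.
      eapply Rle_trans; [apply Rabs_triang|]. rewrite Rabs_Ropp. lra. }
  assert (I2 : Rabs (RInt (fun y => Q b1 y - Q a1 y) c1 d1 - (p2 * (b1 - a1)) * (d1 - c1))
    <= (2 * eps * L) * (d1 - c1)).
  { apply RInt_near_const; [lra| |].
    - intros. apply vertical_diff_continuous; lra.
    - intros v Hv. destruct (Hd b1 v) as [_ E1]; try lra. destruct (Hd a1 v) as [_ E2]; try lra.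
      pose proof (Bd b1 v ltac:(lra) Hv). pose proof (Bd a1 v ltac:(lra) Hv).
      replace (Q b1 v - Q a1 v - p2 * (b1 - a1)) with
        ((Q b1 v - Q x y - p2 * (b1 - x) - q2 * (v - y)) +
         - (Q a1 v - Q x y - p2 * (a1 - x) - q2 * (v - y))) by ring.
      eapply Rle_trans; [apply Rabs_triang|]. rewrite Rabs_Ropp. lra. }
  unfold rect_int.
  match type of I1 with Rabs (?A - _) <= _ => set (A0 := A) in * end.
  match type of I2 with Rabs (?A - _) <= _ => set (B0 := A) in * end.
  replace (A0 + B0) with ((A0 - - p2 * (d1 - c1) * (b1 - a1)) +
    (B0 - p2 * (b1 - a1) * (d1 - c1))) by ring.
  eapply Rle_trans; [apply Rabs_triang|].
  replace (2 * eps * L ^ 2) with (2 * eps * L * (b1 - a1) + 2 * eps * L * (d1 - c1)).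
  2: { unfold L. ring. }
  lra.
Qed.

(** Bisection keeps at least a quarter of the integral, hence the [n]-th rectangle carries at least [4 ^ - n] of it, while differentiability at the common point makes it [o (4 ^ - n)]. *)
Theorem goursat : rect_int P Q a b c d = 0.
Proof.
  destruct (nested_intervals (fun n => fst (corner n)) (fun n => fst (corner n) + w n))
    as [x Hx].
  { intros n. apply corner_spec. }
  { intros n. pose proof (w_S n). destruct (corner_spec n) as (_ & _ & _ & ? & _). lra. }
  { intros n. pose proof (w_pos n). lra. }
  destruct (nested_intervals (fun n => snd (corner n)) (fun n => snd (corner n) + h n))
    as [y Hy].
  { intros n. apply corner_spec. }
  { intros n. pose proof (h_S n). destruct (corner_spec n) as (_ & _ & _ & _ & ?). lra. }
  { intros n. pose proof (h_pos n). lra. }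
  simpl in Hx, Hy.
  assert (Hx0 : a <= x <= b).
  { specialize (Hx O). simpl in Hx. unfold w in Hx. simpl in Hx. lra. }
  assert (Hy0 : c <= y <= d).
  { specialize (Hy O). simpl in Hy. unfold h in Hy. simpl in Hy. lra. }
  destruct (Req_dec (rect_int P Q a b c d) 0) as [E|E]; [exact E|exfalso].
  apply Rabs_pos_lt in E. set (eta := Rabs (rect_int P Q a b c d)) in *.
  assert (EJ : J O (a, c) = eta).
  { unfold J, eta, w, h. simpl. do 2 f_equal; lra. }
  destruct (HPQ x y Hx0 Hy0) as (p1 & p2 & q2 & Hd).
  set (L := b - a + (d - c)).
  assert (HL : 0 <= L) by (unfold L; lra).
  set (eps := eta / (4 * (L ^ 2 + 1))).
  assert (HL2 : 0 < L ^ 2 + 1) by nra.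
  assert (Heps : 0 < eps) by (unfold eps; apply Rdiv_lt_0_compat; lra).
  destruct (Hd eps Heps) as (del & Hdel & Hdd).
  assert (exists n, (b - a) / 2 ^ n < del /\ (d - c) / 2 ^ n < del) as [n [Hn1 Hn2]].
  { destruct (pow_lt_1_zero (/ 2) ltac:(rewrite Rabs_right; lra) (del / (L + 1))
      ltac:(apply Rdiv_lt_0_compat; lra)) as [n Hn].
    exists n. specialize (Hn n (Nat.le_refl n)).
    rewrite pow_inv in Hn.
    assert (0 < / 2 ^ n) by (apply Rinv_0_lt_compat, pow_lt; lra).
    rewrite Rabs_right in Hn by lra.
    assert (/ 2 ^ n * (L + 1) < del).
    { apply Rlt_le_trans with (del / (L + 1) * (L + 1)); [|right; field; lra].
      apply Rmult_lt_compat_r; lra. }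
    unfold L in *. unfold Rdiv. split; nra. }
  fold (w n) in Hn1. fold (h n) in Hn2.
  destruct (corner_spec n) as (M1 & M2 & M3 & _ & _).
  specialize (Hx n). specialize (Hy n). rewrite EJ in M3.
  pose proof (w_pos n). pose proof (h_pos n).
  assert (B := small_rect_bound x y p1 p2 q2 eps (fst (corner n)) (fst (corner n) + w n)
    (snd (corner n)) (snd (corner n) + h n)).
  assert (B' : J n (corner n) <= 2 * eps * (w n + h n) ^ 2).
  { unfold J. replace (w n + h n) with
     (fst (corner n) + w n - fst (corner n) + (snd (corner n) + h n - snd (corner n))) by ring.
    apply B; try lra.
    intros u v Hu Hv. apply Hdd; apply Rabs_lt_between; lra. }
  assert (E2 : (w n + h n) ^ 2 = L ^ 2 / 4 ^ n).
  { unfold w, h, L. replace 4 with (2 * 2) by ring. rewrite Rpow_mult_distr.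
    field. apply pow_nonzero; lra. }
  rewrite E2 in B'.
  assert (H4 : 0 < / 4 ^ n) by (apply Rinv_0_lt_compat, pow_lt; lra).
  assert (F : eta * / 4 ^ n <= 2 * eps * L ^ 2 * / 4 ^ n) by (unfold Rdiv in *; lra).
  apply Rmult_le_reg_r in F; [|exact H4].
  assert (eps * (4 * (L ^ 2 + 1)) = eta) by (unfold eps; field; lra).
  nra.
Qed.
End Goursat.

(** * The exponential and the principal square root *)

(** The Cauchy-Riemann equations: [Im (f dz)] is closed. *)
Lemma holomorphic_closed_form f x y : C_differentiable f (x, y) ->
  closed_form_at (fun u v => Im (f (u, v))) (fun u v => Re (f (u, v))) x y.
Proof.
  intros Hf. apply C_differentiable_iff in Hf. destruct Hf as [l Hl].
  exists (Im l), (Re l), (- Im l). intros eps Heps.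
  destruct (Hl eps Heps) as (del & Hdel & H1).
  exists (del / 2). split; [lra|]. intros u v Hu Hv.
  assert (Hd : ((u, v) - (x, y))%C = (u - x, v - y)) by reflexivity.
  assert (Hm : Cmod ((u, v) - (x, y)) <= Rabs (u - x) + Rabs (v - y)).
  { rewrite Hd. apply Cmod_le_re_im. }
  specialize (H1 (u, v) ltac:(lra)).
  assert (H2 : Cmod (f (u, v) - f (x, y) - l * ((u, v) - (x, y)))
     <= eps * (Rabs (u - x) + Rabs (v - y))) by nra.
  rewrite Hd in H2.
  split.
  - eapply Rle_trans; [right|eapply Rle_trans; [apply im_le_Cmod|exact H2]].
    f_equal. destruct l as [l1 l2]. simpl. unfold Im. simpl. ring.
  - eapply Rle_trans; [right|eapply Rle_trans; [apply re_le_Cmod|exact H2]].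
    f_equal. destruct l as [l1 l2]. simpl. unfold Re. simpl. ring.
Qed.

Lemma derivable_pt_lim_remainder f x l : derivable_pt_lim f x l ->
  forall eps, 0 < eps -> exists del, 0 < del /\
    forall h, Rabs h < del -> Rabs (f (x + h) - f x - l * h) <= eps * Rabs h.
Proof.
  intros Hf eps Heps. destruct (Hf eps Heps) as [del Hd].
  exists del. split; [apply cond_pos|]. intros h Hh.
  destruct (Req_dec h 0) as [->|Hn].
  - rewrite Rplus_0_r, Rabs_R0. replace (f x - f x - l * 0) with 0 by ring.
    rewrite Rabs_R0. lra.
  - specialize (Hd h Hn Hh).
    replace (f (x + h) - f x - l * h) with (((f (x + h) - f x) / h - l) * h) by (field; exact Hn).
    rewrite Rabs_mult. apply Rmult_le_compat_r; [apply Rabs_pos|lra].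
Qed.

Definition Cexp (w : C) : C := (exp (Re w) * cos (Im w), exp (Re w) * sin (Im w)).

Lemma Cexp_plus w d : Cexp (w + d) = (Cexp w * Cexp d)%C.
Proof.
  destruct w as [a b], d as [p q]. unfold Cexp, Cmult. simpl.
  rewrite exp_plus, cos_plus, sin_plus. f_equal; ring.
Qed.

Lemma Cmod_Cexp w : Cmod (Cexp w) = exp (Re w).
Proof.
  apply Rsqr_inj; [apply Cmod_ge_0|left; apply exp_pos|].
  unfold Rsqr. pose proof (Cmod2_alt (Cexp w)) as E. unfold Cexp in *. simpl in E.
  pose proof (sin2_cos2 (Im w)) as T. unfold Rsqr in T. nra.
Qed.

Lemma C_differentiable_Cexp w : C_differentiable Cexp w.
Proof.
  apply C_differentiable_iff. exists (Cexp w). intros eps Heps.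
  pose proof (exp_pos (Re w)) as Hp.
  set (M := exp (Re w)) in *.
  set (e := Rmin 1 (eps / (8 * M))).
  assert (He : 0 < e) by (apply Rmin_glb_lt; [lra|apply Rdiv_lt_0_compat; lra]).
  assert (He1 : e <= 1) by apply Rmin_l.
  assert (HeM : M * (8 * e) <= eps).
  { pose proof (Rmin_r 1 (eps / (8 * M))) as R. fold e in R.
    apply Rle_trans with (M * (8 * (eps / (8 * M)))); [nra|]. right. field. lra. }
  destruct (derivable_pt_lim_remainder exp 0 (exp 0) (derivable_pt_lim_exp 0) e He) as (d1 & Hd1 & H1).
  destruct (derivable_pt_lim_remainder cos 0 (- sin 0) (derivable_pt_lim_cos 0) e He) as (d2 & Hd2 & H2).
  destruct (derivable_pt_lim_remainder sin 0 (cos 0) (derivable_pt_lim_sin 0) e He) as (d3 & Hd3 & H3).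
  exists (Rmin (Rmin d1 d2) (Rmin d3 (e / 2))).
  split; [repeat apply Rmin_glb_lt; lra|].
  intros v Hv.
  pose proof (Rmin_l (Rmin d1 d2) (Rmin d3 (e / 2))).
  pose proof (Rmin_r (Rmin d1 d2) (Rmin d3 (e / 2))).
  pose proof (Rmin_l d1 d2). pose proof (Rmin_r d1 d2).
  pose proof (Rmin_l d3 (e / 2)). pose proof (Rmin_r d3 (e / 2)).
  set (d := (v - w)%C) in *.
  replace v with (w + d)%C by (unfold d; ring).
  rewrite Cexp_plus.
  replace (Cexp w * Cexp d - Cexp w - Cexp w * d)%C with
    (Cexp w * (Cexp d - 1 - d))%C by ring.
  rewrite Cmod_mult, Cmod_Cexp. fold M.
  pose proof (re_le_Cmod d) as Ra. pose proof (im_le_Cmod d) as Rb.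
  pose proof (Cmod_ge_0 d) as Rd.
  set (m := Cmod d) in *.
  destruct d as [a b]. unfold Re, Im in Ra, Rb. simpl in Ra, Rb.
  specialize (H1 a ltac:(lra)). specialize (H2 b ltac:(lra)). specialize (H3 b ltac:(lra)).
  rewrite Rplus_0_l, exp_0 in H1. rewrite Rplus_0_l, cos_0, sin_0 in H2.
  rewrite Rplus_0_l, sin_0, cos_0 in H3.
  assert (B : Cmod (Cexp (a, b) - 1 - (a, b)) <= 8 * e * m).
  { eapply Rle_trans; [apply Cmod_le_re_im|].
    unfold Cexp. simpl. unfold Re, Im. simpl.
    assert (A1 : Rabs (exp a - 1 - a) <= e * m).
    { apply Rle_trans with (e * Rabs a); [|apply Rmult_le_compat_l; lra].
      eapply Rle_trans; [right|exact H1]. f_equal. ring. }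
    assert (A2 : Rabs (cos b - 1) <= e * m).
    { apply Rle_trans with (e * Rabs b); [|apply Rmult_le_compat_l; lra].
      eapply Rle_trans; [right|exact H2]. f_equal. ring. }
    assert (A3 : Rabs (sin b - b) <= e * m).
    { apply Rle_trans with (e * Rabs b); [|apply Rmult_le_compat_l; lra].
      eapply Rle_trans; [right|exact H3]. f_equal. ring. }
    assert (A4 : Rabs (exp a - 1) <= 2 * m).
    { replace (exp a - 1) with ((exp a - 1 - a) + a) by ring.
      eapply Rle_trans; [apply Rabs_triang|]. nra. }
    assert (A5 : Rabs (exp a) <= 2).
    { replace (exp a) with ((exp a - 1) + 1) by ring.
      eapply Rle_trans; [apply Rabs_triang|]. rewrite Rabs_R1. nra. }
    replace (exp a * cos b + - (1) + - a) with ((exp a - 1 - a) + exp a * (cos b - 1)) by ring.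
    replace (exp a * sin b + - 0 + - b) with (exp a * (sin b - b) + (exp a - 1) * b) by ring.
    pose proof (Rabs_triang (exp a - 1 - a) (exp a * (cos b - 1))) as T1.
    pose proof (Rabs_triang (exp a * (sin b - b)) ((exp a - 1) * b)) as T2.
    rewrite Rabs_mult in T1. rewrite !Rabs_mult in T2.
    pose proof (Rabs_pos (cos b - 1)). pose proof (Rabs_pos (sin b - b)).
    pose proof (Rabs_pos (exp a)). pose proof (Rabs_pos (exp a - 1)). pose proof (Rabs_pos b).
    assert (Rabs (exp a) * Rabs (cos b - 1) <= 2 * (e * m)) by (apply Rmult_le_compat; assumption).
    assert (Rabs (exp a) * Rabs (sin b - b) <= 2 * (e * m)) by (apply Rmult_le_compat; assumption).
    assert (Rabs (exp a - 1) * Rabs b <= (2 * m) * (e / 2)) by (apply Rmult_le_compat; lra).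
    lra. }
  apply Rle_trans with (M * (8 * e * m)); [apply Rmult_le_compat_l; lra|].
  assert (M * (8 * e) * m <= eps * m) by (apply Rmult_le_compat_r; lra). lra.
Qed.

(** Dividing [Im z] by twice the real part gives the imaginary part its sign; on the cut the value is meaningless. *)
Definition Csqrt (z : C) : C :=
  let p := sqrt ((Cmod z + Re z) / 2) in (p, Im z / (2 * p)).

Lemma Cmod_plus_re_nonneg (z : C) : 0 <= Cmod z + Re z.
Proof.
  pose proof (re_le_Cmod z) as Ra. apply Rabs_le_between in Ra. lra.
Qed.

Lemma slit_plane_re_pos (z : C) : slit_plane z <-> 0 < Cmod z + Re z.
Proof.
  pose proof (Cmod2_alt z) as E. pose proof (Cmod_ge_0 z) as G.
  pose proof (Cmod_plus_re_nonneg z) as P.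
  split.
  - intros Hz. destruct P as [P|P]; [exact P|]. exfalso. apply Hz.
    assert (Im z ^ 2 = 0) by nra. split; [|lra].
    destruct (Req_dec (Im z) 0) as [K|K]; [exact K|].
    apply (pow_nonzero _ 2) in K. contradiction.
  - intros H [I R]. rewrite I in E. nra.
Qed.

Lemma Re_Csqrt_pos z : slit_plane z -> 0 < Re (Csqrt z).
Proof.
  intros Hz. apply slit_plane_re_pos in Hz. unfold Csqrt, Re at 1. simpl.
  apply sqrt_lt_R0. lra.
Qed.

Lemma Re_Csqrt_sqr z : Re (Csqrt z) ^ 2 = (Cmod z + Re z) / 2.
Proof.
  unfold Csqrt, Re at 1. simpl. rewrite Rmult_1_r. apply sqrt_sqrt.
  pose proof (Cmod_plus_re_nonneg z). lra.
Qed.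

Lemma Csqrt_sqr z : slit_plane z -> (Csqrt z * Csqrt z)%C = z.
Proof.
  intros Hz. pose proof (Re_Csqrt_pos z Hz) as Hp. pose proof (Re_Csqrt_sqr z) as E.
  pose proof (Cmod2_alt z) as E2.
  unfold Csqrt in *. unfold Re at 1 in Hp. unfold Re at 1 in E. simpl fst in *.
  set (p := sqrt ((Cmod z + Re z) / 2)) in *.
  destruct z as [x y]. unfold Re, Im in *. simpl in *. unfold Cmult. simpl. f_equal.
  - assert (K : y / (2 * p) * (y / (2 * p)) = p ^ 2 - x).
    { replace (y / (2 * p) * (y / (2 * p))) with (y ^ 2 / (4 * p ^ 2)) by (field; lra).
      apply Rmult_eq_reg_r with (4 * p ^ 2); [|nra].
      replace (y ^ 2 / (4 * p ^ 2) * (4 * p ^ 2)) with (y ^ 2) by (field; lra). nra. }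
    rewrite K. ring.
  - field. lra.
Qed.

Lemma Csqrt_nonzero z : slit_plane z -> Csqrt z <> 0%C.
Proof.
  intros Hz E. pose proof (Re_Csqrt_pos z Hz) as Hp. rewrite E in Hp. simpl in Hp. lra.
Qed.

Lemma Cmod_Csqrt_sqr z : slit_plane z -> Cmod (Csqrt z) ^ 2 = Cmod z.
Proof.
  intros Hz. rewrite <- (Csqrt_sqr z Hz) at 2. rewrite Cmod_mult. ring.
Qed.

Lemma Cmod_Csqrt z : slit_plane z -> Cmod (Csqrt z) = sqrt (Cmod z).
Proof.
  intros Hz. rewrite <- (Cmod_Csqrt_sqr z Hz), sqrt_pow2; [reflexivity|apply Cmod_ge_0].
Qed.

Lemma Csqrt_pos x : 0 < x -> Csqrt (RtoC x) = RtoC (sqrt x).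
Proof.
  intros Hx. unfold Csqrt. rewrite Cmod_R, Rabs_right by lra.
  unfold Re, Im, RtoC. simpl. replace ((x + x) / 2) with x by field.
  f_equal. unfold Rdiv. ring.
Qed.

Lemma Re_le_Cmod c : Re c <= Cmod c.
Proof. pose proof (re_le_Cmod c) as K. apply Rabs_le_between in K. lra. Qed.

(** Both roots have positive real part, so that the sum of two roots is bounded
    below by either real part. *)
Lemma Csqrt_lipschitz z w : slit_plane z -> slit_plane w ->
  Cmod (Csqrt w - Csqrt z) <= Cmod (w - z) / Re (Csqrt z).
Proof.
  intros Hz Hw. pose proof (Re_Csqrt_pos z Hz) as Pz. pose proof (Re_Csqrt_pos w Hw) as Pw.
  assert (S : Re (Csqrt z) <= Cmod (Csqrt w + Csqrt z)).
  { eapply Rle_trans; [|apply Re_le_Cmod]. rewrite re_plus. lra. }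
  assert (E : (w - z = (Csqrt w - Csqrt z) * (Csqrt w + Csqrt z))%C).
  { rewrite <- (Csqrt_sqr z Hz) at 1. rewrite <- (Csqrt_sqr w Hw) at 1. ring. }
  apply Rmult_le_reg_r with (Re (Csqrt z)); [exact Pz|].
  unfold Rdiv. rewrite Rmult_assoc, Rinv_l, Rmult_1_r by lra.
  rewrite E at 1. rewrite Cmod_mult. apply Rmult_le_compat_l; [apply Cmod_ge_0|exact S].
Qed.

(** The remainder is [- (Csqrt w - Csqrt z) ^ 2 / (2 Csqrt z)]. Its form, with a constant depending only on [Re (Csqrt z)], permits differentiation under an integral. *)
Lemma Csqrt_taylor z w : slit_plane z -> slit_plane w ->
  Cmod (Csqrt w - Csqrt z - / (2 * Csqrt z) * (w - z)) <=
    Cmod (w - z) ^ 2 / (2 * Re (Csqrt z) ^ 3).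
Proof.
  intros Hz Hw. pose proof (Re_Csqrt_pos z Hz) as Pz.
  pose proof (Csqrt_nonzero z Hz) as Nz.
  pose proof (Csqrt_lipschitz z w Hz Hw) as L.
  assert (E : (w - z = (Csqrt w - Csqrt z) * (Csqrt w + Csqrt z))%C).
  { rewrite <- (Csqrt_sqr z Hz) at 1. rewrite <- (Csqrt_sqr w Hw) at 1. ring. }
  assert (F : (Csqrt w - Csqrt z - / (2 * Csqrt z) * (w - z) =
     - ((Csqrt w - Csqrt z) * (Csqrt w - Csqrt z) / (2 * Csqrt z)))%C).
  { rewrite E. field. exact Nz. }
  rewrite F, Cmod_opp, Cmod_div, !Cmod_mult, Cmod_R, Rabs_right; try lra.
  2: { apply Cmult_neq_0; [|exact Nz]. intros K. apply RtoC_inj in K. lra. }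
  pose proof (Re_le_Cmod (Csqrt z)) as Q.
  set (p := Re (Csqrt z)) in *. set (D := Cmod (Csqrt w - Csqrt z)) in *.
  assert (D0 : 0 <= D) by apply Cmod_ge_0.
  pose proof (Cmod_ge_0 (w - z)) as D1. set (d := Cmod (w - z)) in *.
  replace (d ^ 2 / (2 * p ^ 3)) with ((d / p) * (d / p) * / (2 * p)) by (field; lra).
  unfold Rdiv at 1. apply Rmult_le_compat.
  - nra.
  - left. apply Rinv_0_lt_compat. lra.
  - apply Rmult_le_compat; assumption.
  - apply Rinv_le_contravar; lra.
Qed.

Lemma slit_plane_open z : slit_plane z ->
  forall w, Cmod (w - z) < Re (Csqrt z) ^ 2 -> slit_plane w.
Proof.
  intros Hz w Hw [I R]. rewrite Re_Csqrt_sqr in Hw.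
  pose proof (Cmod2_alt z) as E. pose proof (Cmod_ge_0 z) as G.
  pose proof (Cmod2_alt (w - z)) as E2. pose proof (Cmod_ge_0 (w - z)) as G2.
  pose proof (Cmod_plus_re_nonneg z) as P.
  set (m := Cmod z) in *. set (d := Cmod (w - z)) in *.
  destruct z as [x y], w as [a b]. unfold Re, Im in *. simpl in *. subst b.
  assert (d ^ 2 = (a - x) ^ 2 + y ^ 2) by (simpl; nra). clear E2.
  assert (Hd : d ^ 2 < ((m + x) / 2) ^ 2) by (simpl; nra).
  assert (Em : m ^ 2 = x ^ 2 + y ^ 2) by (simpl; nra).
  destruct (Rle_dec 0 x) as [Hx|Hx].
  - assert (x <= m) by nra. assert (x ^ 2 <= (a - x) ^ 2) by nra.
    assert (((m + x) / 2) ^ 2 <= m ^ 2) by nra. lra.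
  - assert (y ^ 2 = (m - x) * (m + x)) by nra.
    assert ((m + x) * (m + x) <= (m - x) * (m + x)) by nra.
    assert (0 <= (a - x) ^ 2) by apply pow2_ge_0. nra.
Qed.

Lemma C_differentiable_Csqrt z : slit_plane z -> C_differentiable Csqrt z.
Proof.
  intros Hz. apply C_differentiable_iff. exists (/ (2 * Csqrt z))%C. intros eps Heps.
  pose proof (Re_Csqrt_pos z Hz) as Pz. set (p := Re (Csqrt z)) in *.
  assert (Pp : 0 < 2 * p ^ 3) by (assert (0 < p ^ 3) by (apply pow_lt; lra); lra).
  exists (Rmin (p ^ 2) (eps * (2 * p ^ 3))). split.
  { apply Rmin_glb_lt; [nra|apply Rmult_lt_0_compat; lra]. }
  intros w Hw.
  pose proof (Rmin_l (p ^ 2) (eps * (2 * p ^ 3))).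
  pose proof (Rmin_r (p ^ 2) (eps * (2 * p ^ 3))).
  eapply Rle_trans; [apply Csqrt_taylor; [exact Hz|]|].
  - apply (slit_plane_open z Hz). fold p. lra.
  - fold p. pose proof (Cmod_ge_0 (w - z)).
    apply Rmult_le_reg_r with (2 * p ^ 3); [exact Pp|].
    unfold Rdiv. rewrite Rmult_assoc, Rinv_l by lra. nra.
Qed.

(** From [Im z = 2 Re (Csqrt z) Im (Csqrt z)]. *)
Lemma Re_Csqrt_lower z : slit_plane z -> Rabs (Im z) <= 2 * Re (Csqrt z) * sqrt (Cmod z).
Proof.
  intros Hz. rewrite <- (Csqrt_sqr z Hz) at 1. rewrite im_mult.
  pose proof (Re_Csqrt_pos z Hz) as Pz.
  replace (Re (Csqrt z) * Im (Csqrt z) + Im (Csqrt z) * Re (Csqrt z))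
    with (2 * Re (Csqrt z) * Im (Csqrt z)) by ring.
  rewrite Rabs_mult, (Rabs_right (2 * _)) by lra.
  apply Rmult_le_compat_l; [lra|]. rewrite <- Cmod_Csqrt by exact Hz. apply im_le_Cmod.
Qed.

(** * Unique continuation from the positive half-line *)

Lemma cauchy_rectangle f a b c d : a <= b -> c <= d ->
  (forall x y, a <= x <= b -> c <= y <= d -> C_differentiable f (x, y)) ->
  rect_int (fun u v => Im (f (u, v))) (fun u v => Re (f (u, v))) a b c d = 0.
Proof.
  intros Hab Hcd Hf. apply goursat; [exact Hab|exact Hcd|].
  intros x y Hx Hy. apply holomorphic_closed_form. apply Hf; assumption.
Qed.

Lemma C_differentiable_Im_x f x y : C_differentiable f (x, y) ->
  continuous (fun u => Im (f (u, y))) x.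
Proof.
  intros Hf. apply continuous_eps. intros eps Heps.
  destruct (C_differentiable_continuous f (x, y) Hf eps Heps) as (del & Hd & H1).
  exists del. split; [exact Hd|]. intros u Hu.
  specialize (H1 (u, y)). eapply Rle_lt_trans; [|apply H1].
  - eapply Rle_trans; [right|apply im_le_Cmod]. f_equal.
  - eapply Rle_lt_trans; [apply Cmod_le_re_im|]. unfold Re, Im; simpl.
    replace (y + - y) with 0 by ring. rewrite Rabs_R0. unfold Rminus in Hu. lra.
Qed.

Lemma Cmod_reverse_triangle (a b : C) : Rabs (Cmod a - Cmod b) <= Cmod (a - b).
Proof.
  pose proof (Cmod_triangle (a - b) b) as T1. pose proof (Cmod_triangle (b - a) a) as T2.
  replace (a - b + b)%C with a in T1 by ring. replace (b - a + a)%C with b in T2 by ring.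
  replace (b - a)%C with (- (a - b))%C in T2 by ring. rewrite Cmod_opp in T2.
  apply Rabs_le. lra.
Qed.

Lemma bounded_on_vertical f x c d : c <= d ->
  (forall y, c <= y <= d -> C_differentiable f (x, y)) ->
  exists M, 0 <= M /\ forall y, c <= y <= d -> Cmod (f (x, y)) <= M.
Proof.
  intros Hcd Hf.
  destruct (continuity_ab_maj (fun y => Cmod (f (x, y))) c d Hcd) as (m & Hm & _).
  { intros y Hy. apply continuity_pt_filterlim. apply continuous_eps. intros eps Heps.
    destruct (C_differentiable_continuous f (x, y) (Hf y Hy) eps Heps) as (del & Hd & H1).
    exists del. split; [exact Hd|]. intros u Hu.
    eapply Rle_lt_trans; [apply Cmod_reverse_triangle|]. apply H1.
    eapply Rle_lt_trans; [apply Cmod_le_re_im|]. unfold Re, Im; simpl.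
    replace (x + - x) with 0 by ring. rewrite Rabs_R0. unfold Rminus in Hu. lra. }
  exists (Cmod (f (x, m))). split; [apply Cmod_ge_0|exact Hm].
Qed.

Lemma bounded_on_horizontal f y a b : a <= b ->
  (forall x, a <= x <= b -> C_differentiable f (x, y)) ->
  exists M, 0 <= M /\ forall x, a <= x <= b -> Cmod (f (x, y)) <= M.
Proof.
  intros Hcd Hf.
  destruct (continuity_ab_maj (fun x => Cmod (f (x, y))) a b Hcd) as (m & Hm & _).
  { intros x Hy. apply continuity_pt_filterlim. apply continuous_eps. intros eps Heps.
    destruct (C_differentiable_continuous f (x, y) (Hf x Hy) eps Heps) as (del & Hd & H1).
    exists del. split; [exact Hd|]. intros u Hu.
    eapply Rle_lt_trans; [apply Cmod_reverse_triangle|]. apply H1.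
    eapply Rle_lt_trans; [apply Cmod_le_re_im|]. unfold Re, Im; simpl.
    replace (y + - y) with 0 by ring. rewrite Rabs_R0. unfold Rminus in Hu. lra. }
  exists (Cmod (f (m, y))). split; [apply Cmod_ge_0|exact Hm].
Qed.

(** On the horizontal line through [w0] its powers concentrate at [w0]. The scale ten is chosen so that they are small on the lateral sides of a rectangle of half-width five and height at most four ([kernel_side]). *)
Definition kernel (w0 w : C) : C := (1 - ((w - w0) / 10) * ((w - w0) / 10))%C.

Lemma kernel_real u0 b x : kernel (u0, b) (u0 + x, b) = RtoC (1 - x ^ 2 / 100).
Proof.
  unfold kernel, Cdiv, Cinv, Cminus, Cplus, Copp, Cmult, RtoC. simpl. f_equal; field.
Qed.

Lemma kernel_side u0 b y s : 0 <= y <= b -> b <= 4 -> s = 5 \/ s = -5 ->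
  Cmod (kernel (u0, b) (u0 + s, y)) <= 995 / 1000.
Proof.
  intros Hy Hb Hs. apply Rsqr_incr_0_var; [|lra]. unfold Rsqr.
  pose proof (Cmod2_alt (kernel (u0, b) (u0 + s, y))) as E.
  assert (R1 : Re (kernel (u0, b) (u0 + s, y)) = 1 - (s ^ 2 - (b - y) ^ 2) / 100).
  { unfold kernel, Cdiv, Cinv, Cminus, Cplus, Copp, Cmult, RtoC, Re. simpl. field. }
  assert (I1 : Im (kernel (u0, b) (u0 + s, y)) = 2 * s * (b - y) / 100).
  { unfold kernel, Cdiv, Cinv, Cminus, Cplus, Copp, Cmult, RtoC, Im. simpl. field. }
  rewrite R1, I1 in E.
  set (t := (b - y) ^ 2).
  assert (Ht : 0 <= t <= 16) by (unfold t; nra).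
  assert (E' : Cmod (kernel (u0, b) (u0 + s, y)) ^ 2 =
     1 - 2 * (25 - t) / 100 + (25 + t) ^ 2 / 10000).
  { rewrite E. unfold t. destruct Hs as [-> | ->]; field. }
  nra.
Qed.

Lemma C_differentiable_kernel w0 w : C_differentiable (kernel w0) w.
Proof.
  unfold kernel.
  assert (D : C_differentiable (fun w => (w - w0) / 10)%C w).
  { apply (C_differentiable_mult (fun w => w - w0)%C (fun _ => / 10)%C).
    - apply (C_differentiable_minus (fun w => w) (fun _ => w0)).
      + apply C_differentiable_id.
      + apply C_differentiable_const.
    - apply C_differentiable_const. }
  apply (C_differentiable_minus (fun _ => 1%C)).
  - apply C_differentiable_const.
  - apply (C_differentiable_mult (fun w => (w - w0) / 10)%C (fun w => (w - w0) / 10)%C);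
    exact D.
Qed.

Lemma RInt_ge_const (f : R -> R) (a b k : R) : a <= b ->
  (forall x, a <= x <= b -> continuous f x) ->
  (forall x, a <= x <= b -> k <= f x) -> k * (b - a) <= RInt f a b.
Proof.
  intros Hab Hc Hk.
  assert (E : k * (b - a) = RInt (fun _ => k) a b).
  { rewrite RInt_const. unfold scal; simpl; unfold mult; simpl. ring. }
  rewrite E. apply RInt_le; [exact Hab|apply ex_RInt_const| |].
  - apply ex_RInt_continuous_R.
    intros z. rewrite Rmin_left, Rmax_right by lra. apply Hc.
  - intros x Hx. apply Hk. lra.
Qed.

Lemma geometric_domination (A B K L : R) : 0 <= B -> B < A -> 0 < K ->
  exists n, L * B ^ n < K * A ^ n.
Proof.
  intros HB HA HK.
  destruct (pow_lt_1_zero (B / A)) with (y := K / (Rabs L + 1)) as [n Hn].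
  { rewrite Rabs_right; [|apply Rle_ge, Rmult_le_pos; [lra|left; apply Rinv_0_lt_compat; lra]].
    apply Rmult_lt_reg_r with A; [lra|]. unfold Rdiv. rewrite Rmult_assoc, Rinv_l by lra. lra. }
  { pose proof (Rabs_pos L). apply Rdiv_lt_0_compat; lra. }
  exists n. specialize (Hn n (Nat.le_refl n)).
  assert (HAn : 0 < A ^ n) by (apply pow_lt; lra).
  assert (HBn : 0 <= B ^ n) by (apply pow_le; lra).
  unfold Rdiv at 1 in Hn. rewrite Rpow_mult_distr, pow_inv in Hn.
  rewrite Rabs_right in Hn.
  2: { apply Rle_ge, Rmult_le_pos; [exact HBn|left; apply Rinv_0_lt_compat; exact HAn]. }
  pose proof (Rabs_pos L) as L0. pose proof (Rle_abs L) as L1.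
  apply (Rmult_lt_compat_r (A ^ n)) in Hn; [|exact HAn].
  rewrite Rmult_assoc, Rinv_l, Rmult_1_r in Hn by lra.
  apply (Rmult_lt_compat_r (Rabs L + 1)) in Hn; [|lra].
  replace (K / (Rabs L + 1) * A ^ n * (Rabs L + 1)) with (K * A ^ n) in Hn by (field; lra).
  nra.
Qed.

(** Unique continuation across a strip. If [f] vanishes on the bottom side, Cauchy's theorem for [f * kernel (u0, b) ^ n] equates the integral over the top side to those over the lateral sides. A nonzero value at [(u0, b)] would make the first exponentially larger than the others. *)
Lemma strip_uniqueness f u0 b : 0 < b <= 4 ->
  (forall u v, u0 - 5 <= u <= u0 + 5 -> 0 <= v <= b -> C_differentiable f (u, v)) ->
  (forall u, u0 - 5 <= u <= u0 + 5 -> f (u, 0) = 0%C) ->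
  f (u0, b) = 0%C.
Proof.
  intros Hb Hf H0.
  destruct (Ceq_dec (f (u0, b)) 0) as [E|N]; [exact E|exfalso].
  apply Cmod_gt_0 in N. set (m := Cmod (f (u0, b))) in *.
  (* rotated so that g (u0, b) is positive imaginary: Cauchy's theorem is used for Im (g dz) *)
  set (g := fun w => (Ci * Cconj (f (u0, b)) * f w)%C).
  assert (Hg : forall u v, u0 - 5 <= u <= u0 + 5 -> 0 <= v <= b -> C_differentiable g (u, v)).
  { intros. apply C_differentiable_scal. apply Hf; assumption. }
  assert (G0 : Im (g (u0, b)) = m ^ 2).
  { unfold g, m. rewrite (Cmod2_alt (f (u0, b))). destruct (f (u0, b)) as [p q].
    unfold Re, Im. simpl. ring. }
  assert (Gb : forall u, u0 - 5 <= u <= u0 + 5 -> g (u, 0) = 0%C).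
  { intros u Hu. unfold g. rewrite H0 by exact Hu. ring. }
  destruct (bounded_on_vertical g (u0 + 5) 0 b ltac:(lra)) as (M1 & M1p & HM1).
  { intros. apply Hg; lra. }
  destruct (bounded_on_vertical g (u0 - 5) 0 b ltac:(lra)) as (M2 & M2p & HM2).
  { intros. apply Hg; lra. }
  destruct (bounded_on_horizontal g b (u0 - 5) (u0 + 5) ltac:(lra)) as (M3 & M3p & HM3).
  { intros. apply Hg; lra. }
  set (eta := m ^ 2 / 2). assert (Heta : 0 < eta) by (unfold eta; nra).
  destruct (C_differentiable_continuous g (u0, b) (Hg u0 b ltac:(lra) ltac:(lra)) eta Heta)
    as (d0 & Hd0 & Hd).
  set (del := Rmin 1 (d0 / 2)).
  assert (Hdel : 0 < del) by (apply Rmin_glb_lt; lra).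
  assert (Hdel1 : del <= 1) by apply Rmin_l.
  assert (Hdel2 : del <= d0 / 2) by apply Rmin_r.
  assert (Gd : forall x, Rabs x <= del -> eta <= Im (g (u0 + x, b))).
  { intros x Hx.
    assert (Cmod ((u0 + x, b) - (u0, b)) < d0) as HH.
    { eapply Rle_lt_trans; [apply Cmod_le_re_im|]. unfold Re, Im; simpl.
      replace (b + - b) with 0 by ring. replace (u0 + x + - u0) with x by ring.
      rewrite Rabs_R0. lra. }
    specialize (Hd _ HH).
    pose proof (im_le_Cmod (g (u0 + x, b) - g (u0, b))) as K.
    assert (E : Im (g (u0 + x, b) - g (u0, b)) = Im (g (u0 + x, b)) - m ^ 2).
    { rewrite <- G0. unfold Im. simpl. ring. }
    rewrite E in K. apply Rabs_le_between in K. unfold eta in *. lra. }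
  (* on the top side the kernel is at least A within del / 2 of the centre and at most B beyond del *)
  set (A := 1 - del ^ 2 / 400). set (B := Rmax (995 / 1000) (1 - del ^ 2 / 100)).
  assert (HB0 : 0 <= B) by (eapply Rle_trans; [|apply Rmax_l]; lra).
  assert (HBA : B < A) by (unfold B, A; apply Rmax_lub_lt; nra).
  assert (HB1 : 995 / 1000 <= B) by apply Rmax_l.
  assert (HB2 : 1 - del ^ 2 / 100 <= B) by apply Rmax_r.
  destruct (geometric_domination A B (eta * del) (b * (M1 + M2) + 10 * M3) HB0 HBA) as [n Hn].
  { apply Rmult_lt_0_compat; assumption. }
  set (k := fun w => (g w * kernel (u0, b) w ^ n)%C).
  assert (Hk : forall u v, u0 - 5 <= u <= u0 + 5 -> 0 <= v <= b -> C_differentiable k (u, v)).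
  { intros. apply (C_differentiable_mult g (fun w => kernel (u0, b) w ^ n)%C); [apply Hg; lra|].
    apply (C_differentiable_pow (kernel (u0, b))). apply C_differentiable_kernel. }
  pose proof (cauchy_rectangle k (u0 - 5) (u0 + 5) 0 b ltac:(lra) ltac:(lra) Hk) as Cau.
  unfold rect_int in Cau.
  assert (HAn : 0 <= A ^ n) by (apply pow_le; lra).
  assert (HBn : 0 <= B ^ n) by (apply pow_le; lra).
  assert (Side : Rabs (RInt (fun y => Re (k (u0 + 5, y)) - Re (k (u0 - 5, y))) 0 b - 0 * (b - 0))
     <= ((M1 + M2) * B ^ n) * (b - 0)).
  { apply RInt_near_const; [lra| |].
    - intros y Hy. apply (continuous_minus (fun y => Re (k (u0 + 5, y))) (fun y => Re (k (u0 - 5, y)))).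
      + apply (vertical_continuous (fun u v => Im (k (u, v))) (fun u v => Re (k (u, v)))
          (u0 - 5) (u0 + 5) 0 b); try lra.
        intros; apply holomorphic_closed_form, Hk; assumption.
      + apply (vertical_continuous (fun u v => Im (k (u, v))) (fun u v => Re (k (u, v)))
          (u0 - 5) (u0 + 5) 0 b); try lra.
        intros; apply holomorphic_closed_form, Hk; assumption.
    - intros y Hy.
      assert (S : forall s M, s = 5 \/ s = -5 -> 0 <= M -> Cmod (g (u0 + s, y)) <= M ->
         Rabs (Re (k (u0 + s, y))) <= M * B ^ n).
      { intros s M Hs HM HgM. eapply Rle_trans; [apply re_le_Cmod|]. unfold k.
        rewrite Cmod_mult, Cmod_pow. apply Rmult_le_compat; [apply Cmod_ge_0| |exact HgM|].
        - apply pow_le, Cmod_ge_0.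
        - apply pow_incr. split; [apply Cmod_ge_0|].
          eapply Rle_trans; [apply kernel_side; lra|lra]. }
      pose proof (S 5 M1 (or_introl eq_refl) M1p (HM1 y Hy)) as S1.
      pose proof (S (-5) M2 (or_intror eq_refl) M2p) as S2.
      replace (u0 + -5) with (u0 - 5) in S2 by ring. specialize (S2 (HM2 y Hy)).
      replace (Re (k (u0 + 5, y)) - Re (k (u0 - 5, y)) - 0) with
        (Re (k (u0 + 5, y)) + - Re (k (u0 - 5, y))) by ring.
      eapply Rle_trans; [apply Rabs_triang|]. rewrite Rabs_Ropp. lra. }
  set (top := fun x => Im (k (x, b))).
  assert (Ctop : forall x, u0 - 5 <= x <= u0 + 5 -> continuous top x).
  { intros x Hx. apply C_differentiable_Im_x. apply Hk; lra. }
  assert (Etop : forall x, top (u0 + x) = Im (g (u0 + x, b)) * (1 - x ^ 2 / 100) ^ n).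
  { intros x. unfold top, k. rewrite kernel_real, <- RtoC_pow. apply im_scal_r. }
  assert (Hbot : RInt (fun x => Im (k (x, 0)) - Im (k (x, b))) (u0 - 5) (u0 + 5)
     = - RInt top (u0 - 5) (u0 + 5)).
  { rewrite <- (RInt_opp (V := R_CompleteNormedModule)).
    - apply RInt_ext. intros x Hx. rewrite Rmin_left, Rmax_right in Hx by lra.
      unfold k at 1. rewrite Gb by lra. rewrite Cmult_0_l. unfold top.
      exact (Rminus_0_l (Im (k (x, b)))).
    - apply ex_RInt_continuous_R.
      intros z. rewrite Rmin_left, Rmax_right by lra. apply Ctop. }
  rewrite Hbot in Cau.
  assert (Ex : forall p q, u0 - 5 <= p -> p <= q -> q <= u0 + 5 -> ex_RInt top p q).
  { intros p q Hp Hpq Hq. apply ex_RInt_continuous_R.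
    intros z. rewrite Rmin_left, Rmax_right by lra. intros. apply Ctop. lra. }
  assert (Split : RInt top (u0 - 5) (u0 + 5) = RInt top (u0 - 5) (u0 - del / 2)
     + RInt top (u0 - del / 2) (u0 + del / 2) + RInt top (u0 + del / 2) (u0 + 5)).
  { rewrite <- (RInt_Chasles (V := R_CompleteNormedModule) top (u0 - 5) (u0 + del / 2) (u0 + 5)).
    2, 3 : apply Ex; lra.
    rewrite <- (RInt_Chasles (V := R_CompleteNormedModule) top (u0 - 5) (u0 - del / 2) (u0 + del / 2)).
    2, 3 : apply Ex; lra.
    reflexivity. }
  assert (Out : forall x, u0 - 5 <= x <= u0 + 5 -> del / 2 <= Rabs (x - u0) ->
     - M3 * B ^ n <= top x).
  { intros x Hx Hxd. replace x with (u0 + (x - u0)) by ring. rewrite Etop.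
    set (y := x - u0) in *. assert (Hy : -5 <= y <= 5) by (unfold y; lra).
    assert (K0 : 0 <= 1 - y ^ 2 / 100) by nra.
    destruct (Rle_dec (Rabs y) del) as [Hyd|Hyd].
    - specialize (Gd y Hyd). assert (0 <= (1 - y ^ 2 / 100) ^ n) by (apply pow_le; exact K0).
      assert (0 <= M3 * B ^ n) by (apply Rmult_le_pos; assumption). nra.
    - assert (K1 : (1 - y ^ 2 / 100) ^ n <= B ^ n).
      { apply pow_incr. split; [exact K0|]. rewrite <- pow2_abs.
        pose proof (Rabs_pos y). nra. }
      assert (K2 : 0 <= (1 - y ^ 2 / 100) ^ n) by (apply pow_le; exact K0).
      assert (K3 : - M3 <= Im (g (u0 + y, b))).
      { pose proof (im_le_Cmod (g (u0 + y, b))) as K. apply Rabs_le_between in K.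
        specialize (HM3 (u0 + y)). lra. }
      nra. }
  assert (In : forall x, u0 - del / 2 <= x <= u0 + del / 2 -> eta * A ^ n <= top x).
  { intros x Hx. replace x with (u0 + (x - u0)) by ring. rewrite Etop.
    set (y := x - u0) in *. assert (Hy : - (del / 2) <= y <= del / 2) by (unfold y; lra).
    apply Rmult_le_compat; [lra|exact HAn| |].
    - apply Gd. apply Rabs_le. lra.
    - apply pow_incr. split; unfold A; nra. }
  pose proof (RInt_ge_const top (u0 - 5) (u0 - del / 2) (- M3 * B ^ n) ltac:(lra)) as I1.
  pose proof (RInt_ge_const top (u0 - del / 2) (u0 + del / 2) (eta * A ^ n) ltac:(lra)) as I2.
  pose proof (RInt_ge_const top (u0 + del / 2) (u0 + 5) (- M3 * B ^ n) ltac:(lra)) as I3.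
  specialize (I1 ltac:(intros; apply Ctop; lra)).
  specialize (I2 ltac:(intros; apply Ctop; lra)).
  specialize (I3 ltac:(intros; apply Ctop; lra)).
  specialize (I1 ltac:(intros; apply Out; [lra|rewrite Rabs_left1; lra])).
  specialize (I2 In).
  specialize (I3 ltac:(intros; apply Out; [lra|rewrite Rabs_right; lra])).
  apply Rabs_le_between in Side.
  assert (0 <= M3 * B ^ n) by (apply Rmult_le_pos; assumption).
  nra.
Qed.

Lemma polar_upper (z : C) : 0 < Im z -> exists u v, 0 < v < PI /\ z = Cexp (u, v).
Proof.
  intros Hz. pose proof (Cmod2_alt z) as E. pose proof (Cmod_ge_0 z) as G.
  set (r := Cmod z) in *.
  assert (Hr : 0 < r) by (destruct G as [G|G]; [exact G|nra]).
  assert (Hc : -1 <= Re z / r <= 1).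
  { pose proof (re_le_Cmod z) as K. fold r in K. apply Rabs_le_between in K.
    split; [apply Rle_div_r|apply Rle_div_l]; lra. }
  assert (Hc' : -1 < Re z / r < 1).
  { split; [apply Rlt_div_r|apply Rlt_div_l]; try lra; nra. }
  exists (ln r), (acos (Re z / r)).
  pose proof (cos_acos _ Hc) as C1. pose proof (sin_acos _ Hc) as S1.
  split; [apply acos_bound_lt; exact Hc'|].
  unfold Cexp. unfold Re at 2 4, Im. simpl.
  rewrite exp_ln by exact Hr. rewrite C1, S1.
  rewrite (surjective_pairing z) at 1. f_equal.
  - unfold Re. field. lra.
  - replace (1 - (Re z / r)²) with ((Im z / r) ^ 2).
    + rewrite sqrt_pow2; [unfold Im; field; lra|].
      left. apply Rdiv_lt_0_compat; assumption.
    + unfold Rsqr. apply Rmult_eq_reg_r with (r ^ 2); [|nra].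
      replace ((1 - Re z / r * (Re z / r)) * r ^ 2) with (r ^ 2 - Re z ^ 2) by (field; lra).
      replace ((Im z / r) ^ 2 * r ^ 2) with (Im z ^ 2) by (field; lra). lra.
Qed.

Lemma slit_plane_Cexp u v : - PI < v < PI -> slit_plane (Cexp (u, v)).
Proof.
  intros Hv [I R]. unfold Cexp, Im, Re in I, R. simpl in I, R.
  pose proof (exp_pos u).
  assert (S : sin v = 0) by nra.
  assert (Cs : cos v <= 0) by nra.
  destruct (Rtotal_order v 0) as [K|[K|K]].
  - assert (0 < sin (- v)) by (apply sin_gt_0; lra). rewrite sin_neg in *. lra.
  - subst v. rewrite cos_0 in Cs. lra.
  - assert (0 < sin v) by (apply sin_gt_0; lra). lra.
Qed.

(** The exponential maps a horizontal strip onto a sector, with the real axis going to the positive half-line; an angle below [PI < 4] fits into one strip. *)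
Theorem slit_plane_uniqueness f :
  (forall z, slit_plane z -> C_differentiable f z) ->
  (forall h, 0 < h -> f (RtoC h) = 0%C) ->
  forall z, 0 < Im z -> f z = 0%C.
Proof.
  intros Hf H0 z Hz. destruct (polar_upper z Hz) as (u0 & b & Hb & ->).
  pose proof PI_4.
  apply (strip_uniqueness (fun w => f (Cexp w)) u0 b); [lra| |].
  - intros u v Hu Hv. apply C_differentiable_comp.
    + apply Hf. apply slit_plane_Cexp. lra.
    + apply C_differentiable_Cexp.
  - intros u Hu. rewrite <- (H0 (exp u) (exp_pos u)). f_equal.
    unfold Cexp, RtoC. simpl. rewrite cos_0, sin_0. f_equal; ring.
Qed.

(** * Integrals depending on a complex parameter *)

(** The equalities produced by the integral lemmas live in a module type convertible to [R], which [ring] does not see through. *)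
Ltac as_R := match goal with |- ?a = ?b => change (@eq R a b) end.
Ltac ring_R := as_R; ring.

Definition ccont (f : R -> C) : Prop :=
  forall t, continuous (fun u => Re (f u)) t /\ continuous (fun u => Im (f u)) t.

Definition CInt (f : R -> C) (a b : R) : C :=
  (RInt (fun t => Re (f t)) a b, RInt (fun t => Im (f t)) a b).

Lemma ccont_eps f : ccont f -> forall t eps, 0 < eps -> exists del, 0 < del /\
  forall u, Rabs (u - t) < del -> Cmod (f u - f t) < eps.
Proof.
  intros Hf t eps Heps. destruct (Hf t) as [Hr Hi].
  apply continuity_pt_filterlim in Hr. apply continuity_pt_filterlim in Hi.
  destruct (Hr (eps / 2) ltac:(lra)) as (d1 & Hd1 & H1).
  destruct (Hi (eps / 2) ltac:(lra)) as (d2 & Hd2 & H2).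
  exists (Rmin d1 d2). split; [apply Rmin_glb_lt; assumption|].
  intros u Hu. pose proof (Rmin_l d1 d2). pose proof (Rmin_r d1 d2).
  destruct (Req_dec u t) as [->|Hn].
  { replace (f t - f t)%C with (RtoC 0) by ring. rewrite Cmod_0. exact Heps. }
  assert (D : D_x no_cond t u) by (split; [exact I|auto]).
  specialize (H1 u (conj D (Rlt_le_trans _ _ _ Hu (Rmin_l d1 d2)))).
  specialize (H2 u (conj D (Rlt_le_trans _ _ _ Hu (Rmin_r d1 d2)))).
  simpl in H1, H2. unfold R_dist in H1, H2.
  eapply Rle_lt_trans; [apply Cmod_le_re_im|].
  destruct (f u) as [a b], (f t) as [c d]. unfold Re, Im in *. simpl in *. unfold Rminus in *. lra.
Qed.

Lemma ccont_of_eps f : (forall t eps, 0 < eps -> exists del, 0 < del /\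
  forall u, Rabs (u - t) < del -> Cmod (f u - f t) < eps) -> ccont f.
Proof.
  intros H t. split; apply continuous_eps; intros eps Heps;
    destruct (H t eps Heps) as (del & Hd & H1); exists del; (split; [exact Hd|]);
    intros u Hu; specialize (H1 u Hu); (eapply Rle_lt_trans; [|exact H1]).
  - eapply Rle_trans; [right|apply re_le_Cmod]. reflexivity.
  - eapply Rle_trans; [right|apply im_le_Cmod]. reflexivity.
Qed.

Lemma ccont_comp (h : C -> C) f : ccont f -> (forall t, C_differentiable h (f t)) ->
  ccont (fun t => h (f t)).
Proof.
  intros Hf Hh. apply ccont_of_eps. intros t eps Heps.
  destruct (C_differentiable_continuous h (f t) (Hh t) eps Heps) as (d & Hd & H1).
  destruct (ccont_eps f Hf t d Hd) as (d' & Hd' & H2).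
  exists d'. split; [exact Hd'|]. intros u Hu. apply H1, H2, Hu.
Qed.

Lemma ccont_mult f g : ccont f -> ccont g -> ccont (fun t => f t * g t)%C.
Proof.
  intros Hf Hg t. destruct (Hf t) as [F1 F2], (Hg t) as [G1 G2]. split.
  - apply (continuous_ext (fun u => Re (f u) * Re (g u) - Im (f u) * Im (g u))).
    { intros u. symmetry. apply re_mult. }
    apply (continuous_minus (fun u => Re (f u) * Re (g u)) (fun u => Im (f u) * Im (g u)));
    [apply (continuous_mult (fun u => Re (f u)) (fun u => Re (g u)))
    |apply (continuous_mult (fun u => Im (f u)) (fun u => Im (g u)))]; assumption.
  - apply (continuous_ext (fun u => Re (f u) * Im (g u) + Im (f u) * Re (g u))).
    { intros u. symmetry. apply im_mult. }
    apply (continuous_plus (fun u => Re (f u) * Im (g u)) (fun u => Im (f u) * Re (g u)));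
    [apply (continuous_mult (fun u => Re (f u)) (fun u => Im (g u)))
    |apply (continuous_mult (fun u => Im (f u)) (fun u => Re (g u)))]; assumption.
Qed.

Lemma ccont_real (f : R -> R) : (forall t, continuous f t) -> ccont (fun t => RtoC (f t)).
Proof.
  intros Hf t. split; [apply Hf|]. apply continuous_const.
Qed.

Lemma ex_RInt_all_continuous (f : R -> R) a b : (forall t, continuous f t) -> ex_RInt f a b.
Proof.
  intros Hf. apply ex_RInt_continuous_R. intros; apply Hf.
Qed.

Lemma ccont_const c : ccont (fun _ => c).
Proof. intros t. split; apply continuous_const. Qed.

Lemma ccont_minus f g : ccont f -> ccont g -> ccont (fun t => f t - g t)%C.
Proof.
  intros Hf Hg t. destruct (Hf t) as [F1 F2], (Hg t) as [G1 G2]. split.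
  - apply (continuous_minus (fun u => Re (f u)) (fun u => Re (g u))); assumption.
  - apply (continuous_minus (fun u => Im (f u)) (fun u => Im (g u))); assumption.
Qed.

Lemma CInt_minus f g a b : ccont f -> ccont g ->
  CInt (fun t => f t - g t)%C a b = (CInt f a b - CInt g a b)%C.
Proof.
  intros Hf Hg. unfold CInt, Cminus, Cplus, Copp. simpl. f_equal.
  - apply (RInt_minus (V := R_CompleteNormedModule) (fun t => Re (f t)) (fun t => Re (g t)));
    apply ex_RInt_all_continuous; [exact (fun t => proj1 (Hf t))|exact (fun t => proj1 (Hg t))].
  - apply (RInt_minus (V := R_CompleteNormedModule) (fun t => Im (f t)) (fun t => Im (g t)));
    apply ex_RInt_all_continuous; [exact (fun t => proj2 (Hf t))|exact (fun t => proj2 (Hg t))].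
Qed.

Lemma RInt_lin2 (f g : R -> R) p q a b :
  (forall t, continuous f t) -> (forall t, continuous g t) ->
  RInt (fun t => p * f t + q * g t) a b = p * RInt f a b + q * RInt g a b.
Proof.
  intros Hf Hg.
  transitivity (plus (RInt (fun t => scal p (f t)) a b) (RInt (fun t => scal q (g t)) a b)).
  - apply (RInt_plus (V := R_CompleteNormedModule) (fun t => scal p (f t)) (fun t => scal q (g t)));
    apply (ex_RInt_scal (V := R_CompleteNormedModule)); apply ex_RInt_all_continuous; assumption.
  - rewrite !(RInt_scal (V := R_CompleteNormedModule)) by (apply ex_RInt_all_continuous; assumption).
    reflexivity.
Qed.

Lemma CInt_mult_const f c a b : ccont f ->
  CInt (fun t => f t * c)%C a b = (CInt f a b * c)%C.
Proof.
  intros Hf.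
  assert (E1 : RInt (fun t => Re (f t * c)%C) a b =
    Re c * RInt (fun t => Re (f t)) a b + (- Im c) * RInt (fun t => Im (f t)) a b).
  { rewrite <- RInt_lin2; [|exact (fun t => proj1 (Hf t))|exact (fun t => proj2 (Hf t))].
    apply RInt_ext. intros t _. rewrite re_mult. ring_R. }
  assert (E2 : RInt (fun t => Im (f t * c)%C) a b =
    Im c * RInt (fun t => Re (f t)) a b + Re c * RInt (fun t => Im (f t)) a b).
  { rewrite <- RInt_lin2; [|exact (fun t => proj1 (Hf t))|exact (fun t => proj2 (Hf t))].
    apply RInt_ext. intros t _. rewrite im_mult. ring_R. }
  unfold CInt at 1. rewrite E1, E2. unfold CInt, Cmult, Re, Im. simpl. f_equal; ring.
Qed.

Lemma CInt_bound f a b M : a <= b -> ccont f ->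
  (forall t, a <= t <= b -> Cmod (f t) <= M) -> Cmod (CInt f a b) <= 2 * M * (b - a).
Proof.
  intros Hab Hf HM. eapply Rle_trans; [apply Cmod_le_re_im|].
  unfold CInt, Re at 1, Im at 2. simpl.
  assert (H1 : Rabs (RInt (fun t => Re (f t)) a b - 0 * (b - a)) <= M * (b - a)).
  { apply RInt_near_const; [exact Hab|exact (fun t _ => proj1 (Hf t))|].
    intros t Ht. rewrite Rminus_0_r. eapply Rle_trans; [apply re_le_Cmod|apply HM, Ht]. }
  assert (H2 : Rabs (RInt (fun t => Im (f t)) a b - 0 * (b - a)) <= M * (b - a)).
  { apply RInt_near_const; [exact Hab|exact (fun t _ => proj2 (Hf t))|].
    intros t Ht. rewrite Rminus_0_r. eapply Rle_trans; [apply im_le_Cmod|apply HM, Ht]. }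
  rewrite Rmult_0_l, Rminus_0_r in H1, H2. lra.
Qed.

(** Differentiation under the integral sign, from a first order expansion of the integrand that is uniform in [t]. *)
Lemma C_differentiable_CInt (F : C -> R -> C) (F' : R -> C) a b s r K :
  a <= b -> 0 < r -> 0 <= K ->
  (forall w, Cmod (w - s) < r -> ccont (F w)) -> ccont F' ->
  (forall w t, Cmod (w - s) < r ->
     Cmod (F w t - F s t - F' t * (w - s)) <= K * Cmod (w - s) ^ 2) ->
  C_differentiable (fun w => CInt (F w) a b) s.
Proof.
  intros Hab Hr HK HF HF' Hrem. apply C_differentiable_iff.
  exists (CInt F' a b). intros eps Heps.
  set (L := 2 * K * (b - a) + 1).
  assert (HL : 0 < L) by (unfold L; assert (0 <= K * (b - a)) by (apply Rmult_le_pos; lra); lra).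
  exists (Rmin r (eps / L)). split.
  { apply Rmin_glb_lt; [exact Hr|apply Rdiv_lt_0_compat; assumption]. }
  intros w Hw. pose proof (Rmin_l r (eps / L)). pose proof (Rmin_r r (eps / L)).
  assert (Hs : ccont (F s)).
  { apply HF. replace (s - s)%C with (RtoC 0) by ring. rewrite Cmod_0. exact Hr. }
  assert (Hw' : ccont (F w)) by (apply HF; lra).
  rewrite <- CInt_minus by assumption.
  rewrite <- CInt_mult_const by assumption.
  rewrite <- CInt_minus.
  2: { apply ccont_minus; assumption. }
  2: { apply ccont_mult; [assumption|apply ccont_const]. }
  eapply Rle_trans.
  { apply (CInt_bound _ a b (K * Cmod (w - s) ^ 2)); [exact Hab| |].
    - apply ccont_minus; [apply ccont_minus; assumption|].
      apply ccont_mult; [assumption|apply ccont_const].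
    - intros t Ht. apply Hrem. lra. }
  pose proof (Cmod_ge_0 (w - s)) as G. set (d := Cmod (w - s)) in *.
  assert (d * L <= eps).
  { apply Rle_trans with (eps / L * L); [apply Rmult_le_compat_r; lra|right; field; lra]. }
  unfold L in *. assert (0 <= K * (b - a)) by (apply Rmult_le_pos; lra). nra.
Qed.

(** * The two period integrals *)

(** On the oval of energy [h], with [s = sqrt (1 + 4 h)] and [x = sqrt (1 + s) cos t], the motion in [t] has speed [sqrt (radicand s t / 2)]. *)
Definition radicand (s : C) (t : R) : C :=
  (RtoC (1 + cos t ^ 2) * s - RtoC (1 - cos t ^ 2))%C.

(** The angle on the section [x = 0], [y > 0]; one revolution later it is [turn1]. *)
Definition turn0 := - (PI / 2).
Definition turn1 := 3 * (PI / 2).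

(** Up to the factor [1 + s] and a constant, the integrals of [y ^ 2] (this one) and of [x ^ 2] ([Nper]) over the oval with respect to time, as functions of [s]. *)
Definition Dper (s : C) : C :=
  CInt (fun t => RtoC (sin t ^ 2) * Csqrt (radicand s t))%C turn0 turn1.
Definition Nper (s : C) : C :=
  CInt (fun t => RtoC (cos t ^ 2) * / Csqrt (radicand s t))%C turn0 turn1.

Lemma turn_length : turn1 - turn0 = 2 * PI.
Proof. unfold turn0, turn1. field. Qed.

Lemma turn_le : turn0 <= turn1.
Proof. pose proof turn_length. pose proof PI_RGT_0. lra. Qed.

Lemma Re_radicand s t : Re (radicand s t) = (1 + cos t ^ 2) * Re s - (1 - cos t ^ 2).
Proof. unfold radicand, Re. simpl. ring. Qed.
Lemma Im_radicand s t : Im (radicand s t) = (1 + cos t ^ 2) * Im s.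
Proof. unfold radicand, Im. simpl. ring. Qed.

Lemma cos2_bounds t : 0 <= cos t ^ 2 <= 1.
Proof. pose proof (COS_bound t). nra. Qed.
Lemma sin2_bounds t : 0 <= sin t ^ 2 <= 1.
Proof. pose proof (SIN_bound t). nra. Qed.

Lemma radicand_slit s t : slit_plane (s - 1) -> slit_plane (radicand s t).
Proof.
  intros Hs [I R]. apply Hs. rewrite Im_radicand in I. rewrite Re_radicand in R.
  pose proof (cos2_bounds t).
  assert (I0 : Im s = 0) by nra.
  split.
  - destruct s as [x y]. unfold Im in *. simpl in *. lra.
  - destruct s as [x y]. unfold Re, Im in *. simpl in *. nra.
Qed.

Lemma Cmod_radicand_le s t : Cmod (radicand s t) <= 2 * Cmod s + 1.
Proof.
  unfold radicand. pose proof (cos2_bounds t). pose proof (Cmod_ge_0 s).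
  replace (RtoC (1 + cos t ^ 2) * s - RtoC (1 - cos t ^ 2))%C with
    (RtoC (1 + cos t ^ 2) * s + RtoC (- (1 - cos t ^ 2)))%C.
  2: { rewrite RtoC_opp. ring. }
  eapply Rle_trans; [apply Cmod_triangle|].
  rewrite Cmod_mult, !Cmod_R, Rabs_Ropp, !Rabs_right by lra. nra.
Qed.

Lemma ccont_radicand s : ccont (radicand s).
Proof.
  intros t. split.
  - apply (continuous_ext (fun u => (1 + cos u ^ 2) * Re s - (1 - cos u ^ 2))).
    { intros u. symmetry. apply Re_radicand. }
    apply derivable_continuous_R. auto_derive. trivial.
  - apply (continuous_ext (fun u => (1 + cos u ^ 2) * Im s)).
    { intros u. symmetry. apply Im_radicand. }
    apply derivable_continuous_R. auto_derive. trivial.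
Qed.

Lemma ccont_Csqrt_radicand s : slit_plane (s - 1) -> ccont (fun t => Csqrt (radicand s t)).
Proof.
  intros Hs. apply ccont_comp; [apply ccont_radicand|].
  intros t. apply C_differentiable_Csqrt, radicand_slit, Hs.
Qed.

Lemma ccont_inv_Csqrt_radicand s : slit_plane (s - 1) -> ccont (fun t => / Csqrt (radicand s t))%C.
Proof.
  intros Hs. apply (ccont_comp Cinv (fun t => Csqrt (radicand s t))).
  - apply ccont_Csqrt_radicand, Hs.
  - intros t. apply C_differentiable_Cinv, Csqrt_nonzero, radicand_slit, Hs.
Qed.

Lemma continuous_sin2 t : continuous (fun u => sin u ^ 2) t.
Proof.
  apply derivable_continuous_R. auto_derive. trivial.
Qed.
Lemma continuous_cos2 t : continuous (fun u => cos u ^ 2) t.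
Proof.
  apply derivable_continuous_R. auto_derive. trivial.
Qed.

Lemma ccont_Dper_integrand s : slit_plane (s - 1) ->
  ccont (fun t => RtoC (sin t ^ 2) * Csqrt (radicand s t))%C.
Proof.
  intros Hs. apply ccont_mult; [apply ccont_real, continuous_sin2|].
  apply ccont_Csqrt_radicand, Hs.
Qed.
Lemma ccont_Nper_integrand s : slit_plane (s - 1) ->
  ccont (fun t => RtoC (cos t ^ 2) * / Csqrt (radicand s t))%C.
Proof.
  intros Hs. apply ccont_mult; [apply ccont_real, continuous_cos2|].
  apply ccont_inv_Csqrt_radicand, Hs.
Qed.

Lemma radicand_root_lower s : slit_plane (s - 1) ->
  exists p, 0 < p /\ forall t, p <= Re (Csqrt (radicand s t)).
Proof.
  intros Hs. destruct (Req_dec (Im s) 0) as [I0|I0].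
  - assert (Hs1 : 1 < Re s).
    { destruct (Rle_dec (Re s) 1) as [K|K]; [|lra]. exfalso. apply Hs.
      destruct s as [x y]. unfold Re, Im in *. simpl in *. split; lra. }
    exists (sqrt (Re s - 1)). split; [apply sqrt_lt_R0; lra|].
    intros t. apply Rsqr_incr_0_var.
    2: { left. apply Re_Csqrt_pos, radicand_slit, Hs. }
    rewrite Rsqr_sqrt by lra.
    assert (E : (Re (Csqrt (radicand s t)))² = Re (Csqrt (radicand s t)) ^ 2) by (unfold Rsqr; ring).
    rewrite E, Re_Csqrt_sqr. pose proof (Re_le_Cmod (radicand s t)).
    rewrite Re_radicand in *. pose proof (cos2_bounds t). nra.
  - set (B := 2 * Cmod s + 1). pose proof (Cmod_ge_0 s).
    assert (HB : 0 < sqrt B) by (apply sqrt_lt_R0; unfold B; lra).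
    pose proof (Rabs_pos_lt _ I0) as Ip.
    exists (Rabs (Im s) / (2 * sqrt B)). split; [apply Rdiv_lt_0_compat; lra|].
    intros t. pose proof (Re_Csqrt_lower (radicand s t) (radicand_slit s t Hs)) as L.
    pose proof (Re_Csqrt_pos (radicand s t) (radicand_slit s t Hs)) as P.
    rewrite Im_radicand, Rabs_mult in L. pose proof (cos2_bounds t).
    rewrite Rabs_right in L by lra.
    assert (sqrt (Cmod (radicand s t)) <= sqrt B) by (apply sqrt_le_1_alt, Cmod_radicand_le).
    apply Rle_div_l; [lra|]. nra.
Qed.

Lemma radicand_diff s w t :
  (radicand w t - radicand s t)%C = (RtoC (1 + cos t ^ 2) * (w - s))%C.
Proof. unfold radicand. ring. Qed.

Lemma Cmod_radicand_diff s w t : Cmod (radicand w t - radicand s t) <= 2 * Cmod (w - s).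
Proof.
  rewrite radicand_diff.
  pose proof (cos2_bounds t). pose proof (Cmod_ge_0 (w - s)).
  rewrite Cmod_mult, Cmod_R, Rabs_right by lra. nra.
Qed.

Lemma radicand_slit_near s p w : slit_plane (s - 1) -> 0 < p ->
  (forall t, p <= Re (Csqrt (radicand s t))) -> Cmod (w - s) < p ^ 2 / 4 ->
  forall t, slit_plane (radicand w t).
Proof.
  intros Hs Hp Hpt Hw t. apply (slit_plane_open _ (radicand_slit s t Hs)).
  eapply Rle_lt_trans; [apply Cmod_radicand_diff|]. specialize (Hpt t).
  apply Rlt_le_trans with (p ^ 2); nra.
Qed.

Lemma ccont_Csqrt_of_slit w : (forall t, slit_plane (radicand w t)) ->
  ccont (fun t => Csqrt (radicand w t)).
Proof.
  intros H. apply ccont_comp; [apply ccont_radicand|].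
  intros t. apply C_differentiable_Csqrt, H.
Qed.

Lemma C_differentiable_Dper s : slit_plane (s - 1) -> C_differentiable Dper s.
Proof.
  intros Hs. destruct (radicand_root_lower s Hs) as (p & Hp & Hpt).
  assert (Hp3 : 0 < p ^ 3) by (apply pow_lt; exact Hp).
  apply (C_differentiable_CInt (fun w t => RtoC (sin t ^ 2) * Csqrt (radicand w t))%C
    (fun t => RtoC (sin t ^ 2) * (RtoC (1 + cos t ^ 2) * (/ 2 * / Csqrt (radicand s t))))%C
    turn0 turn1 s (p ^ 2 / 4) (4 / (2 * p ^ 3))).
  - apply turn_le.
  - nra.
  - left. apply Rdiv_lt_0_compat; lra.
  - intros w Hw. apply ccont_mult; [apply ccont_real, continuous_sin2|].
    apply ccont_Csqrt_of_slit. apply (radicand_slit_near s p); assumption.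
  - apply ccont_mult; [apply ccont_real, continuous_sin2|].
    apply ccont_mult.
    + apply ccont_real. intros t.
      apply (continuous_plus (fun _ => 1) (fun u => cos u ^ 2)); [apply continuous_const|apply continuous_cos2].
    + apply ccont_mult; [apply ccont_const|]. apply ccont_inv_Csqrt_radicand, Hs.
  - intros w t Hw.
    pose proof (radicand_slit_near s p w Hs Hp Hpt Hw t) as Sw.
    pose proof (radicand_slit s t Hs) as Ss.
    pose proof (Csqrt_taylor _ _ Ss Sw) as T.
    pose proof (Csqrt_nonzero _ Ss) as N.
    replace (RtoC (sin t ^ 2) * Csqrt (radicand w t) - RtoC (sin t ^ 2) * Csqrt (radicand s t)
      - RtoC (sin t ^ 2) * (RtoC (1 + cos t ^ 2) * (/ 2 * / Csqrt (radicand s t))) * (w - s))%C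
    with (RtoC (sin t ^ 2) * (Csqrt (radicand w t) - Csqrt (radicand s t)
      - / (2 * Csqrt (radicand s t)) * (radicand w t - radicand s t)))%C.
    2: { rewrite radicand_diff. field. exact N. }
    pose proof (sin2_bounds t).
    rewrite Cmod_mult, Cmod_R, Rabs_right by lra.
    apply Rle_trans with (1 * (Cmod (radicand w t - radicand s t) ^ 2 / (2 * Re (Csqrt (radicand s t)) ^ 3))).
    + apply Rmult_le_compat; [lra|apply Cmod_ge_0|lra|exact T].
    + rewrite Rmult_1_l. pose proof (Cmod_radicand_diff s w t) as D.
      pose proof (Cmod_ge_0 (radicand w t - radicand s t)). pose proof (Cmod_ge_0 (w - s)).
      unfold Rdiv. replace (4 * / (2 * p ^ 3) * Cmod (w - s) ^ 2) with
        ((2 * Cmod (w - s)) ^ 2 * / (2 * p ^ 3)) by (field; lra).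
      apply Rmult_le_compat.
      * apply pow2_ge_0.
      * left. apply Rinv_0_lt_compat. specialize (Hpt t).
        assert (0 < Re (Csqrt (radicand s t)) ^ 3) by (apply pow_lt; lra). lra.
      * apply pow_incr. lra.
      * apply Rinv_le_contravar; [lra|]. specialize (Hpt t).
        apply Rmult_le_compat_l; [lra|]. apply pow_incr. lra.
Qed.

(** The analogue of [Csqrt_taylor] for the inverse root, which is the integrand of [Nper]. *)
Lemma inv_Csqrt_taylor z w p : slit_plane z -> slit_plane w -> 0 < p -> p <= Re (Csqrt z) ->
  Cmod (w - z) <= p ^ 2 / 2 ->
  Cmod (/ Csqrt w - / Csqrt z + (w - z) * / (2 * (Csqrt z * Csqrt z * Csqrt z)))
    <= 5 / (2 * p ^ 5) * Cmod (w - z) ^ 2.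
Proof.
  intros Hz Hw Hp Hpz Hwz.
  pose proof (Csqrt_nonzero z Hz) as Nz. pose proof (Csqrt_nonzero w Hw) as Nw.
  pose proof (Csqrt_lipschitz z w Hz Hw) as L.
  pose proof (Re_le_Cmod (Csqrt z)) as Q.
  pose proof (Csqrt_sqr z Hz) as Ez. pose proof (Csqrt_sqr w Hw) as Ew.
  pose proof (Cmod_ge_0 (w - z)) as D1.
  set (a := Csqrt z) in *. set (b := Csqrt w) in *.
  assert (L' : Cmod (b - a) <= Cmod (w - z) / p).
  { eapply Rle_trans; [exact L|]. unfold Rdiv. apply Rmult_le_compat_l; [exact D1|].
    apply Rinv_le_contravar; lra. }
  assert (E : (/ b - / a + (w - z) * / (2 * (a * a * a)) =
     (b - a) * (b - a) * (b + 2 * a) / (2 * (a * a * a) * b))%C).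
  { rewrite <- Ez at 1. rewrite <- Ew at 1. field. split; assumption. }
  rewrite E. clear E L Ez Ew.
  assert (N2 : (2 * (a * a * a) * b)%C <> 0%C).
  { repeat apply Cmult_neq_0; try assumption. intros K. apply RtoC_inj in K. lra. }
  rewrite Cmod_div by exact N2. rewrite !Cmod_mult, Cmod_R, Rabs_right by lra.
  set (d := Cmod (w - z)) in *.
  assert (Ha : p <= Cmod a) by lra.
  pose proof (Cmod_ge_0 (b - a)) as B0.
  assert (Hd2 : d / p <= p / 2).
  { apply Rle_div_l; [exact Hp|]. lra. }
  assert (Hb : Cmod a / 2 <= Cmod b).
  { pose proof (Cmod_reverse_triangle b a) as T. apply Rabs_le_between in T. lra. }
  assert (Hb2 : Cmod (b + 2 * a) <= 5 * Cmod b).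
  { eapply Rle_trans; [apply Cmod_triangle|]. rewrite Cmod_mult, Cmod_R, Rabs_right by lra. lra. }
  pose proof (Cmod_ge_0 (b + 2 * a)) as B1.
  assert (Pb : 0 < Cmod b) by lra.
  assert (P5 : 0 < p ^ 5) by (apply pow_lt; exact Hp).
  apply Rle_trans with ((d / p) * (d / p) * (5 * Cmod b) / (2 * (p * p * p) * Cmod b)).
  2: { right. field. split; lra. }
  unfold Rdiv at 1 4. apply Rmult_le_compat.
  - repeat apply Rmult_le_pos; assumption.
  - left. apply Rinv_0_lt_compat. repeat apply Rmult_lt_0_compat; lra.
  - apply Rmult_le_compat; [apply Rmult_le_pos; assumption|exact B1| |exact Hb2].
    apply Rmult_le_compat; assumption.
  - apply Rinv_le_contravar.
    + repeat apply Rmult_lt_0_compat; lra.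
    + apply Rmult_le_compat_r; [lra|]. apply Rmult_le_compat_l; [lra|].
      assert (p * p <= Cmod a * Cmod a) by (apply Rmult_le_compat; lra).
      apply Rmult_le_compat; lra.
Qed.

Lemma C_differentiable_Nper s : slit_plane (s - 1) -> C_differentiable Nper s.
Proof.
  intros Hs. destruct (radicand_root_lower s Hs) as (p & Hp & Hpt).
  assert (Hp5 : 0 < p ^ 5) by (apply pow_lt; exact Hp).
  apply (C_differentiable_CInt (fun w t => RtoC (cos t ^ 2) * / Csqrt (radicand w t))%C
    (fun t => RtoC (cos t ^ 2) * (RtoC (1 + cos t ^ 2) * (- / 2 * (/ Csqrt (radicand s t) *
       / Csqrt (radicand s t) * / Csqrt (radicand s t)))))%C
    turn0 turn1 s (p ^ 2 / 4) (4 * (5 / (2 * p ^ 5)))).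
  - apply turn_le.
  - nra.
  - left. apply Rmult_lt_0_compat; [lra|]. apply Rdiv_lt_0_compat; lra.
  - intros w Hw. apply ccont_mult; [apply ccont_real, continuous_cos2|].
    apply (ccont_comp Cinv (fun t => Csqrt (radicand w t))).
    + apply ccont_Csqrt_of_slit. apply (radicand_slit_near s p); assumption.
    + intros t. apply C_differentiable_Cinv, Csqrt_nonzero.
      apply (radicand_slit_near s p); assumption.
  - pose proof (ccont_inv_Csqrt_radicand s Hs) as CI.
    apply ccont_mult; [apply ccont_real, continuous_cos2|].
    apply ccont_mult.
    + apply ccont_real. intros t.
      apply (continuous_plus (fun _ => 1) (fun u => cos u ^ 2)); [apply continuous_const|apply continuous_cos2].
    + apply ccont_mult; [apply ccont_const|]. exact (ccont_mult _ _ (ccont_mult _ _ CI CI) CI).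
  - intros w t Hw.
    pose proof (radicand_slit_near s p w Hs Hp Hpt Hw t) as Sw.
    pose proof (radicand_slit s t Hs) as Ss.
    pose proof (Csqrt_nonzero _ Ss) as N. pose proof (Csqrt_nonzero _ Sw) as Nw.
    pose proof (Cmod_radicand_diff s w t) as D.
    pose proof (inv_Csqrt_taylor _ _ p Ss Sw Hp (Hpt t) ltac:(lra)) as T.
    replace (RtoC (cos t ^ 2) * / Csqrt (radicand w t) - RtoC (cos t ^ 2) * / Csqrt (radicand s t)
      - RtoC (cos t ^ 2) * (RtoC (1 + cos t ^ 2) * (- / 2 * (/ Csqrt (radicand s t) *
       / Csqrt (radicand s t) * / Csqrt (radicand s t)))) * (w - s))%C
    with (RtoC (cos t ^ 2) * (/ Csqrt (radicand w t) - / Csqrt (radicand s t)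
      + (radicand w t - radicand s t) *
        / (2 * (Csqrt (radicand s t) * Csqrt (radicand s t) * Csqrt (radicand s t)))))%C.
    2: { rewrite radicand_diff. field. split; assumption. }
    pose proof (cos2_bounds t).
    rewrite Cmod_mult, Cmod_R, Rabs_right by lra.
    pose proof (Cmod_ge_0 (radicand w t - radicand s t)) as G. pose proof (Cmod_ge_0 (w - s)).
    assert (0 < 5 / (2 * p ^ 5)) by (apply Rdiv_lt_0_compat; lra).
    set (Q := 5 / (2 * p ^ 5)) in *.
    apply Rle_trans with (1 * (Q * Cmod (radicand w t - radicand s t) ^ 2)).
    + apply Rmult_le_compat; [lra|apply Cmod_ge_0|lra|exact T].
    + assert (Cmod (radicand w t - radicand s t) ^ 2 <= (2 * Cmod (w - s)) ^ 2)
        by (apply pow_incr; lra).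
      nra.
Qed.

(** * Size and argument of the ratio of the periods *)

(** A trigonometric antiderivative is a linear function plus a multiple of [cos t], which vanishes at both ends. *)
Lemma turn_antiderivative (F f : R -> R) (k : R) :
  (forall t, is_derive F t (f t)) -> (forall t, continuous f t) ->
  (forall t, cos t = 0 -> F t = k * t) -> RInt f turn0 turn1 = k * (2 * PI).
Proof.
  intros Hd Hc HF.
  rewrite (is_RInt_unique _ _ _ _ (is_RInt_derive (V := R_CompleteNormedModule) F f turn0 turn1
    (fun t _ => Hd t) (fun t _ => Hc t))).
  rewrite !HF.
  - rewrite <- turn_length. unfold minus, plus, opp; simpl. ring.
  - unfold turn0. rewrite cos_neg. apply cos_PI2.
  - unfold turn1. apply cos_3PI2.
Qed.

Lemma RInt_sin2 : RInt (fun t => sin t ^ 2) turn0 turn1 = PI.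
Proof.
  rewrite (turn_antiderivative (fun t => t / 2 - sin t * cos t / 2) _ (1 / 2)); [as_R; field| | |].
  - intros t. auto_derive; [exact I|]. pose proof (sin2_cos2 t) as E. unfold Rsqr in E. nra.
  - apply continuous_sin2.
  - intros t Ht. rewrite Ht. field.
Qed.

Lemma continuous_sin_pow n t : continuous (fun u => sin u ^ n) t.
Proof.
  apply derivable_continuous_R. auto_derive. trivial.
Qed.

Lemma RInt_sin4 : RInt (fun t => sin t ^ 4) turn0 turn1 = 3 / 4 * PI.
Proof.
  rewrite (turn_antiderivative
    (fun t => 3 * t / 8 - 3 * (sin t * cos t) / 8 - sin t ^ 3 * cos t / 4) _ (3 / 8)); [as_R; field| | |].
  - intros t. auto_derive; [exact I|]. pose proof (sin2_cos2 t) as E. unfold Rsqr in E.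
    assert (C2 : cos t * cos t = 1 - sin t * sin t) by lra.
    replace (sin t ^ 4) with (sin t ^ 4 + (3 / 8 + 3 / 4 * sin t ^ 2) * (1 - sin t * sin t - cos t * cos t))
      by (rewrite C2; ring).
    simpl. field.
  - apply continuous_sin_pow.
  - intros t Ht. rewrite Ht. field.
Qed.

Lemma RInt_sin6 : RInt (fun t => sin t ^ 6) turn0 turn1 = 5 / 8 * PI.
Proof.
  rewrite (turn_antiderivative
    (fun t => 5 * t / 16 - 5 * (sin t * cos t) / 16 - 5 * (sin t ^ 3 * cos t) / 24
       - sin t ^ 5 * cos t / 6) _ (5 / 16)); [as_R; field| | |].
  - intros t. auto_derive; [exact I|]. pose proof (sin2_cos2 t) as E. unfold Rsqr in E.
    assert (C2 : cos t * cos t = 1 - sin t * sin t) by lra.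
    replace (sin t ^ 6) with (sin t ^ 6 + (5 / 16 + 5 / 8 * sin t ^ 2 + 5 / 6 * sin t ^ 4)
       * (1 - sin t * sin t - cos t * cos t))
      by (rewrite C2; ring).
    simpl. field.
  - apply continuous_sin_pow.
  - intros t Ht. rewrite Ht. field.
Qed.

Lemma Re_CInt f a b : Re (CInt f a b) = RInt (fun t => Re (f t)) a b.
Proof. reflexivity. Qed.
Lemma Im_CInt f a b : Im (CInt f a b) = RInt (fun t => Im (f t)) a b.
Proof. reflexivity. Qed.

Lemma Re_Dper s : Re (Dper s) =
  RInt (fun t => sin t ^ 2 * Re (Csqrt (radicand s t))) turn0 turn1.
Proof. unfold Dper. rewrite Re_CInt. apply RInt_ext. intros t _. apply re_scal_l. Qed.
Lemma Im_Dper s : Im (Dper s) =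
  RInt (fun t => sin t ^ 2 * Im (Csqrt (radicand s t))) turn0 turn1.
Proof. unfold Dper. rewrite Im_CInt. apply RInt_ext. intros t _. apply im_scal_l. Qed.
Lemma Re_Nper s : Re (Nper s) =
  RInt (fun t => cos t ^ 2 * Re (/ Csqrt (radicand s t))%C) turn0 turn1.
Proof. unfold Nper. rewrite Re_CInt. apply RInt_ext. intros t _. apply re_scal_l. Qed.
Lemma Im_Nper s : Im (Nper s) =
  RInt (fun t => cos t ^ 2 * Im (/ Csqrt (radicand s t))%C) turn0 turn1.
Proof. unfold Nper. rewrite Im_CInt. apply RInt_ext. intros t _. apply im_scal_l. Qed.

Lemma RInt_cos2 : RInt (fun t => cos t ^ 2) turn0 turn1 = PI.
Proof.
  rewrite (turn_antiderivative (fun t => t / 2 + sin t * cos t / 2) _ (1 / 2)); [as_R; field| | |].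
  - intros t. auto_derive; [exact I|]. pose proof (sin2_cos2 t) as E. unfold Rsqr in E. nra.
  - apply continuous_cos2.
  - intros t Ht. rewrite Ht. field.
Qed.

Lemma RInt_weight_ge (q f : R -> R) k : (forall t, continuous q t) -> (forall t, continuous f t) ->
  (forall t, 0 <= q t) -> (forall t, k <= f t) ->
  k * RInt q turn0 turn1 <= RInt (fun t => q t * f t) turn0 turn1.
Proof.
  intros Hq Hf Hq0 Hk.
  rewrite <- (RInt_scal (V := R_CompleteNormedModule) q _ _ k) by (apply ex_RInt_all_continuous, Hq).
  apply RInt_le; [apply turn_le| | |].
  - apply (ex_RInt_scal (V := R_CompleteNormedModule)). apply ex_RInt_all_continuous, Hq.
  - apply ex_RInt_all_continuous. intros t. apply (continuous_mult q f); [apply Hq|apply Hf].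
  - intros t _. change (scal k (q t)) with (k * q t). specialize (Hq0 t). specialize (Hk t). nra.
Qed.

(** A root of a point of the upper half plane lies in the first quadrant, and [Im z] is twice the product of its parts. *)
Lemma root_components z : slit_plane z -> 0 <= Im z ->
  0 <= Im (Csqrt z) /\
  Im z / (2 * sqrt (Cmod z)) <= Re (Csqrt z) /\
  Im z / (2 * sqrt (Cmod z)) <= Im (Csqrt z).
Proof.
  intros Hz I0. pose proof (Re_Csqrt_pos z Hz) as Pz.
  pose proof (re_le_Cmod (Csqrt z)) as R1. pose proof (im_le_Cmod (Csqrt z)) as I1.
  pose proof (Cmod_Csqrt z Hz) as E. rewrite E in R1, I1.
  assert (Q : Im z = 2 * Re (Csqrt z) * Im (Csqrt z)).
  { rewrite <- (Csqrt_sqr z Hz) at 1. rewrite im_mult. ring. }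
  assert (Ip : 0 <= Im (Csqrt z)) by nra.
  apply Rabs_le_between in R1. apply Rabs_le_between in I1.
  assert (0 < sqrt (Cmod z)) by lra.
  split; [exact Ip|]. split; apply Rle_div_l; try lra; rewrite Q; nra.
Qed.

Lemma im_inv (c : C) : c <> 0%C -> Im (/ c)%C = - Im c / Cmod c ^ 2.
Proof.
  intros Hc. rewrite Cmod2_alt. destruct c as [a b]. unfold Re, Im. simpl. reflexivity.
Qed.
Lemma re_inv (c : C) : c <> 0%C -> Re (/ c)%C = Re c / Cmod c ^ 2.
Proof.
  intros Hc. rewrite Cmod2_alt. destruct c as [a b]. unfold Re, Im. simpl. reflexivity.
Qed.

Lemma upper_slit z : 0 < Im z -> slit_plane z.
Proof. intros H [E _]. lra. Qed.

Lemma upper_slit_minus1 s : 0 < Im s -> slit_plane (s - 1).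
Proof.
  intros H. apply upper_slit. destruct s. unfold Im in *. simpl in *. lra.
Qed.

Section UpperHalf.
Variable s : C.
Hypothesis Hs : 0 < Im s.
Let B := 2 * Cmod s + 1.

Lemma B_ge1 : 1 <= B.
Proof. unfold B. pose proof (Cmod_ge_0 s). lra. Qed.
Lemma sqrtB_pos : 0 < sqrt B.
Proof. apply sqrt_lt_R0. pose proof B_ge1. lra. Qed.

Lemma root_radicand_lower t :
  Im s / (2 * sqrt B) <= Re (Csqrt (radicand s t)) /\
  Im s / (2 * sqrt B) <= Im (Csqrt (radicand s t)).
Proof.
  pose proof (radicand_slit s t (upper_slit_minus1 s Hs)) as Sl.
  pose proof (cos2_bounds t) as C2. pose proof (Im_radicand s t) as IX.
  destruct (root_components _ Sl) as (_ & R1 & I1); [rewrite IX; nra|].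
  pose proof sqrtB_pos.
  assert (Hm : 0 < Cmod (radicand s t)).
  { apply Cmod_gt_0. intros E. rewrite E in IX. simpl in IX. nra. }
  assert (Hq : 0 < sqrt (Cmod (radicand s t))) by (apply sqrt_lt_R0; exact Hm).
  assert (Hle : sqrt (Cmod (radicand s t)) <= sqrt B) by (apply sqrt_le_1_alt, Cmod_radicand_le).
  assert (K : Im s / (2 * sqrt B) <= Im (radicand s t) / (2 * sqrt (Cmod (radicand s t)))).
  { unfold Rdiv. apply Rmult_le_compat; [lra| |rewrite IX; nra|apply Rinv_le_contravar; lra].
    left. apply Rinv_0_lt_compat. lra. }
  lra.
Qed.

Lemma inv_root_radicand_lower t :
  Im s / (2 * sqrt B) / B <= Re (/ Csqrt (radicand s t))%C /\
  Im s / (2 * sqrt B) / B <= - Im (/ Csqrt (radicand s t))%C.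
Proof.
  pose proof (radicand_slit s t (upper_slit_minus1 s Hs)) as Sl.
  destruct (root_radicand_lower t) as [R1 I1].
  pose proof sqrtB_pos as Hb.
  assert (N := Csqrt_nonzero _ Sl).
  rewrite re_inv, im_inv by exact N. rewrite Cmod_Csqrt_sqr by exact Sl.
  assert (Hm : 0 < Cmod (radicand s t)).
  { rewrite <- Cmod_Csqrt_sqr by exact Sl. apply Cmod_gt_0 in N. nra. }
  assert (P : 0 <= Im s / (2 * sqrt B)) by (left; apply Rdiv_lt_0_compat; lra).
  pose proof (Cmod_radicand_le s t) as L. fold B in L. pose proof B_ge1.
  replace (- (- Im (Csqrt (radicand s t)) / Cmod (radicand s t)))
    with (Im (Csqrt (radicand s t)) / Cmod (radicand s t)) by (field; lra).
  unfold Rdiv in *. split; (apply Rmult_le_compat; [exact P| |assumption|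
    apply Rinv_le_contravar; lra]); left; apply Rinv_0_lt_compat; lra.
Qed.

(** The integrand lies in the first quadrant. *)
Lemma Dper_quadrant :
  PI * (Im s / (2 * sqrt B)) <= Re (Dper s) /\ PI * (Im s / (2 * sqrt B)) <= Im (Dper s).
Proof.
  pose proof (ccont_Csqrt_radicand s (upper_slit_minus1 s Hs)) as CC.
  rewrite <- RInt_sin2, Re_Dper, Im_Dper, (Rmult_comm (RInt _ _ _)).
  split; (apply RInt_weight_ge; [apply continuous_sin2| |apply sin2_bounds|]).
  - exact (fun t => proj1 (CC t)).
  - apply root_radicand_lower.
  - exact (fun t => proj2 (CC t)).
  - apply root_radicand_lower.
Qed.

(** The integrand lies in the fourth quadrant. *)
Lemma Nper_quadrant :
  PI * (Im s / (2 * sqrt B) / B) <= Re (Nper s) /\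
  PI * (Im s / (2 * sqrt B) / B) <= - Im (Nper s).
Proof.
  pose proof (ccont_inv_Csqrt_radicand s (upper_slit_minus1 s Hs)) as CC.
  rewrite <- RInt_cos2, Re_Nper, Im_Nper, (Rmult_comm (RInt _ _ _)).
  split.
  - apply RInt_weight_ge; [apply continuous_cos2| |apply cos2_bounds|].
    + exact (fun t => proj1 (CC t)).
    + apply inv_root_radicand_lower.
  - rewrite <- (RInt_opp (V := R_CompleteNormedModule)).
    2: { apply ex_RInt_all_continuous. intros t.
         apply (continuous_mult (fun u => cos u ^ 2) (fun u => Im (/ Csqrt (radicand s u))%C));
         [apply continuous_cos2|exact (proj2 (CC t))]. }
    rewrite (RInt_ext (fun x => opp (cos x ^ 2 * Im (/ Csqrt (radicand s x))%C))
      (fun x => cos x ^ 2 * - Im (/ Csqrt (radicand s x))%C)).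
    2: { intros t _. unfold opp; simpl. ring_R. }
    apply RInt_weight_ge; [apply continuous_cos2| |apply cos2_bounds|].
    + intros t. apply (continuous_opp (fun u => Im (/ Csqrt (radicand s u))%C)).
      exact (proj2 (CC t)).
    + apply inv_root_radicand_lower.
Qed.

Lemma Cmod_Dper_le : Cmod (Dper s) <= 2 * sqrt B * (2 * PI).
Proof.
  unfold Dper. rewrite <- turn_length. apply CInt_bound; [apply turn_le| |].
  - apply ccont_Dper_integrand, upper_slit_minus1, Hs.
  - intros t _. rewrite Cmod_mult, Cmod_R. pose proof (sin2_bounds t).
    rewrite Rabs_right by lra.
    rewrite Cmod_Csqrt by (apply radicand_slit, upper_slit_minus1, Hs).
    assert (sqrt (Cmod (radicand s t)) <= sqrt B) by (apply sqrt_le_1_alt, Cmod_radicand_le).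
    pose proof (sqrt_pos (Cmod (radicand s t))). nra.
Qed.

(** The numerator lies in the fourth quadrant and the denominator in the first: the ratio of the periods has negative imaginary part. The explicit bound is used at one point of the contour argument where strictness must be quantitative. *)
Lemma period_ratio_im :
  Im (Nper s / Dper s)%C <= - (Im s ^ 2 / (32 * B ^ 3)).
Proof.
  destruct Dper_quadrant as [D1 D2]. destruct Nper_quadrant as [N1 N2].
  pose proof Cmod_Dper_le as DU. pose proof sqrtB_pos as Hb. pose proof B_ge1 as HB.
  pose proof PI_RGT_0 as HP.
  assert (Sq : sqrt B * sqrt B = B) by (apply sqrt_sqrt; lra).
  set (b := sqrt B) in *.
  assert (K0 : 0 < PI * (Im s / (2 * b))).
  { apply Rmult_lt_0_compat; [lra|]. apply Rdiv_lt_0_compat; lra. }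
  assert (K1 : 0 < PI * (Im s / (2 * b) / B)).
  { apply Rmult_lt_0_compat; [lra|]. repeat apply Rdiv_lt_0_compat; lra. }
  assert (ND : Dper s <> 0%C).
  { intros E. rewrite E in D1. simpl in D1. lra. }
  assert (Pm : 0 < Cmod (Dper s)) by (apply Cmod_gt_0; exact ND).
  unfold Cdiv. rewrite im_mult, re_inv, im_inv by exact ND.
  set (d1 := Re (Dper s)) in *. set (d2 := Im (Dper s)) in *.
  set (n1 := Re (Nper s)) in *. set (n2 := Im (Nper s)) in *.
  set (m := Cmod (Dper s)) in *.
  replace (n1 * (- d2 / m ^ 2) + n2 * (d1 / m ^ 2)) with
    (- ((n1 * d2 + (- n2) * d1) / m ^ 2)) by (field; lra).
  apply Ropp_le_contravar.
  set (p := PI * (Im s / (2 * b))) in *.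
  assert (E1 : PI * (Im s / (2 * b) / B) = p / B) by (unfold p; field; lra).
  rewrite E1 in *.
  assert (A1 : p / B * p <= n1 * d2) by (apply Rmult_le_compat; lra).
  assert (A2 : p / B * p <= - n2 * d1) by (apply Rmult_le_compat; lra).
  assert (M2 : m ^ 2 <= (2 * b * (2 * PI)) ^ 2) by (apply pow_incr; lra).
  assert (E2 : Im s ^ 2 / (32 * B ^ 3) = (2 * (p / B * p)) / (2 * b * (2 * PI)) ^ 2).
  { unfold p. rewrite <- Sq. field. split; lra. }
  rewrite E2. unfold Rdiv at 1 3. apply Rmult_le_compat.
  - assert (0 < p / B) by lra. nra.
  - left. apply Rinv_0_lt_compat. apply pow_lt. nra.
  - lra.
  - apply Rinv_le_contravar; [apply pow_lt; lra|exact M2].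
Qed.
End UpperHalf.

Lemma RInt_radicand_sqr x y : 0 <= x ->
  PI / 10 * (1 + (x ^ 2 + y ^ 2)) <=
  RInt (fun t => sin t ^ 2 * (((1 + cos t ^ 2) * x - (1 - cos t ^ 2)) ^ 2 + y ^ 2)) turn0 turn1.
Proof.
  intros Hx.
  rewrite (RInt_ext _ (fun t => 1 * ((4 * x ^ 2 + y ^ 2) * sin t ^ 2 + (- (4 * x * (1 + x))) * sin t ^ 4)
     + (1 + x) ^ 2 * sin t ^ 6)).
  2: { intros t _. as_R. pose proof (sin2_cos2 t) as E. unfold Rsqr in E.
       assert (C2 : cos t ^ 2 = 1 - sin t ^ 2) by (simpl; lra). rewrite C2. ring. }
  rewrite (RInt_lin2 (fun t => (4 * x ^ 2 + y ^ 2) * sin t ^ 2 + (- (4 * x * (1 + x))) * sin t ^ 4)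
    (fun t => sin t ^ 6)).
  2: { intros t. apply derivable_continuous_R. auto_derive. trivial. }
  2: { apply continuous_sin_pow. }
  rewrite RInt_lin2 by apply continuous_sin_pow.
  rewrite RInt_sin2, RInt_sin4, RInt_sin6. pose proof PI_RGT_0.
  assert (1 / 10 * (1 + (x ^ 2 + y ^ 2)) <=
    4 * x ^ 2 + y ^ 2 - 3 * (x * (1 + x)) + 5 / 8 * (1 + x) ^ 2).
  { pose proof (pow2_ge_0 (x - 574 / 1000)). pose proof (pow2_ge_0 y). nra. }
  nra.
Qed.

Lemma RInt_scal_R (f : R -> R) k a b : (forall t, continuous f t) ->
  RInt (fun t => k * f t) a b = k * RInt f a b.
Proof.
  intros Hf. apply (RInt_scal (V := R_CompleteNormedModule) f a b k).
  apply ex_RInt_all_continuous, Hf.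
Qed.

(** The modulus of the root is at most the sum of its two parts, whose integrals are those of [Dper]; and [sqrt r >= r ^ 2 / (B sqrt B)] for [r <= B] leads to the integral of [|radicand| ^ 2], which is trigonometric. *)
Lemma Dper_lower s : slit_plane (s - 1) -> 0 <= Re s -> 0 <= Im s ->
  sqrt (2 * Cmod s + 1) / 60 <= Cmod (Dper s).
Proof.
  intros Hs Hr Hi. set (B := 2 * Cmod s + 1).
  pose proof (Cmod_ge_0 s) as G.
  assert (HB : 1 <= B) by (unfold B; lra).
  assert (Hb : 0 < sqrt B) by (apply sqrt_lt_R0; lra).
  assert (Sq : sqrt B * sqrt B = B) by (apply sqrt_sqrt; lra).
  pose proof (ccont_Csqrt_radicand s Hs) as CC.
  set (w := fun t => Re (Csqrt (radicand s t)) + Im (Csqrt (radicand s t))).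
  assert (Cw : forall t, continuous w t).
  { intros t. apply (continuous_plus (fun u => Re (Csqrt (radicand s u))) (fun u => Im (Csqrt (radicand s u))));
    [exact (proj1 (CC t))|exact (proj2 (CC t))]. }
  assert (Hw : forall t, Cmod (radicand s t) ^ 2 / (B * sqrt B) <= w t).
  { intros t. pose proof (radicand_slit s t Hs) as Sl.
    destruct (root_components _ Sl) as (I0 & _ & _).
    { rewrite Im_radicand. pose proof (cos2_bounds t). nra. }
    pose proof (Re_Csqrt_pos _ Sl) as R0.
    pose proof (Cmod_le_re_im (Csqrt (radicand s t))) as T.
    rewrite !Rabs_right in T by lra. rewrite Cmod_Csqrt in T by exact Sl. fold (w t) in T.
    pose proof (Cmod_radicand_le s t) as L. fold B in L.
    pose proof (Cmod_ge_0 (radicand s t)) as X0.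
    assert (S1 : sqrt (Cmod (radicand s t)) <= sqrt B) by (apply sqrt_le_1_alt, L).
    pose proof (sqrt_pos (Cmod (radicand s t))) as S0.
    pose proof (sqrt_sqrt _ X0) as S2.
    eapply Rle_trans; [|exact T]. apply Rle_div_l; [nra|].
    set (x := Cmod (radicand s t)) in *. set (r := sqrt x) in *.
    replace (x ^ 2) with (r * (x * r)) by (rewrite <- S2; ring).
    apply Rmult_le_compat_l; [exact S0|]. apply Rmult_le_compat; lra. }
  assert (Sum : RInt (fun t => sin t ^ 2 * w t) turn0 turn1 <= 2 * Cmod (Dper s)).
  { pose proof (re_le_Cmod (Dper s)) as K1. pose proof (im_le_Cmod (Dper s)) as K2.
    apply Rabs_le_between in K1. apply Rabs_le_between in K2.
    rewrite (RInt_ext _ (fun t => 1 * (sin t ^ 2 * Re (Csqrt (radicand s t)))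
      + 1 * (sin t ^ 2 * Im (Csqrt (radicand s t))))).
    2: { intros t _. unfold w. ring_R. }
    rewrite (RInt_lin2 (fun t => sin t ^ 2 * Re (Csqrt (radicand s t)))
      (fun t => sin t ^ 2 * Im (Csqrt (radicand s t)))).
    - rewrite <- Re_Dper, <- Im_Dper. lra.
    - intros t. apply (continuous_mult (fun u => sin u ^ 2) (fun u => Re (Csqrt (radicand s u))));
      [apply continuous_sin2|exact (proj1 (CC t))].
    - intros t. apply (continuous_mult (fun u => sin u ^ 2) (fun u => Im (Csqrt (radicand s u))));
      [apply continuous_sin2|exact (proj2 (CC t))]. }
  assert (Low : RInt (fun t => / (B * sqrt B) *
       (sin t ^ 2 * (((1 + cos t ^ 2) * Re s - (1 - cos t ^ 2)) ^ 2 + Im s ^ 2))) turn0 turn1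
     <= RInt (fun t => sin t ^ 2 * w t) turn0 turn1).
  { apply RInt_le; [apply turn_le| | |].
    - apply ex_RInt_all_continuous. intros t.
      apply derivable_continuous_R. auto_derive. trivial.
    - apply ex_RInt_all_continuous. intros t.
      apply (continuous_mult (fun u => sin u ^ 2) w); [apply continuous_sin2|apply Cw].
    - intros t _. specialize (Hw t). pose proof (sin2_bounds t) as S2.
      apply Rle_trans with (sin t ^ 2 * (Cmod (radicand s t) ^ 2 / (B * sqrt B))); [|nra].
      assert (P : ((1 + cos t ^ 2) * Re s - (1 - cos t ^ 2)) ^ 2 + Im s ^ 2
        <= Cmod (radicand s t) ^ 2).
      { rewrite Cmod2_alt, Re_radicand, Im_radicand. pose proof (cos2_bounds t).
        assert (Im s ^ 2 <= ((1 + cos t ^ 2) * Im s) ^ 2) by (apply pow_incr; nra).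
        lra. }
      assert (K : 0 < / (B * sqrt B)) by (apply Rinv_0_lt_compat; nra).
      unfold Rdiv. set (k := / (B * sqrt B)) in *.
      match goal with |- k * (?q * ?u) <= ?q * (?v * k) =>
        replace (q * (v * k)) with (k * (q * v)) by ring end.
      apply Rmult_le_compat_l; [lra|]. apply Rmult_le_compat_l; lra. }
  rewrite RInt_scal_R in Low.
  2: { intros t.
      apply derivable_continuous_R. auto_derive. trivial. }
  pose proof (RInt_radicand_sqr (Re s) (Im s) Hr) as RS.
  rewrite <- Cmod2_alt in RS.
  set (Q := RInt _ turn0 turn1) in RS, Low at 1.
  assert (BB : B * sqrt B * (/ (B * sqrt B) * Q) = Q) by (field; lra).
  pose proof PI2_3_2 as P3. unfold PI2 in P3.
  assert (P : 0 < B * sqrt B) by nra.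
  assert (F : Q <= (B * sqrt B) * (2 * Cmod (Dper s))).
  { rewrite <- BB. apply Rmult_le_compat_l; lra. }
  assert (F2 : 3 / 10 * (B ^ 2 / 8) <= PI / 10 * (1 + Cmod s ^ 2)).
  { assert (B ^ 2 / 8 <= 1 + Cmod s ^ 2) by (unfold B; nra).
    assert (0 <= B ^ 2 / 8) by nra. nra. }
  apply Rmult_le_reg_l with (B * sqrt B); [exact P|].
  replace (B * sqrt B * (sqrt B / 60)) with (B * B / 60) by (rewrite <- Sq at 2; field).
  nra.
Qed.

(** On the positive half-line, the square root of the discriminant [1 + 4 h]; [1 + 4 z] stays off the cut with [z]. *)
Definition energy_root (z : C) : C := Csqrt (1 + 4 * z)%C.

Definition period_ratio (z : C) : C := (Nper (energy_root z) / Dper (energy_root z))%C.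

Lemma one_plus_4_slit z : slit_plane z -> slit_plane (1 + 4 * z)%C.
Proof.
  intros Hz [I R]. apply Hz. destruct z as [x y]. unfold Re, Im in *. simpl in *. split; lra.
Qed.

Lemma energy_root_sqr z : slit_plane z -> (energy_root z * energy_root z = 1 + 4 * z)%C.
Proof. intros Hz. apply Csqrt_sqr, one_plus_4_slit, Hz. Qed.

Lemma Re_energy_root_pos z : slit_plane z -> 0 < Re (energy_root z).
Proof. intros Hz. apply Re_Csqrt_pos, one_plus_4_slit, Hz. Qed.

Lemma Im_energy_root z : slit_plane z -> 2 * Im z = Re (energy_root z) * Im (energy_root z).
Proof.
  intros Hz. pose proof (energy_root_sqr z Hz) as E. apply (f_equal Im) in E.
  rewrite im_mult in E.
  assert (K : Im (1 + 4 * z)%C = 4 * Im z) by (destruct z; unfold Im; simpl; ring).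
  lra.
Qed.

Lemma Im_energy_root_nonneg z : slit_plane z -> 0 <= Im z -> 0 <= Im (energy_root z).
Proof.
  intros Hz HI. pose proof (Im_energy_root z Hz). pose proof (Re_energy_root_pos z Hz). nra.
Qed.

Lemma Im_energy_root_pos z : 0 < Im z -> 0 < Im (energy_root z).
Proof.
  intros HI. pose proof (upper_slit z HI) as Hz.
  pose proof (Im_energy_root z Hz). pose proof (Re_energy_root_pos z Hz). nra.
Qed.

Lemma energy_root_slit z : slit_plane z -> slit_plane (energy_root z - 1)%C.
Proof.
  intros Hz [I R]. pose proof (Re_energy_root_pos z Hz) as P.
  pose proof (energy_root_sqr z Hz) as E.
  apply Hz. destruct (energy_root z) as [a b]. destruct z as [x y].
  unfold Re, Im in *. simpl in *. apply (f_equal (fun c => (fst c, snd c))) in E. simpl in E.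
  injection E as E1 E2. assert (b = 0) by lra. subst b. split; nra.
Qed.

Lemma C_differentiable_energy_root z : slit_plane z -> C_differentiable energy_root z.
Proof.
  intros Hz. apply (C_differentiable_comp Csqrt (fun w => 1 + 4 * w)%C).
  - apply C_differentiable_Csqrt, one_plus_4_slit, Hz.
  - apply (C_differentiable_plus (fun _ => 1%C)); [apply C_differentiable_const|].
    apply C_differentiable_scal, C_differentiable_id.
Qed.

(** The constant at the right is uniform: the large factors [sqrt (2 |s| + 1)] of the numerator and of the denominator cancel. The hypothesis on [sigma] says that [z] keeps a definite angle from the cut, so that the radicand does not become small. *)
Lemma period_ratio_bound z sigma : slit_plane z -> 0 <= Im z -> 0 < sigma ->
  (forall t, 0 <= t -> sigma * Cmod z <= Cmod (z + RtoC t)) ->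
  Cmod (period_ratio z) <= 480 / sqrt (sigma * Cmod z).
Proof.
  intros Hz HI Hsig Hdist. unfold period_ratio.
  pose proof (energy_root_sqr z Hz) as E.
  pose proof (energy_root_slit z Hz) as Hs.
  pose proof (Re_energy_root_pos z Hz) as Hr. pose proof (Im_energy_root_nonneg z Hz HI) as Hi.
  set (s := energy_root z) in *.
  pose proof (Dper_lower s Hs (Rlt_le _ _ Hr) Hi) as DL.
  set (B := 2 * Cmod s + 1) in *. pose proof (Cmod_ge_0 s) as G.
  assert (HB : 1 <= B) by (unfold B; lra).
  assert (Hb : 0 < sqrt B) by (apply sqrt_lt_R0; lra).
  assert (Sq : sqrt B * sqrt B = B) by (apply sqrt_sqrt; lra).
  assert (Zp : 0 < Cmod z).
  { apply Cmod_gt_0. intros E0. apply Hz. rewrite E0. simpl. lra. }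
  assert (Hq : 0 < sqrt (sigma * Cmod z)) by (apply sqrt_lt_R0, Rmult_lt_0_compat; assumption).
  assert (Sq2 : sqrt (sigma * Cmod z) * sqrt (sigma * Cmod z) = sigma * Cmod z).
  { apply sqrt_sqrt. nra. }
  set (q := sqrt (sigma * Cmod z)) in *. set (b := sqrt B) in *.
  assert (Xl : forall t, 4 * (sigma * Cmod z) <= Cmod (radicand s t) * B).
  { intros t. pose proof (cos2_bounds t) as C2.
    set (c := cos t ^ 2) in *. set (r := (1 - c) / (1 + c)).
    assert (Hr01 : 0 <= r <= 1).
    { unfold r. split; [apply Rle_div_r; lra|apply Rle_div_l; lra]. }
    assert (EX : radicand s t = (RtoC (1 + c) * (s - RtoC r))%C).
    { unfold radicand. fold c. unfold r. rewrite RtoC_div by lra.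
      field. intros K. apply RtoC_inj in K. lra. }
    assert (EP : ((s - RtoC r) * (s + RtoC r) = 4 * (z + RtoC ((1 - r ^ 2) / 4)))%C).
    { replace ((s - RtoC r) * (s + RtoC r))%C with (s * s - RtoC r * RtoC r)%C by ring.
      rewrite E. rewrite RtoC_div by lra. rewrite RtoC_minus, RtoC_pow. field. }
    specialize (Hdist ((1 - r ^ 2) / 4) ltac:(nra)).
    apply (f_equal Cmod) in EP. rewrite !Cmod_mult, Cmod_R, Rabs_right in EP by lra.
    assert (U : Cmod (s + RtoC r) <= B).
    { eapply Rle_trans; [apply Cmod_triangle|]. rewrite Cmod_R, Rabs_right by lra. unfold B. lra. }
    rewrite EX, Cmod_mult, Cmod_R, Rabs_right by lra.
    pose proof (Cmod_ge_0 (s - RtoC r)). pose proof (Cmod_ge_0 (s + RtoC r)).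
    assert (Cmod (s - RtoC r) * Cmod (s + RtoC r) <= Cmod (s - RtoC r) * B) by nra.
    assert (0 <= Cmod (s - RtoC r) * B) by nra. nra. }
  assert (NU : Cmod (Nper s) <= 2 * (b / (2 * q)) * (2 * PI)).
  { unfold Nper. rewrite <- turn_length. apply CInt_bound; [apply turn_le| |].
    - apply ccont_Nper_integrand, Hs.
    - intros t _. pose proof (radicand_slit s t Hs) as Sl.
      pose proof (Csqrt_nonzero _ Sl) as N. pose proof (Cmod_Csqrt_sqr _ Sl) as M2.
      rewrite Cmod_mult, Cmod_R, Cmod_inv by exact N. pose proof (cos2_bounds t).
      rewrite Rabs_right by lra. apply Cmod_gt_0 in N.
      set (m := Cmod (Csqrt (radicand s t))) in *. specialize (Xl t). rewrite <- M2 in Xl.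
      assert (L : 2 * q <= m * b).
      { apply Rsqr_incr_0_var; [|nra]. unfold Rsqr. rewrite <- Sq2, <- Sq in Xl. nra. }
      assert (/ m <= b / (2 * q)).
      { apply Rle_div_r; [lra|]. apply Rmult_le_reg_l with m; [exact N|].
        rewrite <- Rmult_assoc, Rinv_r by lra. lra. }
      assert (0 < / m) by (apply Rinv_0_lt_compat, N). nra. }
  assert (ND : Dper s <> 0%C) by (apply Cmod_gt_0; lra).
  rewrite Cmod_div by exact ND.
  pose proof PI_4 as P4. pose proof PI_RGT_0.
  apply Rle_div_l; [lra|].
  apply Rle_trans with (480 / q * (b / 60)).
  2: { apply Rmult_le_compat_l; [|lra]. left. apply Rdiv_lt_0_compat; lra. }
  eapply Rle_trans; [exact NU|].
  replace (2 * (b / (2 * q)) * (2 * PI)) with (b / q * (2 * PI)) by (field; lra).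
  replace (480 / q * (b / 60)) with (b / q * 8) by (field; lra).
  apply Rmult_le_compat_l; [|lra]. left. apply Rdiv_lt_0_compat; lra.
Qed.

(** * Division of a function by its zeros *)

Definition lin_prod (rs : list C) (w : C) : C :=
  fold_right (fun a acc => (w - a) * acc)%C 1%C rs.

Lemma lin_prod_app rs rs' w : lin_prod (rs ++ rs') w = (lin_prod rs w * lin_prod rs' w)%C.
Proof.
  induction rs as [|a rs IH]; simpl; [ring|]. unfold lin_prod in *. simpl. rewrite IH. ring.
Qed.

Lemma lin_prod_repeat a m w : lin_prod (repeat a m) w = ((w - a) ^ m)%C.
Proof.
  induction m as [|m IH]; [reflexivity|]. unfold lin_prod in *. simpl. rewrite IH. reflexivity.
Qed.

(** A nonreal zero is listed with its conjugate, so that the product of the linear factors is real on the real axis. *)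
Definition entry_roots (p : C * nat) : list C :=
  if Req_dec_T (Im (fst p)) 0 then repeat (fst p) (snd p)
  else repeat (fst p) (snd p) ++ repeat (Cconj (fst p)) (snd p).

Definition all_roots (l : list (C * nat)) : list C := flat_map entry_roots l.

Definition closed_upper (z : C) : Prop := slit_plane z /\ 0 <= Im z.

Lemma Cminus_nonzero (w a : C) : w <> a -> (w - a)%C <> 0%C.
Proof. intros H. apply Cminus_eq_contra. exact H. Qed.

Lemma C_differentiable_linear_pow a m z : C_differentiable (fun w => (w - a) ^ m)%C z.
Proof.
  apply (C_differentiable_pow (fun w => w - a)%C).
  apply (C_differentiable_minus (fun w => w) (fun _ => a));
  [apply C_differentiable_id|apply C_differentiable_const].
Qed.

Lemma vanishes_div F z m D r : 0 < r -> vanishes_to_order F z m ->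
  (forall w, Cmod (w - z) < r -> C_differentiable D w /\ D w <> 0%C) ->
  vanishes_to_order (fun w => F w / D w)%C z m.
Proof.
  intros Hr (g & r0 & Hr0 & Hg) HD. exists (fun w => g w / D w)%C, (Rmin r r0).
  split; [apply Rmin_glb_lt; assumption|].
  intros w Hw. pose proof (Rmin_l r r0). pose proof (Rmin_r r r0).
  destruct (Hg w ltac:(lra)) as [G1 G2]. destruct (HD w ltac:(lra)) as [D1 D2].
  split; [apply C_differentiable_div; assumption|].
  rewrite G2. field. exact D2.
Qed.

Lemma vanishes_ext F G z m r : 0 < r -> (forall w, Cmod (w - z) < r -> F w = G w) ->
  vanishes_to_order F z m -> vanishes_to_order G z m.
Proof.
  intros Hr E (g & r0 & Hr0 & Hg). exists g, (Rmin r r0).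
  split; [apply Rmin_glb_lt; assumption|].
  intros w Hw. pose proof (Rmin_l r r0). pose proof (Rmin_r r r0).
  destruct (Hg w ltac:(lra)) as [G1 G2]. split; [exact G1|]. rewrite <- E by lra. exact G2.
Qed.

Lemma near_neq (z a w : C) : Cmod (w - z) < Cmod (z - a) -> w <> a.
Proof.
  intros H E. subst w. replace (a - z)%C with (- (z - a))%C in H by ring.
  rewrite Cmod_opp in H. lra.
Qed.

Lemma Cmod_minus_pos (z a : C) : z <> a -> 0 < Cmod (z - a).
Proof. intros H. apply Cmod_gt_0, Cminus_nonzero, H. Qed.

(** The quotient is extended over the zero by the function that vanishing to the given order provides; other zeros keep their order. *)
Lemma divide_linear F a m : vanishes_to_order F a m ->
  exists G,
    (forall w, F w = ((w - a) ^ m * G w)%C) /\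
    (forall w, w <> a -> G w = (F w / (w - a) ^ m)%C) /\
    C_differentiable G a /\
    (forall w, w <> a -> C_differentiable F w -> C_differentiable G w) /\
    (forall z k, z <> a -> vanishes_to_order F z k -> vanishes_to_order G z k).
Proof.
  intros (g & r & Hr & Hg).
  set (G := fun w => if Ceq_dec w a then g a else (F w / (w - a) ^ m)%C).
  assert (Gn : forall w, w <> a -> G w = (F w / (w - a) ^ m)%C).
  { intros w Hw. unfold G. destruct (Ceq_dec w a); [contradiction|reflexivity]. }
  assert (Ga : G a = g a).
  { unfold G. destruct (Ceq_dec a a); [reflexivity|contradiction]. }
  exists G. split; [|split; [|split; [|split]]].
  - intros w. destruct (Ceq_dec w a) as [->|Hw].
    + rewrite Ga. apply Hg. replace (a - a)%C with (RtoC 0) by ring. rewrite Cmod_0. exact Hr.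
    + rewrite Gn by exact Hw. field. apply Cpow_nz, Cminus_nonzero, Hw.
  - exact Gn.
  - apply (C_differentiable_locally g G a r Hr).
    + intros w Hw. destruct (Ceq_dec w a) as [->|Hn]; [symmetry; exact Ga|].
      rewrite Gn by exact Hn. destruct (Hg w Hw) as [_ E]. rewrite E.
      field. apply Cpow_nz, Cminus_nonzero, Hn.
    + apply Hg. replace (a - a)%C with (RtoC 0) by ring. rewrite Cmod_0. exact Hr.
  - intros w Hw HF.
    apply (C_differentiable_locally (fun w => F w / (w - a) ^ m)%C G w (Cmod (w - a))).
    + apply Cmod_minus_pos, Hw.
    + intros v Hv. symmetry. apply Gn. exact (near_neq w a v Hv).
    + apply C_differentiable_div; [exact HF|apply C_differentiable_linear_pow|].
      apply Cpow_nz, Cminus_nonzero, Hw.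
  - intros z k Hz HF.
    apply (vanishes_ext (fun w => F w / (w - a) ^ m)%C G z k (Cmod (z - a))).
    + apply Cmod_minus_pos, Hz.
    + intros v Hv. symmetry. apply Gn. exact (near_neq z a v Hv).
    + apply (vanishes_div F z k (fun w => (w - a) ^ m)%C (Cmod (z - a))).
      * apply Cmod_minus_pos, Hz.
      * exact HF.
      * intros w Hw. split; [apply C_differentiable_linear_pow|].
        apply Cpow_nz, Cminus_nonzero. exact (near_neq z a w Hw).
Qed.

Lemma real_of_im_0 (c : C) : Im c = 0 -> c = RtoC (Re c).
Proof. intros H. destruct c as [a b]. unfold Im, Re, RtoC in *. simpl in *. congruence. Qed.

Lemma im_div_real (c : C) (x : R) : Im c = 0 -> x <> 0 -> Im (c / RtoC x)%C = 0.
Proof.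
  intros H Hx. rewrite (real_of_im_0 c H), <- RtoC_div by exact Hx. reflexivity.
Qed.

Lemma real_at_limit G a : C_differentiable G (RtoC a) ->
  (forall h, 0 < h -> h <> a -> Im (G (RtoC h)) = 0) -> 0 < a -> Im (G (RtoC a)) = 0.
Proof.
  intros HG Hr Ha. destruct (Req_dec (Im (G (RtoC a))) 0) as [E|N]; [exact E|exfalso].
  apply Rabs_pos_lt in N.
  destruct (C_differentiable_continuous G (RtoC a) HG _ N) as (d & Hd & H1).
  specialize (H1 (RtoC (a + d / 2))).
  assert (K : Cmod (RtoC (a + d / 2) - RtoC a) < d).
  { rewrite <- RtoC_minus, Cmod_R. replace (a + d / 2 - a) with (d / 2) by ring.
    rewrite Rabs_right; lra. }
  specialize (H1 K). specialize (Hr (a + d / 2) ltac:(lra) ltac:(lra)).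
  pose proof (im_le_Cmod (G (RtoC (a + d / 2)) - G (RtoC a))%C) as L.
  assert (E : Im (G (RtoC (a + d / 2)) - G (RtoC a))%C = - Im (G (RtoC a))).
  { transitivity (Im (G (RtoC (a + d / 2))) - Im (G (RtoC a))); [reflexivity|]. rewrite Hr. ring. }
  rewrite E, Rabs_Ropp in L. lra.
Qed.

Lemma im_zero_real (z : C) : Im z = 0 -> slit_plane z -> z = RtoC (Re z) /\ 0 < Re z.
Proof.
  intros HI Hz. split; [apply real_of_im_0, HI|].
  destruct (Rle_dec (Re z) 0); [exfalso; apply Hz; split; assumption|lra].
Qed.

Lemma conj_product_real h z m :
  ((RtoC h - z) ^ m * (RtoC h - Cconj z) ^ m)%C = RtoC ((Cmod (RtoC h - z) ^ 2) ^ m).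
Proof.
  rewrite <- Cpow_mult_l, RtoC_pow. f_equal. rewrite RtoC_pow, <- RtoC_pow, Cmod2_conj.
  rewrite Cminus_conj. f_equal. f_equal. unfold Cconj, RtoC. simpl. f_equal. ring.
Qed.

Lemma closed_upper_neq_conj w z : closed_upper w -> 0 < Im z -> w <> Cconj z.
Proof. intros [_ H] Hz E. subst w. rewrite im_conj in H. lra. Qed.

Lemma Cconj_ne z w : 0 < Im z -> 0 <= Im w -> (w - Cconj z)%C <> 0%C.
Proof.
  intros Hz Hw. apply Cminus_nonzero. intros E. subst w. rewrite im_conj in Hw. lra.
Qed.

(** Division by all the zeros of the closed upper half of the slit plane. Each factor is taken together with its conjugate: the quotient stays real on the positive half-line and the conjugate factor has no zero where the quotient is used. *)
Lemma divide_zeros l : forall F,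
  (forall z, closed_upper z -> C_differentiable F z) ->
  (forall h, 0 < h -> Im (F (RtoC h)) = 0) ->
  NoDup (map fst l) ->
  (forall z m, In (z, m) l -> closed_upper z /\ vanishes_to_order F z m) ->
  exists G,
    (forall z, closed_upper z -> C_differentiable G z) /\
    (forall h, 0 < h -> Im (G (RtoC h)) = 0) /\
    (forall w, closed_upper w -> F w = (lin_prod (all_roots l) w * G w)%C).
Proof.
  induction l as [|[a m] l IH]; intros F HF Hreal Hnd Hv.
  - exists F. split; [exact HF|]. split; [exact Hreal|].
    intros w _. unfold lin_prod. simpl. ring.
  - simpl in Hnd. inversion Hnd as [|x xs Hnot Hnd']; subst.
    destruct (Hv a m (or_introl eq_refl)) as [[Sa Ia] Va].
    destruct (divide_linear F a m Va) as (G & G1 & G2 & G3 & G4 & G5).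
    assert (Hv' : forall z k, In (z, k) l -> closed_upper z /\ z <> a /\ vanishes_to_order G z k).
    { intros z k Hin. destruct (Hv z k (or_intror Hin)) as [A1 A2].
      assert (z <> a).
      { intros E. apply Hnot. rewrite <- E. apply (in_map fst l (z, k) Hin). }
      split; [exact A1|]. split; [assumption|]. apply G5; assumption. }
    assert (Gd : forall z, closed_upper z -> C_differentiable G z).
    { intros z Hz. destruct (Ceq_dec z a) as [->|Hn]; [exact G3|]. apply G4; [exact Hn|apply HF, Hz]. }
    destruct (Req_dec_T (Im a) 0) as [I0|I0].
    + destruct (im_zero_real a I0 Sa) as [Ea Pa].
      assert (Gr : forall h, 0 < h -> Im (G (RtoC h)) = 0).
      { assert (Off : forall h, 0 < h -> h <> Re a -> Im (G (RtoC h)) = 0).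
        { intros h Hh Hn. rewrite G2.
          2: { intros E. apply Hn. rewrite <- E. reflexivity. }
          rewrite Ea, <- RtoC_minus, <- RtoC_pow. apply im_div_real; [apply Hreal, Hh|].
          apply pow_nonzero. lra. }
        intros h Hh. destruct (Req_dec h (Re a)) as [->|Hn]; [|apply Off; assumption].
        apply real_at_limit; [|exact Off|exact Pa]. rewrite <- Ea. exact G3. }
      destruct (IH G Gd Gr Hnd') as (K & K1 & K2 & K3).
      { intros z k Hin. destruct (Hv' z k Hin) as (A1 & _ & A2). auto. }
      exists K. split; [exact K1|]. split; [exact K2|].
      intros w Hw. rewrite G1, (K3 w Hw). simpl. unfold entry_roots. simpl fst. simpl snd.
      destruct (Req_dec_T (Im a) 0); [|contradiction].
      rewrite lin_prod_app, lin_prod_repeat. ring.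
    + assert (Ip : 0 < Im a) by lra.
      set (G' := fun w => (G w / (w - Cconj a) ^ m)%C).
      assert (Gd' : forall z, closed_upper z -> C_differentiable G' z).
      { intros z Hz. apply C_differentiable_div; [apply Gd, Hz|apply C_differentiable_linear_pow|].
        apply Cpow_nz, Cconj_ne; [exact Ip|apply Hz]. }
      assert (Gr' : forall h, 0 < h -> Im (G' (RtoC h)) = 0).
      { intros h Hh. assert (Hn : RtoC h <> a).
        { intros E. rewrite <- E in Ip. simpl in Ip. lra. }
        unfold G'. rewrite G2 by exact Hn.
        replace (F (RtoC h) / (RtoC h - a) ^ m / (RtoC h - Cconj a) ^ m)%C with
          (F (RtoC h) / ((RtoC h - a) ^ m * (RtoC h - Cconj a) ^ m))%C.
        - rewrite conj_product_real. apply im_div_real; [apply Hreal, Hh|].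
          apply pow_nonzero, pow_nonzero. pose proof (Cmod_minus_pos _ _ Hn). lra.
        - field. split; apply Cpow_nz.
          + apply Cminus_nonzero, Hn.
          + apply Cconj_ne; [exact Ip|simpl; lra]. }
      destruct (IH G' Gd' Gr' Hnd') as (K & K1 & K2 & K3).
      { intros z k Hin. destruct (Hv' z k Hin) as (A1 & _ & A2). split; [exact A1|].
        assert (Hzc : z <> Cconj a) by (apply closed_upper_neq_conj; assumption).
        apply (vanishes_div G z k (fun w => (w - Cconj a) ^ m)%C (Cmod (z - Cconj a))).
        - apply Cmod_minus_pos, Hzc.
        - exact A2.
        - intros w Hw. split; [apply C_differentiable_linear_pow|].
          apply Cpow_nz, Cminus_nonzero. exact (near_neq _ _ w Hw). }
      exists K. split; [exact K1|]. split; [exact K2|].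
      intros w Hw. simpl. unfold entry_roots. simpl fst. simpl snd.
      destruct (Req_dec_T (Im a) 0); [contradiction|].
      rewrite !lin_prod_app, !lin_prod_repeat.
      specialize (K3 w Hw). rewrite G1.
      assert (Gw : G w = ((w - Cconj a) ^ m * G' w)%C).
      { unfold G'. field. apply Cpow_nz, Cconj_ne; [exact Ip|apply Hw]. }
      rewrite Gw, K3. ring.
Qed.

Lemma all_roots_slit l : (forall z m, In (z, m) l -> slit_plane z) ->
  forall a, In a (all_roots l) -> slit_plane a.
Proof.
  intros H a Ha. unfold all_roots in Ha. apply in_flat_map in Ha.
  destruct Ha as ([z m] & Hin & Ha). specialize (H z m Hin).
  unfold entry_roots in Ha. simpl fst in Ha. simpl snd in Ha.
  assert (Hc : slit_plane (Cconj z)).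
  { intros [I R]. rewrite im_conj in I. rewrite re_conj in R. apply H. split; lra. }
  destruct (Req_dec_T (Im z) 0).
  - apply repeat_spec in Ha. subst. exact H.
  - apply in_app_or in Ha. destruct Ha as [Ha|Ha]; apply repeat_spec in Ha; subst; assumption.
Qed.

(** On the cut conjugate factors combine to squares of moduli, and the factors of positive zeros are negative. *)
Lemma lin_prod_sign l : (forall z m, In (z, m) l -> slit_plane z) ->
  exists sg, (sg = 1 \/ sg = -1) /\
    forall r, 0 < r -> lin_prod (all_roots l) (RtoC (- r)) =
      RtoC (sg * Cmod (lin_prod (all_roots l) (RtoC (- r)))).
Proof.
  induction l as [|[a m] l IH]; intros H.
  - exists 1. split; [auto|]. intros r _. unfold lin_prod. simpl.
    rewrite Cmod_1. rewrite Rmult_1_l. reflexivity.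
  - destruct IH as (sg & Hsg & E).
    { intros z k Hin. apply (H z k). right. exact Hin. }
    specialize (H a m (or_introl eq_refl)).
    simpl all_roots. unfold entry_roots. simpl fst. simpl snd.
    destruct (Req_dec_T (Im a) 0) as [I0|I0].
    + destruct (im_zero_real a I0 H) as [Ea Pa].
      exists ((-1) ^ m * sg). split.
      { assert ((-1) ^ m = 1 \/ (-1) ^ m = -1) as [-> | ->].
        { clear. induction m as [|m [IH|IH]]; simpl; [auto| |]; rewrite IH; [right|left]; ring. }
        all: destruct Hsg as [-> | ->]; [|]; lra. }
      intros r Hr. rewrite lin_prod_app, lin_prod_repeat, Cmod_mult, Cmod_pow.
      rewrite (E r Hr) at 1. rewrite Ea at 1 2. rewrite <- RtoC_minus, Cmod_R.
      rewrite <- RtoC_pow, <- RtoC_mult. f_equal.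
      replace (- r - Re a) with (- (r + Re a)) by ring.
      rewrite Rabs_Ropp, Rabs_right by lra.
      replace (- (r + Re a)) with (-1 * (r + Re a)) by ring.
      rewrite Rpow_mult_distr. ring.
    + exists sg. split; [exact Hsg|].
      intros r Hr. rewrite !lin_prod_app, !lin_prod_repeat, conj_product_real, !Cmod_mult.
      rewrite Cmod_R, (E r Hr) at 1. rewrite <- RtoC_mult. f_equal.
      rewrite (Rabs_right (_ ^ _)); [ring|].
      apply Rle_ge, pow_le, pow2_ge_0.
Qed.

(** * Behaviour near the cut, at zero and at infinity *)

(** The point of modulus [exp u] at angle [e] above the negative half-line. *)
Definition rho (u e : R) : C := Cexp (u, PI - e).

Lemma rho_eq u e : rho u e = (- (exp u * cos e), exp u * sin e).
Proof.
  unfold rho, Cexp. unfold Re, Im. simpl. rewrite sin_PI_x, Rtrigo_facts.cos_pi_minus.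
  f_equal. ring.
Qed.

Lemma Cmod_rho u e : Cmod (rho u e) = exp u.
Proof. apply Cmod_Cexp. Qed.

Lemma rho_0 u : rho u 0 = RtoC (- exp u).
Proof. rewrite rho_eq, cos_0, sin_0. unfold RtoC. f_equal; ring. Qed.

Lemma sin_small e : 0 <= e <= 1 -> e / 2 <= sin e <= e.
Proof.
  intros He. pose proof PI2_3_2 as P. unfold PI2 in P.
  split.
  - pose proof (sin_bound e 0 ltac:(lra) ltac:(lra)) as [S _].
    unfold sin_approx, sin_term in S. simpl in S.
    replace (IZR 1) with 1 in S by reflexivity.
    assert (e * (e * e) <= e) by nra.
    lra.
  - destruct (proj1 He) as [K|<-]; [left; apply sin_lt_x, K|rewrite sin_0; lra].
Qed.

Lemma one_minus_cos_small e : 0 <= e <= 1 -> 0 <= 1 - cos e <= e.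
Proof.
  intros He. split; [pose proof (COS_bound e); lra|].
  replace e with (2 * (e / 2)) at 1 by field. rewrite cos_2a_sin.
  pose proof (sin_small (e / 2) ltac:(lra)). nra.
Qed.

Lemma rho_near_real u e : 0 <= e <= 1 ->
  Cmod (rho u e - RtoC (- exp u)) <= 2 * e * exp u.
Proof.
  intros He. eapply Rle_trans; [apply Cmod_le_re_im|].
  rewrite rho_eq. unfold Re, Im. simpl.
  pose proof (sin_small e He). pose proof (one_minus_cos_small e He). pose proof (exp_pos u).
  replace (- (exp u * cos e) + - - exp u) with (exp u * (1 - cos e)) by ring.
  replace (exp u * sin e + - 0) with (exp u * sin e) by ring.
  rewrite !Rabs_right by (apply Rle_ge; nra). nra.
Qed.

(** [h] has size [W] near the negative half-line and differs there from its value on the half-line by a quantity of order [e * W]. The bound is uniform from zero to infinity and stable under products. *)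
Definition tame (e0 : R) (W : R -> R) (h : C -> C) : Prop :=
  exists K, 0 <= K /\ forall u e, 0 <= e <= e0 ->
    Cmod (h (rho u e)) <= K * W (exp u) /\
    Cmod (h (rho u e) - h (RtoC (- exp u))) <= K * e * W (exp u).

Definition weight_pos (W : R -> R) : Prop := forall r, 0 < r -> 0 <= W r.

Lemma tame_smaller e0 e1 W h : e1 <= e0 -> tame e0 W h -> tame e1 W h.
Proof.
  intros He (K & HK & H). exists K. split; [exact HK|]. intros u e He1. apply H. lra.
Qed.

Lemma tame_weaken e0 W W' h : 0 <= e0 -> (forall r, 0 < r -> W r <= W' r) ->
  tame e0 W h -> tame e0 W' h.
Proof.
  intros He0 HW (K & HK & H). exists K. split; [exact HK|]. intros u e He.
  destruct (H u e He) as [H1 H2]. specialize (HW (exp u) (exp_pos u)).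
  split; [eapply Rle_trans; [exact H1|]|eapply Rle_trans; [exact H2|]];
  apply Rmult_le_compat_l; try assumption. apply Rmult_le_pos; lra.
Qed.

Lemma tame_const e0 c : tame e0 (fun _ => 1) (fun _ => c).
Proof.
  exists (Cmod c). split; [apply Cmod_ge_0|]. intros u e He. split; [lra|].
  replace (c - c)%C with (RtoC 0) by ring. rewrite Cmod_0, Rmult_1_r.
  apply Rmult_le_pos; [apply Cmod_ge_0|lra].
Qed.

Lemma tame_id e0 : e0 <= 1 -> tame e0 (fun r => 1 + r) (fun w => w).
Proof.
  intros H0. exists 2. split; [lra|]. intros u e He. rewrite Cmod_rho. pose proof (exp_pos u).
  split; [lra|]. eapply Rle_trans; [apply rho_near_real; lra|]. nra.
Qed.

Lemma tame_plus e0 W h k : tame e0 W h -> tame e0 W k -> tame e0 W (fun w => h w + k w)%C.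
Proof.
  intros (K & HK & H) (K' & HK' & H'). exists (K + K'). split; [lra|].
  intros u e He. destruct (H u e He) as [A1 A2], (H' u e He) as [B1 B2]. split.
  - eapply Rle_trans; [apply Cmod_triangle|]. lra.
  - replace (h (rho u e) + k (rho u e) - (h (RtoC (- exp u)) + k (RtoC (- exp u))))%C with
      ((h (rho u e) - h (RtoC (- exp u))) + (k (rho u e) - k (RtoC (- exp u))))%C by ring.
    eapply Rle_trans; [apply Cmod_triangle|]. lra.
Qed.

Lemma tame_mult e0 W W' h k : 0 <= e0 -> weight_pos W -> weight_pos W' ->
  tame e0 W h -> tame e0 W' k -> tame e0 (fun r => W r * W' r) (fun w => h w * k w)%C.
Proof.
  intros He0 PW PW' (K & HK & H) (K' & HK' & H'). exists (2 * (K * K')).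
  split; [apply Rmult_le_pos; [lra|apply Rmult_le_pos; assumption]|].
  intros u e He. destruct (H u e He) as [A1 A2], (H' u e He) as [B1 B2].
  destruct (H u 0 ltac:(lra)) as [A0 _]. rewrite rho_0 in A0.
  pose proof (PW (exp u) (exp_pos u)) as P. pose proof (PW' (exp u) (exp_pos u)) as P'.
  set (w := W (exp u)) in *. set (w' := W' (exp u)) in *.
  assert (Pr : 0 <= (K * w) * (K' * w')) by (repeat apply Rmult_le_pos; assumption).
  split.
  - rewrite Cmod_mult. apply Rle_trans with ((K * w) * (K' * w')).
    + apply Rmult_le_compat; try apply Cmod_ge_0; assumption.
    + lra.
  - replace (h (rho u e) * k (rho u e) - h (RtoC (- exp u)) * k (RtoC (- exp u)))%C with
      ((h (rho u e) - h (RtoC (- exp u))) * k (rho u e)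
       + h (RtoC (- exp u)) * (k (rho u e) - k (RtoC (- exp u))))%C by ring.
    eapply Rle_trans; [apply Cmod_triangle|]. rewrite !Cmod_mult.
    assert (C1 : Cmod (h (rho u e) - h (RtoC (- exp u))) * Cmod (k (rho u e))
       <= (K * e * w) * (K' * w')) by (apply Rmult_le_compat; try apply Cmod_ge_0; assumption).
    assert (C2 : Cmod (h (RtoC (- exp u))) * Cmod (k (rho u e) - k (RtoC (- exp u)))
       <= (K * w) * (K' * e * w')) by (apply Rmult_le_compat; try apply Cmod_ge_0; assumption).
    lra.
Qed.

(** The sector around the negative half-line seen from a point off it. *)
Lemma slit_distance a : slit_plane a -> exists k, 0 < k /\
  forall r, 0 < r -> k * (1 + r) <= Cmod (RtoC (- r) - a).
Proof.
  intros Ha. apply slit_plane_re_pos in Ha.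
  pose proof (Cmod2_alt a) as E. pose proof (Cmod_ge_0 a) as G. pose proof (re_le_Cmod a) as Ra.
  apply Rabs_le_between in Ra.
  set (m := Cmod a) in *. set (x := Re a) in *.
  assert (Hm : 0 < m) by lra.
  set (lam := Rmin 1 ((m + x) / m)).
  assert (L0 : 0 < lam) by (apply Rmin_glb_lt; [lra|apply Rdiv_lt_0_compat; lra]).
  assert (L1 : lam <= 1) by apply Rmin_l.
  assert (L2 : lam * m <= m + x).
  { pose proof (Rmin_r 1 ((m + x) / m)) as R. fold lam in R.
    apply Rle_trans with ((m + x) / m * m); [nra|right; field; lra]. }
  set (mu := Rmin 1 (m ^ 2) / 2).
  assert (M0 : 0 < mu).
  { unfold mu. assert (0 < Rmin 1 (m ^ 2)) by (apply Rmin_glb_lt; nra). lra. }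
  assert (M1 : mu <= 1 / 2) by (unfold mu; pose proof (Rmin_l 1 (m ^ 2)); lra).
  assert (M2 : mu <= m ^ 2 / 2) by (unfold mu; pose proof (Rmin_r 1 (m ^ 2)); lra).
  exists (sqrt (lam * mu)). split; [apply sqrt_lt_R0; nra|].
  intros r Hr. apply Rsqr_incr_0_var; [|apply Cmod_ge_0].
  rewrite Rsqr_mult, Rsqr_sqrt by nra.
  assert (E2 : (Cmod (RtoC (- r) - a))² = r ^ 2 + 2 * r * x + m ^ 2).
  { unfold Rsqr. pose proof (Cmod2_alt (RtoC (- r) - a)) as K.
    assert (K1 : Re (RtoC (- r) - a)%C = - r - x) by reflexivity.
    assert (K2 : Im (RtoC (- r) - a)%C = - Im a) by (unfold Im; simpl; ring).
    rewrite K1, K2 in K. nra. }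
  rewrite E2. unfold Rsqr.
  assert (Q1 : lam * (r ^ 2 + m ^ 2) <= r ^ 2 + 2 * r * x + m ^ 2).
  { assert (0 <= (r - m) ^ 2) by apply pow2_ge_0.
    assert (r * (lam * m) <= r * (m + x)) by (apply Rmult_le_compat_l; lra).
    assert (lam * (r - m) ^ 2 <= 1 * (r - m) ^ 2) by (apply Rmult_le_compat_r; assumption).
    replace (lam * (r ^ 2 + m ^ 2)) with (lam * (r - m) ^ 2 + 2 * (r * (lam * m))) by ring.
    replace (r ^ 2 + 2 * r * x + m ^ 2) with (1 * (r - m) ^ 2 + 2 * (r * (m + x))) by ring.
    lra. }
  assert (Q2 : mu * ((1 + r) * (1 + r)) <= r ^ 2 + m ^ 2).
  { assert (mu * ((1 + r) * (1 + r)) <= mu * (2 * (1 + r ^ 2))).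
    { apply Rmult_le_compat_l; [lra|]. pose proof (pow2_ge_0 (r - 1)). lra. }
    assert (mu * r ^ 2 <= 1 / 2 * r ^ 2) by (apply Rmult_le_compat_r; [apply pow2_ge_0|lra]).
    lra. }
  assert (lam * (mu * ((1 + r) * (1 + r))) <= lam * (r ^ 2 + m ^ 2))
    by (apply Rmult_le_compat_l; lra).
  lra.
Qed.

Definition inv_weight (n : nat) (r : R) : R := (/ (1 + r)) ^ n.

Lemma inv_weight_pos n : weight_pos (inv_weight n).
Proof. intros r Hr. apply pow_le. left. apply Rinv_0_lt_compat. lra. Qed.

Lemma tame_inv_linear a : slit_plane a -> exists e0, 0 < e0 <= 1 /\
  (forall u e, 0 <= e <= e0 -> (rho u e - a)%C <> 0%C) /\
  tame e0 (inv_weight 1) (fun w => / (w - a))%C.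
Proof.
  intros Ha. destruct (slit_distance a Ha) as (k & Hk & Hd).
  set (e0 := Rmin 1 (k / 4)).
  assert (E0 : 0 < e0) by (apply Rmin_glb_lt; lra).
  assert (E1 : e0 <= 1) by apply Rmin_l. assert (E2 : e0 <= k / 4) by apply Rmin_r.
  assert (Low : forall u e, 0 <= e <= e0 -> k / 2 * (1 + exp u) <= Cmod (rho u e - a)).
  { intros u e He. specialize (Hd (exp u) (exp_pos u)). pose proof (exp_pos u).
    pose proof (rho_near_real u e ltac:(lra)) as N.
    pose proof (Cmod_reverse_triangle (rho u e - a) (RtoC (- exp u) - a)) as T.
    replace (rho u e - a - (RtoC (- exp u) - a))%C with (rho u e - RtoC (- exp u))%C in T by ring.
    apply Rabs_le_between in T. nra. }
  assert (NZ : forall u e, 0 <= e <= e0 -> (rho u e - a)%C <> 0%C).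
  { intros u e He. apply Cmod_gt_0. specialize (Low u e He). pose proof (exp_pos u). nra. }
  exists e0. split; [lra|]. split; [exact NZ|].
  assert (Hinv : 0 < / (k / 2)) by (apply Rinv_0_lt_compat; lra).
  exists (/ (k / 2) + 2 * (/ (k / 2) * / (k / 2))).
  split; [nra|]. intros u e He. pose proof (exp_pos u) as Hu.
  unfold inv_weight. rewrite pow_1.
  assert (B : forall e', 0 <= e' <= e0 -> Cmod (/ (rho u e' - a))%C <= / (k / 2) * / (1 + exp u)).
  { intros e' He'. rewrite Cmod_inv by (apply NZ; exact He'). rewrite <- Rinv_mult.
    apply Rinv_le_contravar; [nra|apply Low, He']. }
  assert (P : 0 < / (1 + exp u)) by (apply Rinv_0_lt_compat; lra).
  split.
  - eapply Rle_trans; [apply B, He|]. apply Rmult_le_compat_r; [lra|].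
    assert (0 < / (k / 2) * / (k / 2)) by nra. lra.
  - pose proof (NZ u e He) as N1. pose proof (NZ u 0 ltac:(lra)) as N0.
    pose proof (B e He) as B1. pose proof (B 0 ltac:(lra)) as B0.
    rewrite rho_0 in N0, B0.
    replace (/ (rho u e - a) - / (RtoC (- exp u) - a))%C with
      (- ((rho u e - RtoC (- exp u)) * (/ (rho u e - a) * / (RtoC (- exp u) - a))))%C
      by (field; split; assumption).
    rewrite Cmod_opp, !Cmod_mult.
    assert (Z : Cmod (rho u e - RtoC (- exp u)) <= 2 * e * (1 + exp u)).
    { eapply Rle_trans; [apply rho_near_real; lra|]. nra. }
    set (q := / (k / 2)) in *. set (v := / (1 + exp u)) in *.
    assert (V : (1 + exp u) * v = 1) by (unfold v; field; lra).
    apply Rle_trans with ((2 * e * (1 + exp u)) * ((q * v) * (q * v))).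
    + apply Rmult_le_compat; [apply Cmod_ge_0| |exact Z|].
      * apply Rmult_le_pos; apply Cmod_ge_0.
      * apply Rmult_le_compat; try apply Cmod_ge_0; assumption.
    + replace (2 * e * (1 + exp u) * (q * v * (q * v))) with (2 * (q * q) * e * v * ((1 + exp u) * v)) by ring.
      rewrite V. assert (0 <= q * e * v) by (repeat apply Rmult_le_pos; lra). nra.
Qed.

Lemma lin_prod_cons a rs w : lin_prod (a :: rs) w = ((w - a) * lin_prod rs w)%C.
Proof. reflexivity. Qed.

Lemma tame_inv_prod rs : (forall a, In a rs -> slit_plane a) -> exists e0, 0 < e0 <= 1 /\
  (forall u e, 0 <= e <= e0 -> lin_prod rs (rho u e) <> 0%C) /\
  tame e0 (inv_weight (length rs)) (fun w => / lin_prod rs w)%C.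
Proof.
  induction rs as [|a rs IH]; intros H.
  - exists 1. split; [lra|]. split.
    + intros u e _. unfold lin_prod. simpl. exact C1_nz.
    + apply (tame_const 1 (/ 1)%C).
  - destruct IH as (e1 & He1 & N1 & T1); [intros b Hb; apply H; right; exact Hb|].
    destruct (tame_inv_linear a (H a (or_introl eq_refl))) as (e2 & He2 & N2 & T2).
    assert (Hm : 0 < Rmin e1 e2) by (apply Rmin_glb_lt; lra).
    pose proof (Rmin_l e1 e2) as Ml. pose proof (Rmin_r e1 e2) as Mr.
    exists (Rmin e1 e2). split; [lra|].
    assert (N : forall u e, 0 <= e <= Rmin e1 e2 -> lin_prod (a :: rs) (rho u e) <> 0%C).
    { intros u e He. rewrite lin_prod_cons. apply Cmult_neq_0; [apply N2|apply N1]; lra. }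
    split; [exact N|].
    pose proof (tame_smaller _ (Rmin e1 e2) _ _ Ml T1) as T1'.
    pose proof (tame_smaller _ (Rmin e1 e2) _ _ Mr T2) as T2'.
    destruct (tame_mult (Rmin e1 e2) _ _ _ _ ltac:(lra) (inv_weight_pos 1) (inv_weight_pos (length rs)) T2' T1')
      as (K & HK & T).
    exists K. split; [exact HK|]. intros u e He. destruct (T u e He) as [A1 A2].
    pose proof (N2 u e ltac:(lra)). pose proof (N1 u e ltac:(lra)).
    pose proof (N2 u 0 ltac:(lra)) as Q2. pose proof (N1 u 0 ltac:(lra)) as Q1.
    rewrite rho_0 in Q1, Q2.
    assert (Ew : inv_weight (length (a :: rs)) (exp u) =
      inv_weight 1 (exp u) * inv_weight (length rs) (exp u)).
    { unfold inv_weight. simpl. ring. }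
    rewrite Ew, !lin_prod_cons. split.
    + eapply Rle_trans; [right|exact A1]. f_equal. field. split; assumption.
    + eapply Rle_trans; [right|exact A2]. f_equal. field. repeat split; assumption.
Qed.

(** No root is zero, so near zero the product is of the size of its constant term, and near infinity of the size of its leading one. *)
Lemma lin_prod_lower rs : (forall a, In a rs -> slit_plane a) -> exists c r0 r1,
  0 < c /\ 0 < r0 /\ 0 < r1 /\
  forall z, Cmod z <= r0 \/ r1 <= Cmod z ->
    c * (1 + Cmod z) ^ length rs <= Cmod (lin_prod rs z).
Proof.
  induction rs as [|a rs IH]; intros H.
  - exists 1, 1, 1. repeat split; try lra. intros z _. unfold lin_prod. simpl.
    rewrite Cmod_1. lra.
  - destruct IH as (c & r0 & r1 & Hc & H0 & H1 & L); [intros b Hb; apply H; right; exact Hb|].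
    assert (Pa : 0 < Cmod a).
    { apply Cmod_gt_0. intros E. apply (H a (or_introl eq_refl)). rewrite E. simpl. lra. }
    set (m := Cmod a) in *.
    set (k := Rmin (1 / 4) (m / (2 * (1 + m)))).
    assert (K0 : 0 < k) by (apply Rmin_glb_lt; [lra|apply Rdiv_lt_0_compat; lra]).
    assert (K1 : k <= 1 / 4) by apply Rmin_l.
    assert (K2 : k * (1 + m) <= m / 2).
    { pose proof (Rmin_r (1 / 4) (m / (2 * (1 + m)))) as R. fold k in R.
      apply Rle_trans with (m / (2 * (1 + m)) * (1 + m)); [apply Rmult_le_compat_r; lra|].
      right. field. lra. }
    exists (k * c), (Rmin r0 (m / 2)), (Rmax r1 (2 * m + 1)).
    split; [nra|]. split; [apply Rmin_glb_lt; lra|].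
    split; [apply Rlt_le_trans with r1; [exact H1|apply Rmax_l]|].
    intros z Hz.
    pose proof (Rmin_l r0 (m / 2)). pose proof (Rmin_r r0 (m / 2)).
    pose proof (Rmax_l r1 (2 * m + 1)). pose proof (Rmax_r r1 (2 * m + 1)).
    specialize (L z ltac:(lra)). pose proof (Cmod_ge_0 z) as Z0.
    assert (F : k * (1 + Cmod z) <= Cmod (z - a)).
    { pose proof (Cmod_reverse_triangle z a) as T. fold m in T. apply Rabs_le_between in T.
      pose proof (Cmod_reverse_triangle a z) as T2. fold m in T2. apply Rabs_le_between in T2.
      replace (a - z)%C with (- (z - a))%C in T2 by ring. rewrite Cmod_opp in T2.
      destruct Hz as [Hz|Hz]; nra. }
    rewrite lin_prod_cons, Cmod_mult. simpl length. rewrite <- tech_pow_Rmult.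
    replace (k * c * ((1 + Cmod z) * (1 + Cmod z) ^ length rs)) with
      ((k * (1 + Cmod z)) * (c * (1 + Cmod z) ^ length rs)) by ring.
    apply Rmult_le_compat; [nra| |exact F|exact L].
    apply Rmult_le_pos; [lra|]. apply pow_le. lra.
Qed.

(** * The contour argument *)

Lemma closed_upper_Cexp u v : 0 <= v < PI -> closed_upper (Cexp (u, v)).
Proof.
  intros Hv. split; [apply slit_plane_Cexp; lra|].
  unfold Cexp, Im. simpl. apply Rmult_le_pos; [left; apply exp_pos|apply sin_ge_0; lra].
Qed.

Lemma Dper_nonzero z : closed_upper z -> Dper (energy_root z) <> 0%C.
Proof.
  intros [Hz Hi]. apply Cmod_gt_0.
  pose proof (Dper_lower (energy_root z) (energy_root_slit z Hz)
    (Rlt_le _ _ (Re_energy_root_pos z Hz)) (Im_energy_root_nonneg z Hz Hi)) as L.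
  assert (0 < sqrt (2 * Cmod (energy_root z) + 1)).
  { apply sqrt_lt_R0. pose proof (Cmod_ge_0 (energy_root z)). lra. }
  lra.
Qed.

Lemma one_plus_energy_root_nonzero z : slit_plane z -> (1 + energy_root z)%C <> 0%C.
Proof.
  intros Hz E. pose proof (Re_energy_root_pos z Hz) as P.
  apply (f_equal Re) in E. rewrite re_plus, !re_RtoC in E. lra.
Qed.

Lemma Im_Csqrt_real z : Im z = 0 -> Im (Csqrt z) = 0.
Proof. intros H. unfold Csqrt, Im at 1. simpl. rewrite H. unfold Rdiv. ring. Qed.

Lemma Im_energy_root_real h : Im (energy_root (RtoC h)) = 0.
Proof. apply Im_Csqrt_real. unfold Im. simpl. ring. Qed.

Lemma Im_Dper_real s : Im s = 0 -> Im (Dper s) = 0.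
Proof.
  intros Hs. rewrite Im_Dper.
  rewrite (RInt_ext _ (fun _ => 0)).
  - rewrite RInt_const. unfold scal; simpl; unfold mult; simpl. apply Rmult_0_r.
  - intros t _. rewrite Im_Csqrt_real; [apply Rmult_0_r|]. rewrite Im_radicand, Hs. ring.
Qed.

Lemma sector_distance u v e t : 0 < e <= 1 -> 0 <= v <= PI - e -> 0 <= t ->
  sin e * Cmod (Cexp (u, v)) <= Cmod (Cexp (u, v) + RtoC t).
Proof.
  intros He Hv Ht. rewrite Cmod_Cexp. unfold Re at 1. simpl.
  pose proof PI2_3_2 as P2. unfold PI2 in P2.
  pose proof (exp_pos u) as Hu. pose proof (sin_small e ltac:(lra)) as Se.
  apply Rsqr_incr_0_var; [|apply Cmod_ge_0].
  assert (E : (Cmod (Cexp (u, v) + RtoC t))² = (exp u * cos v + t) ^ 2 + (exp u * sin v) ^ 2).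
  { unfold Rsqr. pose proof (Cmod2_alt (Cexp (u, v) + RtoC t)) as K.
    assert (K1 : Re (Cexp (u, v) + RtoC t)%C = exp u * cos v + t) by reflexivity.
    assert (K2 : Im (Cexp (u, v) + RtoC t)%C = exp u * sin v) by (unfold Im; simpl; ring).
    rewrite K1, K2 in K. lra. }
  rewrite E. unfold Rsqr. pose proof (sin2_cos2 v) as T. unfold Rsqr in T.
  destruct (Rle_dec v (PI / 2)) as [K|K].
  - assert (0 <= cos v) by (apply cos_ge_0; lra).
    assert (sin e * exp u * (sin e * exp u) <= exp u * exp u).
    { assert (sin e * exp u <= exp u) by nra. apply Rmult_le_compat; nra. }
    assert (0 <= exp u * cos v * t) by (repeat apply Rmult_le_pos; lra).
    assert ((exp u * cos v) ^ 2 + (exp u * sin v) ^ 2 = exp u * exp u).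
    { replace ((exp u * cos v) ^ 2 + (exp u * sin v) ^ 2) with
       (exp u * exp u * (sin v * sin v + cos v * cos v)) by ring. rewrite T. ring. }
    nra.
  - assert (Sv : sin e <= sin v).
    { rewrite <- (sin_PI_x v). apply sin_incr_1; lra. }
    assert (sin e * exp u * (sin e * exp u) <= (exp u * sin v) ^ 2).
    { assert (sin e * exp u <= exp u * sin v) by nra.
      replace ((exp u * sin v) ^ 2) with ((exp u * sin v) * (exp u * sin v)) by ring.
      apply Rmult_le_compat; nra. }
    pose proof (pow2_ge_0 (exp u * cos v + t)). lra.
Qed.

(** The integrable majorant [sqrt r / (1 + r)] of [r |Phi|], in the coordinate [r = exp u]. *)
Definition psi (u : R) : R := exp (u / 2) / (1 + exp u).

Lemma exp_le x y : x <= y -> exp x <= exp y.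
Proof. intros [H| ->]; [left; apply exp_increasing, H|lra]. Qed.

Lemma exp_half_sqr u : exp (u / 2) * exp (u / 2) = exp u.
Proof. rewrite <- exp_plus. f_equal. field. Qed.

Lemma psi_pos u : 0 < psi u.
Proof.
  unfold psi. pose proof (exp_pos u). apply Rdiv_lt_0_compat; [apply exp_pos|lra].
Qed.

Lemma psi_le u : psi u <= exp (- Rabs u / 2).
Proof.
  unfold psi. pose proof (exp_pos u). pose proof (exp_pos (u / 2)).
  apply Rle_div_l; [lra|].
  destruct (Rle_dec 0 u) as [K|K].
  - rewrite Rabs_right by lra.
    replace (exp (u / 2)) with (exp (- u / 2) * exp u).
    2: { rewrite <- exp_plus. f_equal. field. }
    pose proof (exp_pos (- u / 2)). nra.
  - rewrite Rabs_left by lra. replace (- - u / 2) with (u / 2) by field. nra.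
Qed.

Lemma continuous_psi u : continuous psi u.
Proof.
  apply derivable_continuous_R.
  unfold psi. auto_derive. pose proof (exp_pos u). lra.
Qed.

(** [2 atan (exp (u / 2))] is an antiderivative. *)
Lemma RInt_psi a b : RInt psi a b <= PI.
Proof.
  assert (D : forall u, is_derive (fun u => 2 * atan (exp (u / 2))) u (psi u)).
  { intros u. auto_derive; [exact Logic.I|]. unfold psi, Rsqr.
    rewrite <- (exp_half_sqr u). change (u * / 2) with (u / 2).
    field. pose proof (exp_pos (u / 2)). nra. }
  rewrite (is_RInt_unique _ _ _ _ (is_RInt_derive (V := R_CompleteNormedModule)
    (fun u => 2 * atan (exp (u / 2))) psi a b (fun t _ => D t) (fun t _ => continuous_psi t))).
  unfold minus, plus, opp; simpl.
  pose proof (atan_bound (exp (b / 2))).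
  assert (0 < atan (exp (a / 2))) by (rewrite <- atan_0; apply atan_increasing, exp_pos).
  lra.
Qed.

Lemma RInt_lin2_on (f g : R -> R) p q a b : a <= b ->
  (forall t, a <= t <= b -> continuous f t) -> (forall t, a <= t <= b -> continuous g t) ->
  RInt (fun t => p * f t + q * g t) a b = p * RInt f a b + q * RInt g a b.
Proof.
  intros Hab Hf Hg.
  assert (Ef : ex_RInt f a b).
  { apply ex_RInt_continuous_R.
    intros z. rewrite Rmin_left, Rmax_right by lra. apply Hf. }
  assert (Eg : ex_RInt g a b).
  { apply ex_RInt_continuous_R.
    intros z. rewrite Rmin_left, Rmax_right by lra. apply Hg. }
  transitivity (plus (RInt (fun t => scal p (f t)) a b) (RInt (fun t => scal q (g t)) a b)).
  - apply (RInt_plus (V := R_CompleteNormedModule) (fun t => scal p (f t)) (fun t => scal q (g t)));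
    apply (ex_RInt_scal (V := R_CompleteNormedModule)); assumption.
  - rewrite !(RInt_scal (V := R_CompleteNormedModule)) by assumption. reflexivity.
Qed.

Section Contour.
Variables (p0 p1 v0 v1 v2 : R) (rs : list C) (G : C -> C).

Definition affine_poly (z : C) : C := (RtoC p0 + RtoC p1 * z)%C.
Definition quad_poly (z : C) : C := (RtoC v0 + RtoC v1 * z + RtoC v2 * (z * z))%C.

Hypothesis Hrs : forall a, In a rs -> slit_plane a.
Hypothesis Hlen : (5 <= length rs)%nat.
Variable sg : R.
Hypothesis Hsg : sg = 1 \/ sg = -1.
Hypothesis Hsign : forall r, 0 < r ->
  lin_prod rs (RtoC (- r)) = RtoC (sg * Cmod (lin_prod rs (RtoC (- r)))).
Hypothesis HG : forall z, closed_upper z -> C_differentiable G z.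
Hypothesis HGreal : forall h, 0 < h -> Im (G (RtoC h)) = 0.
Hypothesis HF : forall z, closed_upper z ->
  (lin_prod rs z * G z = (1 + energy_root z) *
    (affine_poly z * Dper (energy_root z) + quad_poly z * Nper (energy_root z)))%C.

(** With [P] and [V] the affine and the quadratic polynomial, [Phi = V (P + V kappa) / L], where [kappa] is the ratio of the periods and [L] the product of the linear factors ([Phi_eq]). The factor [V] makes the coefficient of [kappa] a square up to [L], so that the imaginary part keeps its sign along the cut. *)
Definition Phi (z : C) : C :=
  (G z * quad_poly z / ((1 + energy_root z) * Dper (energy_root z)))%C.
(** The form [Phi dz] in the coordinate [log z]. *)
Definition Phi_log (w : C) : C := (Phi (Cexp w) * Cexp w)%C.

Lemma C_differentiable_affine_poly z : C_differentiable affine_poly z.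
Proof.
  unfold affine_poly. apply (C_differentiable_plus (fun _ => RtoC p0)).
  - apply C_differentiable_const.
  - apply C_differentiable_scal, C_differentiable_id.
Qed.
Lemma C_differentiable_quad_poly z : C_differentiable quad_poly z.
Proof.
  unfold quad_poly. apply (C_differentiable_plus (fun z => RtoC v0 + RtoC v1 * z)%C).
  - apply (C_differentiable_plus (fun _ => RtoC v0)).
    + apply C_differentiable_const.
    + apply C_differentiable_scal, C_differentiable_id.
  - apply (C_differentiable_scal (RtoC v2) (fun z => z * z)%C), C_differentiable_square.
Qed.

Lemma C_differentiable_Phi z : closed_upper z -> C_differentiable Phi z.
Proof.
  intros Hz. pose proof Hz as [Sz _]. unfold Phi. apply C_differentiable_div.
  - apply (C_differentiable_mult G quad_poly); [apply HG, Hz|apply C_differentiable_quad_poly].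
  - apply (C_differentiable_mult (fun w => 1 + energy_root w)%C (fun w => Dper (energy_root w))).
    + apply (C_differentiable_plus (fun _ => 1%C) energy_root);
      [apply C_differentiable_const|apply C_differentiable_energy_root, Sz].
    + apply (C_differentiable_comp Dper energy_root);
      [apply C_differentiable_Dper, energy_root_slit, Sz|apply C_differentiable_energy_root, Sz].
  - apply Cmult_neq_0; [apply one_plus_energy_root_nonzero, Sz|apply Dper_nonzero, Hz].
Qed.

Lemma C_differentiable_Phi_log u v : 0 <= v < PI -> C_differentiable Phi_log (u, v).
Proof.
  intros Hv. unfold Phi_log. apply (C_differentiable_mult (fun w => Phi (Cexp w)) Cexp).
  - apply (C_differentiable_comp Phi Cexp); [apply C_differentiable_Phi, closed_upper_Cexp, Hv|].
    apply C_differentiable_Cexp.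
  - apply C_differentiable_Cexp.
Qed.

Lemma Phi_eq z : closed_upper z -> lin_prod rs z <> 0%C ->
  Phi z = (quad_poly z * affine_poly z * / lin_prod rs z
     + quad_poly z * quad_poly z * / lin_prod rs z * period_ratio z)%C.
Proof.
  intros Hz N. pose proof (Dper_nonzero z Hz) as ND.
  pose proof (one_plus_energy_root_nonzero z (proj1 Hz)) as N1.
  assert (EG : G z = ((1 + energy_root z) *
    (affine_poly z * Dper (energy_root z) + quad_poly z * Nper (energy_root z)) / lin_prod rs z)%C).
  { rewrite <- HF by exact Hz. field. exact N. }
  unfold Phi, period_ratio. rewrite EG. field. repeat split; assumption.
Qed.

Lemma Im_mult_real (a b : C) : Im a = 0 -> Im b = 0 -> Im (a * b)%C = 0.
Proof. intros Ha Hb. rewrite im_mult, Ha, Hb. ring. Qed.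
Lemma Im_div_real (a b : C) : Im a = 0 -> Im b = 0 -> Im (a / b)%C = 0.
Proof.
  intros Ha Hb. apply Im_mult_real; [exact Ha|].
  destruct b as [x y]. unfold Im in *. simpl in *. subst y. unfold Rdiv. ring.
Qed.
Lemma Im_plus_real (a b : C) : Im a = 0 -> Im b = 0 -> Im (a + b)%C = 0.
Proof. intros Ha Hb. unfold Im in *. simpl. lra. Qed.

Lemma Im_quad_poly_real x : Im (quad_poly (RtoC x)) = 0.
Proof. unfold quad_poly, Im. simpl. ring. Qed.
Lemma Im_affine_poly_real x : Im (affine_poly (RtoC x)) = 0.
Proof. unfold affine_poly, Im. simpl. ring. Qed.

Lemma Phi_log_real u : Im (Phi_log (u, 0)) = 0.
Proof.
  assert (E : Cexp (u, 0) = RtoC (exp u)).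
  { unfold Cexp, RtoC. simpl. rewrite cos_0, sin_0. f_equal; ring. }
  unfold Phi_log. rewrite E. apply Im_mult_real; [|reflexivity].
  unfold Phi. apply Im_div_real.
  - apply Im_mult_real; [apply HGreal, exp_pos|apply Im_quad_poly_real].
  - apply Im_mult_real.
    + apply Im_plus_real; [reflexivity|apply Im_energy_root_real].
    + apply Im_Dper_real, Im_energy_root_real.
Qed.

Lemma affine_poly_bound : exists K, 0 <= K /\ forall z, Cmod (affine_poly z) <= K * (1 + Cmod z).
Proof.
  exists (Rabs p0 + Rabs p1). pose proof (Rabs_pos p0). pose proof (Rabs_pos p1).
  split; [lra|]. intros z. unfold affine_poly. eapply Rle_trans; [apply Cmod_triangle|].
  rewrite Cmod_mult, !Cmod_R. pose proof (Cmod_ge_0 z). nra.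
Qed.

Lemma quad_poly_bound : exists K, 0 <= K /\ forall z, Cmod (quad_poly z) <= K * (1 + Cmod z) ^ 2.
Proof.
  exists (Rabs v0 + Rabs v1 + Rabs v2).
  pose proof (Rabs_pos v0). pose proof (Rabs_pos v1). pose proof (Rabs_pos v2).
  split; [lra|]. intros z. unfold quad_poly. eapply Rle_trans; [apply Cmod_triangle|].
  eapply Rle_trans; [apply Rplus_le_compat_r, Cmod_triangle|].
  rewrite !Cmod_mult, !Cmod_R. pose proof (Cmod_ge_0 z) as Z. set (m := Cmod z) in *.
  assert (1 <= (1 + m) ^ 2) by nra. assert (m <= (1 + m) ^ 2) by nra.
  assert (m * m <= (1 + m) ^ 2) by nra. 
  assert (Rabs v0 * 1 <= Rabs v0 * (1 + m) ^ 2) by (apply Rmult_le_compat_l; lra).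
  assert (Rabs v1 * m <= Rabs v1 * (1 + m) ^ 2) by (apply Rmult_le_compat_l; lra).
  assert (Rabs v2 * (m * m) <= Rabs v2 * (1 + m) ^ 2) by (apply Rmult_le_compat_l; lra).
  lra.
Qed.

Lemma period_ratio_log u v e : 0 < e <= 1 -> 0 <= v <= PI - e ->
  Cmod (period_ratio (Cexp (u, v))) <= 960 / (sqrt e * exp (u / 2)).
Proof.
  intros He Hv. pose proof (sin_small e ltac:(lra)) as Se.
  pose proof (closed_upper_Cexp u v ltac:(lra)) as [Sl I0].
  eapply Rle_trans.
  { apply (period_ratio_bound _ (sin e) Sl I0); [lra|].
    intros t Ht. apply sector_distance; assumption. }
  rewrite Cmod_Cexp. unfold Re. simpl fst.
  pose proof (exp_pos u). pose proof (exp_pos (u / 2)) as Hq.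
  assert (Hse : 0 < sqrt e) by (apply sqrt_lt_R0; lra).
  assert (L : sqrt e * exp (u / 2) / 2 <= sqrt (sin e * exp u)).
  { apply Rsqr_incr_0_var; [|apply sqrt_pos]. rewrite Rsqr_sqrt by nra.
    unfold Rsqr. replace (sqrt e * exp (u / 2) / 2 * (sqrt e * exp (u / 2) / 2)) with
      ((sqrt e * sqrt e) * (exp (u / 2) * exp (u / 2)) / 4) by field.
    rewrite sqrt_sqrt, exp_half_sqr by lra. nra. }
  assert (0 < sqrt e * exp (u / 2)) by (apply Rmult_lt_0_compat; assumption).
  replace (960 / (sqrt e * exp (u / 2))) with (480 / (sqrt e * exp (u / 2) / 2)) by (field; split; lra).
  unfold Rdiv. apply Rmult_le_compat_l; [lra|]. apply Rinv_le_contravar; [lra|exact L].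
Qed.

Lemma pow_inv_cancel (r : R) n k : 0 < r -> (1 + r) ^ n * (/ (1 + r)) ^ (n + k) = (/ (1 + r)) ^ k.
Proof.
  intros Hr. rewrite pow_add, <- Rmult_assoc, <- Rpow_mult_distr, Rinv_r, pow1 by lra. ring.
Qed.

(** Five roots are exactly what makes [Phi] integrable at infinity, where [V ^ 2 kappa] grows like [r ^ 4 / sqrt r]. *)
Lemma inv_weight_le5 n r : (5 <= n)%nat -> 0 < r -> inv_weight n r <= (/ (1 + r)) ^ 5.
Proof.
  intros Hn Hr. unfold inv_weight.
  assert (0 < / (1 + r)) by (apply Rinv_0_lt_compat; lra).
  assert (/ (1 + r) <= 1) by (rewrite <- Rinv_1; apply Rinv_le_contravar; lra).
  replace n with (5 + (n - 5))%nat by lia. rewrite pow_add.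
  assert ((/ (1 + r)) ^ (n - 5) <= 1).
  { eapply Rle_trans; [apply pow_incr with (y := 1); lra|]. rewrite pow1. lra. }
  assert (0 <= (/ (1 + r)) ^ 5) by (apply pow_le; lra). nra.
Qed.

(** [r / (1 + r) ^ 2] and [r / (1 + r) * (1 / sqrt r)], which come from the two terms of [Phi], are at most [psi]. *)
Lemma psi_dominates1 u : exp u * (/ (1 + exp u)) ^ 2 <= psi u.
Proof.
  pose proof (exp_pos u). pose proof (exp_pos (u / 2)) as Hq. pose proof (exp_half_sqr u) as E.
  unfold psi. set (q := exp (u / 2)) in *. rewrite <- E.
  assert (W : 0 < / (1 + q * q)) by (apply Rinv_0_lt_compat; nra).
  assert (V : q * (q * / (1 + q * q)) <= 1).
  { replace (q * (q * / (1 + q * q))) with (1 - / (1 + q * q)) by (field; nra). lra. }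
  assert (V2 : q * / (1 + q * q) <= 1).
  { apply Rmult_le_reg_r with (1 + q * q); [nra|].
    rewrite Rmult_assoc, Rinv_l by nra. nra. }
  replace (q * q * (/ (1 + q * q)) ^ 2) with (q * / (1 + q * q) * (q * / (1 + q * q))) by ring.
  unfold Rdiv. assert (0 < q * / (1 + q * q)) by (apply Rmult_lt_0_compat; assumption). nra.
Qed.

Lemma psi_dominates2 u e : 0 < e ->
  exp u * / (1 + exp u) * (960 / (sqrt e * exp (u / 2))) = 960 / sqrt e * psi u.
Proof.
  intros He. pose proof (exp_pos u). pose proof (exp_pos (u / 2)) as Hq.
  assert (Hse : 0 < sqrt e) by (apply sqrt_lt_R0; lra).
  unfold psi. rewrite <- (exp_half_sqr u) at 1. field. repeat split; lra.
Qed.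

Lemma lateral_bound e : 0 < e <= 1 -> exists K U0, 0 <= K /\ forall u v,
  U0 <= Rabs u -> 0 <= v <= PI - e -> Cmod (Phi_log (u, v)) <= K * psi u.
Proof.
  intros He.
  destruct (lin_prod_lower rs Hrs) as (c & r0 & r1 & Hc & H0 & H1 & L).
  destruct affine_poly_bound as (Ka & HKa & Ba). destruct quad_poly_bound as (Kq & HKq & Bq).
  assert (Hse : 0 < sqrt e) by (apply sqrt_lt_R0; lra).
  exists (Kq * Ka / c + Kq * Kq / c * (960 / sqrt e)), (Rmax (- ln r0) (ln r1)).
  assert (C1 : 0 <= Kq * Ka / c).
  { apply Rmult_le_pos; [apply Rmult_le_pos; assumption|left; apply Rinv_0_lt_compat, Hc]. }
  assert (C2 : 0 <= Kq * Kq / c).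
  { apply Rmult_le_pos; [apply Rmult_le_pos; assumption|left; apply Rinv_0_lt_compat, Hc]. }
  split.
  { assert (0 < 960 / sqrt e) by (apply Rdiv_lt_0_compat; lra). nra. }
  intros u v Hu Hv.
  pose proof (closed_upper_Cexp u v ltac:(lra)) as Hz.
  pose proof (Cmod_Cexp (u, v)) as Mz. unfold Re in Mz. simpl fst in Mz.
  set (z := Cexp (u, v)) in *. pose proof (exp_pos u) as Hr. set (r := exp u) in *.
  assert (HL : c * (1 + r) ^ length rs <= Cmod (lin_prod rs z)).
  { specialize (L z). rewrite Mz in L. apply L.
    pose proof (Rmax_l (- ln r0) (ln r1)). pose proof (Rmax_r (- ln r0) (ln r1)).
    destruct (Rle_dec 0 u) as [K|K].
    - rewrite Rabs_right in Hu by lra. right. rewrite <- (exp_ln r1) by exact H1.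
      unfold r. apply exp_le. lra.
    - rewrite Rabs_left in Hu by lra. left. rewrite <- (exp_ln r0) by exact H0.
      unfold r. apply exp_le. lra. }
  assert (Pw : 0 < (1 + r) ^ length rs) by (apply pow_lt; lra).
  assert (N : lin_prod rs z <> 0%C) by (apply Cmod_gt_0; nra).
  set (w := / (1 + r)). assert (W0 : 0 < w) by (apply Rinv_0_lt_compat; lra).
  assert (BI : Cmod (/ lin_prod rs z)%C <= / c * w ^ 5).
  { rewrite Cmod_inv by exact N. apply Rle_trans with (/ (c * (1 + r) ^ length rs)).
    - apply Rinv_le_contravar; [nra|exact HL].
    - rewrite Rinv_mult. apply Rmult_le_compat_l; [left; apply Rinv_0_lt_compat, Hc|].
      pose proof (inv_weight_le5 (length rs) r Hlen Hr) as W. unfold inv_weight in W.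
      rewrite pow_inv in W. exact W. }
  unfold Phi_log. fold z. rewrite (Phi_eq z Hz N), Cmod_mult, Mz.
  specialize (Ba z). specialize (Bq z). rewrite Mz in Ba, Bq.
  pose proof (period_ratio_log u v e He Hv) as PR. fold z in PR.
  assert (T1 : Cmod (quad_poly z * affine_poly z * / lin_prod rs z) <= Kq * Ka / c * w ^ 2).
  { rewrite !Cmod_mult.
    apply Rle_trans with ((Kq * (1 + r) ^ 2) * (Ka * (1 + r)) * (/ c * w ^ 5)).
    - apply Rmult_le_compat; [apply Rmult_le_pos; apply Cmod_ge_0|apply Cmod_ge_0| |exact BI].
      apply Rmult_le_compat; try apply Cmod_ge_0; assumption.
    - right. pose proof (pow_inv_cancel r 3 2 Hr) as E. fold w in E. change (3 + 2)%nat with 5%nat in E. rewrite <- E.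
      unfold Rdiv. ring. }
  assert (T2 : Cmod (quad_poly z * quad_poly z * / lin_prod rs z) <= Kq * Kq / c * w).
  { rewrite !Cmod_mult.
    apply Rle_trans with ((Kq * (1 + r) ^ 2) * (Kq * (1 + r) ^ 2) * (/ c * w ^ 5)).
    - apply Rmult_le_compat; [apply Rmult_le_pos; apply Cmod_ge_0|apply Cmod_ge_0| |exact BI].
      apply Rmult_le_compat; try apply Cmod_ge_0; assumption.
    - right. pose proof (pow_inv_cancel r 4 1 Hr) as E. fold w in E. change (4 + 1)%nat with 5%nat in E.
      rewrite pow_1 in E. transitivity (Kq * Kq / c * ((1 + r) ^ 4 * w ^ 5)).
      + unfold Rdiv. ring.
      + rewrite E. reflexivity. }
  pose proof (psi_dominates1 u) as D1. pose proof (psi_dominates2 u e (proj1 He)) as D2.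
  fold r in D1, D2. fold w in D1, D2.
  apply Rle_trans with ((Kq * Ka / c * w ^ 2 + Kq * Kq / c * w * (960 / (sqrt e * exp (u / 2)))) * r).
  - apply Rmult_le_compat_r; [lra|]. eapply Rle_trans; [apply Cmod_triangle|].
    apply Rplus_le_compat; [exact T1|]. rewrite Cmod_mult.
    apply Rmult_le_compat; try apply Cmod_ge_0; assumption.
  - replace ((Kq * Ka / c * w ^ 2 + Kq * Kq / c * w * (960 / (sqrt e * exp (u / 2)))) * r) with
      (Kq * Ka / c * (r * w ^ 2) + Kq * Kq / c * (r * w * (960 / (sqrt e * exp (u / 2))))) by ring.
    rewrite D2. rewrite Rmult_plus_distr_r. apply Rplus_le_compat.
    + apply Rmult_le_compat_l; assumption.
    + right. ring.
Qed.

(** The direction of a point, which tends to [-1] at the negative half-line. In [z Phi = r (direction z * Phi)] the modulus [r] is left to the majorant [psi]. *)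
Definition direction (z : C) : C := (z / RtoC (Cmod z))%C.

Lemma direction_mult (z : C) : z <> 0%C -> (RtoC (Cmod z) * direction z = z)%C.
Proof.
  intros H. unfold direction. field. intros E. apply RtoC_inj in E.
  apply Cmod_gt_0 in H. lra.
Qed.

Lemma direction_negative r : 0 < r -> direction (RtoC (- r)) = RtoC (-1).
Proof.
  intros Hr. unfold direction. rewrite Cmod_R, Rabs_Ropp, Rabs_right by lra.
  rewrite <- RtoC_div by lra. f_equal. field. lra.
Qed.

Lemma rho_nonzero u e : rho u e <> 0%C.
Proof. apply Cmod_gt_0. rewrite Cmod_rho. apply exp_pos. Qed.

Lemma tame_direction e0 : e0 <= 1 -> tame e0 (fun _ => 1) direction.
Proof.
  intros H0. exists 2. split; [lra|]. intros u e He. pose proof (exp_pos u) as Hu.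
  assert (NZ : RtoC (exp u) <> 0%C) by (intros E; apply RtoC_inj in E; lra).
  assert (Ed : forall z, Cmod z = exp u -> direction z = (z / RtoC (exp u))%C).
  { intros z Hz. unfold direction. rewrite Hz. reflexivity. }
  assert (M : Cmod (RtoC (- exp u)) = exp u) by (rewrite Cmod_R, Rabs_Ropp, Rabs_right; lra).
  split.
  - rewrite Ed by apply Cmod_rho. rewrite Cmod_div, Cmod_rho, Cmod_R, Rabs_right by (exact NZ || lra).
    unfold Rdiv. rewrite Rinv_r; lra.
  - rewrite !Ed by (apply Cmod_rho || exact M).
    replace (rho u e / RtoC (exp u) - RtoC (- exp u) / RtoC (exp u))%C with
      ((rho u e - RtoC (- exp u)) / RtoC (exp u))%C by (field; exact NZ).
    rewrite Cmod_div, Cmod_R, (Rabs_right (exp u)) by (exact NZ || lra).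
    apply Rle_div_l; [lra|]. pose proof (rho_near_real u e ltac:(lra)). lra.
Qed.

Definition pow_weight (n : nat) (r : R) : R := (1 + r) ^ n.

Lemma pow_weight_pos n : weight_pos (pow_weight n).
Proof. intros r Hr. apply pow_le. lra. Qed.

Lemma tame_affine_poly e0 : 0 <= e0 <= 1 -> tame e0 (pow_weight 1) affine_poly.
Proof.
  intros He. unfold affine_poly.
  apply (tame_plus e0 _ (fun _ => RtoC p0) (fun z => RtoC p1 * z)%C).
  - apply (tame_weaken _ (fun _ => 1)); [lra| |apply tame_const].
    intros r Hr. unfold pow_weight. lra.
  - apply (tame_weaken _ (fun r => 1 * (1 + r))); [lra| |].
    + intros r Hr. unfold pow_weight. lra.
    + apply (tame_mult e0 (fun _ => 1) (fun r => 1 + r) (fun _ => RtoC p1) (fun z => z)).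
      * lra.
      * intros r Hr; lra.
      * intros r Hr; lra.
      * apply tame_const.
      * apply tame_id. lra.
Qed.

Lemma tame_quad_poly e0 : 0 <= e0 <= 1 -> tame e0 (pow_weight 2) quad_poly.
Proof.
  intros He. unfold quad_poly.
  assert (P1 : weight_pos (fun _ => 1)) by (intros r Hr; lra).
  assert (P2 : weight_pos (fun r => 1 + r)) by (intros r Hr; lra).
  assert (P3 : weight_pos (fun r => (1 + r) * (1 + r))) by (intros r Hr; nra).
  apply (tame_plus e0 _ (fun z => RtoC v0 + RtoC v1 * z)%C (fun z => RtoC v2 * (z * z))%C);
  [apply (tame_plus e0 _ (fun _ => RtoC v0) (fun z => RtoC v1 * z)%C)|].
  - apply (tame_weaken _ (fun _ => 1)); [lra| |apply tame_const].
    intros r Hr. unfold pow_weight. nra.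
  - apply (tame_weaken _ (fun r => 1 * (1 + r))); [lra| |].
    + intros r Hr. unfold pow_weight. nra.
    + apply (tame_mult e0 (fun _ => 1) (fun r => 1 + r) (fun _ => RtoC v1) (fun z => z));
      [lra|exact P1|exact P2|apply tame_const|apply tame_id; lra].
  - apply (tame_weaken _ (fun r => 1 * ((1 + r) * (1 + r)))); [lra| |].
    + intros r Hr. unfold pow_weight. nra.
    + apply (tame_mult e0 (fun _ => 1) (fun r => (1 + r) * (1 + r)) (fun _ => RtoC v2) (fun z => z * z)%C);
      [lra|exact P1|exact P3|apply tame_const|].
      apply (tame_mult e0 (fun r => 1 + r) (fun r => 1 + r) (fun z => z) (fun z => z));
      [lra|exact P2|exact P2|apply tame_id; lra|apply tame_id; lra].
Qed.

(** Next to the cut the only part of [Im (z Phi)] of order one is the one in which [Im period_ratio] multiplies a real function of constant sign. The other terms are real on the cut, and being tame they contribute [O (e)], or [O (e)] times a ratio of size [1 / sqrt (e r)]. *)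
Lemma top_estimate : exists K e0, 0 <= K /\ 0 < e0 <= 1 /\ forall u e, 0 < e <= e0 ->
  Rabs (Im (Phi_log (u, PI - e)) -
      sg * exp u * (Re (quad_poly (RtoC (- exp u))) ^ 2 / Cmod (lin_prod rs (RtoC (- exp u))))
      * (- Im (period_ratio (rho u e))))
    <= K * sqrt e * psi u.
Proof.
  destruct (tame_inv_prod rs Hrs) as (e0 & He0 & NZ & TI).
  pose proof (tame_direction e0 ltac:(lra)) as TD.
  pose proof (tame_affine_poly e0 ltac:(lra)) as TA.
  pose proof (tame_quad_poly e0 ltac:(lra)) as TQ.
  assert (P1 : weight_pos (fun _ => 1)) by (intros r Hr; lra).
  assert (PQ : weight_pos (fun r => pow_weight 2 r * pow_weight 1 r)).
  { intros r Hr. apply Rmult_le_pos; apply pow_weight_pos, Hr. }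
  assert (PQ2 : weight_pos (fun r => pow_weight 2 r * pow_weight 2 r)).
  { intros r Hr. apply Rmult_le_pos; apply pow_weight_pos, Hr. }
  assert (PI1 : weight_pos (fun r => pow_weight 2 r * pow_weight 1 r * inv_weight (length rs) r)).
  { intros r Hr. apply Rmult_le_pos; [apply PQ, Hr|apply inv_weight_pos, Hr]. }
  assert (PI2 : weight_pos (fun r => pow_weight 2 r * pow_weight 2 r * inv_weight (length rs) r)).
  { intros r Hr. apply Rmult_le_pos; [apply PQ2, Hr|apply inv_weight_pos, Hr]. }
  pose (h1 := fun w => (direction w * (quad_poly w * affine_poly w * / lin_prod rs w))%C).
  pose (h2 := fun w => (direction w * (quad_poly w * quad_poly w * / lin_prod rs w))%C).
  assert (T1 : tame e0 (fun r => (/ (1 + r)) ^ 2) h1).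
  { apply (tame_weaken e0 (fun r => 1 * (pow_weight 2 r * pow_weight 1 r * inv_weight (length rs) r))); [lra| |].
    - intros r Hr. pose proof (inv_weight_le5 (length rs) r Hlen Hr) as W.
      pose proof (pow_inv_cancel r 3 2 Hr) as E. change (3 + 2)%nat with 5%nat in E. rewrite <- E.
      unfold pow_weight. assert (0 < (1 + r) ^ 3) by (apply pow_lt; lra).
      replace ((1 + r) ^ 2 * (1 + r) ^ 1) with ((1 + r) ^ 3) by ring. nra.
    - apply (tame_mult e0 _ _ direction); [lra|exact P1|exact PI1|exact TD|].
      apply (tame_mult e0 _ _ (fun w => quad_poly w * affine_poly w)%C); [lra|exact PQ|apply inv_weight_pos| |exact TI].
      apply (tame_mult e0 _ _ quad_poly affine_poly); [lra|apply pow_weight_pos|apply pow_weight_pos|exact TQ|exact TA]. }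
  assert (T2 : tame e0 (fun r => / (1 + r)) h2).
  { apply (tame_weaken e0 (fun r => 1 * (pow_weight 2 r * pow_weight 2 r * inv_weight (length rs) r))); [lra| |].
    - intros r Hr. pose proof (inv_weight_le5 (length rs) r Hlen Hr) as W.
      pose proof (pow_inv_cancel r 4 1 Hr) as E. change (4 + 1)%nat with 5%nat in E. rewrite pow_1 in E. rewrite <- E.
      unfold pow_weight. assert (0 < (1 + r) ^ 4) by (apply pow_lt; lra).
      replace ((1 + r) ^ 2 * (1 + r) ^ 2) with ((1 + r) ^ 4) by ring. nra.
    - apply (tame_mult e0 _ _ direction); [lra|exact P1|exact PI2|exact TD|].
      apply (tame_mult e0 _ _ (fun w => quad_poly w * quad_poly w)%C); [lra|exact PQ2|apply inv_weight_pos| |exact TI].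
      apply (tame_mult e0 _ _ quad_poly quad_poly); [lra|apply pow_weight_pos|apply pow_weight_pos|exact TQ|exact TQ]. }
  destruct T1 as (K1 & HK1 & B1). destruct T2 as (K2 & HK2 & B2).
  exists (K1 + K2 * 960), e0. split; [lra|]. split; [exact He0|].
  intros u e He.
  destruct (B1 u e ltac:(lra)) as [_ D1]. destruct (B2 u e ltac:(lra)) as [_ D2].
  pose proof PI2_3_2 as P3. unfold Rtrigo1.PI2 in P3.
  assert (Hz : closed_upper (rho u e)) by (apply closed_upper_Cexp; lra).
  assert (Nz : lin_prod rs (rho u e) <> 0%C) by (apply NZ; lra).
  pose proof (NZ u 0 ltac:(lra)) as N0. rewrite rho_0 in N0.
  pose proof (exp_pos u) as Hr. set (r := exp u) in *.
  pose proof (direction_mult _ (rho_nonzero u e)) as Ez. rewrite Cmod_rho in Ez. fold r in Ez.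
  assert (EP : Phi_log (u, PI - e) = (RtoC r * (h1 (rho u e) + h2 (rho u e) * period_ratio (rho u e)))%C).
  { unfold Phi_log. change (Cexp (u, PI - e)) with (rho u e). rewrite (Phi_eq _ Hz Nz).
    unfold h1, h2.
    match goal with |- (?X * rho u e)%C = _ =>
      transitivity (X * (RtoC r * direction (rho u e)))%C end.
    - rewrite Ez. reflexivity.
    - ring. }
  rewrite EP, im_scal_l.
  set (kap := period_ratio (rho u e)).
  set (z := rho u e) in *. set (x := RtoC (- r)) in *.
  assert (IP : Im (lin_prod rs x) = 0) by (unfold x; rewrite (Hsign r Hr); reflexivity).
  assert (Im_inv : Im (/ lin_prod rs x)%C = 0).
  { replace (/ lin_prod rs x)%C with (1 / lin_prod rs x)%C by (field; exact N0).
    apply Im_div_real; [reflexivity|exact IP]. }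
  assert (I1 : Im (h1 x) = 0).
  { unfold h1, x. rewrite direction_negative by exact Hr. fold x.
    apply Im_mult_real; [reflexivity|]. apply Im_mult_real; [|exact Im_inv].
    apply Im_mult_real; [apply Im_quad_poly_real|apply Im_affine_poly_real]. }
  set (m := Cmod (lin_prod rs x)). set (q := Re (quad_poly x)).
  assert (Hm : 0 < m) by (apply Cmod_gt_0, N0).
  assert (Esg : sg * sg = 1) by (destruct Hsg as [-> | ->]; ring).
  assert (Nsg : sg <> 0) by (destruct Hsg as [-> | ->]; lra).
  assert (E2 : h2 x = RtoC (- (sg * (q ^ 2 / m)))).
  { unfold h2, x. rewrite direction_negative by exact Hr.
    rewrite (Hsign r Hr). fold x. fold m.
    rewrite (real_of_im_0 (quad_poly x)) by apply Im_quad_poly_real. fold q.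
    rewrite <- RtoC_inv by (apply Rmult_integral_contrapositive_currified; lra).
    rewrite <- !RtoC_mult. f_equal.
    replace (/ (sg * m)) with (sg * / m).
    2: { apply Rmult_eq_reg_l with (sg * m); [|apply Rmult_integral_contrapositive_currified; lra].
         rewrite Rinv_r by (apply Rmult_integral_contrapositive_currified; lra).
         replace (sg * m * (sg * / m)) with (sg * sg * (m * / m)) by ring.
         rewrite Esg, Rinv_r; lra. }
    field. lra. }
  assert (Eq : r * Im (h1 z + h2 z * kap)%C - sg * r * (q ^ 2 / m) * (- Im kap) =
     r * (Im (h1 z - h1 x)%C + Im ((h2 z - h2 x) * kap)%C)).
  { replace (h1 z + h2 z * kap)%C with ((h1 z - h1 x) + h1 x + (h2 z - h2 x) * kap + h2 x * kap)%C by ring.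
    rewrite !im_plus, I1, E2, im_scal_l. ring. }
  rewrite Eq, Rabs_mult, (Rabs_right r) by lra.
  assert (Hse : 0 < sqrt e) by (apply sqrt_lt_R0; lra).
  assert (Sse : sqrt e * sqrt e = e) by (apply sqrt_sqrt; lra).
  assert (e <= sqrt e) as Hes.
  { assert (sqrt e <= 1) by (rewrite <- sqrt_1; apply sqrt_le_1_alt; lra). nra. }
  assert (PR : Cmod kap <= 960 / (sqrt e * exp (u / 2))).
  { apply (period_ratio_log u (PI - e) e); lra. }
  set (w := / (1 + r)) in *. assert (W0 : 0 < w) by (apply Rinv_0_lt_compat; lra).
  pose proof (psi_dominates1 u) as Q1. pose proof (psi_dominates2 u e ltac:(lra)) as Q2.
  fold r in Q1, Q2. fold w in Q1, Q2. pose proof (psi_pos u) as Pp.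
  assert (F1 : Rabs (Im (h1 z - h1 x)%C) <= K1 * e * w ^ 2).
  { eapply Rle_trans; [apply im_le_Cmod|exact D1]. }
  assert (F2 : Rabs (Im ((h2 z - h2 x) * kap)%C) <= K2 * e * w * (960 / (sqrt e * exp (u / 2)))).
  { eapply Rle_trans; [apply im_le_Cmod|]. rewrite Cmod_mult.
    apply Rmult_le_compat; try apply Cmod_ge_0; assumption. }
  apply Rle_trans with (r * (K1 * e * w ^ 2 + K2 * e * w * (960 / (sqrt e * exp (u / 2))))).
  { apply Rmult_le_compat_l; [lra|]. eapply Rle_trans; [apply Rabs_triang|]. lra. }
  replace (r * (K1 * e * w ^ 2 + K2 * e * w * (960 / (sqrt e * exp (u / 2))))) with
    (K1 * e * (r * w ^ 2) + K2 * e * (r * w * (960 / (sqrt e * exp (u / 2))))) by ring.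
  rewrite Q2.
  replace (K2 * e * (960 / sqrt e * psi u)) with (K2 * 960 * sqrt e * psi u).
  2: { rewrite <- Sse at 2. field. lra. }
  assert (K1 * e * (r * w ^ 2) <= K1 * sqrt e * psi u).
  { apply Rmult_le_compat; [nra| |nra|exact Q1]. apply Rmult_le_pos; [lra|apply pow2_ge_0]. }
  lra.
Qed.

Lemma lin_prod_upper (l : list C) : exists K, 0 < K /\ forall z, Cmod z <= 8 -> Cmod (lin_prod l z) <= K.
Proof.
  induction l as [|a l (K & HK & IH)].
  - exists 1. split; [lra|]. intros z _. unfold lin_prod. simpl. rewrite Cmod_1. lra.
  - exists ((8 + Cmod a) * K). pose proof (Cmod_ge_0 a). split; [nra|].
    intros z Hz. rewrite lin_prod_cons, Cmod_mult.
    apply Rmult_le_compat; try apply Cmod_ge_0; [|apply IH, Hz].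
    replace (z - a)%C with (z + - a)%C by ring.
    eapply Rle_trans; [apply Cmod_triangle|]. rewrite Cmod_opp. lra.
Qed.

Lemma period_ratio_negative u e : 0 < e <= 1 -> Im (period_ratio (rho u e)) <= 0.
Proof.
  intros He. pose proof PI2_3_2 as P3. unfold PI2 in P3.
  assert (HI : 0 < Im (rho u e)).
  { rewrite rho_eq. unfold Im. simpl. apply Rmult_lt_0_compat; [apply exp_pos|].
    pose proof (sin_small e). lra. }
  pose proof (Im_energy_root_pos _ HI) as Is.
  pose proof (period_ratio_im _ Is) as K. unfold period_ratio.
  assert (0 <= Im (energy_root (rho u e)) ^ 2 / (32 * (2 * Cmod (energy_root (rho u e)) + 1) ^ 3)).
  { apply Rmult_le_pos; [apply pow2_ge_0|]. left. apply Rinv_0_lt_compat.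
    assert (0 < (2 * Cmod (energy_root (rho u e)) + 1) ^ 3); [|lra].
    apply pow_lt. pose proof (Cmod_ge_0 (energy_root (rho u e))). lra. }
  lra.
Qed.

(** For [1 <= r <= 8] the number [1 + 4 z] is close to a negative one, so [s] is far from the real axis and the bound of [period_ratio_im] is effective. The constants come from [|1 + 4 z| <= 33] and [2 * 33 + 1 = 67]. *)
Lemma period_ratio_gap u e : 0 < e <= 1 / 2 -> 1 <= exp u <= 8 ->
  / (32 * 67 ^ 3) <= - Im (period_ratio (rho u e)).
Proof.
  intros He Hu. pose proof PI2_3_2 as P3. unfold PI2 in P3.
  assert (HI : 0 < Im (rho u e)).
  { rewrite rho_eq. unfold Im. simpl. apply Rmult_lt_0_compat; [apply exp_pos|].
    pose proof (sin_small e). lra. }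
  pose proof (Im_energy_root_pos _ HI) as Is.
  pose proof (period_ratio_im _ Is) as K. unfold period_ratio.
  pose proof (energy_root_sqr _ (upper_slit _ HI)) as Es.
  pose proof (one_minus_cos_small e ltac:(lra)) as Ce.
  set (s := energy_root (rho u e)) in *.
  assert (S1 : 1 <= Im s ^ 2).
  { apply (f_equal Re) in Es. rewrite re_mult in Es.
    assert (K1 : Re (1 + 4 * rho u e)%C = 1 - 4 * (exp u * cos e)).
    { rewrite rho_eq. unfold Re. simpl. ring. }
    rewrite K1 in Es. assert (1 / 2 <= exp u * cos e) by nra.
    pose proof (pow2_ge_0 (Re s)). assert (2 <= 4 * (exp u * cos e)) by lra. nra. }
  assert (S2 : Cmod s <= 33).
  { apply (f_equal Cmod) in Es. rewrite Cmod_mult in Es.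
    assert (Cmod (1 + 4 * rho u e) <= 1 + 4 * exp u).
    { eapply Rle_trans; [apply Cmod_triangle|]. rewrite Cmod_mult, Cmod_rho, !Cmod_R.
      rewrite !Rabs_right; lra. }
    pose proof (Cmod_ge_0 s). nra. }
  pose proof (Cmod_ge_0 s).
  assert (L : / (32 * 67 ^ 3) <= Im s ^ 2 / (32 * (2 * Cmod s + 1) ^ 3)).
  { unfold Rdiv. rewrite <- (Rmult_1_l (/ (32 * 67 ^ 3))).
    apply Rmult_le_compat; [lra| |exact S1|].
    - left. apply Rinv_0_lt_compat. lra.
    - apply Rinv_le_contravar.
      + assert (0 < (2 * Cmod s + 1) ^ 3) by (apply pow_lt; lra). lra.
      + apply Rmult_le_compat_l; [lra|]. apply pow_incr. lra. }
  lra.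
Qed.

Hypothesis HL : exists r, 2 <= r <= 4 /\ Re (quad_poly (RtoC (- r))) <> 0.

(** Cauchy's theorem on [-U <= u <= U], [0 <= v <= PI - e]. On the bottom side [Phi_log] is real, the lateral sides are negligible for large [U], and on the top side the imaginary part has, up to an error of order [sqrt e], a constant sign and a definite size for [r] in an interval where [quad_poly] does not vanish. *)
Theorem contour_contradiction : False.
Proof.
  destruct top_estimate as (K & e0 & HK & He0 & Top).
  destruct (lin_prod_upper rs) as (P & HP & UP).
  destruct HL as (r & Hr & Nr).
  set (g := fun u => Re (quad_poly (RtoC (- exp u)))).
  assert (Cg : continuous g (ln r)).
  { apply derivable_continuous_R.
    exists (- v1 * r + 2 * v2 * r ^ 2).
    apply (is_derive_ext (fun u => v0 - v1 * exp u + v2 * exp u ^ 2)).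
    - intros u. unfold g, quad_poly, Re. simpl. ring.
    - auto_derive; [exact Logic.I|]. rewrite exp_ln by lra. simpl. ring. }
  assert (Gr : g (ln r) = Re (quad_poly (RtoC (- r)))) by (unfold g; rewrite exp_ln; lra || reflexivity).
  apply continuity_pt_filterlim in Cg.
  pose proof (Rabs_pos_lt _ Nr) as Pr. set (ell := Rabs (Re (quad_poly (RtoC (- r))))) in *.
  destruct (Cg (ell / 2) ltac:(lra)) as (d & Hd & Hg).
  set (del := Rmin (d / 2) (ln 2)).
  assert (L2 : 0 < ln 2) by (rewrite <- ln_1; apply ln_increasing; lra).
  assert (Hdel : 0 < del) by (apply Rmin_glb_lt; lra).
  assert (Hdel1 : del <= d / 2) by apply Rmin_l. assert (Hdel2 : del <= ln 2) by apply Rmin_r.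
  set (u1 := ln r - del). set (u2 := ln r + del).
  assert (Hu12 : forall u, u1 <= u <= u2 -> 1 <= exp u <= 8).
  { intros u Hu. unfold u1, u2 in Hu. split.
    - rewrite <- exp_0. apply exp_le.
      assert (ln 2 <= ln r) by (apply ln_le; lra). lra.
    - rewrite <- (exp_ln 8) by lra. apply exp_le.
      assert (ln r <= ln 4) by (apply ln_le; lra).
      assert (ln 8 = ln 4 + ln 2) by (rewrite <- ln_mult by lra; f_equal; lra). lra. }
  assert (Hgl : forall u, u1 <= u <= u2 -> ell ^ 2 / 4 <= g u ^ 2).
  { intros u Hu. unfold u1, u2 in Hu.
    assert (Rabs (g u - g (ln r)) < ell / 2) as Hgu.
    { destruct (Req_dec u (ln r)) as [->|Hn].
      - rewrite Rminus_diag_eq, Rabs_R0 by reflexivity. lra.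
      - apply Hg. split; [split; [exact Logic.I|auto]|]. simpl. unfold R_dist.
        apply Rabs_lt_between. lra. }
    rewrite Gr in Hgu.
    assert (ell / 2 <= Rabs (g u)).
    { pose proof (Rabs_triang_inv (Re (quad_poly (RtoC (- r)))) (Re (quad_poly (RtoC (- r))) - g u)) as T.
      replace (Re (quad_poly (RtoC (- r))) - (Re (quad_poly (RtoC (- r))) - g u)) with (g u) in T by ring.
      rewrite (Rabs_minus_sym _ (g u)) in T. fold ell in T. lra. }
    rewrite <- (pow2_abs (g u)). nra. }
  assert (Hell : 0 < ell ^ 2 / 4) by (clear - Pr; nra).
  set (c0 := ell ^ 2 / 4 / P * / (32 * 67 ^ 3)).
  assert (Hc0 : 0 < c0).
  { unfold c0. apply Rmult_lt_0_compat; [|apply Rinv_0_lt_compat; lra].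
    apply Rdiv_lt_0_compat; [exact Hell|exact HP]. }
  set (c1 := c0 * (u2 - u1)).
  assert (Hc1 : 0 < c1) by (apply Rmult_lt_0_compat; [exact Hc0|unfold u1, u2; lra]).
  pose proof PI2_3_2 as P3. unfold PI2 in P3. pose proof PI_4 as P4.
  (* the error term is then at most half of the main term *)
  assert (exists e, 0 < e /\ e <= e0 /\ e <= 1 / 2 /\ K * sqrt e * PI <= c1 / 2) as (e & He & Hee & Heh & HKe).
  { set (q := c1 / 2 / (4 * (K + 1))).
    assert (Hq : 0 < q) by (unfold q; repeat apply Rdiv_lt_0_compat; lra).
    exists (Rmin (Rmin e0 (1 / 2)) (q * q)).
    pose proof (Rmin_l (Rmin e0 (1 / 2)) (q * q)). pose proof (Rmin_r (Rmin e0 (1 / 2)) (q * q)).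
    pose proof (Rmin_l e0 (1 / 2)). pose proof (Rmin_r e0 (1 / 2)).
    split; [repeat apply Rmin_glb_lt; nra|]. split; [lra|]. split; [lra|].
    assert (Sq : sqrt (Rmin (Rmin e0 (1 / 2)) (q * q)) <= q).
    { eapply Rle_trans; [apply sqrt_le_1_alt; eassumption|]. rewrite sqrt_square; lra. }
    pose proof (sqrt_pos (Rmin (Rmin e0 (1 / 2)) (q * q))).
    apply Rle_trans with ((K + 1) * q * 4).
    - apply Rmult_le_compat; [apply Rmult_le_pos; lra|lra| |lra].
      apply Rmult_le_compat; lra.
    - right. unfold q. field. lra. }
  destruct (lateral_bound e ltac:(lra)) as (Ks & U0 & HKs & Lat).
  set (U := Rmax (Rmax (Rabs U0) (Rabs u1 + Rabs u2)) (2 * (64 * Ks / c1 + 1))).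
  pose proof (Rmax_l (Rmax (Rabs U0) (Rabs u1 + Rabs u2)) (2 * (64 * Ks / c1 + 1))) as M1. fold U in M1.
  pose proof (Rmax_r (Rmax (Rabs U0) (Rabs u1 + Rabs u2)) (2 * (64 * Ks / c1 + 1))) as M2. fold U in M2.
  pose proof (Rmax_l (Rabs U0) (Rabs u1 + Rabs u2)) as M3.
  pose proof (Rmax_r (Rabs U0) (Rabs u1 + Rabs u2)) as M4.
  pose proof (Rabs_pos u1). pose proof (Rabs_pos u2). pose proof (Rle_abs U0).
  assert (Hq0 : 0 <= 64 * Ks / c1).
  { apply Rmult_le_pos; [lra|left; apply Rinv_0_lt_compat, Hc1]. }
  assert (HU : 0 < U) by lra.
  assert (Hu1 : - U <= u1) by (pose proof (Rle_abs (- u1)) as A; rewrite Rabs_Ropp in A; lra).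
  assert (Hu2 : u2 <= U) by (pose proof (Rle_abs u2); lra).
  assert (Hu12' : u1 <= u2) by (unfold u1, u2; lra).
  assert (HD : forall x y, - U <= x <= U -> 0 <= y <= PI - e -> C_differentiable Phi_log (x, y)).
  { intros. apply C_differentiable_Phi_log. lra. }
  pose proof (cauchy_rectangle Phi_log (- U) U 0 (PI - e) ltac:(lra) ltac:(lra) HD) as Cau.
  unfold rect_int in Cau.
  set (top := fun x => Im (Phi_log (x, PI - e))).
  assert (Ctop : forall x, - U <= x <= U -> continuous top x).
  { intros x Hx. apply C_differentiable_Im_x, HD; lra. }
  assert (Side : Rabs (RInt (fun y => Re (Phi_log (U, y)) - Re (Phi_log (- U, y))) 0 (PI - e)
      - 0 * (PI - e - 0)) <= (2 * (Ks * exp (- U / 2))) * (PI - e - 0)).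
  { apply RInt_near_const; [lra| |].
    - intros y Hy. apply (continuous_minus (fun y => Re (Phi_log (U, y))) (fun y => Re (Phi_log (- U, y))));
      apply (vertical_continuous (fun u v => Im (Phi_log (u, v))) (fun u v => Re (Phi_log (u, v)))
          (- U) U 0 (PI - e)); try lra;
      intros; apply holomorphic_closed_form, HD; assumption.
    - intros y Hy.
      assert (S : forall u, Rabs u = U -> Rabs (Re (Phi_log (u, y))) <= Ks * exp (- U / 2)).
      { intros u Hu. eapply Rle_trans; [apply re_le_Cmod|].
        eapply Rle_trans; [apply Lat; lra|]. apply Rmult_le_compat_l; [exact HKs|].
        rewrite <- Hu. apply psi_le. }
      pose proof (S U ltac:(apply Rabs_right; lra)) as S1.
      pose proof (S (- U) ltac:(rewrite Rabs_Ropp; apply Rabs_right; lra)) as S2.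
      replace (Re (Phi_log (U, y)) - Re (Phi_log (- U, y)) - 0) with
        (Re (Phi_log (U, y)) + - Re (Phi_log (- U, y))) by ring.
      eapply Rle_trans; [apply Rabs_triang|]. rewrite Rabs_Ropp. lra. }
  assert (Bot : RInt (fun x => Im (Phi_log (x, 0)) - Im (Phi_log (x, PI - e))) (- U) U
     = - RInt top (- U) U).
  { rewrite <- (RInt_opp (V := R_CompleteNormedModule)).
    - apply RInt_ext. intros x _. rewrite Phi_log_real.
      exact (Rminus_0_l (Im (Phi_log (x, PI - e)))).
    - apply ex_RInt_continuous_R.
      intros z. rewrite Rmin_left, Rmax_right by lra. apply Ctop. }
  rewrite Bot in Cau.
  (* the multiple of psi outweighs the error of top_estimate, so that k is nonnegative everywhere *)
  set (k := fun x => sg * top x + K * sqrt e * psi x).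
  assert (Ck : forall x, - U <= x <= U -> continuous k x).
  { intros x Hx. apply (continuous_plus (fun x => sg * top x) (fun x => K * sqrt e * psi x)).
    - apply (continuous_scal_R sg top). apply Ctop, Hx.
    - apply (continuous_scal_R (K * sqrt e) psi).
      apply continuous_psi. }
  assert (Esg : sg * sg = 1) by (destruct Hsg as [-> | ->]; ring).
  assert (Kl : forall x, exp x * (g x ^ 2 / Cmod (lin_prod rs (RtoC (- exp x)))) *
     (- Im (period_ratio (rho x e))) <= k x).
  { intros x. specialize (Top x e ltac:(lra)). fold (top x) in Top. fold (g x) in Top.
    set (B := exp x * (g x ^ 2 / Cmod (lin_prod rs (RtoC (- exp x)))) *
     (- Im (period_ratio (rho x e)))) in *.
    assert (EB : sg * exp x * (g x ^ 2 / Cmod (lin_prod rs (RtoC (- exp x)))) *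
     (- Im (period_ratio (rho x e))) = sg * B) by (unfold B; ring).
    rewrite EB in Top. unfold k.
    assert (Rabs (sg * (top x - sg * B)) <= K * sqrt e * psi x).
    { rewrite Rabs_mult. replace (Rabs sg) with 1; [lra|].
      destruct Hsg as [-> | ->]; [rewrite Rabs_right|rewrite Rabs_left]; lra. }
    apply Rabs_le_between in H2.
    replace (sg * (top x - sg * B)) with (sg * top x - sg * sg * B) in H2 by ring.
    rewrite Esg in H2. lra. }
  assert (Kpos : forall x, 0 <= k x).
  { intros x. eapply Rle_trans; [|apply Kl]. pose proof (exp_pos x).
    pose proof (period_ratio_negative x e ltac:(lra)).
    apply Rmult_le_pos; [|lra]. apply Rmult_le_pos; [lra|].
    apply Rmult_le_pos; [apply pow2_ge_0|].
    destruct (Cmod_ge_0 (lin_prod rs (RtoC (- exp x)))) as [Q|Q].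
    - left. apply Rinv_0_lt_compat, Q.
    - rewrite <- Q, Rinv_0. lra. }
  assert (Kgap : forall x, u1 <= x <= u2 -> c0 <= k x).
  { intros x Hx. eapply Rle_trans; [|apply Kl].
    pose proof (Hu12 x Hx) as Ex. pose proof (Hgl x Hx) as Gx.
    pose proof (period_ratio_gap x e ltac:(lra) Ex) as Px.
    assert (UPx : Cmod (lin_prod rs (RtoC (- exp x))) <= P).
    { apply UP. rewrite Cmod_R, Rabs_Ropp, Rabs_right; lra. }
    assert (Mx : 0 < Cmod (lin_prod rs (RtoC (- exp x)))).
    { destruct (tame_inv_prod rs Hrs) as (e1 & He1 & NZ & _).
      specialize (NZ x 0 ltac:(lra)). rewrite rho_0 in NZ. apply Cmod_gt_0, NZ. }
    assert (Q : ell ^ 2 / 4 / P <= g x ^ 2 / Cmod (lin_prod rs (RtoC (- exp x)))).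
    { unfold Rdiv at 1 3. apply Rmult_le_compat; [lra|left; apply Rinv_0_lt_compat, HP|exact Gx|].
      apply Rinv_le_contravar; assumption. }
    assert (Q0 : 0 < ell ^ 2 / 4 / P) by (apply Rdiv_lt_0_compat; assumption).
    unfold c0. apply Rmult_le_compat.
    - lra.
    - left. apply Rinv_0_lt_compat. lra.
    - rewrite <- (Rmult_1_l (ell ^ 2 / 4 / P)). apply Rmult_le_compat; lra.
    - exact Px. }
  assert (Ex : forall a b, - U <= a -> a <= b -> b <= U -> ex_RInt k a b).
  { intros a b Ha Hab Hb. apply ex_RInt_continuous_R.
    intros z. rewrite Rmin_left, Rmax_right by lra. intros. apply Ck. lra. }
  assert (Split : RInt k (- U) U = RInt k (- U) u1 + RInt k u1 u2 + RInt k u2 U).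
  { rewrite <- (RInt_Chasles (V := R_CompleteNormedModule) k (- U) u2 U).
    2, 3 : apply Ex; lra.
    rewrite <- (RInt_Chasles (V := R_CompleteNormedModule) k (- U) u1 u2).
    2, 3 : apply Ex; lra.
    reflexivity. }
  pose proof (RInt_ge_const k (- U) u1 0 ltac:(lra) ltac:(intros; apply Ck; lra) ltac:(intros; apply Kpos)) as J1.
  pose proof (RInt_ge_const k u1 u2 c0 ltac:(lra) ltac:(intros; apply Ck; lra) Kgap) as J2.
  pose proof (RInt_ge_const k u2 U 0 ltac:(lra) ltac:(intros; apply Ck; lra) ltac:(intros; apply Kpos)) as J3.
  fold c1 in J2.
  assert (Ek : RInt k (- U) U = sg * RInt top (- U) U + K * sqrt e * RInt psi (- U) U).
  { apply RInt_lin2_on; [lra|exact Ctop|intros; apply continuous_psi]. }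
  pose proof (RInt_psi (- U) U) as Ip.
  assert (KI : K * sqrt e * RInt psi (- U) U <= K * sqrt e * PI).
  { apply Rmult_le_compat_l; [|exact Ip]. apply Rmult_le_pos; [exact HK|apply sqrt_pos]. }
  assert (HT : c1 / 2 <= sg * RInt top (- U) U) by lra.
  assert (HT2 : sg * RInt top (- U) U <= 2 * (Ks * exp (- U / 2)) * 4).
  { apply Rle_trans with (Rabs (RInt top (- U) U)).
    - destruct Hsg as [-> | ->].
      + rewrite Rmult_1_l. apply Rle_abs.
      + pose proof (Rle_abs (- RInt top (- U) U)) as A. rewrite Rabs_Ropp in A. lra.
    - assert (ET : RInt top (- U) U =
        RInt (fun y => Re (Phi_log (U, y)) - Re (Phi_log (- U, y))) 0 (PI - e) - 0 * (PI - e - 0)) by lra.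
      rewrite ET. eapply Rle_trans; [exact Side|].
      assert (0 <= Ks * exp (- U / 2)) by (apply Rmult_le_pos; [exact HKs|left; apply exp_pos]).
      apply Rmult_le_compat_l; lra. }
  assert (HE : exp (- U / 2) * (1 + U / 2) <= 1).
  { pose proof (exp_ineq1_le (U / 2)) as E. pose proof (exp_pos (- U / 2)) as Ep.
    apply Rle_trans with (exp (- U / 2) * exp (U / 2)); [apply Rmult_le_compat_l; lra|].
    rewrite <- exp_plus. replace (- U / 2 + U / 2) with 0 by field. rewrite exp_0. lra. }
  assert (F : c1 * (1 + U / 2) <= 16 * Ks).
  { assert (c1 <= 16 * Ks * exp (- U / 2)) by lra.
    apply Rle_trans with (16 * Ks * exp (- U / 2) * (1 + U / 2)).
    - apply Rmult_le_compat_r; lra.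
    - rewrite Rmult_assoc. rewrite <- (Rmult_1_r (16 * Ks)) at 2. apply Rmult_le_compat_l; lra. }
  assert (F2 : c1 * (64 * Ks / c1 + 1) <= c1 * (U / 2)) by (apply Rmult_le_compat_l; lra).
  replace (c1 * (64 * Ks / c1 + 1)) with (64 * Ks + c1) in F2 by (field; lra).
  rewrite Rmult_plus_distr_l in F. lra.
Qed.
End Contour.

(** * Zeros of the continuation *)

(** The real counterpart of [radicand]; likewise for the two integrals below. *)
Definition radicand_R (S t : R) : R := (1 + cos t ^ 2) * S - (1 - cos t ^ 2).

Definition Dper_R (S : R) : R := RInt (fun t => sin t ^ 2 * sqrt (radicand_R S t)) turn0 turn1.
Definition Nper_R (S : R) : R := RInt (fun t => cos t ^ 2 * / sqrt (radicand_R S t)) turn0 turn1.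

Lemma radicand_R_pos S t : 1 < S -> 0 < radicand_R S t.
Proof. intros HS. unfold radicand_R. pose proof (cos2_bounds t). nra. Qed.

Lemma Csqrt_radicand_R S t : 1 < S -> Csqrt (radicand (RtoC S) t) = RtoC (sqrt (radicand_R S t)).
Proof.
  intros HS. rewrite <- Csqrt_pos by (apply radicand_R_pos, HS). f_equal.
  unfold radicand, radicand_R. rewrite <- RtoC_mult, <- RtoC_minus. reflexivity.
Qed.

Lemma C_eq_parts (c : C) x : Re c = x -> Im c = 0 -> c = RtoC x.
Proof. intros H1 H2. destruct c as [a b]. unfold Re, Im, RtoC in *. simpl in *. congruence. Qed.

Lemma RInt_zero a b : RInt (fun _ => 0) a b = 0.
Proof. rewrite RInt_const. unfold scal; simpl; unfold mult; simpl. apply Rmult_0_r. Qed.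

Lemma Dper_RtoC S : 1 < S -> Dper (RtoC S) = RtoC (Dper_R S).
Proof.
  intros HS. apply C_eq_parts.
  - rewrite Re_Dper. apply RInt_ext. intros t _. rewrite Csqrt_radicand_R by exact HS. reflexivity.
  - apply Im_Dper_real. reflexivity.
Qed.

Lemma Nper_RtoC S : 1 < S -> Nper (RtoC S) = RtoC (Nper_R S).
Proof.
  intros HS.
  assert (N : forall t, sqrt (radicand_R S t) <> 0).
  { intros t. pose proof (sqrt_lt_R0 _ (radicand_R_pos S t HS)). lra. }
  apply C_eq_parts.
  - rewrite Re_Nper. apply RInt_ext. intros t _. rewrite Csqrt_radicand_R by exact HS.
    rewrite <- RtoC_inv by apply N. reflexivity.
  - rewrite Im_Nper. rewrite (RInt_ext _ (fun _ => 0)); [apply RInt_zero|].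
    intros t _. rewrite Csqrt_radicand_R by exact HS.
    rewrite <- RtoC_inv by apply N. exact (Rmult_0_r _).
Qed.

Lemma energy_root_RtoC h : 0 < h -> energy_root (RtoC h) = RtoC (sqrt (1 + 4 * h)).
Proof.
  intros Hh. unfold energy_root. rewrite <- Csqrt_pos by lra. f_equal.
  rewrite RtoC_plus, RtoC_mult. reflexivity.
Qed.

Lemma sqrt_energy_gt1 h : 0 < h -> 1 < sqrt (1 + 4 * h).
Proof. intros Hh. rewrite <- sqrt_1 at 1. apply sqrt_lt_1_alt. lra. Qed.

(** The functions that occur as second Melnikov function, continued to the slit plane ([period_form] is the restriction to the half-line). *)
Definition continuation (p0 p1 v0 v1 v2 : R) (z : C) : C :=
  ((1 + energy_root z) * (affine_poly p0 p1 z * Dper (energy_root z)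
     + quad_poly v0 v1 v2 z * Nper (energy_root z)))%C.

Definition period_form (p0 p1 v0 v1 v2 h : R) : R :=
  let S := sqrt (1 + 4 * h) in
  (1 + S) * ((p0 + p1 * h) * Dper_R S + (v0 + v1 * h + v2 * h ^ 2) * Nper_R S).

Lemma continuation_RtoC p0 p1 v0 v1 v2 h : 0 < h ->
  continuation p0 p1 v0 v1 v2 (RtoC h) = RtoC (period_form p0 p1 v0 v1 v2 h).
Proof.
  intros Hh. unfold continuation, period_form. pose proof (sqrt_energy_gt1 h Hh) as HS.
  rewrite energy_root_RtoC by exact Hh. rewrite Dper_RtoC, Nper_RtoC by exact HS.
  unfold affine_poly, quad_poly.
  rewrite <- !RtoC_mult, <- !RtoC_plus, <- !RtoC_mult, <- !RtoC_plus, <- RtoC_mult.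
  f_equal. ring.
Qed.

Lemma C_differentiable_continuation p0 p1 v0 v1 v2 z : slit_plane z ->
  C_differentiable (continuation p0 p1 v0 v1 v2) z.
Proof.
  intros Hz. pose proof (C_differentiable_energy_root z Hz) as DE.
  pose proof (energy_root_slit z Hz) as SE.
  unfold continuation.
  apply (C_differentiable_mult (fun w => 1 + energy_root w)%C
    (fun w => affine_poly p0 p1 w * Dper (energy_root w) + quad_poly v0 v1 v2 w * Nper (energy_root w))%C).
  - apply (C_differentiable_plus (fun _ => 1%C) energy_root); [apply C_differentiable_const|exact DE].
  - apply (C_differentiable_plus (fun w => affine_poly p0 p1 w * Dper (energy_root w))%C
      (fun w => quad_poly v0 v1 v2 w * Nper (energy_root w))%C).
    + apply (C_differentiable_mult (affine_poly p0 p1) (fun w => Dper (energy_root w))).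
      * apply C_differentiable_affine_poly.
      * apply (C_differentiable_comp Dper energy_root); [apply C_differentiable_Dper, SE|exact DE].
    + apply (C_differentiable_mult (quad_poly v0 v1 v2) (fun w => Nper (energy_root w))).
      * apply C_differentiable_quad_poly.
      * apply (C_differentiable_comp Nper energy_root); [apply C_differentiable_Nper, SE|exact DE].
Qed.

Lemma continuation_unique p0 p1 v0 v1 v2 m F :
  (forall h, 0 < h -> m h = period_form p0 p1 v0 v1 v2 h) ->
  analytic_continuation m F ->
  forall z, closed_upper z -> F z = continuation p0 p1 v0 v1 v2 z.
Proof.
  intros Hm [HF HFr] z [Hz Hi].
  assert (Real : forall h, 0 < h -> F (RtoC h) = continuation p0 p1 v0 v1 v2 (RtoC h)).
  { intros h Hh. rewrite HFr, Hm, continuation_RtoC by exact Hh. reflexivity. }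
  destruct (Req_dec (Im z) 0) as [I0|I0].
  - destruct (im_zero_real z I0 Hz) as [E P]. rewrite E. apply Real, P.
  - apply Ceq_minus.
    apply (slit_plane_uniqueness (fun z => F z - continuation p0 p1 v0 v1 v2 z)%C); [| |lra].
    + intros w Hw. apply C_differentiable_minus; [apply HF, Hw|].
      apply C_differentiable_continuation, Hw.
    + intros h Hh. rewrite Real by exact Hh. ring.
Qed.

(** The only members of the list that are not zeros themselves are conjugates of nonreal zeros. *)
Lemma in_all_roots a l : In a (all_roots l) ->
  exists z m, In (z, m) l /\ (1 <= m)%nat /\ (a = z \/ Im z <> 0).
Proof.
  unfold all_roots. intros H. apply in_flat_map in H. destruct H as ([z m] & Hin & Ha).
  exists z, m. split; [exact Hin|]. unfold entry_roots in Ha. simpl fst in Ha. simpl snd in Ha.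
  destruct m as [|m].
  - destruct (Req_dec_T (Im z) 0); simpl in Ha; contradiction.
  - split; [lia|]. destruct (Req_dec_T (Im z) 0) as [I0|I0].
    + left. apply repeat_spec in Ha. exact Ha.
    + right. exact I0.
Qed.

Lemma vanishes_zero F z m : (1 <= m)%nat -> vanishes_to_order F z m -> F z = 0%C.
Proof.
  intros Hm (g & r & Hr & H). destruct (H z) as [_ E].
  - replace (z - z)%C with (RtoC 0) by ring. rewrite Cmod_0. exact Hr.
  - rewrite E. destruct m as [|m]; [lia|]. simpl. ring.
Qed.

Lemma zero_at_limit Q a : C_differentiable Q (RtoC a) ->
  (forall h, a < h -> Q (RtoC h) = 0%C) -> Q (RtoC a) = 0%C.
Proof.
  intros HQ H0. destruct (Ceq_dec (Q (RtoC a)) 0%C) as [E|N]; [exact E|exfalso].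
  apply Cmod_gt_0 in N.
  destruct (C_differentiable_continuous Q (RtoC a) HQ _ N) as (d & Hd & H1).
  specialize (H1 (RtoC (a + d / 2))). rewrite H0 in H1 by lra.
  assert (K : Cmod (RtoC (a + d / 2) - RtoC a) < d).
  { rewrite <- RtoC_minus, Cmod_R. replace (a + d / 2 - a) with (d / 2) by ring.
    rewrite Rabs_right; lra. }
  specialize (H1 K). replace (0 - Q (RtoC a))%C with (- Q (RtoC a))%C in H1 by ring.
  rewrite Cmod_opp in H1. lra.
Qed.

Lemma C_differentiable_lin_prod rs z : C_differentiable (lin_prod rs) z.
Proof.
  induction rs as [|a rs IH].
  - exact (C_differentiable_const 1%C z).
  - apply (C_differentiable_mult (fun w => w - a)%C (lin_prod rs)); [|exact IH].
    apply (C_differentiable_minus (fun w => w) (fun _ => a));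
    [apply C_differentiable_id|apply C_differentiable_const].
Qed.

Lemma affine_zero p0 p1 z : (p0 <> 0 \/ p1 <> 0) -> affine_poly p0 p1 z = 0%C ->
  p1 <> 0 /\ z = RtoC (- p0 / p1).
Proof.
  intros Hp E. unfold affine_poly in E.
  assert (E1 := f_equal Re E). assert (E2 := f_equal Im E).
  destruct z as [x y]. unfold Re, Im in E1, E2. simpl in E1, E2.
  assert (P1 : p1 <> 0).
  { intros K. subst p1. destruct Hp as [Hp|Hp]; [|contradiction]. apply Hp. lra. }
  split; [exact P1|]. unfold RtoC. f_equal.
  - apply Rmult_eq_reg_l with p1; [|exact P1]. field_simplify; [lra|exact P1].
  - apply Rmult_eq_reg_l with p1; [|exact P1]. lra.
Qed.

(** When the quadratic polynomial vanishes, the function is an affine one times a function without zeros. If the affine zero were counted twice, division by [w - x] would make the zero-free factor vanish at [x]. *)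
Lemma affine_case p0 p1 l F G :
  (p0 <> 0 \/ p1 <> 0) ->
  (forall z, closed_upper z -> F z = continuation p0 p1 0 0 0 z) ->
  (forall z m, In (z, m) l -> closed_upper z /\ vanishes_to_order F z m) ->
  (forall z, closed_upper z -> C_differentiable G z) ->
  (forall w, closed_upper w -> F w = (lin_prod (all_roots l) w * G w)%C) ->
  (2 <= length (all_roots l))%nat -> False.
Proof.
  intros Hp HF Hl HG HFG Hlen.
  assert (Fform : forall z, closed_upper z -> F z =
    ((1 + energy_root z) * (affine_poly p0 p1 z * Dper (energy_root z)))%C).
  { intros z Hz. rewrite HF by exact Hz. unfold continuation, quad_poly. ring. }
  assert (Root : forall a, In a (all_roots l) -> p1 <> 0 /\ a = RtoC (- p0 / p1) /\ closed_upper a).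
  { intros a Ha. destruct (in_all_roots a l Ha) as (z & m & Hin & Hm & Haz).
    destruct (Hl z m Hin) as [Hz Hv]. pose proof (vanishes_zero F z m Hm Hv) as Z.
    rewrite Fform in Z by exact Hz.
    assert (A0 : affine_poly p0 p1 z = 0%C).
    { destruct (Ceq_dec (affine_poly p0 p1 z) 0%C) as [E|N]; [exact E|exfalso]. revert Z.
      apply Cmult_neq_0; [apply one_plus_energy_root_nonzero, Hz|].
      apply Cmult_neq_0; [exact N|apply Dper_nonzero, Hz]. }
    destruct (affine_zero p0 p1 z Hp A0) as [P1 Ez]. split; [exact P1|].
    destruct Haz as [->|I0].
    - split; [exact Ez|exact Hz].
    - exfalso. apply I0. rewrite Ez. reflexivity. }
  destruct (all_roots l) as [|a [|b rs]] eqn:Er; [simpl in Hlen; lia|simpl in Hlen; lia|].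
  destruct (Root a (or_introl eq_refl)) as (P1 & Ea & Ca).
  destruct (Root b (or_intror (or_introl eq_refl))) as (_ & Eb & _).
  set (x := - p0 / p1) in *. rewrite Ea in *. rewrite Eb in *.
  assert (Hx : 0 < x).
  { destruct Ca as [Sl _]. destruct (Rle_dec x 0) as [K|K]; [|lra].
    exfalso. apply Sl. split; [reflexivity|exact K]. }
  set (Q := fun w => ((w - RtoC x) * (lin_prod rs w * G w)
     - RtoC p1 * ((1 + energy_root w) * Dper (energy_root w)))%C).
  assert (Q0 : Q (RtoC x) = 0%C).
  { apply zero_at_limit.
    - unfold Q. destruct Ca as [Sl Il].
      apply (C_differentiable_minus (fun w => (w - RtoC x) * (lin_prod rs w * G w))%C
        (fun w => RtoC p1 * ((1 + energy_root w) * Dper (energy_root w)))%C).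
      + apply (C_differentiable_mult (fun w => w - RtoC x)%C (fun w => lin_prod rs w * G w)%C).
        * apply (C_differentiable_minus (fun w => w) (fun _ => RtoC x));
          [apply C_differentiable_id|apply C_differentiable_const].
        * apply (C_differentiable_mult (lin_prod rs) G);
          [apply C_differentiable_lin_prod|apply HG; split; assumption].
      + apply C_differentiable_scal.
        apply (C_differentiable_mult (fun w => 1 + energy_root w)%C (fun w => Dper (energy_root w))).
        * apply (C_differentiable_plus (fun _ => 1%C) energy_root);
          [apply C_differentiable_const|apply C_differentiable_energy_root, Sl].
        * apply (C_differentiable_comp Dper energy_root);
          [apply C_differentiable_Dper, energy_root_slit, Sl|apply C_differentiable_energy_root, Sl].
    - intros h Hh.
      assert (Ch : closed_upper (RtoC h)).
      { split; [intros [_ K]; simpl in K; lra|simpl; lra]. }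
      assert (Nh : (RtoC h - RtoC x)%C <> 0%C).
      { rewrite <- RtoC_minus. intros E. apply RtoC_inj in E. lra. }
      pose proof (HFG (RtoC h) Ch) as E1. rewrite (Fform _ Ch) in E1.
      rewrite !lin_prod_cons in E1.
      assert (EA : affine_poly p0 p1 (RtoC h) = (RtoC p1 * (RtoC h - RtoC x))%C).
      { unfold affine_poly, x. rewrite <- !RtoC_mult, <- RtoC_minus, <- RtoC_plus, <- RtoC_mult.
        f_equal. field. exact P1. }
      rewrite EA in E1.
      assert (E2 : ((RtoC h - RtoC x) * Q (RtoC h) = 0)%C).
      { unfold Q.
        transitivity ((RtoC h - RtoC x) * ((RtoC h - RtoC x) * lin_prod rs (RtoC h)) * G (RtoC h)
          - (1 + energy_root (RtoC h)) * (RtoC p1 * (RtoC h - RtoC x) * Dper (energy_root (RtoC h))))%C.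
        - ring.
        - rewrite E1. ring. }
      destruct (Ceq_dec (Q (RtoC h)) 0%C) as [K|K]; [exact K|exfalso].
      revert E2. apply Cmult_neq_0; assumption. }
  revert Q0. unfold Q. replace (RtoC x - RtoC x)%C with (RtoC 0) by ring.
  rewrite Cmult_0_l. intros E.
  assert (N : (RtoC p1 * ((1 + energy_root (RtoC x)) * Dper (energy_root (RtoC x))))%C <> 0%C).
  { apply Cmult_neq_0; [intros K; apply RtoC_inj in K; contradiction|].
    apply Cmult_neq_0; [apply one_plus_energy_root_nonzero, Ca|apply Dper_nonzero, Ca]. }
  apply N.
  match goal with |- ?X = _ => transitivity (0 - (0 - X))%C; [ring|rewrite E; ring] end.
Qed.

(** With five or more roots the contour argument applies as soon as the quadratic polynomial is not zero at one of the points [-2], [-3], [-4]; otherwise it is identically zero. *)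
Lemma upper_zeros p0 p1 v0 v1 v2 m F l :
  (forall h, 0 < h -> m h = period_form p0 p1 v0 v1 v2 h) ->
  (exists h, 0 < h /\ m h <> 0) ->
  analytic_continuation m F ->
  NoDup (map fst l) ->
  (forall z k, In (z, k) l -> closed_upper z /\ vanishes_to_order F z k) ->
  (length (all_roots l) <= 4)%nat.
Proof.
  intros Hm (h0 & Hh0 & Hm0) HF Hnd Hl.
  destruct (Compare_dec.le_lt_dec (length (all_roots l)) 4) as [K|K]; [exact K|exfalso].
  pose proof (continuation_unique p0 p1 v0 v1 v2 m F Hm HF) as Fz.
  assert (Sl : forall z k, In (z, k) l -> slit_plane z) by (intros z k Hin; apply (Hl z k Hin)).
  destruct (divide_zeros l F) as (G & G1 & G2 & G3).
  - intros z Hz. apply HF, Hz.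
  - intros h Hh. destruct HF as [_ HFr]. rewrite HFr by exact Hh. reflexivity.
  - exact Hnd.
  - exact Hl.
  - destruct (Req_dec (v0 - 2 * v1 + 4 * v2) 0) as [E2|E2].
    destruct (Req_dec (v0 - 3 * v1 + 9 * v2) 0) as [E3|E3].
    destruct (Req_dec (v0 - 4 * v1 + 16 * v2) 0) as [E4|E4].
    { assert (V2 : v2 = 0) by lra. assert (V1 : v1 = 0) by lra. assert (V0 : v0 = 0) by lra.
      subst v0 v1 v2.
      apply (affine_case p0 p1 l F G); try assumption; [|lia].
      destruct (Req_dec p0 0) as [P0|P0]; [|left; exact P0].
      destruct (Req_dec p1 0) as [P1|P1]; [|right; exact P1].
      exfalso. apply Hm0. rewrite Hm by exact Hh0. subst. unfold period_form. ring. }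
    all: destruct (lin_prod_sign l Sl) as (sg & Hsg & Hsign).
    all: apply (contour_contradiction p0 p1 v0 v1 v2 (all_roots l) G (all_roots_slit l Sl)
      ltac:(lia) sg Hsg Hsign G1 G2).
    all: try (intros z Hz; rewrite <- G3 by exact Hz; apply Fz, Hz).
    + exists 4. split; [lra|]. unfold quad_poly, Re. simpl. lra.
    + exists 3. split; [lra|]. unfold quad_poly, Re. simpl. lra.
    + exists 2. split; [lra|]. unfold quad_poly, Re. simpl. lra.
Qed.

(** * Reflection in the real axis *)

Lemma C_differentiable_reflect f z : C_differentiable f (Cconj z) ->
  C_differentiable (fun w => Cconj (f (Cconj w))) z.
Proof.
  intros H. apply C_differentiable_iff in H. destruct H as [l Hl].
  apply C_differentiable_iff. exists (Cconj l). intros eps Heps.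
  destruct (Hl eps Heps) as (d & Hd & H1). exists d. split; [exact Hd|].
  intros w Hw.
  assert (E : Cmod (Cconj w - Cconj z) = Cmod (w - z)).
  { rewrite <- Cminus_conj. apply Cmod_conj. }
  specialize (H1 (Cconj w) ltac:(rewrite E; exact Hw)). rewrite E in H1.
  eapply Rle_trans; [right|exact H1].
  rewrite <- (Cmod_conj (f (Cconj w) - f (Cconj z) - l * (Cconj w - Cconj z))). f_equal.
  rewrite !Cminus_conj, Cmult_conj, Cminus_conj, !Cconj_conj. reflexivity.
Qed.

Lemma slit_plane_conj z : slit_plane z -> slit_plane (Cconj z).
Proof.
  intros H [I R]. rewrite im_conj in I. rewrite re_conj in R. apply H. split; lra.
Qed.

Lemma analytic_continuation_reflect m F : analytic_continuation m F ->
  analytic_continuation m (fun w => Cconj (F (Cconj w))).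
Proof.
  assert (CR : forall x, Cconj (RtoC x) = RtoC x).
  { intros x. unfold Cconj, RtoC. simpl. f_equal. ring. }
  intros [H1 H2]. split.
  - intros z Hz. apply C_differentiable_reflect, H1, slit_plane_conj, Hz.
  - intros h Hh. rewrite CR, H2 by exact Hh. apply CR.
Qed.

Lemma vanishes_reflect F z k : vanishes_to_order F z k ->
  vanishes_to_order (fun w => Cconj (F (Cconj w))) (Cconj z) k.
Proof.
  intros (g & r & Hr & H). exists (fun w => Cconj (g (Cconj w))), r. split; [exact Hr|].
  intros w Hw.
  assert (E : Cmod (Cconj w - z) < r).
  { rewrite <- (Cmod_conj (Cconj w - z)), Cminus_conj, Cconj_conj. exact Hw. }
  destruct (H _ E) as [D1 D2]. split.
  - apply C_differentiable_reflect, D1.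
  - rewrite D2, Cmult_conj, Cpow_conj, Cminus_conj, Cconj_conj. reflexivity.
Qed.

Definition upper_part (l : list (C * nat)) : list (C * nat) :=
  filter (fun p => if Rle_dec 0 (Im (fst p)) then true else false) l.
Definition reflected (l : list (C * nat)) : list (C * nat) :=
  map (fun p => (Cconj (fst p), snd p)) l.

Lemma length_entry_roots p : length (entry_roots p) =
  (if Req_dec_T (Im (fst p)) 0 then snd p else snd p + snd p)%nat.
Proof.
  unfold entry_roots. destruct (Req_dec_T (Im (fst p)) 0).
  - apply repeat_length.
  - rewrite length_app, !repeat_length. reflexivity.
Qed.

(** A nonreal zero counts twice in its half plane, a real one once in both. *)
Lemma count_both_halves l :
  (length (all_roots (upper_part l)) + length (all_roots (upper_part (reflected l)))
   = 2 * list_sum (map snd l))%nat.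
Proof.
  induction l as [|[z m] l IH]; [reflexivity|].
  unfold upper_part, reflected, all_roots in *. cbn [map filter fst snd].
  rewrite im_conj. change (list_sum (m :: map snd l)) with (m + list_sum (map snd l))%nat.
  destruct (Rle_dec 0 (Im z)) as [A1|A1]; destruct (Rle_dec 0 (- Im z)) as [A2|A2];
    cbn [flat_map]; rewrite ?length_app, ?length_entry_roots; cbn [fst snd];
    rewrite ?im_conj.
  - destruct (Req_dec_T (Im z) 0) as [I|I]; [|lra].
    destruct (Req_dec_T (- Im z) 0) as [I'|I']; [|lra]. lia.
  - destruct (Req_dec_T (Im z) 0) as [I|I]; [lra|]. lia.
  - destruct (Req_dec_T (- Im z) 0) as [I'|I']; [lra|]. lia.
  - lra.
Qed.

Lemma NoDup_upper_part l : NoDup (map fst l) -> NoDup (map fst (upper_part l)).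
Proof.
  induction l as [|p l IH]; intros H; [constructor|].
  simpl in H. inversion H as [|x xs Hn Hd]; subst. unfold upper_part in *. simpl.
  destruct (Rle_dec 0 (Im (fst p))); [|apply IH, Hd].
  simpl. constructor; [|apply IH, Hd].
  intros K. apply Hn. apply in_map_iff in K. destruct K as (q & Eq & Hq).
  apply filter_In in Hq. rewrite <- Eq. apply in_map, Hq.
Qed.

Lemma NoDup_reflected l : NoDup (map fst l) -> NoDup (map fst (reflected l)).
Proof.
  intros H. unfold reflected. rewrite map_map. simpl.
  rewrite <- (map_map fst Cconj). apply FinFun.Injective_map_NoDup; [|exact H].
  intros a b E. rewrite <- (Cconj_conj a), E. apply Cconj_conj.
Qed.

(** [upper_zeros] is applied to the given function and to its reflection: each of the two counts is at most four, and together they count every zero twice. *)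
Theorem period_form_zeros p0 p1 v0 v1 v2 m F :
  (forall h, 0 < h -> m h = period_form p0 p1 v0 v1 v2 h) ->
  (exists h, 0 < h /\ m h <> 0) ->
  analytic_continuation m F ->
  at_most_zeros 4 slit_plane F.
Proof.
  intros Hm Hnz HF l Hnd Hl.
  assert (U1 : (length (all_roots (upper_part l)) <= 4)%nat).
  { apply (upper_zeros p0 p1 v0 v1 v2 m F); try assumption; [apply NoDup_upper_part, Hnd|].
    intros z k Hin. unfold upper_part in Hin. apply filter_In in Hin. destruct Hin as [Hin Hi].
    simpl in Hi. destruct (Rle_dec 0 (Im z)); [|discriminate].
    destruct (Hl z k Hin) as [A1 A2]. split; [split; assumption|exact A2]. }
  assert (U2 : (length (all_roots (upper_part (reflected l))) <= 4)%nat).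
  { apply (upper_zeros p0 p1 v0 v1 v2 m (fun w => Cconj (F (Cconj w)))); try assumption.
    - apply analytic_continuation_reflect, HF.
    - apply NoDup_upper_part, NoDup_reflected, Hnd.
    - intros z k Hin. unfold upper_part in Hin. apply filter_In in Hin. destruct Hin as [Hin Hi].
      simpl in Hi. destruct (Rle_dec 0 (Im z)); [|discriminate].
      unfold reflected in Hin. apply in_map_iff in Hin. destruct Hin as ([y j] & Eq & Hin).
      simpl in Eq. injection Eq as E1 E2. subst z k.
      destruct (Hl y j Hin) as [A1 A2]. split.
      + split; [apply slit_plane_conj, A1|assumption].
      + apply vanishes_reflect, A2. }
  pose proof (count_both_halves l). lia.
Qed.

(** * The ovals in angular coordinates *)

(** The angular speed on the oval of energy [h], where [S = sqrt (1 + 4 h)]. The factorization [2 y ^ 2 = (1 + S - x ^ 2) (x ^ 2 + S - 1)] of the energy relation suggests [x = sqrt (1 + S) cos t]; the minus sign in [yh] makes [t] increase along the flow. *)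
Definition mh (S t : R) : R := sqrt (radicand_R S t / 2).
Definition xh (S t : R) : R := sqrt (1 + S) * cos t.
Definition yh (S t : R) : R := - (sqrt (1 + S) * mh S t * sin t).

Lemma mh_pos S t : 1 < S -> 0 < mh S t.
Proof. intros HS. apply sqrt_lt_R0. pose proof (radicand_R_pos S t HS). lra. Qed.

Lemma mh_sqr S t : 1 < S -> mh S t ^ 2 = radicand_R S t / 2.
Proof.
  intros HS. pose proof (radicand_R_pos S t HS). unfold mh. simpl. rewrite Rmult_1_r.
  apply sqrt_sqrt. lra.
Qed.

Lemma sqrt1S_sqr S : 1 < S -> sqrt (1 + S) ^ 2 = 1 + S.
Proof. intros HS. simpl. rewrite Rmult_1_r. apply sqrt_sqrt. lra. Qed.

Lemma cos2_sin2 t : cos t ^ 2 = 1 - sin t ^ 2.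
Proof. pose proof (sin2_cos2 t) as E. unfold Rsqr in E. lra. Qed.

Lemma xh_sqr S t : 1 < S -> xh S t ^ 2 = (1 + S) * cos t ^ 2.
Proof. intros HS. unfold xh. rewrite Rpow_mult_distr, sqrt1S_sqr; auto. Qed.

Lemma mh_xh S t : 1 < S -> 2 * mh S t ^ 2 = xh S t ^ 2 + S - 1.
Proof. intros HS. rewrite mh_sqr, xh_sqr by exact HS. unfold radicand_R. field. Qed.

Lemma yh_sqr S t : 1 < S -> yh S t ^ 2 = (1 + S - xh S t ^ 2) * mh S t ^ 2.
Proof.
  intros HS. rewrite xh_sqr by exact HS. unfold yh.
  replace ((- (sqrt (1 + S) * mh S t * sin t)) ^ 2) with
    (sqrt (1 + S) ^ 2 * (mh S t ^ 2 * sin t ^ 2)) by ring.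
  rewrite sqrt1S_sqr, cos2_sin2 by exact HS. ring.
Qed.

Lemma H_hat S t : 1 < S -> H (xh S t) (yh S t) = (S ^ 2 - 1) / 4.
Proof.
  intros HS. unfold H. rewrite yh_sqr by exact HS.
  replace (mh S t ^ 2) with ((xh S t ^ 2 + S - 1) / 2) by (rewrite <- mh_xh by exact HS; field).
  field.
Qed.

Lemma is_derive_xh S t : 1 < S -> is_derive (xh S) t (yh S t / mh S t).
Proof.
  intros HS. pose proof (mh_pos S t HS). unfold xh, yh. auto_derive; [exact I|]. field. lra.
Qed.

Lemma is_derive_mh S t : 1 < S -> is_derive (mh S) t (- ((1 + S) * (cos t * sin t)) / (2 * mh S t)).
Proof.
  intros HS. pose proof (mh_pos S t HS) as P. pose proof (radicand_R_pos S t HS) as Q.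
  unfold mh, radicand_R in *. auto_derive; [lra|].
  match goal with |- context [sqrt ?u] => set (q := sqrt u) in * end.
  match goal with |- _ = _ / (2 * sqrt ?u) => replace (sqrt u) with q in * by
    (unfold q; f_equal; ring) end.
  field. unfold Rdiv, Rminus in *. lra.
Qed.

Lemma is_derive_yh S t : 1 < S -> is_derive (yh S) t ((xh S t - xh S t ^ 3) / mh S t).
Proof.
  intros HS. pose proof (mh_pos S t HS) as P. pose proof (is_derive_mh S t HS) as D.
  unfold yh. auto_derive.
  - exists (- ((1 + S) * (cos t * sin t)) / (2 * mh S t)). exact D.
  - replace (Derive (fun x => mh S x) t) with (- ((1 + S) * (cos t * sin t)) / (2 * mh S t)).
    2: { symmetry. apply is_derive_unique. exact D. }
    pose proof (mh_sqr S t HS) as M. unfold radicand_R in M.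
    unfold xh. set (a := sqrt (1 + S)) in *.
    assert (A2 : a ^ 2 = 1 + S) by (apply sqrt1S_sqr, HS).
    set (m := mh S t) in *.
    apply Rmult_eq_reg_r with (2 * m); [|lra].
    transitivity (a * cos t * ((1 + S) * sin t ^ 2 - 2 * m ^ 2)); [field; lra|].
    transitivity (a * cos t * (2 - 2 * (a ^ 2 * cos t ^ 2))); [|field; lra].
    f_equal. rewrite M, A2, cos2_sin2. field.
Qed.

(** The angle, between [- PI] and [PI], of the point [(x ^ 2 - 1, sqrt 2 y)], which on the oval runs on the circle of radius [sqrt (1 + 4 H)]. *)
Definition phase (x y : R) : R := 2 * atan (sqrt 2 * y / (sqrt (1 + 4 * H x y) + x ^ 2 - 1)).

(** [phase] along the oval, with the denominator simplified by [mh_xh]. *)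
Definition phase_hat (S t : R) : R := 2 * atan (sqrt 2 * yh S t / (2 * mh S t ^ 2)).

Lemma phase_eq S t : 1 < S -> phase (xh S t) (yh S t) = phase_hat S t.
Proof.
  intros HS. unfold phase, phase_hat. rewrite H_hat by exact HS.
  replace (1 + 4 * ((S ^ 2 - 1) / 4)) with (S ^ 2) by field.
  rewrite sqrt_pow2 by lra. rewrite mh_xh by exact HS. do 3 f_equal. ring.
Qed.

Lemma sqrt2_sqr : sqrt 2 ^ 2 = 2.
Proof. simpl. rewrite Rmult_1_r. apply sqrt_sqrt. lra. Qed.

Lemma sqrt2_pos : 0 < sqrt 2.
Proof. apply sqrt_lt_R0. lra. Qed.

Lemma is_derive_phase_hat S t : 1 < S ->
  is_derive (phase_hat S) t (- sqrt 2 * xh S t / mh S t).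
Proof.
  intros HS. pose proof (mh_pos S t HS) as P. pose proof (is_derive_mh S t HS) as D.
  pose proof (is_derive_yh S t HS) as Dy.
  unfold phase_hat. auto_derive.
  - split; [exists ((xh S t - xh S t ^ 3) / mh S t); exact Dy|].
    split; [exists (- ((1 + S) * (cos t * sin t)) / (2 * mh S t)); exact D|].
    split; [|exact I]. assert (0 < mh S t * (mh S t * 1)) by (rewrite Rmult_1_r; nra). lra.
  - replace (Derive (fun x => mh S x) t) with (- ((1 + S) * (cos t * sin t)) / (2 * mh S t)).
    2: { symmetry. apply is_derive_unique. exact D. }
    replace (Derive (fun x => yh S x) t) with ((xh S t - xh S t ^ 3) / mh S t).
    2: { symmetry. apply is_derive_unique. exact Dy. }
    pose proof (yh_sqr S t HS) as Y. pose proof (mh_xh S t HS) as M.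
    assert (XY : (1 + S) * (cos t * sin t) * mh S t = - (xh S t * yh S t)).
    { unfold xh, yh. rewrite <- (sqrt1S_sqr S HS) at 1. ring. }
    assert (XY' : (1 + S) * (cos t * sin t) = - (xh S t * yh S t) / mh S t)
      by (rewrite <- XY; field; lra).
    rewrite XY'. clear XY XY' D Dy.
    set (x := xh S t) in *. set (y := yh S t) in *. set (m := mh S t) in *.
    set (r := sqrt 2). pose proof sqrt2_sqr as R2. fold r in R2.
    pose proof sqrt2_pos as Rp. fold r in Rp.
    assert (N : 2 * m ^ 4 + y ^ 2 = 2 * S * m ^ 2).
    { rewrite Y. replace (2 * m ^ 4) with ((2 * m ^ 2) * m ^ 2) by ring. rewrite M. ring. }
    assert (U : 1 + (r * y / (2 * m ^ 2)) ^ 2 = S / m ^ 2).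
    { replace (1 + (r * y / (2 * m ^ 2)) ^ 2) with ((4 * m ^ 4 + r ^ 2 * y ^ 2) / (4 * m ^ 4)) by (field; lra).
      rewrite R2. replace (4 * m ^ 4 + 2 * y ^ 2) with (2 * (2 * m ^ 4 + y ^ 2)) by ring.
      rewrite N. field. lra. }
    match goal with |- 2 * (?A * / ?B) = _ =>
      change B with (1 + (r * y / (2 * m ^ 2)) ^ 2); rewrite U;
      replace A with (- r * x * S / (2 * m ^ 3)) end.
    + field. split; lra.
    + apply Rmult_eq_reg_r with (2 * m ^ 5); [|assert (0 < m ^ 5) by (apply pow_lt; lra); lra].
      transitivity (- r * x * S * m ^ 2); [field; lra|].
      transitivity (r * x * ((1 - x ^ 2) * m ^ 2 - y ^ 2)); [|field; lra].
      rewrite Y. ring.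
Qed.

(** * Averages over an oval *)

(** The integral over one period of the flow: [dt = d theta / mh]. *)
Definition avg (S : R) (Om : R -> R) : R := RInt (fun t => Om t / mh S t) turn0 turn1.

Definition mu (S : R) (i j : nat) : R := avg S (fun t => xh S t ^ i * yh S t ^ j).

Lemma continuous_xh S t : 1 < S -> continuous (xh S) t.
Proof.
  intros HS. apply derivable_continuous_R.
  eexists. apply is_derive_xh, HS.
Qed.
Lemma continuous_yh S t : 1 < S -> continuous (yh S) t.
Proof.
  intros HS. apply derivable_continuous_R.
  eexists. apply is_derive_yh, HS.
Qed.
Lemma continuous_mh S t : 1 < S -> continuous (mh S) t.
Proof.
  intros HS. apply derivable_continuous_R.
  eexists. apply is_derive_mh, HS.
Qed.
Lemma continuous_phase_hat S t : 1 < S -> continuous (phase_hat S) t.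
Proof.
  intros HS. apply derivable_continuous_R.
  eexists. apply is_derive_phase_hat, HS.
Qed.

Lemma continuous_pow_R (f : R -> R) n t : continuous f t -> continuous (fun u => f u ^ n) t.
Proof.
  intros Hf. induction n as [|n IH]; [apply continuous_const|].
  apply (continuous_mult f (fun u => f u ^ n)); assumption.
Qed.

Lemma continuous_div_mh S (Om : R -> R) t : 1 < S -> continuous Om t ->
  continuous (fun u => Om u / mh S u) t.
Proof.
  intros HS Ho. apply (continuous_mult Om (fun u => / mh S u)); [exact Ho|].
  apply (continuous_comp (mh S) Rinv); [apply continuous_mh, HS|].
  apply continuous_Rinv. pose proof (mh_pos S t HS). lra.
Qed.

Lemma continuous_monomial S i j t : 1 < S -> continuous (fun u => xh S u ^ i * yh S u ^ j) t.
Proof.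
  intros HS. apply (continuous_mult (fun u => xh S u ^ i) (fun u => yh S u ^ j));
  apply continuous_pow_R; [apply continuous_xh, HS|apply continuous_yh, HS].
Qed.

Lemma avg_lin2 S Om Om' p q : 1 < S ->
  (forall t, continuous Om t) -> (forall t, continuous Om' t) ->
  avg S (fun t => p * Om t + q * Om' t) = p * avg S Om + q * avg S Om'.
Proof.
  intros HS H1 H2. unfold avg.
  rewrite <- RInt_lin2; [|intros; apply continuous_div_mh; auto..].
  apply RInt_ext. intros t _. as_R. unfold Rdiv. ring.
Qed.

Lemma avg_ext S Om Om' : (forall t, Om t = Om' t) -> avg S Om = avg S Om'.
Proof. intros E. apply RInt_ext. intros t _. rewrite E. reflexivity. Qed.

(** The integral of a total derivative over a closed oval. *)
Lemma avg_total S (W w : R -> R) : 1 < S ->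
  (forall t, is_derive W t (w t / mh S t)) -> (forall t, continuous w t) ->
  W turn0 = W turn1 -> avg S w = 0.
Proof.
  intros HS Hd Hc E. unfold avg.
  rewrite (is_RInt_unique _ _ _ _ (is_RInt_derive (V := R_CompleteNormedModule) W
    (fun t => w t / mh S t) turn0 turn1 (fun t _ => Hd t)
    (fun t _ => continuous_div_mh S w t HS (Hc t)))).
  rewrite E. unfold minus, plus, opp; simpl. ring.
Qed.

Lemma cos_turn0 : cos turn0 = 0.
Proof. unfold turn0. rewrite cos_neg. apply cos_PI2. Qed.
Lemma cos_turn1 : cos turn1 = 0.
Proof. unfold turn1. apply cos_3PI2. Qed.
Lemma sin_turn0 : sin turn0 = -1.
Proof. unfold turn0. rewrite sin_neg, sin_PI2. reflexivity. Qed.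
Lemma sin_turn1 : sin turn1 = -1.
Proof. unfold turn1. apply sin_3PI2. Qed.

Lemma xh_turn S : xh S turn0 = xh S turn1.
Proof. unfold xh. rewrite cos_turn0, cos_turn1. reflexivity. Qed.
Lemma mh_turn S : mh S turn0 = mh S turn1.
Proof. unfold mh, radicand_R. rewrite cos_turn0, cos_turn1. reflexivity. Qed.
Lemma yh_turn S : yh S turn0 = yh S turn1.
Proof. unfold yh. rewrite mh_turn, sin_turn0, sin_turn1. reflexivity. Qed.
Lemma phase_hat_turn S : phase_hat S turn0 = phase_hat S turn1.
Proof. unfold phase_hat. rewrite yh_turn, mh_turn. reflexivity. Qed.

Lemma is_derive_pow_S (f : R -> R) n t l : is_derive f t l ->
  is_derive (fun u => f u ^ Datatypes.S n) t (INR (Datatypes.S n) * l * f t ^ n).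
Proof. intros Hf. apply (is_derive_pow f (Datatypes.S n) t l Hf). Qed.

(** The average of the derivative of [x ^ (i + 1) y ^ (j + 1)] along the flow. *)
Lemma moment_exact S i j : 1 < S ->
  INR (i + 1) * mu S i (j + 2) + INR (j + 1) * (mu S (i + 2) j - mu S (i + 4) j) = 0.
Proof.
  intros HS.
  assert (Z : avg S (fun t => INR (i + 1) * (xh S t ^ i * yh S t ^ (j + 2)) +
     INR (j + 1) * (1 * (xh S t ^ (i + 2) * yh S t ^ j) + (-1) * (xh S t ^ (i + 4) * yh S t ^ j))) = 0).
  { apply (avg_total S (fun t => xh S t ^ (i + 1) * yh S t ^ (j + 1))); [exact HS| | |].
    - intros t. pose proof (mh_pos S t HS) as P.
      replace (i + 1)%nat with (Datatypes.S i) by lia. replace (j + 1)%nat with (Datatypes.S j) by lia.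
      pose proof (is_derive_pow_S _ i t _ (is_derive_xh S t HS)) as DX.
      pose proof (is_derive_pow_S _ j t _ (is_derive_yh S t HS)) as DY.
      pose proof (is_derive_mult _ _ t _ _ DX DY Rmult_comm) as DD.
      eapply (is_derive_ext_loc _ _ _ _ (filter_forall _ (fun u => eq_refl))) in DD.
      match type of DD with is_derive _ _ ?l => match goal with |- is_derive _ _ ?l' =>
        replace l' with l; [exact DD|] end end.
      change (INR (Datatypes.S i) * (yh S t / mh S t) * xh S t ^ i * yh S t ^ Datatypes.S j +
        xh S t ^ Datatypes.S i * (INR (Datatypes.S j) * ((xh S t - xh S t ^ 3) / mh S t) * yh S t ^ j) =
        (INR (Datatypes.S i) * (xh S t ^ i * yh S t ^ (j + 2)) +
        INR (Datatypes.S j) * (1 * (xh S t ^ (i + 2) * yh S t ^ j) + -1 * (xh S t ^ (i + 4) * yh S t ^ j))) / mh S t).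
      rewrite !pow_add, <- !tech_pow_Rmult. field. lra.
    - intros t.
      apply (continuous_plus (fun t => INR (i + 1) * (xh S t ^ i * yh S t ^ (j + 2)))
        (fun t => INR (j + 1) * (1 * (xh S t ^ (i + 2) * yh S t ^ j) + (-1) * (xh S t ^ (i + 4) * yh S t ^ j)))).
      + apply (continuous_scal_R (INR (i + 1))
          (fun t => xh S t ^ i * yh S t ^ (j + 2))). apply continuous_monomial, HS.
      + apply (continuous_scal_R (INR (j + 1))
          (fun t => 1 * (xh S t ^ (i + 2) * yh S t ^ j) + (-1) * (xh S t ^ (i + 4) * yh S t ^ j))).
        apply (continuous_plus (fun t => 1 * (xh S t ^ (i + 2) * yh S t ^ j))
          (fun t => (-1) * (xh S t ^ (i + 4) * yh S t ^ j)));
        [apply (continuous_scal_R 1 (fun t => xh S t ^ (i + 2) * yh S t ^ j))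
        |apply (continuous_scal_R (-1) (fun t => xh S t ^ (i + 4) * yh S t ^ j))];
        apply continuous_monomial, HS.
    - rewrite xh_turn, yh_turn. reflexivity. }
  rewrite avg_lin2 in Z; [|exact HS|intros; apply continuous_monomial, HS|].
  2: { intros t. apply (continuous_plus (fun t => 1 * (xh S t ^ (i + 2) * yh S t ^ j))
          (fun t => (-1) * (xh S t ^ (i + 4) * yh S t ^ j)));
        [apply (continuous_scal_R 1 (fun t => xh S t ^ (i + 2) * yh S t ^ j))
        |apply (continuous_scal_R (-1) (fun t => xh S t ^ (i + 4) * yh S t ^ j))];
        apply continuous_monomial, HS. }
  rewrite avg_lin2 in Z by (exact HS || (intros; apply continuous_monomial, HS)).
  unfold mu. rewrite <- Z at 1. ring.
Qed.

(** The relation [y ^ 2 = 2 H + x ^ 2 - x ^ 4 / 2]. *)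
Lemma moment_energy S i j : 1 < S ->
  mu S i (j + 2) = (S ^ 2 - 1) / 2 * mu S i j + mu S (i + 2) j - mu S (i + 4) j / 2.
Proof.
  intros HS. unfold mu.
  rewrite (avg_ext S (fun t => xh S t ^ i * yh S t ^ (j + 2))
    (fun t => 1 * ((S ^ 2 - 1) / 2 * (xh S t ^ i * yh S t ^ j) + 1 * (xh S t ^ (i + 2) * yh S t ^ j))
      + (- / 2) * (xh S t ^ (i + 4) * yh S t ^ j))).
  - rewrite avg_lin2; [|exact HS| |intros; apply continuous_monomial, HS].
    2: { intros t. apply (continuous_plus (fun t => (S ^ 2 - 1) / 2 * (xh S t ^ i * yh S t ^ j))
           (fun t => 1 * (xh S t ^ (i + 2) * yh S t ^ j)));
        [apply (continuous_scal_R ((S ^ 2 - 1) / 2) (fun t => xh S t ^ i * yh S t ^ j))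
        |apply (continuous_scal_R 1 (fun t => xh S t ^ (i + 2) * yh S t ^ j))];
        apply continuous_monomial, HS. }
    rewrite avg_lin2 by (exact HS || (intros; apply continuous_monomial, HS)). field.
  - intros t. pose proof (H_hat S t HS) as E. unfold H in E.
    rewrite !pow_add.
    replace (yh S t ^ 2) with ((S ^ 2 - 1) / 2 + xh S t ^ 2 - xh S t ^ 4 / 2) by lra. field.
Qed.

(** * Symmetries *)

Lemma RInt_antisymmetric_reflection (f : R -> R) :
  (forall t, continuous f t) -> (forall t, f (PI - t) = - f t) -> RInt f turn0 turn1 = 0.
Proof.
  intros Hc Hf.
  assert (E : RInt f turn1 turn0 = RInt f turn0 turn1).
  { pose proof (RInt_comp_lin (V := R_CompleteNormedModule) f (-1) PI turn0 turn1) as K.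
    replace (-1 * turn0 + PI) with turn1 in K by (unfold turn0, turn1; field).
    replace (-1 * turn1 + PI) with turn0 in K by (unfold turn0, turn1; field).
    rewrite <- K by (apply ex_RInt_all_continuous, Hc).
    apply RInt_ext. intros t _. as_R. change (-1 * f (-1 * t + PI) = f t).
    replace (-1 * t + PI) with (PI - t) by ring. rewrite Hf. ring. }
  pose proof (opp_RInt_swap (V := R_CompleteNormedModule) f turn0 turn1
    (ex_RInt_all_continuous f _ _ Hc)) as Sw.
  change (- RInt f turn0 turn1 = RInt f turn1 turn0) in Sw. lra.
Qed.

Lemma RInt_antisymmetric_shift (f : R -> R) :
  (forall t, continuous f t) -> (forall t, f (t + PI) = - f t) -> RInt f turn0 turn1 = 0.
Proof.
  intros Hc Hf.
  rewrite <- (RInt_Chasles (V := R_CompleteNormedModule) f turn0 (PI / 2) turn1)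
    by (apply ex_RInt_all_continuous, Hc).
  pose proof (RInt_comp_lin (V := R_CompleteNormedModule) f 1 PI turn0 (PI / 2)) as K.
  replace (1 * turn0 + PI) with (PI / 2) in K by (unfold turn0; field).
  replace (1 * (PI / 2) + PI) with turn1 in K by (unfold turn1; field).
  rewrite <- K by (apply ex_RInt_all_continuous, Hc).
  rewrite (RInt_ext (fun y => scal 1 (f (1 * y + PI))) (fun y => opp (f y))).
  - rewrite (RInt_opp (V := R_CompleteNormedModule)) by (apply ex_RInt_all_continuous, Hc).
    apply (plus_opp_r (G := R_AbelianGroup)).
  - intros t _. change (1 * f (1 * t + PI) = - f t).
    replace (1 * t + PI) with (t + PI) by ring. rewrite Hf. ring.
Qed.

Lemma mh_reflection S t : mh S (PI - t) = mh S t.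
Proof.
  unfold mh, radicand_R. rewrite Rtrigo_facts.cos_pi_minus.
  replace ((- cos t) ^ 2) with (cos t ^ 2) by ring. reflexivity.
Qed.
Lemma xh_reflection S t : xh S (PI - t) = - xh S t.
Proof. unfold xh. rewrite Rtrigo_facts.cos_pi_minus. ring. Qed.
Lemma yh_reflection S t : yh S (PI - t) = yh S t.
Proof. unfold yh. rewrite mh_reflection, sin_PI_x. reflexivity. Qed.
Lemma phase_reflection S t : phase_hat S (PI - t) = phase_hat S t.
Proof. unfold phase_hat. rewrite mh_reflection, yh_reflection. reflexivity. Qed.
Lemma mh_shift S t : mh S (t + PI) = mh S t.
Proof.
  unfold mh, radicand_R. rewrite neg_cos.
  replace ((- cos t) ^ 2) with (cos t ^ 2) by ring. reflexivity.
Qed.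
Lemma xh_shift S t : xh S (t + PI) = - xh S t.
Proof. unfold xh. rewrite neg_cos. ring. Qed.
Lemma yh_shift S t : yh S (t + PI) = - yh S t.
Proof. unfold yh. rewrite mh_shift, neg_sin. ring. Qed.
Lemma phase_shift S t : phase_hat S (t + PI) = - phase_hat S t.
Proof.
  unfold phase_hat. rewrite mh_shift, yh_shift.
  replace (sqrt 2 * - yh S t / (2 * mh S t ^ 2)) with (- (sqrt 2 * yh S t / (2 * mh S t ^ 2))).
  - rewrite atan_opp. ring.
  - unfold Rdiv. ring.
Qed.

Lemma pow_opp_odd x n : Nat.Odd n -> (- x) ^ n = - x ^ n.
Proof.
  intros [k ->]. rewrite Nat.add_1_r. rewrite <- !tech_pow_Rmult, !pow_mult.
  replace ((- x) ^ 2) with (x ^ 2) by ring. ring.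
Qed.
Lemma pow_opp_even x n : Nat.Even n -> (- x) ^ n = x ^ n.
Proof.
  intros [k ->]. rewrite !pow_mult. replace ((- x) ^ 2) with (x ^ 2) by ring. reflexivity.
Qed.

(** The ovals are symmetric in both axes. *)
Lemma mu_odd S i j : 1 < S -> Nat.Odd i \/ Nat.Odd j -> mu S i j = 0.
Proof.
  intros HS Hij. unfold mu, avg.
  assert (C : forall t, continuous (fun t => xh S t ^ i * yh S t ^ j / mh S t) t).
  { intros t. apply continuous_div_mh; [exact HS|apply continuous_monomial, HS]. }
  destruct (Nat.Even_or_Odd i) as [Ei|Oi].
  - destruct Hij as [Oi|Oj]; [exfalso; apply (Nat.Even_Odd_False i Ei Oi)|].
    apply RInt_antisymmetric_shift; [exact C|]. intros t.
    rewrite xh_shift, yh_shift, mh_shift, pow_opp_even, pow_opp_odd by assumption.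
    unfold Rdiv. ring.
  - apply RInt_antisymmetric_reflection; [exact C|]. intros t.
    rewrite xh_reflection, yh_reflection, mh_reflection, pow_opp_odd by assumption.
    unfold Rdiv. ring.
Qed.

(** Moments weighted by the phase; they enter because [x y dx] is not exact on the ovals. *)
Definition nu (S : R) (i j : nat) : R := avg S (fun t => phase_hat S t * (xh S t ^ i * yh S t ^ j)).

Lemma continuous_phase_monomial S i j t : 1 < S ->
  continuous (fun t => phase_hat S t * (xh S t ^ i * yh S t ^ j)) t.
Proof.
  intros HS. apply (continuous_mult (phase_hat S) (fun u => xh S u ^ i * yh S u ^ j));
  [apply continuous_phase_hat, HS|apply continuous_monomial, HS].
Qed.

(** The phase is even in [x] and odd in [y]. *)
Lemma nu_odd S i j : 1 < S -> Nat.Odd i \/ Nat.Even j -> nu S i j = 0.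
Proof.
  intros HS Hij. unfold nu, avg.
  assert (C : forall t, continuous (fun t => phase_hat S t * (xh S t ^ i * yh S t ^ j) / mh S t) t).
  { intros t. apply continuous_div_mh; [exact HS|apply continuous_phase_monomial, HS]. }
  destruct (Nat.Even_or_Odd i) as [Ei|Oi].
  - destruct Hij as [Oi|Oj]; [exfalso; apply (Nat.Even_Odd_False i Ei Oi)|].
    apply RInt_antisymmetric_shift; [exact C|]. intros t.
    rewrite phase_shift, xh_shift, yh_shift, mh_shift, !pow_opp_even by assumption.
    unfold Rdiv. ring.
  - apply RInt_antisymmetric_reflection; [exact C|]. intros t.
    rewrite phase_reflection, xh_reflection, yh_reflection, mh_reflection, pow_opp_odd by assumption.
    unfold Rdiv. ring.
Qed.

(** The average of the derivative of [phase * x ^ (k + 1)], as the phase turns at the rate [- sqrt 2 x]. *)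
Lemma nu_exact S k : 1 < S -> INR (k + 1) * nu S k 1 = sqrt 2 * mu S (k + 2) 0.
Proof.
  intros HS.
  assert (Z : avg S (fun t => INR (k + 1) * (phase_hat S t * (xh S t ^ k * yh S t ^ 1))
     + (- sqrt 2) * (xh S t ^ (k + 2) * yh S t ^ 0)) = 0).
  { apply (avg_total S (fun t => phase_hat S t * xh S t ^ (k + 1))); [exact HS| | |].
    - intros t. pose proof (mh_pos S t HS) as P.
      replace (k + 1)%nat with (Datatypes.S k) by lia.
      pose proof (is_derive_pow_S _ k t _ (is_derive_xh S t HS)) as DX.
      pose proof (is_derive_mult _ _ t _ _ (is_derive_phase_hat S t HS) DX Rmult_comm) as DD.
      match type of DD with is_derive _ _ ?l => match goal with |- is_derive _ _ ?l' =>
        replace l' with l; [exact DD|] end end.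
      change (- sqrt 2 * xh S t / mh S t * xh S t ^ Datatypes.S k +
        phase_hat S t * (INR (Datatypes.S k) * (yh S t / mh S t) * xh S t ^ k) =
        (INR (Datatypes.S k) * (phase_hat S t * (xh S t ^ k * yh S t ^ 1))
         + - sqrt 2 * (xh S t ^ (k + 2) * yh S t ^ 0)) / mh S t).
      rewrite !pow_add, <- !tech_pow_Rmult. field. lra.
    - intros t.
      apply (continuous_plus (fun t => INR (k + 1) * (phase_hat S t * (xh S t ^ k * yh S t ^ 1)))
        (fun t => (- sqrt 2) * (xh S t ^ (k + 2) * yh S t ^ 0))).
      + apply (continuous_scal_R (INR (k + 1))
          (fun t => phase_hat S t * (xh S t ^ k * yh S t ^ 1))). apply continuous_phase_monomial, HS.
      + apply (continuous_scal_R (- sqrt 2)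
          (fun t => xh S t ^ (k + 2) * yh S t ^ 0)). apply continuous_monomial, HS.
    - rewrite xh_turn, phase_hat_turn. reflexivity. }
  rewrite avg_lin2 in Z; [|exact HS|intros; apply continuous_phase_monomial, HS|intros; apply continuous_monomial, HS].
  unfold nu, mu. lra.
Qed.

Lemma nu_energy S i j : 1 < S ->
  nu S i (j + 2) = (S ^ 2 - 1) / 2 * nu S i j + nu S (i + 2) j - nu S (i + 4) j / 2.
Proof.
  intros HS. unfold nu.
  rewrite (avg_ext S (fun t => phase_hat S t * (xh S t ^ i * yh S t ^ (j + 2)))
    (fun t => 1 * ((S ^ 2 - 1) / 2 * (phase_hat S t * (xh S t ^ i * yh S t ^ j))
       + 1 * (phase_hat S t * (xh S t ^ (i + 2) * yh S t ^ j)))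
      + (- / 2) * (phase_hat S t * (xh S t ^ (i + 4) * yh S t ^ j)))).
  - rewrite avg_lin2; [|exact HS| |intros; apply continuous_phase_monomial, HS].
    2: { intros t. apply (continuous_plus (fun t => (S ^ 2 - 1) / 2 * (phase_hat S t * (xh S t ^ i * yh S t ^ j)))
           (fun t => 1 * (phase_hat S t * (xh S t ^ (i + 2) * yh S t ^ j))));
        [apply (continuous_scal_R ((S ^ 2 - 1) / 2)
           (fun t => phase_hat S t * (xh S t ^ i * yh S t ^ j)))
        |apply (continuous_scal_R 1
           (fun t => phase_hat S t * (xh S t ^ (i + 2) * yh S t ^ j)))];
        apply continuous_phase_monomial, HS. }
    rewrite avg_lin2 by (exact HS || (intros; apply continuous_phase_monomial, HS)). field.
  - intros t. pose proof (H_hat S t HS) as E. unfold H in E.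
    rewrite !pow_add.
    replace (yh S t ^ 2) with ((S ^ 2 - 1) / 2 + xh S t ^ 2 - xh S t ^ 4 / 2) by lra. field.
Qed.

(** * The module of period integrals *)

Definition energyS (h : R) : R := sqrt (1 + 4 * h).

Lemma energyS_sqr h : 0 < h -> energyS h ^ 2 = 1 + 4 * h.
Proof. intros Hh. unfold energyS. simpl. rewrite Rmult_1_r. apply sqrt_sqrt. lra. Qed.

Lemma energyS_gt1 h : 0 < h -> 1 < energyS h.
Proof. apply sqrt_energy_gt1. Qed.

Lemma mh_sqrt S t : mh S t = sqrt (radicand_R S t) / sqrt 2.
Proof. unfold mh. apply sqrt_div_alt. lra. Qed.

Lemma continuous_sqrt_radicand S t : 1 < S -> continuous (fun u => sqrt (radicand_R S u)) t.
Proof.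
  intros HS. apply derivable_continuous_R.
  pose proof (radicand_R_pos S t HS) as P. unfold radicand_R in *. auto_derive. lra.
Qed.

Lemma mu20_Nper S : 1 < S -> mu S 2 0 = sqrt 2 * ((1 + S) * Nper_R S).
Proof.
  intros HS. unfold mu, avg, Nper_R. rewrite <- Rmult_assoc.
  rewrite <- RInt_scal_R.
  - apply RInt_ext. intros t _. as_R. rewrite xh_sqr, mh_sqrt by exact HS.
    pose proof (sqrt_lt_R0 _ (radicand_R_pos S t HS)). pose proof sqrt2_pos.
    simpl. field. split; lra.
  - intros t. apply (continuous_mult (fun u => cos u ^ 2) (fun u => / sqrt (radicand_R S u))).
    + apply continuous_cos2.
    + apply (continuous_comp (fun u => sqrt (radicand_R S u)) Rinv);
      [apply continuous_sqrt_radicand, HS|].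
      apply continuous_Rinv. pose proof (sqrt_lt_R0 _ (radicand_R_pos S t HS)). lra.
Qed.

Lemma mu02_Dper S : 1 < S -> mu S 0 2 = / sqrt 2 * ((1 + S) * Dper_R S).
Proof.
  intros HS. unfold mu, avg, Dper_R. rewrite <- Rmult_assoc.
  rewrite <- RInt_scal_R.
  - apply RInt_ext. intros t _. as_R. pose proof (mh_pos S t HS) as P.
    replace (xh S t ^ 0 * yh S t ^ 2 / mh S t) with ((1 + S) * (sin t ^ 2 * mh S t)).
    + rewrite mh_sqrt. pose proof sqrt2_pos. field. lra.
    + rewrite yh_sqr, xh_sqr, cos2_sin2 by exact HS. field. lra.
  - intros t. apply (continuous_mult (fun u => sin u ^ 2) (fun u => sqrt (radicand_R S u))).
    + apply continuous_sin2.
    + apply continuous_sqrt_radicand, HS.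
Qed.

(** The coefficients of [mu02] and [mu20] have degrees one and two. This asymmetry is what the contour argument exploits: five real parameters and four zeros. *)
Definition in_period_module (phi : R -> R) : Prop :=
  exists p0 p1 v0 v1 v2, forall h, 0 < h ->
    phi h = (p0 + p1 * h) * mu (energyS h) 0 2 + (v0 + v1 * h + v2 * h ^ 2) * mu (energyS h) 2 0.

Lemma in_period_module_form phi : in_period_module phi ->
  exists p0 p1 v0 v1 v2, forall h, 0 < h -> phi h = period_form p0 p1 v0 v1 v2 h.
Proof.
  intros (p0 & p1 & v0 & v1 & v2 & H).
  exists (/ sqrt 2 * p0), (/ sqrt 2 * p1), (sqrt 2 * v0), (sqrt 2 * v1), (sqrt 2 * v2).
  intros h Hh. rewrite H by exact Hh.
  rewrite mu20_Nper, mu02_Dper by (apply energyS_gt1, Hh).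
  unfold period_form. fold (energyS h). ring.
Qed.

Lemma in_module_ext phi chi : (forall h, 0 < h -> phi h = chi h) ->
  in_period_module phi -> in_period_module chi.
Proof.
  intros E (p0 & p1 & v0 & v1 & v2 & H). exists p0, p1, v0, v1, v2.
  intros h Hh. rewrite <- E by exact Hh. apply H, Hh.
Qed.

Lemma in_module_0 : in_period_module (fun _ => 0).
Proof. exists 0, 0, 0, 0, 0. intros. ring. Qed.

Lemma in_module_plus phi chi : in_period_module phi -> in_period_module chi ->
  in_period_module (fun h => phi h + chi h).
Proof.
  intros (p0 & p1 & v0 & v1 & v2 & H) (q0 & q1 & w0 & w1 & w2 & H').
  exists (p0 + q0), (p1 + q1), (v0 + w0), (v1 + w1), (v2 + w2).
  intros h Hh. rewrite H, H' by exact Hh. ring.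
Qed.

Lemma in_module_scal k phi : in_period_module phi -> in_period_module (fun h => k * phi h).
Proof.
  intros (p0 & p1 & v0 & v1 & v2 & H).
  exists (k * p0), (k * p1), (k * v0), (k * v1), (k * v2).
  intros h Hh. rewrite H by exact Hh. ring.
Qed.

Section Moments.
Variable h : R.
Hypothesis Hh : 0 < h.
Let S := energyS h.
Let HS : 1 < S := energyS_gt1 h Hh.

Lemma two_h : (S ^ 2 - 1) / 2 = 2 * h.
Proof. unfold S. rewrite energyS_sqr by exact Hh. field. Qed.

Lemma mu40_eq : mu S 4 0 = mu S 2 0 + mu S 0 2.
Proof. pose proof (moment_exact S 0 0 HS) as E. simpl in E. lra. Qed.
Lemma mu60_eq : mu S 6 0 = mu S 4 0 + 3 * mu S 2 2.
Proof. pose proof (moment_exact S 2 0 HS) as E. simpl in E. lra. Qed.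
Lemma mu22_eq : mu S 2 2 = (mu S 0 2 + (1 + 4 * h) * mu S 2 0) / 5.
Proof.
  pose proof (moment_energy S 2 0 HS) as E. rewrite two_h in E. simpl in E.
  rewrite mu60_eq, mu40_eq in E. lra.
Qed.
Lemma mu04_exact : mu S 0 4 = 3 * mu S 4 2 - 3 * mu S 2 2.
Proof. pose proof (moment_exact S 0 2 HS) as E. simpl in E. lra. Qed.
Lemma mu42_eq : mu S 4 2 = (4 * h * mu S 0 2 + 8 * mu S 2 2) / 7.
Proof.
  pose proof (moment_energy S 0 2 HS) as E. rewrite two_h in E. simpl in E.
  rewrite mu04_exact in E. lra.
Qed.
Lemma mu04_eq : mu S 0 4 = 12 / 7 * h * mu S 0 2 + 3 / 7 * mu S 2 2.
Proof. rewrite mu04_exact, mu42_eq. lra. Qed.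
Lemma mu80_eq : mu S 8 0 = mu S 6 0 + 5 * mu S 4 2.
Proof. pose proof (moment_exact S 4 0 HS) as E. simpl in E. lra. Qed.
Lemma mu24_exact : mu S 2 4 = mu S 6 2 - mu S 4 2.
Proof. pose proof (moment_exact S 2 2 HS) as E. simpl in E. lra. Qed.
Lemma mu62_eq : mu S 6 2 = (4 * h * mu S 2 2 + 4 * mu S 4 2) / 3.
Proof.
  pose proof (moment_energy S 2 2 HS) as E. rewrite two_h in E. simpl in E.
  rewrite mu24_exact in E. lra.
Qed.
Lemma nu01_eq : nu S 0 1 = sqrt 2 * mu S 2 0.
Proof. pose proof (nu_exact S 0 HS) as E. simpl in E. lra. Qed.
Lemma nu21_eq : nu S 2 1 = sqrt 2 / 3 * mu S 4 0.
Proof. pose proof (nu_exact S 2 HS) as E. simpl in E. lra. Qed.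
Lemma nu41_eq : nu S 4 1 = sqrt 2 / 5 * mu S 6 0.
Proof. pose proof (nu_exact S 4 HS) as E. simpl in E. lra. Qed.
Lemma nu03_eq : nu S 0 3 = 2 * h * nu S 0 1 + nu S 2 1 - nu S 4 1 / 2.
Proof. pose proof (nu_energy S 0 1 HS) as E. rewrite two_h in E. exact E. Qed.
End Moments.

Ltac module_witness p0 p1 v0 v1 v2 :=
  exists p0, p1, v0, v1, v2; intros h Hh.

Lemma in_module_mu20 : in_period_module (fun h => mu (energyS h) 2 0).
Proof. module_witness 0 0 1 0 0. ring. Qed.
Lemma in_module_mu02 : in_period_module (fun h => mu (energyS h) 0 2).
Proof. module_witness 1 0 0 0 0. ring. Qed.
Lemma in_module_mu40 : in_period_module (fun h => mu (energyS h) 4 0).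
Proof. module_witness 1 0 1 0 0. rewrite mu40_eq by exact Hh. ring. Qed.
Lemma in_module_mu22 : in_period_module (fun h => mu (energyS h) 2 2).
Proof. module_witness (1/5) 0 (1/5) (4/5) 0. rewrite mu22_eq by exact Hh. field. Qed.
Lemma in_module_mu60 : in_period_module (fun h => mu (energyS h) 6 0).
Proof.
  module_witness (8/5) 0 (8/5) (12/5) 0. rewrite mu60_eq, mu40_eq, mu22_eq by exact Hh. field.
Qed.
Lemma in_module_mu42 : in_period_module (fun h => mu (energyS h) 4 2).
Proof.
  module_witness (8/35) (4/7) (8/35) (32/35) 0. rewrite mu42_eq, mu22_eq by exact Hh. field.
Qed.
Lemma in_module_mu80 : in_period_module (fun h => mu (energyS h) 8 0).
Proof.
  apply (in_module_ext (fun h => mu (energyS h) 6 0 + 5 * mu (energyS h) 4 2)).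
  - intros h Hh. rewrite mu80_eq by exact Hh. reflexivity.
  - apply in_module_plus; [apply in_module_mu60|apply in_module_scal, in_module_mu42].
Qed.
Lemma in_module_mu04 : in_period_module (fun h => mu (energyS h) 0 4).
Proof.
  apply (in_module_ext (fun h => 3 * mu (energyS h) 4 2 + -3 * mu (energyS h) 2 2)).
  - intros h Hh. rewrite (mu04_exact h Hh). ring.
  - apply in_module_plus; apply in_module_scal; [apply in_module_mu42|apply in_module_mu22].
Qed.
Lemma in_module_h_mu22 : in_period_module (fun h => h * mu (energyS h) 2 2).
Proof. module_witness 0 (1/5) 0 (1/5) (4/5). rewrite mu22_eq by exact Hh. field. Qed.
Lemma in_module_mu62 : in_period_module (fun h => mu (energyS h) 6 2).
Proof.
  apply (in_module_ext (fun h => 4 / 3 * (h * mu (energyS h) 2 2) + 4 / 3 * mu (energyS h) 4 2)).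
  - intros h Hh. rewrite mu62_eq by exact Hh. field.
  - apply in_module_plus; apply in_module_scal; [apply in_module_h_mu22|apply in_module_mu42].
Qed.
Lemma in_module_mu24 : in_period_module (fun h => mu (energyS h) 2 4).
Proof.
  apply (in_module_ext (fun h => mu (energyS h) 6 2 + -1 * mu (energyS h) 4 2)).
  - intros h Hh. rewrite (mu24_exact h Hh). ring.
  - apply in_module_plus; [apply in_module_mu62|apply in_module_scal, in_module_mu42].
Qed.
Lemma in_module_nu01 : in_period_module (fun h => nu (energyS h) 0 1).
Proof.
  apply (in_module_ext (fun h => sqrt 2 * mu (energyS h) 2 0)).
  - intros h Hh. rewrite nu01_eq by exact Hh. reflexivity.
  - apply in_module_scal, in_module_mu20.
Qed.
Lemma in_module_nu21 : in_period_module (fun h => nu (energyS h) 2 1).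
Proof.
  apply (in_module_ext (fun h => sqrt 2 / 3 * mu (energyS h) 4 0)).
  - intros h Hh. rewrite nu21_eq by exact Hh. reflexivity.
  - apply in_module_scal, in_module_mu40.
Qed.
Lemma in_module_nu41 : in_period_module (fun h => nu (energyS h) 4 1).
Proof.
  apply (in_module_ext (fun h => sqrt 2 / 5 * mu (energyS h) 6 0)).
  - intros h Hh. rewrite nu41_eq by exact Hh. reflexivity.
  - apply in_module_scal, in_module_mu60.
Qed.
Lemma in_module_nu03 : in_period_module (fun h => nu (energyS h) 0 3).
Proof.
  apply (in_module_ext (fun h => 2 * sqrt 2 * (h * mu (energyS h) 2 0)
    + (nu (energyS h) 2 1 + - / 2 * nu (energyS h) 4 1))).
  - intros h Hh. rewrite nu03_eq, nu01_eq by exact Hh. field.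
  - apply in_module_plus; [apply in_module_scal|apply in_module_plus].
    + module_witness 0 0 0 1 0. ring.
    + apply in_module_nu21.
    + apply in_module_scal, in_module_nu41.
Qed.

Lemma in_module_mu_odd i j : Nat.Odd i \/ Nat.Odd j ->
  in_period_module (fun h => mu (energyS h) i j).
Proof.
  intros H. apply (in_module_ext (fun _ => 0)); [|apply in_module_0].
  intros h Hh. rewrite mu_odd; [reflexivity|apply energyS_gt1, Hh|exact H].
Qed.
Lemma in_module_nu_odd i j : Nat.Odd i \/ Nat.Even j ->
  in_period_module (fun h => nu (energyS h) i j).
Proof.
  intros H. apply (in_module_ext (fun _ => 0)); [|apply in_module_0].
  intros h Hh. rewrite nu_odd; [reflexivity|apply energyS_gt1, Hh|exact H].
Qed.

(** * Independence of the three first-order integrals *)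

Lemma RInt_sin2_cos2 : RInt (fun t => sin t ^ 2 * cos t ^ 2) turn0 turn1 = PI / 4.
Proof.
  rewrite (RInt_ext _ (fun t => 1 * sin t ^ 2 + (-1) * sin t ^ 4)).
  - rewrite RInt_lin2 by apply continuous_sin_pow. rewrite RInt_sin2, RInt_sin4. as_R. field.
  - intros t _. as_R. rewrite cos2_sin2. ring.
Qed.

Lemma mh_bounds S t : 3 <= S -> sqrt (S / 3) <= mh S t <= sqrt S.
Proof.
  intros HS. pose proof (cos2_bounds t). unfold mh. split; apply sqrt_le_1_alt;
  unfold radicand_R; nra.
Qed.

Lemma sqrt_third S : 0 < S -> sqrt S <= 2 * sqrt (S / 3).
Proof.
  intros HS. apply Rsqr_incr_0_var; [|pose proof (sqrt_pos (S / 3)); lra].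
  rewrite Rsqr_mult, !Rsqr_sqrt by lra. unfold Rsqr. lra.
Qed.

Lemma mu02_formula S : 1 < S -> mu S 0 2 = (1 + S) * RInt (fun t => sin t ^ 2 * mh S t) turn0 turn1.
Proof.
  intros HS. rewrite <- RInt_scal_R.
  - apply RInt_ext. intros t _. as_R. pose proof (mh_pos S t HS).
    rewrite yh_sqr, xh_sqr, cos2_sin2 by exact HS. field. lra.
  - intros t. apply (continuous_mult (fun u => sin u ^ 2) (mh S));
    [apply continuous_sin2|apply continuous_mh, HS].
Qed.
Lemma mu22_formula S : 1 < S ->
  mu S 2 2 = (1 + S) ^ 2 * RInt (fun t => sin t ^ 2 * cos t ^ 2 * mh S t) turn0 turn1.
Proof.
  intros HS. rewrite <- RInt_scal_R.
  - apply RInt_ext. intros t _. as_R. pose proof (mh_pos S t HS).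
    rewrite yh_sqr, !xh_sqr by exact HS. rewrite (cos2_sin2 t). field. lra.
  - intros t. apply (continuous_mult (fun u => sin u ^ 2 * cos u ^ 2) (mh S)).
    + apply (continuous_mult (fun u => sin u ^ 2) (fun u => cos u ^ 2));
      [apply continuous_sin2|apply continuous_cos2].
    + apply continuous_mh, HS.
Qed.

Lemma RInt_weight_le (q f : R -> R) k : (forall t, continuous q t) -> (forall t, continuous f t) ->
  (forall t, 0 <= q t) -> (forall t, f t <= k) ->
  RInt (fun t => q t * f t) turn0 turn1 <= k * RInt q turn0 turn1.
Proof.
  intros Hq Hf Hq0 Hk. rewrite <- RInt_scal_R by exact Hq.
  apply RInt_le; [apply turn_le| | |].
  - apply ex_RInt_all_continuous. intros t. apply (continuous_mult q f); [apply Hq|apply Hf].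
  - apply ex_RInt_all_continuous. intros t.
    apply (continuous_scal_R k q), Hq.
  - intros t _. specialize (Hq0 t). specialize (Hk t). nra.
Qed.

(** The mean of [x ^ 2] over an oval grows like [S], that is, like [sqrt h], because [mh] is comparable to [sqrt S] along the whole oval. *)
Lemma mean_growth S : 3 <= S ->
  0 < mu S 0 2 /\ S / 8 * mu S 0 2 <= mu S 2 2 <= (1 + S) * mu S 0 2.
Proof.
  intros HS. assert (HS1 : 1 < S) by lra.
  rewrite mu02_formula, mu22_formula by exact HS1.
  assert (Cm : forall t, continuous (mh S) t) by (intros; apply continuous_mh, HS1).
  assert (Cw : forall t, continuous (fun t => sin t ^ 2 * cos t ^ 2) t).
  { intros t. apply (continuous_mult (fun u => sin u ^ 2) (fun u => cos u ^ 2));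
    [apply continuous_sin2|apply continuous_cos2]. }
  assert (Pw : forall t, 0 <= sin t ^ 2 * cos t ^ 2).
  { intros t. apply Rmult_le_pos; apply pow2_ge_0. }
  pose proof (RInt_weight_ge (fun t => sin t ^ 2) (mh S) (sqrt (S / 3)) continuous_sin2 Cm
    (fun t => pow2_ge_0 (sin t)) (fun t => proj1 (mh_bounds S t HS))) as L1.
  pose proof (RInt_weight_le (fun t => sin t ^ 2) (mh S) (sqrt S) continuous_sin2 Cm
    (fun t => pow2_ge_0 (sin t)) (fun t => proj2 (mh_bounds S t HS))) as L2.
  pose proof (RInt_weight_ge (fun t => sin t ^ 2 * cos t ^ 2) (mh S) (sqrt (S / 3)) Cw Cm Pw (fun t => proj1 (mh_bounds S t HS))) as L3.
  rewrite RInt_sin2 in L1, L2. rewrite RInt_sin2_cos2 in L3.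
  assert (L4 : RInt (fun t => sin t ^ 2 * cos t ^ 2 * mh S t) turn0 turn1 <=
     RInt (fun t => sin t ^ 2 * mh S t) turn0 turn1).
  { apply RInt_le; [apply turn_le| | |].
    - apply ex_RInt_all_continuous. intros t.
      apply (continuous_mult (fun u => sin u ^ 2 * cos u ^ 2) (mh S)); [apply Cw|apply Cm].
    - apply ex_RInt_all_continuous. intros t.
      apply (continuous_mult (fun u => sin u ^ 2) (mh S)); [apply continuous_sin2|apply Cm].
    - intros t _. pose proof (cos2_bounds t). pose proof (pow2_ge_0 (sin t)).
      pose proof (mh_pos S t HS1).
      assert (0 <= sin t ^ 2 * mh S t) by (apply Rmult_le_pos; lra). nra. }
  pose proof PI_RGT_0 as P. pose proof (sqrt_third S ltac:(lra)) as T.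
  assert (Q : 0 < sqrt (S / 3)) by (apply sqrt_lt_R0; lra).
  set (A := RInt (fun t => sin t ^ 2 * mh S t) turn0 turn1) in *.
  set (B := RInt (fun t => sin t ^ 2 * cos t ^ 2 * mh S t) turn0 turn1) in *.
  set (q := sqrt (S / 3)) in *.
  assert (A0 : 0 < A) by nra.
  assert (BA : A / 8 <= B) by nra.
  split; [nra|]. split.
  - replace (S / 8 * ((1 + S) * A)) with (S * (1 + S) * (A / 8)) by field.
    replace ((1 + S) ^ 2 * B) with ((1 + S) * (1 + S) * B) by ring.
    apply Rmult_le_compat; nra.
  - replace ((1 + S) ^ 2 * B) with ((1 + S) * ((1 + S) * B)) by ring.
    apply Rmult_le_compat_l; [lra|]. apply Rmult_le_compat_l; lra.
Qed.

Lemma bounded_multiple_zero c K : (forall S, 3 <= S -> Rabs c * S <= K) -> c = 0.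
Proof.
  intros H. destruct (Req_dec c 0) as [E|N]; [exact E|exfalso].
  apply Rabs_pos_lt in N. pose proof (H 3 ltac:(lra)) as H3.
  specialize (H (3 + K / Rabs c)).
  assert (0 <= K / Rabs c) by (apply Rmult_le_pos; [lra|left; apply Rinv_0_lt_compat, N]).
  specialize (H ltac:(lra)).
  replace (Rabs c * (3 + K / Rabs c)) with (3 * Rabs c + K) in H by (field; lra). lra.
Qed.

(** Divided by [mu02], the three integrals are [1], a quantity [N] of order [S], and one of order [S ^ 2]. *)
Lemma first_order_independent a c k :
  (forall h, 0 < h -> a * mu (energyS h) 0 2 + c * mu (energyS h) 2 2 + k * mu (energyS h) 0 4 = 0) ->
  a = 0 /\ c = 0 /\ k = 0.
Proof.
  intros H0.
  assert (H : forall S, 3 <= S -> exists N, S / 8 <= N <= 1 + S /\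
    a + c * N + k * (3 / 7 * (S ^ 2 - 1) + 3 / 7 * N) = 0).
  { intros S HS. set (h := (S ^ 2 - 1) / 4). assert (Hh : 0 < h) by (unfold h; nra).
    assert (ES : energyS h = S).
    { unfold energyS, h. replace (1 + 4 * ((S ^ 2 - 1) / 4)) with (S ^ 2) by field.
      apply sqrt_pow2. lra. }
    specialize (H0 h Hh). rewrite mu04_eq, ES in H0 by exact Hh.
    destruct (mean_growth S HS) as (P & L & U).
    exists (mu S 2 2 / mu S 0 2). split.
    { split.
      - apply (proj1 (Rle_div_r (S / 8) (mu S 2 2) (mu S 0 2) P)). exact L.
      - apply (proj2 (Rle_div_l (mu S 2 2) (1 + S) (mu S 0 2) P)). exact U. }
    apply Rmult_eq_reg_r with (mu S 0 2); [|lra]. rewrite Rmult_0_l, <- H0.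
    unfold h. field. lra. }
  assert (K : k = 0).
  { apply (bounded_multiple_zero k (7 * (Rabs a + Rabs c + Rabs k))). intros S HS.
    destruct (H S HS) as (N & HN & E).
    assert (E' : k * (3 / 7 * (S ^ 2 - 1)) = - a - (c + 3 / 7 * k) * N) by lra.
    apply (f_equal Rabs) in E'. rewrite Rabs_mult, (Rabs_right (3 / 7 * _)) in E' by nra.
    assert (B : Rabs (- a - (c + 3 / 7 * k) * N) <= Rabs a + (Rabs c + Rabs k) * (1 + S)).
    { replace (- a - (c + 3 / 7 * k) * N) with (- a + - ((c + 3 / 7 * k) * N)) by ring.
      eapply Rle_trans; [apply Rabs_triang|]. rewrite !Rabs_Ropp, Rabs_mult.
      apply Rplus_le_compat_l. rewrite (Rabs_right N) by lra.
      apply Rmult_le_compat; [apply Rabs_pos|lra| |lra].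
      eapply Rle_trans; [apply Rabs_triang|]. rewrite Rabs_mult, (Rabs_right (3 / 7)) by lra.
      pose proof (Rabs_pos k). lra. }
    rewrite <- E' in B. pose proof (Rabs_pos a). pose proof (Rabs_pos c). pose proof (Rabs_pos k).
    assert (Rabs k * (3 / 7 * (S - 1)) * (1 + S) <= (Rabs a + Rabs c + Rabs k) * (1 + S)) by nra.
    assert (Rabs k * (3 / 7 * (S - 1)) <= Rabs a + Rabs c + Rabs k).
    { apply Rmult_le_reg_r with (1 + S); lra. }
    nra. }
  subst k.
  assert (Cz : c = 0).
  { apply (bounded_multiple_zero c (8 * Rabs a)). intros S HS.
    destruct (H S HS) as (N & HN & E).
    assert (E' : c * N = - a) by lra. apply (f_equal Rabs) in E'.
    rewrite Rabs_mult, Rabs_Ropp, (Rabs_right N) in E' by lra.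
    pose proof (Rabs_pos c). nra. }
  subst c. destruct (H 3 ltac:(lra)) as (N & _ & E). split; [lra|split; reflexivity].
Qed.

(** * Observables depending uniformly continuously on the energy *)

(** Boundedness at the level [S0] and continuity there in the level, uniformly in the angle. *)
Definition uniform_at (S0 : R) (F : R -> R -> R) : Prop :=
  (exists M, forall t, Rabs (F S0 t) <= M) /\
  forall eps, 0 < eps -> exists del, 0 < del /\
    forall S t, 1 < S -> Rabs (S - S0) < del -> Rabs (F S t - F S0 t) <= eps.

Lemma uniform_const S0 c : uniform_at S0 (fun _ _ => c).
Proof.
  split; [exists (Rabs c); intros; lra|]. intros eps Heps. exists 1. split; [lra|].
  intros S t _ _. rewrite Rminus_diag_eq, Rabs_R0 by reflexivity. lra.
Qed.

Lemma uniform_theta S0 (f : R -> R) M : (forall t, Rabs (f t) <= M) -> uniform_at S0 (fun _ t => f t).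
Proof.
  intros HM. split; [exists M; exact HM|]. intros eps Heps. exists 1. split; [lra|].
  intros S t _ _. rewrite Rminus_diag_eq, Rabs_R0 by reflexivity. lra.
Qed.

Lemma uniform_mult S0 F G : uniform_at S0 F -> uniform_at S0 G ->
  uniform_at S0 (fun S t => F S t * G S t).
Proof.
  intros [[M HM] HF] [[L HL] HG].
  assert (M0 : 0 <= M) by (eapply Rle_trans; [apply Rabs_pos|apply (HM 0)]).
  assert (L0 : 0 <= L) by (eapply Rle_trans; [apply Rabs_pos|apply (HL 0)]).
  split.
  { exists (M * L). intros t. rewrite Rabs_mult.
    apply Rmult_le_compat; try apply Rabs_pos; auto. }
  intros eps Heps.
  set (e1 := Rmin 1 (eps / (M + L + 1))).
  assert (He1 : 0 < e1) by (apply Rmin_glb_lt; [lra|apply Rdiv_lt_0_compat; lra]).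
  assert (He2 : e1 <= 1) by apply Rmin_l.
  assert (He3 : e1 * (M + L + 1) <= eps).
  { apply Rle_trans with (eps / (M + L + 1) * (M + L + 1)).
    - apply Rmult_le_compat_r; [lra|apply Rmin_r].
    - right. field. lra. }
  destruct (HF e1 He1) as (d1 & Hd1 & H1). destruct (HG e1 He1) as (d2 & Hd2 & H2).
  exists (Rmin d1 d2). split; [apply Rmin_glb_lt; assumption|].
  intros S t HS Hd. pose proof (Rmin_l d1 d2). pose proof (Rmin_r d1 d2).
  specialize (H1 S t HS ltac:(lra)). specialize (H2 S t HS ltac:(lra)).
  specialize (HM t). specialize (HL t).
  replace (F S t * G S t - F S0 t * G S0 t) with
    ((F S t - F S0 t) * (G S t - G S0 t) + (F S t - F S0 t) * G S0 t + F S0 t * (G S t - G S0 t)) by ring.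
  eapply Rle_trans; [apply Rabs_triang|]. eapply Rle_trans; [apply Rplus_le_compat_r, Rabs_triang|].
  rewrite !Rabs_mult.
  assert (Rabs (F S t - F S0 t) * Rabs (G S t - G S0 t) <= e1 * 1)
    by (apply Rmult_le_compat; try apply Rabs_pos; lra).
  assert (Rabs (F S t - F S0 t) * Rabs (G S0 t) <= e1 * L)
    by (apply Rmult_le_compat; try apply Rabs_pos; assumption).
  assert (Rabs (F S0 t) * Rabs (G S t - G S0 t) <= M * e1)
    by (apply Rmult_le_compat; try apply Rabs_pos; assumption).
  lra.
Qed.

Lemma uniform_lipschitz S0 F f K : 0 <= K -> (forall u v, Rabs (f u - f v) <= K * Rabs (u - v)) ->
  uniform_at S0 F -> uniform_at S0 (fun S t => f (F S t)).
Proof.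
  intros HK Hf [[M HM] HF]. split.
  - exists (Rabs (f 0) + K * M). intros t. specialize (HM t). specialize (Hf (F S0 t) 0).
    rewrite Rminus_0_r in Hf.
    replace (f (F S0 t)) with (f 0 + (f (F S0 t) - f 0)) by ring.
    eapply Rle_trans; [apply Rabs_triang|].
    assert (K * Rabs (F S0 t) <= K * M) by (apply Rmult_le_compat_l; assumption). lra.
  - intros eps Heps. destruct (HF (eps / (K + 1)) ltac:(apply Rdiv_lt_0_compat; lra)) as (d & Hd & H1).
    exists d. split; [exact Hd|]. intros S t HS HSd. eapply Rle_trans; [apply Hf|].
    specialize (H1 S t HS HSd).
    assert (K * Rabs (F S t - F S0 t) <= K * (eps / (K + 1))) by (apply Rmult_le_compat_l; assumption).
    assert (eps / (K + 1) * (K + 1) = eps) by (field; lra).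
    assert (0 < eps / (K + 1)) by (apply Rdiv_lt_0_compat; lra). nra.
Qed.

Lemma sqrt_diff_bound p q r : 0 <= p -> 0 < r -> r <= sqrt q -> 0 <= q ->
  Rabs (sqrt p - sqrt q) <= Rabs (p - q) / r.
Proof.
  intros Hp Hr Hrq Hq. apply (proj1 (Rle_div_r _ _ _ Hr)).
  pose proof (sqrt_pos p) as P.
  replace (p - q) with ((sqrt p - sqrt q) * (sqrt p + sqrt q)).
  - rewrite Rabs_mult. apply Rmult_le_compat_l; [apply Rabs_pos|].
    rewrite Rabs_right; lra.
  - rewrite <- (sqrt_sqrt p Hp) at 3. rewrite <- (sqrt_sqrt q Hq) at 3. ring.
Qed.

Lemma mh_lower S t : 1 < S -> sqrt ((S - 1) / 2) <= mh S t.
Proof.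
  intros HS. apply sqrt_le_1_alt. unfold radicand_R. pose proof (cos2_bounds t). nra.
Qed.

Lemma mh_upper S t : 1 < S -> mh S t <= sqrt S.
Proof.
  intros HS. apply sqrt_le_1_alt. unfold radicand_R. pose proof (cos2_bounds t). nra.
Qed.

(** The square root is Lipschitz away from zero, and [mh] is bounded below for [S0 > 1]. *)
Lemma uniform_mh S0 : 1 < S0 -> uniform_at S0 mh.
Proof.
  intros H0. set (r := sqrt ((S0 - 1) / 2)). assert (Hr : 0 < r) by (apply sqrt_lt_R0; lra).
  split.
  - exists (sqrt S0). intros t. rewrite Rabs_right; [apply mh_upper, H0|].
    pose proof (mh_pos S0 t H0). lra.
  - intros eps Heps. exists (eps * r). split; [apply Rmult_lt_0_compat; assumption|].
    intros S t HS Hd.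
    pose proof (radicand_R_pos S t HS). pose proof (radicand_R_pos S0 t H0).
    eapply Rle_trans.
    + apply (sqrt_diff_bound _ _ r); [lra|exact Hr|apply mh_lower, H0|lra].
    + apply (proj2 (Rle_div_l _ _ _ Hr)). pose proof (cos2_bounds t).
      replace (radicand_R S t / 2 - radicand_R S0 t / 2) with ((1 + cos t ^ 2) / 2 * (S - S0))
        by (unfold radicand_R; field).
      rewrite Rabs_mult, Rabs_right by lra. pose proof (Rabs_pos (S - S0)). nra.
Qed.

Lemma uniform_sqrt1S S0 : 1 < S0 -> uniform_at S0 (fun S _ => sqrt (1 + S)).
Proof.
  intros H0. split; [exists (sqrt (1 + S0)); intros _; rewrite Rabs_right; [lra|apply Rle_ge, sqrt_pos]|].
  intros eps Heps. exists eps. split; [exact Heps|]. intros S t HS Hd.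
  eapply Rle_trans; [apply (sqrt_diff_bound _ _ 1); try lra|].
  - pose proof (sqrt_le_1_alt 1 (1 + S0) ltac:(lra)) as L. rewrite sqrt_1 in L. exact L.
  - replace (1 + S - (1 + S0)) with (S - S0) by ring. unfold Rdiv. rewrite Rinv_1. lra.
Qed.

Lemma uniform_inv_mh S0 : 1 < S0 -> uniform_at S0 (fun S t => / mh S t).
Proof.
  intros H0. set (r := sqrt ((S0 - 1) / 2)). assert (Hr : 0 < r) by (apply sqrt_lt_R0; lra).
  destruct (uniform_mh S0 H0) as [_ U]. split.
  - exists (/ r). intros t. pose proof (mh_pos S0 t H0). rewrite Rabs_right.
    + apply Rinv_le_contravar; [exact Hr|apply mh_lower, H0].
    + left. apply Rinv_0_lt_compat. assumption.
  - intros eps Heps.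
    destruct (U (Rmin (r / 2) (eps * (r * r) / 2))) as (d & Hd & H1).
    { apply Rmin_glb_lt; [lra|]. assert (0 < eps * (r * r)) by (apply Rmult_lt_0_compat; nra). lra. }
    exists d. split; [exact Hd|]. intros S t HS HSd. specialize (H1 S t HS HSd).
    pose proof (Rmin_l (r / 2) (eps * (r * r) / 2)). pose proof (Rmin_r (r / 2) (eps * (r * r) / 2)).
    pose proof (mh_lower S0 t H0) as L. fold r in L.
    pose proof (mh_pos S t HS) as P. pose proof (mh_pos S0 t H0) as P0.
    assert (L' : r / 2 <= mh S t) by (apply Rabs_le_between in H1; lra).
    replace (/ mh S t - / mh S0 t) with (- ((mh S t - mh S0 t) / (mh S t * mh S0 t))) by (field; lra).
    assert (Q : r * r / 2 <= mh S t * mh S0 t) by nra.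
    rewrite Rabs_Ropp. unfold Rdiv. rewrite Rabs_mult, Rabs_inv, (Rabs_right (mh S t * mh S0 t)) by nra.
    apply Rle_trans with ((eps * (r * r) / 2) * / (r * r / 2)).
    + apply Rmult_le_compat; [apply Rabs_pos| |lra|apply Rinv_le_contravar; nra].
      left. apply Rinv_0_lt_compat. nra.
    + right. field. lra.
Qed.

Definition path_continuous (Om : R -> R -> R) : Prop :=
  forall (x y : R -> R) t, continuous x t -> continuous y t -> 0 < H (x t) (y t) ->
    continuous (fun u => Om (x u) (y u)) t.

(** What is needed to average an observable along a path close to the oval. *)
Definition regular (S0 : R) (Om : R -> R -> R) : Prop :=
  uniform_at S0 (fun S t => Om (xh S t) (yh S t)) /\
  (forall t, continuous (fun t => Om (xh S0 t) (yh S0 t)) t) /\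
  path_continuous Om.

Lemma regular_mult S0 Om Om' : regular S0 Om -> regular S0 Om' ->
  regular S0 (fun x y => Om x y * Om' x y).
Proof.
  intros (U & C & P) (U' & C' & P'). split; [|split].
  - apply (uniform_mult S0 (fun S t => Om (xh S t) (yh S t)) (fun S t => Om' (xh S t) (yh S t))); assumption.
  - intros t. apply (continuous_mult (fun t => Om (xh S0 t) (yh S0 t)) (fun t => Om' (xh S0 t) (yh S0 t)));
    [apply C|apply C'].
  - intros x y t Hx Hy HH. apply (continuous_mult (fun u => Om (x u) (y u)) (fun u => Om' (x u) (y u)));
    [apply P|apply P']; assumption.
Qed.

Lemma regular_const S0 c : regular S0 (fun _ _ => c).
Proof.
  split; [apply uniform_const|split; [intros|intros x y t _ _ _]; apply continuous_const].
Qed.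

Lemma uniform_xh S0 : 1 < S0 -> uniform_at S0 xh.
Proof.
  intros H0. apply (uniform_mult S0 (fun S _ => sqrt (1 + S)) (fun _ t => cos t)).
  - apply uniform_sqrt1S, H0.
  - apply (uniform_theta S0 cos 1). intros t. apply Rabs_le, COS_bound.
Qed.

Lemma uniform_ext S0 F G : (forall S t, F S t = G S t) -> uniform_at S0 F -> uniform_at S0 G.
Proof.
  intros E [[M HM] HF]. split.
  - exists M. intros t. rewrite <- E. apply HM.
  - intros eps Heps. destruct (HF eps Heps) as (d & Hd & H1). exists d. split; [exact Hd|].
    intros S t HS HSd. rewrite <- !E. apply H1; assumption.
Qed.

Lemma uniform_msin S0 : uniform_at S0 (fun _ t => - sin t).
Proof.
  apply (uniform_theta S0 (fun t => - sin t) 1). intros t. rewrite Rabs_Ropp. apply Rabs_le, SIN_bound.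
Qed.

Lemma uniform_yh S0 : 1 < S0 -> uniform_at S0 yh.
Proof.
  intros H0.
  apply (uniform_ext S0 (fun S t => sqrt (1 + S) * (mh S t * - sin t))).
  - intros S t. unfold yh. ring.
  - apply (uniform_mult S0 (fun S _ => sqrt (1 + S)) (fun S t => mh S t * - sin t)).
    + apply uniform_sqrt1S, H0.
    + apply (uniform_mult S0 mh (fun _ t => - sin t)); [apply uniform_mh, H0|apply uniform_msin].
Qed.

Lemma regular_x S0 : 1 < S0 -> regular S0 (fun x _ => x).
Proof.
  intros H0. split; [apply uniform_xh, H0|split].
  - intros t. apply continuous_xh, H0.
  - intros x y t Hx _ _. exact Hx.
Qed.
Lemma regular_y S0 : 1 < S0 -> regular S0 (fun _ y => y).
Proof.
  intros H0. split; [apply uniform_yh, H0|split].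
  - intros t. apply continuous_yh, H0.
  - intros x y t _ Hy _. exact Hy.
Qed.

Lemma atan_lipschitz u v : Rabs (atan u - atan v) <= 1 * Rabs (u - v).
Proof.
  destruct (MVT_gen atan v u (fun z => / (1 + z ^ 2))) as (c & _ & E).
  - intros z _. auto_derive; [exact I|]. field. nra.
  - intros z _. apply derivable_continuous_pt, derivable_pt_atan.
  - rewrite E, Rabs_mult. apply Rmult_le_compat_r; [apply Rabs_pos|].
    rewrite Rabs_right.
    + rewrite <- Rinv_1 at 2. apply Rinv_le_contravar; nra.
    + left. apply Rinv_0_lt_compat. nra.
Qed.

Lemma phase_denominator x y : 0 < H x y -> 0 < sqrt (1 + 4 * H x y) + x ^ 2 - 1.
Proof.
  intros HH. assert (1 < sqrt (1 + 4 * H x y)) by (apply sqrt_energy_gt1, HH). nra.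
Qed.

Lemma continuous_H (x y : R -> R) t : continuous x t -> continuous y t ->
  continuous (fun u => H (x u) (y u)) t.
Proof.
  intros Hx Hy. unfold H.
  apply (continuous_plus (fun u => y u ^ 2 / 2 - x u ^ 2 / 2) (fun u => x u ^ 4 / 4)).
  - apply (continuous_minus (fun u => y u ^ 2 / 2) (fun u => x u ^ 2 / 2)).
    + apply (continuous_mult (fun u => y u ^ 2) (fun _ => / 2));
      [apply continuous_pow_R, Hy|apply continuous_const].
    + apply (continuous_mult (fun u => x u ^ 2) (fun _ => / 2));
      [apply continuous_pow_R, Hx|apply continuous_const].
  - apply (continuous_mult (fun u => x u ^ 4) (fun _ => / 4));
      [apply continuous_pow_R, Hx|apply continuous_const].
Qed.

Lemma continuous_energy_root (x y : R -> R) t : continuous x t -> continuous y t ->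
  continuous (fun u => sqrt (1 + 4 * H (x u) (y u))) t.
Proof.
  intros Hx Hy.
  apply (continuous_comp (fun u => 1 + 4 * H (x u) (y u)) sqrt).
  - apply (continuous_plus (fun _ => 1) (fun u => 4 * H (x u) (y u))); [apply continuous_const|].
    apply (continuous_scal_R 4 (fun u => H (x u) (y u))).
    apply continuous_H; assumption.
  - apply continuous_sqrt.
Qed.

Lemma regular_phase S0 : 1 < S0 -> regular S0 phase.
Proof.
  intros H0. split; [|split].
  - assert (U : uniform_at S0 phase_hat).
    { apply (uniform_ext S0 (fun S t => 2 * atan (sqrt (1 + S) * (/ mh S t * (- sin t * (sqrt 2 / 2)))))).
      - intros S t. unfold phase_hat, yh. f_equal. f_equal.
        destruct (Req_dec (mh S t) 0) as [E|E].
        + rewrite E. unfold Rdiv. rewrite !Rmult_0_r, pow_i, Rmult_0_r, Rinv_0 by lia. ring.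
        + field. exact E.
      - apply (uniform_mult S0 (fun _ _ => 2)); [apply uniform_const|].
        apply (uniform_lipschitz S0 (fun S t => sqrt (1 + S) * (/ mh S t * (- sin t * (sqrt 2 / 2)))) atan 1);
        [lra|exact atan_lipschitz|].
        apply (uniform_mult S0 (fun S _ => sqrt (1 + S)) (fun S t => / mh S t * (- sin t * (sqrt 2 / 2)))).
        + apply uniform_sqrt1S, H0.
        + apply (uniform_mult S0 (fun S t => / mh S t) (fun S t => - sin t * (sqrt 2 / 2)));
          [apply uniform_inv_mh, H0|].
          apply (uniform_mult S0 (fun S t => - sin t) (fun S t => sqrt 2 / 2));
          [apply uniform_msin|apply uniform_const]. }
    destruct U as [[M HM] U]. split.
    + exists M. intros t. rewrite phase_eq by exact H0. apply HM.
    + intros eps Heps. destruct (U eps Heps) as (d & Hd & H1). exists d. split; [exact Hd|].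
      intros S t HS HSd. rewrite !phase_eq by assumption. apply H1; assumption.
  - intros t. apply (continuous_ext (phase_hat S0)).
    + intros u. symmetry. apply phase_eq, H0.
    + apply continuous_phase_hat, H0.
  - intros x y t Hx Hy HH. unfold phase.
    apply (continuous_scal_R 2
      (fun u => atan (sqrt 2 * y u / (sqrt (1 + 4 * H (x u) (y u)) + x u ^ 2 - 1)))).
    apply (continuous_comp (fun u => sqrt 2 * y u / (sqrt (1 + 4 * H (x u) (y u)) + x u ^ 2 - 1)) atan).
    + apply (continuous_mult (fun u => sqrt 2 * y u) (fun u => / (sqrt (1 + 4 * H (x u) (y u)) + x u ^ 2 - 1))).
      * apply (continuous_scal_R (sqrt 2) y), Hy.
      * apply (continuous_comp (fun u => sqrt (1 + 4 * H (x u) (y u)) + x u ^ 2 - 1) Rinv).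
        -- apply (continuous_minus (fun u => sqrt (1 + 4 * H (x u) (y u)) + x u ^ 2) (fun _ => 1));
           [|apply continuous_const].
           apply (continuous_plus (fun u => sqrt (1 + 4 * H (x u) (y u))) (fun u => x u ^ 2)).
           ++ apply continuous_energy_root; assumption.
           ++ apply continuous_pow_R, Hx.
        -- apply continuous_Rinv. pose proof (phase_denominator _ _ HH). lra.
    + apply continuity_pt_filterlim. apply derivable_continuous_pt, derivable_pt_atan.
Qed.

(** * Lifting a rotation to the angle *)

Lemma continuous_clamp T t : continuous (fun u => Rmax 0 (Rmin u T)) t.
Proof.
  apply continuous_eps. intros eps Heps. exists eps. split; [exact Heps|].
  intros u Hu. eapply Rle_lt_trans; [|exact Hu].
  unfold Rmax, Rmin.
  destruct (Rle_dec u T), (Rle_dec t T);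
  repeat match goal with |- context [Rle_dec ?a ?b] => destruct (Rle_dec a b) end;
  unfold Rabs; repeat destruct (Rcase_abs _); lra.
Qed.

Lemma clamp_id T t : 0 <= t <= T -> Rmax 0 (Rmin t T) = t.
Proof. intros Ht. rewrite Rmin_left by lra. apply Rmax_right. lra. Qed.

Lemma clamp_range T t : 0 <= T -> 0 <= Rmax 0 (Rmin t T) <= T.
Proof.
  intros HT. split; [apply Rmax_l|]. apply Rmax_lub; [exact HT|apply Rmin_r].
Qed.

Lemma null_derivative_const (f : R -> R) a b : a <= b ->
  (forall t, a <= t <= b -> is_derive f t 0) -> f b = f a.
Proof.
  intros Hab Hf. destruct (MVT_gen f a b (fun _ => 0)) as (c & _ & E).
  - intros z Hz. rewrite Rmin_left, Rmax_right in Hz by exact Hab. apply Hf. lra.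
  - intros z Hz. rewrite Rmin_left, Rmax_right in Hz by exact Hab.
    apply continuity_pt_filterlim.
    apply derivable_continuous_R. exists 0. apply Hf. lra.
  - lra.
Qed.

(** A point turning on the unit circle at the rate [w] has the angle [int w]: the squared distance between the point and the one at this angle has zero derivative. *)
Lemma angle_lift (c s w : R -> R) (T th0 : R) : 0 <= T ->
  (forall t, 0 <= t <= T -> is_derive c t (s t * w t)) ->
  (forall t, 0 <= t <= T -> is_derive s t (- c t * w t)) ->
  (forall t, 0 <= t <= T -> continuous w t) ->
  c 0 = cos th0 -> s 0 = - sin th0 ->
  exists th : R -> R, th 0 = th0 /\
    (forall t, 0 <= t <= T -> is_derive th t (w t)) /\
    (forall t, 0 <= t <= T -> c t = cos (th t) /\ s t = - sin (th t)).
Proof.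
  intros HT Dc Ds Cw C0 S0.
  set (W := fun t => w (Rmax 0 (Rmin t T))).
  assert (CW : forall t, continuous W t).
  { intros t. apply (continuous_comp (fun u => Rmax 0 (Rmin u T)) w); [apply continuous_clamp|].
    apply Cw, clamp_range, HT. }
  set (th := fun t => th0 + RInt W 0 t).
  assert (Dth : forall t, is_derive th t (W t)).
  { intros t. unfold th.
    replace (W t) with (plus 0 (W t)) by (unfold plus; simpl; ring).
    apply (is_derive_plus (K := R_AbsRing) (V := R_NormedModule) (fun _ => th0) (fun t => RInt W 0 t)).
    - apply (is_derive_const (K := R_AbsRing) (V := R_NormedModule)).
    - apply (is_derive_RInt (V := R_NormedModule) W (fun b => RInt W 0 b) 0 t); [|apply CW].
      apply filter_forall. intros b.
      apply (RInt_correct (V := R_CompleteNormedModule)). apply ex_RInt_all_continuous, CW. }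
  exists th.
  assert (E0 : th 0 = th0) by (unfold th; rewrite RInt_point; apply Rplus_0_r).
  assert (Dw : forall t, 0 <= t <= T -> is_derive th t (w t)).
  { intros t Ht. pose proof (Dth t) as D. unfold W in D. rewrite clamp_id in D by exact Ht. exact D. }
  split; [exact E0|]. split; [exact Dw|].
  set (d := fun t => (c t - cos (th t)) ^ 2 + (s t + sin (th t)) ^ 2).
  assert (Dd : forall t, 0 <= t <= T -> is_derive d t 0).
  { intros t Ht. specialize (Dc t Ht). specialize (Ds t Ht). specialize (Dw t Ht).
    unfold d. auto_derive.
    - repeat split; eexists; eassumption.
    - replace (Derive (fun x => c x) t) with (s t * w t) by (symmetry; apply is_derive_unique, Dc).
      replace (Derive (fun x => s x) t) with (- c t * w t) by (symmetry; apply is_derive_unique, Ds).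
      replace (Derive (fun x => th x) t) with (w t) by (symmetry; apply is_derive_unique, Dw).
      ring. }
  intros t Ht.
  assert (Z : d t = 0).
  { rewrite (null_derivative_const d 0 t); [|lra|intros; apply Dd; lra].
    unfold d. rewrite E0, C0, S0. ring. }
  unfold d in Z. pose proof (pow2_ge_0 (c t - cos (th t))). pose proof (pow2_ge_0 (s t + sin (th t))).
  assert (Z1 : (c t - cos (th t)) ^ 2 = 0) by lra.
  assert (Z2 : (s t + sin (th t)) ^ 2 = 0) by lra.
  assert (c t - cos (th t) = 0) by nra. assert (s t + sin (th t) = 0) by nra. lra.
Qed.

(** * Energy and angle along a perturbed curve *)

Definition rootH (x y : R) : R := sqrt (1 + 4 * H x y).
Definition speed (x y : R) : R := sqrt ((x ^ 2 + rootH x y - 1) / 2).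
(** For any point of positive energy, [(unit_cos, - unit_sin)] is the point of the unit circle at the angle of the point on its own oval; [speed] is [mh] there. *)
Definition unit_cos (x y : R) : R := x / sqrt (1 + rootH x y).
Definition unit_sin (x y : R) : R := y / (sqrt (1 + rootH x y) * speed x y).

(** The derivative of that angle when [(x, y)] moves with velocity [(X, Y)]. It is linear in the velocity, which separates the perturbation from the Hamiltonian flow ([spin_perturbed]). *)
Definition spin (x y X Y : R) : R :=
  (X * y - x * Y + x * y * (2 * x * X + 2 * ((x ^ 3 - x) * X + y * Y) / rootH x y) / (4 * speed x y ^ 2))
  / ((1 + rootH x y) * speed x y).

Lemma rootH_gt1 x y : 0 < H x y -> 1 < rootH x y.
Proof. apply sqrt_energy_gt1. Qed.

Lemma rootH_sqr x y : 0 < H x y -> rootH x y ^ 2 = 1 + 4 * H x y.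
Proof. intros HH. apply energyS_sqr, HH. Qed.

Lemma speed_sqr x y : 0 < H x y -> speed x y ^ 2 = (x ^ 2 + rootH x y - 1) / 2.
Proof. intros HH. pose proof (rootH_gt1 x y HH). apply pow2_sqrt. nra. Qed.

Lemma speed_pos x y : 0 < H x y -> 0 < speed x y.
Proof. intros HH. pose proof (rootH_gt1 x y HH). apply sqrt_lt_R0. nra. Qed.

Lemma ordinate_sqr x y : 0 < H x y -> y ^ 2 = (1 + rootH x y - x ^ 2) * speed x y ^ 2.
Proof.
  intros HH. rewrite speed_sqr by exact HH. pose proof (rootH_sqr x y HH) as E. unfold H in E.
  nra.
Qed.

Lemma unit_circle x y : 0 < H x y -> unit_cos x y ^ 2 + unit_sin x y ^ 2 = 1.
Proof.
  intros HH. pose proof (rootH_gt1 x y HH) as S1. pose proof (speed_pos x y HH) as M0.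
  pose proof (ordinate_sqr x y HH) as Y.
  assert (A0 : 0 < sqrt (1 + rootH x y)) by (apply sqrt_lt_R0; lra).
  unfold unit_cos, unit_sin.
  replace ((x / sqrt (1 + rootH x y)) ^ 2 + (y / (sqrt (1 + rootH x y) * speed x y)) ^ 2)
    with ((x ^ 2 * speed x y ^ 2 + y ^ 2) / (sqrt (1 + rootH x y) ^ 2 * speed x y ^ 2)) by (field; lra).
  rewrite Y, pow2_sqrt by lra. field. lra.
Qed.

(** The unperturbed flow rotates the unit vector at the rate [speed]. *)
Lemma spin_hamiltonian x y : 0 < H x y -> spin x y y (x - x ^ 3) = speed x y.
Proof.
  intros HH. pose proof (rootH_gt1 x y HH) as S1. pose proof (speed_pos x y HH) as M0.
  pose proof (ordinate_sqr x y HH) as Y. pose proof (speed_sqr x y HH) as M2.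
  unfold spin.
  replace (y * y - x * (x - x ^ 3) +
    x * y * (2 * x * y + 2 * ((x ^ 3 - x) * y + y * (x - x ^ 3)) / rootH x y) / (4 * speed x y ^ 2))
    with ((1 + rootH x y) * speed x y ^ 2).
  - field. lra.
  - replace ((x ^ 3 - x) * y + y * (x - x ^ 3)) with 0 by ring.
    replace (x * y * (2 * x * y + 2 * 0 / rootH x y) / (4 * speed x y ^ 2))
      with (x ^ 2 * y ^ 2 / (2 * speed x y ^ 2)) by (field; lra).
    replace (x ^ 2 * y ^ 2 / (2 * speed x y ^ 2)) with (x ^ 2 * (1 + rootH x y - x ^ 2) / 2)
      by (rewrite Y; field; lra).
    replace (y * y) with (y ^ 2) by ring. rewrite Y, M2. field.
Qed.

Lemma spin_perturbed x y e p q : 0 < H x y ->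
  spin x y (y + e * p) (x - x ^ 3 + e * q) = speed x y + e * spin x y p q.
Proof.
  intros HH. rewrite <- (spin_hamiltonian x y HH).
  pose proof (rootH_gt1 x y HH) as S1. pose proof (speed_pos x y HH) as M0.
  unfold spin. field. lra.
Qed.

Lemma is_derive_H (x y : R -> R) t X Y : is_derive x t X -> is_derive y t Y ->
  is_derive (fun u => H (x u) (y u)) t ((x t ^ 3 - x t) * X + y t * Y).
Proof.
  intros Dx Dy. unfold H. auto_derive.
  - repeat split; eexists; eassumption.
  - replace (Derive (fun u => x u) t) with X by (symmetry; apply is_derive_unique, Dx).
    replace (Derive (fun u => y u) t) with Y by (symmetry; apply is_derive_unique, Dy).
    field.
Qed.

Lemma is_derive_rootH (x y : R -> R) t X Y : is_derive x t X -> is_derive y t Y ->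
  0 < H (x t) (y t) ->
  is_derive (fun u => rootH (x u) (y u)) t (2 * ((x t ^ 3 - x t) * X + y t * Y) / rootH (x t) (y t)).
Proof.
  intros Dx Dy HH. pose proof (is_derive_H x y t X Y Dx Dy) as DH.
  pose proof (rootH_gt1 _ _ HH) as S1.
  set (E := fun u => H (x u) (y u)) in *. change (H (x t) (y t)) with (E t) in HH.
  unfold rootH in *. change (fun u => sqrt (1 + 4 * H (x u) (y u))) with (fun u => sqrt (1 + 4 * E u)).
  change (H (x t) (y t)) with (E t) in *.
  auto_derive.
  - split; [eexists; exact DH|split; [lra|exact I]].
  - replace (Derive (fun u => E u) t) with ((x t ^ 3 - x t) * X + y t * Y)
      by (symmetry; apply is_derive_unique, DH).
    field. lra.
Qed.

Lemma is_derive_speed (x y : R -> R) t X Y : is_derive x t X -> is_derive y t Y ->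
  0 < H (x t) (y t) ->
  is_derive (fun u => speed (x u) (y u)) t
    ((2 * x t * X + 2 * ((x t ^ 3 - x t) * X + y t * Y) / rootH (x t) (y t)) / (4 * speed (x t) (y t))).
Proof.
  intros Dx Dy HH. pose proof (is_derive_rootH x y t X Y Dx Dy HH) as DS.
  pose proof (rootH_gt1 _ _ HH) as S1. pose proof (speed_pos _ _ HH) as M0.
  set (Z := 2 * ((x t ^ 3 - x t) * X + y t * Y) / rootH (x t) (y t)) in *.
  unfold speed in *. set (S := fun u => rootH (x u) (y u)) in *.
  change (fun u => sqrt ((x u ^ 2 + rootH (x u) (y u) - 1) / 2)) with (fun u => sqrt ((x u ^ 2 + S u - 1) / 2)).
  change (rootH (x t) (y t)) with (S t) in *.
  auto_derive.
  - split; [eexists; exact Dx|]. split; [eexists; exact DS|]. split; [|exact I].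
    unfold Rdiv in *. simpl. nra.
  - replace (Derive (fun u => S u) t) with Z by (symmetry; apply is_derive_unique, DS).
    replace (Derive (fun u => x u) t) with X by (symmetry; apply is_derive_unique, Dx).
    unfold Rdiv, Rminus in *. simpl. simpl in M0. field. simpl. lra.
Qed.

Lemma locally_pos (f : R -> R) t : continuous f t -> 0 < f t -> locally t (fun u => 0 < f u).
Proof.
  intros C Hp. apply (C (fun z => 0 < z)).
  exists (mkposreal _ Hp). intros z Hz. unfold ball in Hz. simpl in Hz.
  unfold AbsRing_ball, abs, minus, plus, opp in Hz. simpl in Hz.
  apply Rabs_lt_between in Hz. lra.
Qed.

Lemma rotation_of_derivative (c s : R -> R) (t c' s' : R) : is_derive c t c' -> is_derive s t s' ->
  locally t (fun u => c u ^ 2 + s u ^ 2 = 1) ->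
  c' = s t * (c' * s t - s' * c t) /\ s' = - c t * (c' * s t - s' * c t).
Proof.
  intros Dc Ds L.
  assert (E : c t ^ 2 + s t ^ 2 = 1) by exact (locally_singleton _ _ L).
  assert (D1 : is_derive (fun u => c u ^ 2 + s u ^ 2) t (2 * (c t * c' + s t * s'))).
  { auto_derive.
    - split; [eexists; exact Dc|]. split; [eexists; exact Ds|exact I].
    - replace (Derive (fun u => c u) t) with c' by (symmetry; apply is_derive_unique, Dc).
      replace (Derive (fun u => s u) t) with s' by (symmetry; apply is_derive_unique, Ds). ring. }
  assert (D2 : is_derive (fun u => c u ^ 2 + s u ^ 2) t 0).
  { apply (is_derive_ext_loc (fun _ => 1)).
    - revert L. apply filter_imp. intros u Hu. symmetry. exact Hu.
    - apply (is_derive_const (K := R_AbsRing) (V := R_NormedModule)). }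
  pose proof (is_derive_unique _ _ _ D1) as U1. rewrite (is_derive_unique _ _ _ D2) in U1.
  assert (Z : c t * c' + s t * s' = 0) by lra.
  split.
  - replace (s t * (c' * s t - s' * c t)) with (c' * (c t ^ 2 + s t ^ 2) - c t * (c t * c' + s t * s')) by ring.
    rewrite E, Z. ring.
  - replace (- c t * (c' * s t - s' * c t)) with (s' * (c t ^ 2 + s t ^ 2) - s t * (c t * c' + s t * s')) by ring.
    rewrite E, Z. ring.
Qed.

Lemma is_derive_unit (x y : R -> R) t X Y : is_derive x t X -> is_derive y t Y ->
  0 < H (x t) (y t) ->
  is_derive (fun u => unit_cos (x u) (y u)) t (unit_sin (x t) (y t) * spin (x t) (y t) X Y) /\
  is_derive (fun u => unit_sin (x u) (y u)) t (- unit_cos (x t) (y t) * spin (x t) (y t) X Y).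
Proof.
  intros Dx Dy HH.
  pose proof (is_derive_rootH x y t X Y Dx Dy HH) as DS.
  pose proof (is_derive_speed x y t X Y Dx Dy HH) as Dm.
  pose proof (rootH_gt1 _ _ HH) as S1. pose proof (speed_pos _ _ HH) as M0.
  assert (L : locally t (fun u => unit_cos (x u) (y u) ^ 2 + unit_sin (x u) (y u) ^ 2 = 1)).
  { assert (L : locally t (fun u => 0 < H (x u) (y u))).
    { apply (locally_pos (fun u => H (x u) (y u))); [|exact HH].
      apply continuous_H; apply derivable_continuous_R; eexists; eassumption. }
    revert L. apply filter_imp. intros u Hu. apply unit_circle, Hu. }
  set (S' := 2 * ((x t ^ 3 - x t) * X + y t * Y) / rootH (x t) (y t)) in *.
  set (m' := (2 * x t * X + S') / (4 * speed (x t) (y t))) in *.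
  set (A := sqrt (1 + rootH (x t) (y t))).
  assert (A0 : 0 < A) by (apply sqrt_lt_R0; lra).
  assert (A2 : A ^ 2 = 1 + rootH (x t) (y t)) by (apply pow2_sqrt; lra).
  assert (Dc : is_derive (fun u => unit_cos (x u) (y u)) t (X / A - x t * S' / (2 * A ^ 3))).
  { unfold unit_cos. set (S := fun u => rootH (x u) (y u)) in *.
    change (fun u => x u / sqrt (1 + rootH (x u) (y u))) with (fun u => x u / sqrt (1 + S u)).
    change (rootH (x t) (y t)) with (S t) in *.
    auto_derive.
    - split; [eexists; exact Dx|]. split; [eexists; exact DS|]. split; [lra|]. split; [fold A; lra|exact I].
    - replace (Derive (fun u => S u) t) with S' by (symmetry; apply is_derive_unique, DS).
      replace (Derive (fun u => x u) t) with X by (symmetry; apply is_derive_unique, Dx).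
      fold A. field. lra. }
  assert (Ds : is_derive (fun u => unit_sin (x u) (y u)) t
    (Y / (A * speed (x t) (y t)) - y t * S' / (2 * A ^ 3 * speed (x t) (y t))
     - y t * m' / (A * speed (x t) (y t) ^ 2))).
  { unfold unit_sin. set (S := fun u => rootH (x u) (y u)) in *.
    set (m := fun u => speed (x u) (y u)) in *.
    change (fun u => y u / (sqrt (1 + rootH (x u) (y u)) * speed (x u) (y u)))
      with (fun u => y u / (sqrt (1 + S u) * m u)).
    change (rootH (x t) (y t)) with (S t) in *. change (speed (x t) (y t)) with (m t) in *.
    clearbody S' m'. auto_derive.
    - split; [eexists; exact Dy|]. split; [eexists; exact DS|]. split; [lra|].
      split; [eexists; exact Dm|]. split; [|exact I]. fold A. apply Rgt_not_eq, Rmult_lt_0_compat; lra.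
    - replace (Derive (fun u => S u) t) with S' by (symmetry; apply is_derive_unique, DS).
      replace (Derive (fun u => m u) t) with m' by (symmetry; apply is_derive_unique, Dm).
      replace (Derive (fun u => y u) t) with Y by (symmetry; apply is_derive_unique, Dy).
      fold A. field. lra. }
  destruct (rotation_of_derivative _ _ t _ _ Dc Ds L) as [E1 E2].
  match type of E1 with _ = _ * ?w => assert (W : w = spin (x t) (y t) X Y) end.
  { unfold spin. fold S'. rewrite <- A2. unfold unit_cos, unit_sin. fold A.
    unfold m'. clearbody S'. field. lra. }
  rewrite W in E1, E2. rewrite <- E1, <- E2. split; [exact Dc|exact Ds].
Qed.

(** ** Drift of the energy *)

Definition cubic_growth (K : R) (p : R -> R -> R) : Prop :=
  forall x y, Rabs (p x y) <= K * sqrt (1 + x ^ 2 + y ^ 2) ^ 3.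

(** The derivative of the energy along the perturbed flow, divided by the parameter. *)
Definition energy_rate (p q : R -> R -> R) (x y : R) : R := (x ^ 3 - x) * p x y + y * q x y.

Lemma radius_bounds x y : let r := sqrt (1 + x ^ 2 + y ^ 2) in
  1 <= r /\ Rabs x <= r /\ Rabs y <= r.
Proof.
  intros r. assert (R0 : 0 <= r) by apply sqrt_pos.
  assert (R2 : r ^ 2 = 1 + x ^ 2 + y ^ 2) by (apply pow2_sqrt; nra).
  repeat split; [nra| |]; apply Rabs_le; split; nra.
Qed.

(** A cubic field times the gradient of [H] has degree six. *)
Lemma energy_rate_bound K p q x y : cubic_growth K p -> cubic_growth K q ->
  Rabs (energy_rate p q x y) <= 3 * K * (1 + x ^ 2 + y ^ 2) ^ 3.
Proof.
  intros Hp Hq. specialize (Hp x y). specialize (Hq x y).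
  destruct (radius_bounds x y) as (R1 & Rx & Ry). set (r := sqrt (1 + x ^ 2 + y ^ 2)) in *.
  assert (R2 : r ^ 2 = 1 + x ^ 2 + y ^ 2) by (apply pow2_sqrt; nra).
  assert (R3 : 1 <= r ^ 3) by (simpl; nra).
  assert (K0 : 0 <= K * r ^ 3) by (eapply Rle_trans; [apply Rabs_pos|exact Hp]).
  rewrite <- R2. unfold energy_rate. eapply Rle_trans; [apply Rabs_triang|]. rewrite !Rabs_mult.
  assert (B1 : Rabs (x ^ 3 - x) <= 2 * r ^ 3).
  { replace (x ^ 3 - x) with (x ^ 3 + - x) by ring.
    eapply Rle_trans; [apply Rabs_triang|]. rewrite Rabs_Ropp, <- RPow_abs.
    assert (Rabs x ^ 3 <= r ^ 3) by (apply pow_incr; split; [apply Rabs_pos|exact Rx]).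
    assert (r <= r ^ 3) by (simpl; nra). lra. }
  assert (B2 : Rabs y <= r ^ 3) by (assert (r <= r ^ 3) by (simpl; nra); lra).
  assert (Rabs (x ^ 3 - x) * Rabs (p x y) <= 2 * r ^ 3 * (K * r ^ 3))
    by (apply Rmult_le_compat; try apply Rabs_pos; assumption).
  assert (Rabs y * Rabs (q x y) <= r ^ 3 * (K * r ^ 3))
    by (apply Rmult_le_compat; try apply Rabs_pos; assumption).
  replace ((r ^ 2) ^ 3) with (r ^ 3 * r ^ 3) by ring. nra.
Qed.

Lemma radius_energy x y : 1 + x ^ 2 + y ^ 2 <= 4 * (H x y + 1).
Proof. unfold H. pose proof (pow2_ge_0 (x ^ 2 - 3 / 2)). pose proof (pow2_ge_0 y). nra. Qed.

Lemma energy_plus1 x y : 3 / 4 <= H x y + 1.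
Proof. unfold H. pose proof (pow2_ge_0 (x ^ 2 - 1)). pose proof (pow2_ge_0 y). nra. Qed.

Definition perturbed_solution (p q : R -> R -> R) (e : R) (x y : R -> R) (T : R) : Prop :=
  forall t, 0 <= t <= T ->
    is_derive x t (y t + e * p (x t) (y t)) /\ is_derive y t (x t - x t ^ 3 + e * q (x t) (y t)).

Lemma perturbed_solution_le p q e x y T T' : T' <= T ->
  perturbed_solution p q e x y T -> perturbed_solution p q e x y T'.
Proof. intros HT Hs t Ht. apply Hs. lra. Qed.

Lemma is_derive_energy p q e x y T t : perturbed_solution p q e x y T -> 0 <= t <= T ->
  is_derive (fun u => H (x u) (y u)) t (e * energy_rate p q (x t) (y t)).
Proof.
  intros Hs Ht. destruct (Hs t Ht) as [Dx Dy].
  replace (e * energy_rate p q (x t) (y t)) with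
    ((x t ^ 3 - x t) * (y t + e * p (x t) (y t)) + y t * (x t - x t ^ 3 + e * q (x t) (y t)))
    by (unfold energy_rate; ring).
  apply is_derive_H; assumption.
Qed.

(** The energy may grow faster than exponentially, but its rate is at most cubic in the energy, so that this quantity drifts at a bounded rate and no a priori bound on the path is required. *)
Definition recip (E : R) : R := / (E + 1) ^ 2.

Lemma recip_drift K p q e x y T t : cubic_growth K p -> cubic_growth K q ->
  perturbed_solution p q e x y T -> 0 <= t <= T ->
  Rabs (recip (H (x t) (y t)) - recip (H (x 0) (y 0))) <= 384 * K * Rabs e * t.
Proof.
  intros Hp Hq Hs Ht.
  set (E := fun u => H (x u) (y u)).
  assert (Dv : forall u, 0 <= u <= T ->
    is_derive (fun u => recip (E u)) u (- 2 * (e * energy_rate p q (x u) (y u)) / (E u + 1) ^ 3)).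
  { intros u Hu. pose proof (is_derive_energy p q e x y T u Hs Hu) as DE. fold E in DE.
    assert (P : 3 / 4 <= E u + 1) by apply energy_plus1.
    unfold recip. auto_derive.
    - split; [eexists; exact DE|]. split; [|exact I]. apply Rgt_not_eq. nra.
    - replace (Derive (fun u => E u) u) with (e * energy_rate p q (x u) (y u))
        by (symmetry; apply is_derive_unique, DE).
      field. lra. }
  destruct (MVT_gen (fun u => recip (E u)) 0 t
    (fun u => - 2 * (e * energy_rate p q (x u) (y u)) / (E u + 1) ^ 3)) as (u & Hu & EQ).
  - intros z Hz. rewrite Rmin_left, Rmax_right in Hz by lra. apply Dv. lra.
  - intros z Hz. rewrite Rmin_left, Rmax_right in Hz by lra. apply continuity_pt_filterlim.
    apply (derivable_continuous_R (fun u => recip (E u))).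
    eexists. apply Dv. lra.
  - rewrite Rmin_left, Rmax_right in Hu by lra.
    unfold E in EQ at 1 2. rewrite EQ, Rminus_0_r, Rabs_mult, (Rabs_right t) by lra.
    apply Rmult_le_compat_r; [lra|].
    assert (P : 3 / 4 <= E u + 1) by apply energy_plus1.
    assert (P3 : 0 < (E u + 1) ^ 3) by (apply pow_lt; lra).
    unfold Rdiv. rewrite !Rabs_mult, Rabs_inv, (Rabs_right ((E u + 1) ^ 3)) by lra.
    rewrite (Rabs_left (- 2)) by lra.
    apply (proj2 (Rle_div_l _ _ _ P3)).
    pose proof (energy_rate_bound K p q (x u) (y u) Hp Hq) as B.
    pose proof (radius_energy (x u) (y u)) as N. fold (E u) in N.
    assert (K0 : 0 <= K).
    { specialize (Hp 0 0). destruct (radius_bounds 0 0) as (R1 & _).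
      assert (0 <= K * sqrt (1 + 0 ^ 2 + 0 ^ 2) ^ 3) by (eapply Rle_trans; [apply Rabs_pos|exact Hp]).
      assert (1 <= sqrt (1 + 0 ^ 2 + 0 ^ 2) ^ 3) by (apply pow_R1_Rle; exact R1). nra. }
    (* 384 is 2 * 3 * 64: the factor 2 comes from the exponent in recip, 3 from energy_rate_bound *)
    assert (N3 : (1 + x u ^ 2 + y u ^ 2) ^ 3 <= 64 * (E u + 1) ^ 3).
    { replace (64 * (E u + 1) ^ 3) with ((4 * (E u + 1)) ^ 3) by ring. apply pow_incr. split; [nra|exact N]. }
    pose proof (Rabs_pos e).
    assert (Rabs (energy_rate p q (x u) (y u)) <= 192 * K * (E u + 1) ^ 3) by nra.
    assert (Rabs e * Rabs (energy_rate p q (x u) (y u)) <= Rabs e * (192 * K * (E u + 1) ^ 3))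
      by (apply Rmult_le_compat_l; assumption).
    lra.
Qed.

Lemma root_of_recip E : -1 < E -> sqrt (4 / sqrt (recip E) - 3) = sqrt (1 + 4 * E).
Proof.
  intros HE. unfold recip. f_equal.
  replace (/ (E + 1) ^ 2) with ((/ (E + 1)) ^ 2) by (field; lra).
  rewrite sqrt_pow2 by (left; apply Rinv_0_lt_compat; lra). field. lra.
Qed.

Lemma root_of_recip_continuous E : -1 < E ->
  continuous (fun v => sqrt (4 / sqrt v - 3)) (recip E).
Proof.
  intros HE. assert (P : 0 < recip E) by (apply Rinv_0_lt_compat, pow_lt; lra).
  apply (continuous_comp (fun v => 4 / sqrt v - 3) sqrt); [|apply continuous_sqrt].
  apply (continuous_minus (fun v => 4 / sqrt v) (fun _ => 3)); [|apply continuous_const].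
  apply (continuous_scal_R 4 (fun v => / sqrt v)).
  apply (continuous_comp sqrt Rinv); [apply continuous_sqrt|].
  apply continuous_Rinv. apply Rgt_not_eq, sqrt_lt_R0, P.
Qed.

Lemma continuous_del (f : R -> R) t : continuous f t -> forall eps, 0 < eps ->
  exists del, 0 < del /\ forall u, Rabs (u - t) < del -> Rabs (f u - f t) < eps.
Proof.
  intros C eps Heps.
  assert (L : locally t (fun u => Rabs (f u - f t) < eps)).
  { apply (C (fun z => Rabs (z - f t) < eps)). exists (mkposreal _ Heps). intros z Hz. exact Hz. }
  destruct L as [d Hd]. exists d. split; [apply cond_pos|]. intros u Hu. apply Hd. exact Hu.
Qed.

(** Over a bounded time a small perturbation keeps the energy close to its initial value: by [recip_drift] this holds for [recip], of which the level [rootH] is a continuous function. *)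
Lemma energy_drift h K Tm : 0 < h -> 0 <= K -> 0 <= Tm -> forall eta, 0 < eta ->
  exists del, 0 < del /\
  forall p q e x y T t, cubic_growth K p -> cubic_growth K q ->
    Rabs e < del -> perturbed_solution p q e x y T -> H (x 0) (y 0) = h ->
    0 <= t <= T -> t <= Tm -> Rabs (rootH (x t) (y t) - energyS h) < eta.
Proof.
  intros Hh HK HT eta Heta.
  destruct (continuous_del _ _ (root_of_recip_continuous h ltac:(lra)) eta Heta) as (d & Hd & C).
  exists (d / (384 * K * Tm + 1)).
  assert (KT : 0 <= K * Tm) by (apply Rmult_le_pos; assumption).
  split; [apply Rdiv_lt_0_compat; lra|].
  intros p q e x y T t Hp Hq He Hs H0 Ht HTm.
  pose proof (recip_drift K p q e x y T t Hp Hq Hs Ht) as B. rewrite H0 in B.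
  pose proof (energy_plus1 (x t) (y t)) as P.
  assert (D : Rabs (recip (H (x t) (y t)) - recip h) < d).
  { eapply Rle_lt_trans; [exact B|].
    apply (proj2 (Rlt_div_r _ _ _ (ltac:(lra) : 0 < 384 * K * Tm + 1))) in He.
    pose proof (Rabs_pos e).
    assert (K * t <= K * Tm) by (apply Rmult_le_compat_l; lra).
    assert (Rabs e * (K * t) <= Rabs e * (K * Tm)) by (apply Rmult_le_compat_l; assumption).
    destruct (Req_dec e 0) as [->|En]; [rewrite Rabs_R0; lra|].
    pose proof (Rabs_pos_lt e En). lra. }
  specialize (C _ D). rewrite !root_of_recip in C by lra. exact C.
Qed.

(** ** The angle along a returning curve *)

Lemma path_continuous_x : path_continuous (fun x _ => x).
Proof. intros x y t Hx _ _. exact Hx. Qed.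
Lemma path_continuous_y : path_continuous (fun _ y => y).
Proof. intros x y t _ Hy _. exact Hy. Qed.
Lemma path_continuous_const c : path_continuous (fun _ _ => c).
Proof. intros x y t _ _ _. apply continuous_const. Qed.
Lemma path_continuous_plus Om Om' : path_continuous Om -> path_continuous Om' ->
  path_continuous (fun x y => Om x y + Om' x y).
Proof.
  intros C C' x y t Hx Hy HH.
  apply (continuous_plus (fun u => Om (x u) (y u)) (fun u => Om' (x u) (y u))); [apply C|apply C']; assumption.
Qed.
Lemma path_continuous_minus Om Om' : path_continuous Om -> path_continuous Om' ->
  path_continuous (fun x y => Om x y - Om' x y).
Proof.
  intros C C' x y t Hx Hy HH.
  apply (continuous_minus (fun u => Om (x u) (y u)) (fun u => Om' (x u) (y u))); [apply C|apply C']; assumption.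
Qed.
Lemma path_continuous_mult Om Om' : path_continuous Om -> path_continuous Om' ->
  path_continuous (fun x y => Om x y * Om' x y).
Proof.
  intros C C' x y t Hx Hy HH.
  apply (continuous_mult (fun u => Om (x u) (y u)) (fun u => Om' (x u) (y u))); [apply C|apply C']; assumption.
Qed.
Lemma path_continuous_div Om Om' : path_continuous Om -> path_continuous Om' ->
  (forall x y, 0 < H x y -> Om' x y <> 0) -> path_continuous (fun x y => Om x y / Om' x y).
Proof.
  intros C C' N x y t Hx Hy HH.
  apply (continuous_mult (fun u => Om (x u) (y u)) (fun u => / Om' (x u) (y u))); [apply C; assumption|].
  apply (continuous_comp (fun u => Om' (x u) (y u)) Rinv); [apply C'; assumption|].
  apply continuous_Rinv, N, HH.
Qed.
Lemma path_continuous_pow Om n : path_continuous Om -> path_continuous (fun x y => Om x y ^ n).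
Proof.
  intros C x y t Hx Hy HH. apply (continuous_pow_R (fun u => Om (x u) (y u))), C; assumption.
Qed.
Lemma path_continuous_rootH : path_continuous rootH.
Proof. intros x y t Hx Hy _. apply continuous_energy_root; assumption. Qed.

Lemma path_continuous_speed : path_continuous speed.
Proof.
  intros x y t Hx Hy HH. unfold speed.
  apply (continuous_comp (fun u => (x u ^ 2 + rootH (x u) (y u) - 1) / 2) sqrt); [|apply continuous_sqrt].
  refine (path_continuous_div (fun x y => x ^ 2 + rootH x y - 1) (fun _ _ => 2) _ _ _ x y t Hx Hy HH).
  - apply (path_continuous_minus (fun x y => x ^ 2 + rootH x y)); [|apply path_continuous_const].
    apply (path_continuous_plus (fun x y => x ^ 2)); [|apply path_continuous_rootH].
    apply (path_continuous_pow (fun x _ => x)), path_continuous_x.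
  - apply path_continuous_const.
  - intros; lra.
Qed.

Ltac path_cont :=
  repeat first
  [ assumption
  | match goal with |- path_continuous (fun _ _ => ?c) => exact (path_continuous_const c) end
  | exact path_continuous_x | exact path_continuous_y
  | exact path_continuous_rootH | exact path_continuous_speed
  | match goal with |- path_continuous ?P => match P with
    | (fun x y => @?f x y + @?g x y) => apply (path_continuous_plus f g)
    | (fun x y => @?f x y - @?g x y) => apply (path_continuous_minus f g)
    | (fun x y => @?f x y * @?g x y) => apply (path_continuous_mult f g)
    | (fun x y => @?f x y / @?g x y) => apply (path_continuous_div f g)
    | (fun x y => @?f x y ^ ?n) => apply (path_continuous_pow f n)
    end end ].

Lemma path_continuous_spin X Y : path_continuous X -> path_continuous Y ->
  path_continuous (fun x y => spin x y (X x y) (Y x y)).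
Proof.
  intros CX CY. unfold spin. path_cont;
  intros x y HH; pose proof (rootH_gt1 x y HH); pose proof (speed_pos x y HH).
  - lra.
  - apply Rgt_not_eq. nra.
  - apply Rgt_not_eq. nra.
Qed.

Lemma Rabs_div_le a A b b0 : Rabs a <= A -> 0 < b0 <= b -> Rabs (a / b) <= A / b0.
Proof.
  intros Ha Hb. unfold Rdiv. rewrite Rabs_mult, Rabs_inv, (Rabs_right b) by lra.
  apply Rmult_le_compat; [apply Rabs_pos|left; apply Rinv_0_lt_compat; lra|exact Ha|].
  apply Rinv_le_contravar; lra.
Qed.

(** On a neighbourhood of the oval all the ingredients are bounded, uniformly over the cubics with a given growth constant. *)
Lemma spin_bound S0 K : 1 < S0 -> exists B, 0 < B /\
  forall p q x y, cubic_growth K p -> cubic_growth K q -> 0 < H x y ->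
    Rabs (rootH x y - S0) < (S0 - 1) / 2 -> Rabs (spin x y (p x y) (q x y)) <= B.
Proof.
  intros HS.
  set (N2 := (2 * S0) ^ 2 + 3). set (r := sqrt N2). set (P := Rabs K * r ^ 3).
  set (Q := 3 * Rabs K * N2 ^ 3). set (m0 := sqrt ((S0 - 1) / 4)).
  assert (M0 : 0 < m0) by (apply sqrt_lt_R0; lra).
  assert (R0 : 0 <= r) by apply sqrt_pos.
  assert (P0 : 0 <= P) by (apply Rmult_le_pos; [apply Rabs_pos|apply pow_le, R0]).
  assert (N0 : 0 < N2) by (unfold N2; nra).
  assert (Q0 : 0 <= Q).
  { pose proof (Rabs_pos K). pose proof (pow_lt N2 3 N0). unfold Q. apply Rmult_le_pos; lra. }
  set (B := (P * r + r * P + r * r * ((2 * r * P + 2 * Q / 1) / (4 * m0 ^ 2))) / (1 * m0)).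
  assert (B0 : 0 <= B).
  { unfold B. apply Rmult_le_pos; [|left; apply Rinv_0_lt_compat; lra].
    assert (0 <= P * r) by (apply Rmult_le_pos; assumption).
    assert (0 <= r * r * ((2 * r * P + 2 * Q / 1) / (4 * m0 ^ 2))).
    { apply Rmult_le_pos; [nra|]. apply Rmult_le_pos; [nra|]. left. apply Rinv_0_lt_compat. nra. }
    lra. }
  exists (B + 1). split; [lra|]. intros p q x y Hp Hq HH HS1.
  apply Rle_trans with B; [|lra].
  apply Rabs_lt_between in HS1. pose proof (rootH_sqr x y HH) as SE.
  pose proof (radius_energy x y) as RE.
  assert (RN : 1 + x ^ 2 + y ^ 2 <= N2) by (unfold N2; nra).
  assert (Rr : sqrt (1 + x ^ 2 + y ^ 2) <= r) by (apply sqrt_le_1_alt, RN).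
  destruct (radius_bounds x y) as (_ & Rx & Ry).
  assert (Bx : Rabs x <= r) by lra. assert (By : Rabs y <= r) by lra.
  assert (G : forall f, cubic_growth K f -> Rabs (f x y) <= P).
  { intros f Hf. eapply Rle_trans; [apply Hf|]. unfold P.
    apply Rle_trans with (Rabs K * sqrt (1 + x ^ 2 + y ^ 2) ^ 3).
    - apply Rmult_le_compat_r; [apply pow_le, sqrt_pos|apply Rle_abs].
    - apply Rmult_le_compat_l; [apply Rabs_pos|]. apply pow_incr. split; [apply sqrt_pos|exact Rr]. }
  pose proof (G p Hp) as Bp. pose proof (G q Hq) as Bq.
  assert (Be : Rabs ((x ^ 3 - x) * p x y + y * q x y) <= Q).
  { eapply Rle_trans; [apply (energy_rate_bound K); assumption|]. unfold Q.
    apply Rle_trans with (3 * Rabs K * (1 + x ^ 2 + y ^ 2) ^ 3).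
    - apply Rmult_le_compat_r; [apply pow_le; nra|]. pose proof (Rle_abs K). lra.
    - apply Rmult_le_compat_l; [pose proof (Rabs_pos K); lra|]. apply pow_incr. split; [nra|exact RN]. }
  assert (Bm : m0 <= speed x y) by (apply sqrt_le_1_alt; nra).
  assert (Bm2 : m0 ^ 2 <= speed x y ^ 2) by (apply pow_incr; lra).
  assert (Mul : forall a b A B, Rabs a <= A -> Rabs b <= B -> Rabs (a * b) <= A * B).
  { intros a b A B' Ha Hb. rewrite Rabs_mult. apply Rmult_le_compat; try apply Rabs_pos; assumption. }
  assert (Add : forall a b A B, Rabs a <= A -> Rabs b <= B -> Rabs (a + b) <= A + B).
  { intros a b A B' Ha Hb. eapply Rle_trans; [apply Rabs_triang|lra]. }
  assert (B2 : Rabs 2 <= 2) by (rewrite Rabs_right; lra).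
  unfold spin, B. apply Rabs_div_le; [|split; [lra|]].
  - apply Add; [unfold Rminus; apply Add; [apply Mul; assumption|rewrite Rabs_Ropp; apply Mul; assumption]|].
    apply Rle_trans with (r * r * ((2 * r * P + 2 * Q / 1) / (4 * m0 ^ 2))); [|lra].
    unfold Rdiv at 1. rewrite (Rmult_assoc (x * y)). apply Mul; [apply Mul; assumption|].
    apply (Rabs_div_le _ (2 * r * P + 2 * Q / 1)); [|split; nra].
    apply Add; [apply Mul; [apply Mul|]; assumption|].
    apply Rabs_div_le; [apply Mul; assumption|lra].
  - apply Rmult_le_compat; lra.
Qed.

(** The angle of a point that starts on the section, followed continuously along the solution. *)
Lemma angle_of_solution p q e x y T : path_continuous p -> path_continuous q -> 0 <= T ->
  perturbed_solution p q e x y T -> on_section (x 0) (y 0) ->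
  (forall t, 0 <= t <= T -> 0 < H (x t) (y t)) ->
  exists th : R -> R, th 0 = turn0 /\
    (forall t, 0 <= t <= T ->
      is_derive th t (speed (x t) (y t) + e * spin (x t) (y t) (p (x t) (y t)) (q (x t) (y t)))) /\
    (forall t, 0 <= t <= T ->
      x t = xh (rootH (x t) (y t)) (th t) /\ y t = yh (rootH (x t) (y t)) (th t) /\
      speed (x t) (y t) = mh (rootH (x t) (y t)) (th t)).
Proof.
  intros Cp Cq HT Hs [X0 Y0] HE.
  destruct (angle_lift (fun t => unit_cos (x t) (y t)) (fun t => unit_sin (x t) (y t))
    (fun t => speed (x t) (y t) + e * spin (x t) (y t) (p (x t) (y t)) (q (x t) (y t))) T turn0)
    as (th & T0 & Dth & Eth).
  - exact HT.
  - intros t Ht. destruct (Hs t Ht) as [Dx Dy].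
    rewrite <- spin_perturbed by (apply HE, Ht). apply is_derive_unit; [assumption..|apply HE, Ht].
  - intros t Ht. destruct (Hs t Ht) as [Dx Dy].
    rewrite <- spin_perturbed by (apply HE, Ht). apply is_derive_unit; [assumption..|apply HE, Ht].
  - intros t Ht. destruct (Hs t Ht) as [Dx Dy].
    assert (C : path_continuous (fun x y => speed x y + e * spin x y (p x y) (q x y))).
    { path_cont. apply path_continuous_spin; assumption. }
    apply (C x y t); [| |apply HE, Ht];
      apply derivable_continuous_R; eexists; eassumption.
  - unfold unit_cos. rewrite X0, cos_turn0. unfold Rdiv. ring.
  - rewrite sin_turn0. pose proof (HE 0 ltac:(lra)) as H0.
    pose proof (unit_circle _ _ H0) as E. pose proof (rootH_gt1 _ _ H0). pose proof (speed_pos _ _ H0).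
    assert (P : 0 < unit_sin (x 0) (y 0)).
    { apply Rdiv_lt_0_compat; [exact Y0|]. apply Rmult_lt_0_compat; [apply sqrt_lt_R0; lra|assumption]. }
    assert (C : unit_cos (x 0) (y 0) = 0) by (unfold unit_cos, Rdiv; rewrite X0; ring).
    rewrite C in E. nra.
  - exists th. split; [exact T0|]. split; [exact Dth|]. intros t Ht.
    destruct (Eth t Ht) as [Ec Es]. pose proof (HE t Ht) as H0.
    pose proof (rootH_gt1 _ _ H0) as S1. pose proof (speed_pos _ _ H0) as M0.
    pose proof (speed_sqr _ _ H0) as M2.
    assert (A0 : 0 < sqrt (1 + rootH (x t) (y t))) by (apply sqrt_lt_R0; lra).
    assert (EX : x t = xh (rootH (x t) (y t)) (th t)).
    { unfold xh. rewrite <- Ec. unfold unit_cos. field. lra. }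
    assert (EM : speed (x t) (y t) = mh (rootH (x t) (y t)) (th t)).
    { pose proof (mh_xh _ (th t) S1) as Q. rewrite <- EX in Q.
      pose proof (mh_pos _ (th t) S1). nra. }
    split; [exact EX|]. split; [|exact EM].
    unfold yh. rewrite <- EM.
    replace (sin (th t)) with (- unit_sin (x t) (y t)) by lra.
    unfold unit_sin. field. lra.
Qed.

(** Going once around near the oval of level [S0], in the coordinates level and angle. *)
Definition follows_oval (S0 eta T : R) (x y : R -> R) : Prop :=
  exists th w : R -> R, th 0 = turn0 /\ th T = turn1 /\
    forall t, 0 <= t <= T ->
      1 < rootH (x t) (y t) /\ Rabs (rootH (x t) (y t) - S0) < eta /\
      is_derive th t (w t) /\ continuous w t /\
      Rabs (w t - mh (rootH (x t) (y t)) (th t)) <= eta /\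
      x t = xh (rootH (x t) (y t)) (th t) /\ y t = yh (rootH (x t) (y t)) (th t).

(** The section corresponds to the angles [turn0 + 2 k PI]. *)
Lemma full_turn u : cos u = 0 -> sin u < 0 -> turn0 < u <= turn1 -> u = turn1.
Proof.
  intros C S Hu. unfold turn0, turn1 in *.
  assert (S1 : sin u = - 1) by (pose proof (sin2_cos2 u) as E; unfold Rsqr in E; rewrite C in E; nra).
  assert (E : cos (2 * ((u + PI / 2) / 2)) = 1).
  { replace (2 * ((u + PI / 2) / 2)) with (PI / 2 + u) by field.
    rewrite <- (Ropp_involutive (cos _)), <- sin_cos, S1. ring. }
  rewrite cos_2a_sin in E.
  destruct (Rlt_dec ((u + PI / 2) / 2) PI) as [L|L]; [|lra].
  pose proof (sin_gt_0 ((u + PI / 2) / 2) ltac:(lra) L). nra.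
Qed.

Lemma section_angle S u x y : 1 < S -> x = xh S u -> y = yh S u -> on_section x y ->
  cos u = 0 /\ sin u < 0.
Proof.
  intros HS EX EY [X0 Y0]. pose proof (mh_pos S u HS) as M0.
  assert (A0 : 0 < sqrt (1 + S)) by (apply sqrt_lt_R0; lra).
  rewrite EX in X0. rewrite EY in Y0. unfold xh, yh in *. split; [nra|].
  assert (0 < sqrt (1 + S) * mh S u) by (apply Rmult_lt_0_compat; assumption). nra.
Qed.

Lemma angle_section S u x y : 1 < S -> x = xh S u -> y = yh S u -> u = turn1 -> on_section x y.
Proof.
  intros HS -> -> ->. pose proof (mh_pos S turn1 HS) as M0.
  assert (A0 : 0 < sqrt (1 + S)) by (apply sqrt_lt_R0; lra).
  unfold xh, yh. rewrite cos_turn1, sin_turn1. split; [ring|].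
  assert (0 < sqrt (1 + S) * mh S turn1) by (apply Rmult_lt_0_compat; assumption). lra.
Qed.

Lemma mvt_lower (f f' : R -> R) a b k : a <= b ->
  (forall t, a <= t <= b -> is_derive f t (f' t)) -> (forall t, a <= t <= b -> k <= f' t) ->
  k * (b - a) <= f b - f a.
Proof.
  intros Hab D L. destruct (MVT_gen f a b f') as (c & Hc & E).
  - intros z Hz. rewrite Rmin_left, Rmax_right in Hz by exact Hab. apply D. lra.
  - intros z Hz. rewrite Rmin_left, Rmax_right in Hz by exact Hab. apply continuity_pt_filterlim.
    apply (derivable_continuous_R f). eexists. apply D. lra.
  - rewrite Rmin_left, Rmax_right in Hc by exact Hab. rewrite E. apply Rmult_le_compat_r; [lra|].
    apply L, Hc.
Qed.

Lemma reach_value (f : R -> R) b v : 0 < b -> (forall t, 0 <= t <= b -> continuous f t) ->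
  f 0 < v -> v <= f b -> exists t, 0 < t <= b /\ f t = v.
Proof.
  intros Hb C H0 Hv. destruct (Req_dec (f b) v) as [E|E]; [exists b; split; [lra|exact E]|].
  destruct (Ranalysis5.IVT_interv (fun t => f t - v) 0 b) as (t & Ht & Z).
  - intros a Ha. apply continuity_pt_minus; [|apply continuity_pt_const; intros ? ?; reflexivity].
    apply continuity_pt_filterlim, C, Ha.
  - exact Hb.
  - lra.
  - lra.
  - exists t. split; [|lra]. split; [|lra]. destruct (Req_dec t 0) as [E0|E0]; [|lra].
    rewrite E0 in Z. lra.
Qed.

Definition returning_path (p q : R -> R -> R) (e h : R) (x y : R -> R) (T : R) : Prop :=
  0 < T /\ perturbed_solution p q e x y T /\ on_section (x 0) (y 0) /\ H (x 0) (y 0) = h /\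
  on_section (x T) (y T) /\ forall t, 0 < t < T -> ~ on_section (x t) (y t).

(** Up to the time [8 PI / m0], which does not depend on the parameter, the energy stays close to [h] and the angle advances at least at the rate [m0 / 2]. So the section is met again before that time, and the first meeting occurs at the angle [turn1]. *)
Lemma return_follows_oval h K : 0 < h -> 0 <= K -> exists Tm, 0 < Tm /\
  forall eta, 0 < eta -> exists del, 0 < del /\
  forall p q e x y T, path_continuous p -> path_continuous q -> cubic_growth K p -> cubic_growth K q ->
    Rabs e < del -> returning_path p q e h x y T ->
    T <= Tm /\ follows_oval (energyS h) eta T x y.
Proof.
  intros Hh HK. set (S0 := energyS h). assert (HS0 : 1 < S0) by (apply energyS_gt1, Hh).
  destruct (spin_bound S0 K HS0) as (B & HB & Bd).
  set (m0 := sqrt ((S0 - 1) / 4)). assert (M0 : 0 < m0) by (apply sqrt_lt_R0; lra).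
  pose proof PI_RGT_0 as PI0.
  exists (8 * PI / m0). assert (HTm : 0 < 8 * PI / m0) by (apply Rdiv_lt_0_compat; lra).
  set (Tm := 8 * PI / m0) in *. split; [exact HTm|].
  intros eta Heta. set (eta' := Rmin eta ((S0 - 1) / 2)).
  assert (E0 : 0 < eta') by (apply Rmin_glb_lt; lra).
  assert (E1 : eta' <= eta) by apply Rmin_l. assert (E2 : eta' <= (S0 - 1) / 2) by apply Rmin_r.
  destruct (energy_drift h K Tm Hh HK ltac:(lra) eta' E0) as (d & Hd & Dr).
  set (k := Rmin eta (m0 / 2)). assert (K0 : 0 < k) by (apply Rmin_glb_lt; lra).
  assert (K1 : k <= eta) by apply Rmin_l. assert (K2 : k <= m0 / 2) by apply Rmin_r.
  exists (Rmin d (k / B)). split; [apply Rmin_glb_lt; [exact Hd|apply Rdiv_lt_0_compat; assumption]|].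
  intros p q e x y T Cp Cq Gp Gq He (HT & Hs & On0 & H0 & OnT & No).
  pose proof (Rmin_l d (k / B)) as Md. pose proof (Rmin_r d (k / B)) as Mk.
  set (T' := Rmin T Tm). assert (T1 : T' <= T) by apply Rmin_l. assert (T2 : T' <= Tm) by apply Rmin_r.
  assert (T0 : 0 < T') by (apply Rmin_glb_lt; assumption).
  assert (NearS : forall t, 0 <= t <= T' -> Rabs (rootH (x t) (y t) - S0) < eta').
  { intros t Ht. apply (Dr p q e x y T t); try assumption; lra. }
  assert (S1 : forall t, 0 <= t <= T' -> 1 < rootH (x t) (y t)).
  { intros t Ht. pose proof (NearS t Ht) as N. apply Rabs_lt_between in N. lra. }
  assert (HP : forall t, 0 <= t <= T' -> 0 < H (x t) (y t)).
  { intros t Ht. apply Rnot_le_lt. intros N. specialize (S1 t Ht). unfold rootH in S1.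
    pose proof (sqrt_le_1_alt (1 + 4 * H (x t) (y t)) 1 ltac:(lra)) as L. rewrite sqrt_1 in L. lra. }
  destruct (angle_of_solution p q e x y T' Cp Cq ltac:(lra) (perturbed_solution_le _ _ _ _ _ _ _ T1 Hs) On0 HP)
    as (th & Th0 & Dth & Eth).
  set (w := fun t => speed (x t) (y t) + e * spin (x t) (y t) (p (x t) (y t)) (q (x t) (y t))).
  assert (Small : forall t, 0 <= t <= T' ->
    Rabs (e * spin (x t) (y t) (p (x t) (y t)) (q (x t) (y t))) <= k).
  { intros t Ht. rewrite Rabs_mult.
    assert (Rabs (spin (x t) (y t) (p (x t) (y t)) (q (x t) (y t))) <= B).
    { apply Bd; [assumption..|apply HP, Ht|]. pose proof (NearS t Ht). lra. }
    apply Rle_trans with (k / B * B); [|right; field; lra].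
    apply Rmult_le_compat; try apply Rabs_pos; lra. }
  assert (Wlow : forall t, 0 <= t <= T' -> m0 / 2 <= w t).
  { intros t Ht. pose proof (Small t Ht) as B1. apply Rabs_le_between in B1.
    assert (m0 <= speed (x t) (y t)).
    { apply sqrt_le_1_alt. pose proof (NearS t Ht) as N. apply Rabs_lt_between in N.
      pose proof (pow2_ge_0 (x t)). lra. }
    unfold w. lra. }
  assert (Cth : forall t, 0 <= t <= T' -> continuous th t).
  { intros t Ht. apply (derivable_continuous_R th).
    eexists. apply Dth, Ht. }
  assert (NoTurn : forall t, 0 < t <= T' -> t < T -> th t <> turn1).
  { intros t Ht HtT E. apply (No t); [lra|]. destruct (Eth t ltac:(lra)) as (EX & EY & _).
    apply (angle_section (rootH (x t) (y t)) (th t)); [apply S1; lra|assumption..]. }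
  assert (Inc : m0 / 2 * (T' - 0) <= th T' - th 0).
  { apply (mvt_lower th w); [lra|exact Dth|exact Wlow]. }
  assert (TT : T <= Tm).
  (* otherwise the angle would advance by 4 PI and pass the section on the way *)
  { apply Rnot_lt_le. intros L. assert (ET : T' = Tm) by (apply Rmin_right; lra).
    assert (m0 / 2 * (T' - 0) = 4 * PI) by (rewrite ET; unfold Tm; field; lra).
    destruct (reach_value th T' turn1) as (t & Ht & E); [exact T0|exact Cth| | |].
    - rewrite Th0. unfold turn0, turn1. lra.
    - unfold turn0, turn1 in *. lra.
    - apply (NoTurn t Ht); [lra|exact E]. }
  assert (ET : T' = T) by (apply Rmin_left, TT).
  split; [exact TT|].
  rewrite ET in *. clear T1 T2 T0 ET.
  exists th, w. split; [exact Th0|]. split.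
  - destruct (Eth T ltac:(lra)) as (EX & EY & _).
    destruct (section_angle _ _ _ _ (S1 T ltac:(lra)) EX EY OnT) as [C1 C2].
    apply full_turn; [assumption..|]. split.
    + assert (0 < m0 / 2 * (T - 0)) by (apply Rmult_lt_0_compat; lra). lra.
    + apply Rnot_lt_le. intros L.
      destruct (reach_value th T turn1) as (t & Ht & E); [exact HT|exact Cth| |lra|].
      * rewrite Th0. unfold turn0, turn1. lra.
      * apply (NoTurn t Ht); [|exact E]. destruct (Req_dec t T) as [Et|Et]; [|lra].
        rewrite Et in E. lra.
  - intros t Ht. destruct (Eth t Ht) as (EX & EY & EM).
    split; [apply S1, Ht|]. split; [pose proof (NearS t Ht); lra|]. split; [apply Dth, Ht|].
    split; [|split; [|split; assumption]].
    + destruct (Hs t Ht) as [Dx Dy].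
      assert (C : path_continuous (fun x y => speed x y + e * spin x y (p x y) (q x y))).
      { path_cont. apply path_continuous_spin; assumption. }
      apply (C x y t); [| |apply HP, Ht];
        apply derivable_continuous_R; eexists; eassumption.
    + rewrite <- EM. unfold w.
      match goal with |- Rabs (?a + ?b - ?a) <= _ => replace (a + b - a) with b by ring end.
      pose proof (Small t Ht). lra.
Qed.

(** * Averaging along a return *)

Lemma rootH_gt1_inv x y : 1 < rootH x y -> 0 < H x y.
Proof.
  intros S1. apply Rnot_le_lt. intros N. unfold rootH in S1.
  pose proof (sqrt_le_1_alt (1 + 4 * H x y) 1 ltac:(lra)) as L. rewrite sqrt_1 in L. lra.
Qed.

(** Change of variable from time to angle: the integral of [G (theta) theta'] is exact, and the integrand differs little from it. *)
Lemma average_along S0 Tm L : 1 < S0 -> 0 < Tm -> regular S0 L -> forall eps, 0 < eps ->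
  exists eta, 0 < eta /\ forall Om x y T, 0 < T <= Tm -> follows_oval S0 eta T x y ->
    (forall t, 0 <= t <= T -> continuous x t) -> (forall t, 0 <= t <= T -> continuous y t) ->
    path_continuous Om ->
    (forall t, 0 <= t <= T -> Rabs (Om (x t) (y t) - L (x t) (y t)) <= eta) ->
    Rabs (RInt (fun t => Om (x t) (y t)) 0 T - avg S0 (fun u => L (xh S0 u) (yh S0 u))) <= eps.
Proof.
  intros HS HTm (UF & CF & _) eps Heps.
  destruct UF as [[M HM] UF]. destruct (uniform_mh S0 HS) as [_ Um].
  destruct (uniform_inv_mh S0 HS) as [[I0 HI] _].
  assert (M0 : 0 <= M) by (eapply Rle_trans; [apply Rabs_pos|apply (HM 0)]).
  assert (I1 : 0 <= I0) by (eapply Rle_trans; [apply Rabs_pos|apply (HI 0)]).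
  set (k := eps / (Tm * (2 + 2 * (M * I0)))).
  assert (MI : 0 <= M * I0) by (apply Rmult_le_pos; assumption).
  assert (K0 : 0 < k) by (apply Rdiv_lt_0_compat; [exact Heps|apply Rmult_lt_0_compat; lra]).
  destruct (UF k K0) as (d1 & Hd1 & U1). destruct (Um k K0) as (d2 & Hd2 & U2).
  exists (Rmin k (Rmin d1 d2)).
  split; [repeat apply Rmin_glb_lt; assumption|].
  intros Om x y T HT (th & w & Th0 & ThT & Hth) Cx Cy COm Close.
  pose proof (Rmin_l k (Rmin d1 d2)). pose proof (Rmin_r k (Rmin d1 d2)).
  pose proof (Rmin_l d1 d2). pose proof (Rmin_r d1 d2).
  set (eta := Rmin k (Rmin d1 d2)) in *.
  set (G := fun u => L (xh S0 u) (yh S0 u) / mh S0 u).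
  assert (CG : forall u, continuous G u) by (intros u; apply continuous_div_mh; [exact HS|apply CF]).
  assert (IG : is_RInt (fun t => scal (w t) (G (th t))) 0 T (RInt G turn0 turn1)).
  { rewrite <- Th0, <- ThT. apply (is_RInt_comp (V := R_CompleteNormedModule) G th w).
    - intros t _. apply CG.
    - intros t Ht. rewrite Rmin_left, Rmax_right in Ht by lra.
      destruct (Hth t Ht) as (_ & _ & D & C & _). split; assumption. }
  assert (IO : ex_RInt (fun t => Om (x t) (y t)) 0 T).
  { apply ex_RInt_continuous_R. intros t Ht.
    rewrite Rmin_left, Rmax_right in Ht by lra. apply COm; [apply Cx, Ht|apply Cy, Ht|].
    apply rootH_gt1_inv, Hth, Ht. }
  pose proof (RInt_correct (V := R_CompleteNormedModule) _ _ _ IO) as IO'.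
  pose proof (is_RInt_minus (V := R_NormedModule) _ _ _ _ _ _ IO' IG) as ID.
  assert (EQ : RInt (fun t => minus (Om (x t) (y t)) (scal (w t) (G (th t)))) 0 T =
    minus (RInt (fun t => Om (x t) (y t)) 0 T) (RInt G turn0 turn1))
    by (apply (is_RInt_unique (V := R_CompleteNormedModule)), ID).
  change (Rabs (minus (RInt (fun t => Om (x t) (y t)) 0 T) (RInt G turn0 turn1)) <= eps).
  rewrite <- EQ.
  apply Rle_trans with ((T - 0) * (k + k + M * I0 * (2 * k))).
  - apply abs_RInt_le_const; [lra|eexists; exact ID|].
    intros t Ht. destruct (Hth t Ht) as (S1 & NS & _ & _ & NW & EX & EY).
    set (S := rootH (x t) (y t)) in *. set (u := th t) in *.
    specialize (Close t Ht).
    pose proof (U1 S u S1 ltac:(lra)) as B1. pose proof (U2 S u S1 ltac:(lra)) as B2.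
    rewrite <- EX, <- EY in B1.
    pose proof (mh_pos S0 u HS) as P.
    change (Rabs (Om (x t) (y t) - w t * G u) <= k + k + M * I0 * (2 * k)).
    replace (Om (x t) (y t) - w t * G u) with
      ((Om (x t) (y t) - L (x t) (y t)) + (L (x t) (y t) - L (xh S0 u) (yh S0 u))
       + L (xh S0 u) (yh S0 u) * (/ mh S0 u) * - ((w t - mh S u) + (mh S u - mh S0 u)))
      by (unfold G; field; lra).
    eapply Rle_trans; [apply Rabs_triang|]. apply Rplus_le_compat.
    + eapply Rle_trans; [apply Rabs_triang|]. lra.
    + rewrite !Rabs_mult, Rabs_Ropp. apply Rmult_le_compat; [|apply Rabs_pos| |].
      * apply Rmult_le_pos; apply Rabs_pos.
      * apply Rmult_le_compat; try apply Rabs_pos; [apply HM|apply HI].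
      * eapply Rle_trans; [apply Rabs_triang|]. lra.
  - apply Rle_trans with (Tm * (k + k + M * I0 * (2 * k))).
    + apply Rmult_le_compat_r; [|lra]. assert (0 <= M * I0 * (2 * k)) by (apply Rmult_le_pos; lra). lra.
    + right. unfold k. field. lra.
Qed.

(** ** Convergent families of observables *)

Definition near_level (S0 x y : R) : Prop := 0 < H x y /\ Rabs (rootH x y - S0) < (S0 - 1) / 2.

(** Uniform convergence near the oval. This notion is closed under products, so that polynomial expressions in coefficients depending on the parameter need no expansion into monomials. *)
Definition converges_to (S0 : R) (Om : nat -> R -> R -> R) (L : R -> R -> R) : Prop :=
  (forall n, path_continuous (Om n)) /\ regular S0 L /\
  (exists M, forall x y, near_level S0 x y -> Rabs (L x y) <= M) /\
  forall eps, 0 < eps -> exists N, forall n, (N <= n)%nat ->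
    forall x y, near_level S0 x y -> Rabs (Om n x y - L x y) <= eps.

Lemma converges_fixed S0 L : path_continuous L -> regular S0 L ->
  (exists M, forall x y, near_level S0 x y -> Rabs (L x y) <= M) -> converges_to S0 (fun _ => L) L.
Proof.
  intros C Rg B. split; [intros _; exact C|]. split; [exact Rg|]. split; [exact B|].
  intros eps Heps. exists 0%nat. intros n _ x y _. rewrite Rminus_diag_eq, Rabs_R0 by reflexivity. lra.
Qed.

Lemma near_level_radius S0 x y : 1 < S0 -> near_level S0 x y ->
  sqrt (1 + x ^ 2 + y ^ 2) <= sqrt ((2 * S0) ^ 2 + 3).
Proof.
  intros HS [HH HS1]. apply Rabs_lt_between in HS1. pose proof (rootH_sqr x y HH).
  pose proof (radius_energy x y). apply sqrt_le_1_alt. nra.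
Qed.

Lemma converges_x S0 : 1 < S0 -> converges_to S0 (fun _ x _ => x) (fun x _ => x).
Proof.
  intros HS. apply converges_fixed; [exact path_continuous_x|apply regular_x, HS|].
  exists (sqrt ((2 * S0) ^ 2 + 3)). intros x y HN. pose proof (near_level_radius S0 x y HS HN).
  destruct (radius_bounds x y) as (_ & Rx & _). lra.
Qed.

Lemma converges_y S0 : 1 < S0 -> converges_to S0 (fun _ _ y => y) (fun _ y => y).
Proof.
  intros HS. apply converges_fixed; [exact path_continuous_y|apply regular_y, HS|].
  exists (sqrt ((2 * S0) ^ 2 + 3)). intros x y HN. pose proof (near_level_radius S0 x y HS HN).
  destruct (radius_bounds x y) as (_ & _ & Ry). lra.
Qed.

Lemma converges_phase S0 : 1 < S0 -> converges_to S0 (fun _ => phase) phase.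
Proof.
  intros HS. apply converges_fixed; [exact (proj2 (proj2 (regular_phase S0 HS)))|apply regular_phase, HS|].
  exists PI. intros x y _. unfold phase. apply Rabs_le.
  match goal with |- context [atan ?z] => pose proof (atan_bound z) end. lra.
Qed.

Lemma converges_const S0 (c : nat -> R) (l : R) : is_lim_seq c l -> converges_to S0 (fun n _ _ => c n) (fun _ _ => l).
Proof.
  intros Hc. split; [intros n; apply path_continuous_const|]. split; [apply regular_const|].
  split; [exists (Rabs l); intros; lra|].
  intros eps Heps. apply is_lim_seq_spec in Hc. unfold is_lim_seq' in Hc. destruct (Hc (mkposreal _ Heps)) as [N HN].
  exists N. intros n Hn x y _. left. apply (HN n Hn).
Qed.

Lemma regular_plus S0 Om Om' : regular S0 Om -> regular S0 Om' -> regular S0 (fun x y => Om x y + Om' x y).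
Proof.
  intros ([[M HM] U] & C & P) ([[M' HM'] U'] & C' & P'). split; [split|split].
  - exists (M + M'). intros t. eapply Rle_trans; [apply Rabs_triang|]. specialize (HM t). specialize (HM' t). lra.
  - intros eps Heps. destruct (U (eps / 2) ltac:(lra)) as (d & Hd & H1).
    destruct (U' (eps / 2) ltac:(lra)) as (d' & Hd' & H2).
    exists (Rmin d d'). split; [apply Rmin_glb_lt; assumption|]. intros S t HS HSd.
    pose proof (Rmin_l d d'). pose proof (Rmin_r d d').
    specialize (H1 S t HS ltac:(lra)). specialize (H2 S t HS ltac:(lra)).
    match goal with |- Rabs (?a + ?b - (?c + ?d)) <= _ => replace (a + b - (c + d)) with ((a - c) + (b - d)) by ring end.
    eapply Rle_trans; [apply Rabs_triang|]. lra.
  - intros t. apply (continuous_plus (fun t => Om (xh S0 t) (yh S0 t)) (fun t => Om' (xh S0 t) (yh S0 t)));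
    [apply C|apply C'].
  - apply path_continuous_plus; assumption.
Qed.

Lemma converges_plus S0 Om L Om' L' : converges_to S0 Om L -> converges_to S0 Om' L' ->
  converges_to S0 (fun n x y => Om n x y + Om' n x y) (fun x y => L x y + L' x y).
Proof.
  intros (C & Rg & [M HM] & Cv) (C' & Rg' & [M' HM'] & Cv').
  split; [intros n; apply path_continuous_plus; auto|]. split; [apply regular_plus; assumption|]. split.
  - exists (M + M'). intros x y HN. eapply Rle_trans; [apply Rabs_triang|].
    specialize (HM x y HN). specialize (HM' x y HN). lra.
  - intros eps Heps. destruct (Cv (eps / 2) ltac:(lra)) as [N H1]. destruct (Cv' (eps / 2) ltac:(lra)) as [N' H2].
    exists (max N N'). intros n Hn x y HN.
    specialize (H1 n ltac:(lia) x y HN). specialize (H2 n ltac:(lia) x y HN).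
    match goal with |- Rabs (?a + ?b - (?c + ?d)) <= _ => replace (a + b - (c + d)) with ((a - c) + (b - d)) by ring end.
    eapply Rle_trans; [apply Rabs_triang|]. lra.
Qed.

Lemma converges_mult S0 Om L Om' L' : converges_to S0 Om L -> converges_to S0 Om' L' ->
  converges_to S0 (fun n x y => Om n x y * Om' n x y) (fun x y => L x y * L' x y).
Proof.
  intros (C & Rg & [M HM] & Cv) (C' & Rg' & [M' HM'] & Cv').
  split; [intros n; apply path_continuous_mult; auto|]. split; [apply regular_mult; assumption|]. split.
  - exists (M * M'). intros x y HN. rewrite Rabs_mult.
    apply Rmult_le_compat; try apply Rabs_pos; auto.
  - intros eps Heps.
    set (A := Rabs M + Rabs M' + 1).
    assert (A1 : 1 <= A) by (unfold A; pose proof (Rabs_pos M); pose proof (Rabs_pos M'); lra).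
    set (d := Rmin 1 (eps / A)).
    assert (D0 : 0 < d) by (apply Rmin_glb_lt; [lra|apply Rdiv_lt_0_compat; lra]).
    assert (D1 : d <= 1) by apply Rmin_l.
    assert (D2 : d * A <= eps).
    { apply Rle_trans with (eps / A * A); [apply Rmult_le_compat_r; [lra|apply Rmin_r]|right; field; lra]. }
    destruct (Cv d D0) as [N H1]. destruct (Cv' d D0) as [N' H2].
    exists (max N N'). intros n Hn x y HN.
    specialize (H1 n ltac:(lia) x y HN). specialize (H2 n ltac:(lia) x y HN).
    specialize (HM x y HN). specialize (HM' x y HN).
    pose proof (Rle_abs M). pose proof (Rle_abs M').
    replace (Om n x y * Om' n x y - L x y * L' x y) with
      ((Om n x y - L x y) * (Om' n x y - L' x y) + (Om n x y - L x y) * L' x y + L x y * (Om' n x y - L' x y)) by ring.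
    eapply Rle_trans; [apply Rabs_triang|]. eapply Rle_trans; [apply Rplus_le_compat_r, Rabs_triang|].
    rewrite !Rabs_mult.
    assert (Rabs (Om n x y - L x y) * Rabs (Om' n x y - L' x y) <= d * 1)
      by (apply Rmult_le_compat; try apply Rabs_pos; lra).
    assert (Rabs (Om n x y - L x y) * Rabs (L' x y) <= d * Rabs M')
      by (apply Rmult_le_compat; try apply Rabs_pos; lra).
    assert (Rabs (L x y) * Rabs (Om' n x y - L' x y) <= Rabs M * d)
      by (apply Rmult_le_compat; try apply Rabs_pos; lra).
    unfold A in *. lra.
Qed.

Lemma converges_scal S0 k Om L : converges_to S0 Om L ->
  converges_to S0 (fun n x y => k * Om n x y) (fun x y => k * L x y).
Proof.
  intros C. apply (converges_mult S0 (fun _ _ _ => k) (fun _ _ => k)); [|exact C].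
  apply (converges_const S0 (fun _ => k)), is_lim_seq_const.
Qed.

Lemma converges_minus S0 Om L Om' L' : converges_to S0 Om L -> converges_to S0 Om' L' ->
  converges_to S0 (fun n x y => Om n x y - Om' n x y) (fun x y => L x y - L' x y).
Proof.
  intros C C'.
  assert (N : converges_to S0 (fun n x y => -1 * Om' n x y) (fun x y => -1 * L' x y))
    by (apply converges_scal, C').
  pose proof (converges_plus _ _ _ _ _ C N) as P.
  replace (fun n x y => Om n x y - Om' n x y) with (fun n x y => Om n x y + -1 * Om' n x y)
    by (do 3 (apply functional_extensionality; intro); ring).
  replace (fun x y => L x y - L' x y) with (fun x y => L x y + -1 * L' x y)
    by (do 2 (apply functional_extensionality; intro); ring).
  exact P.
Qed.

Lemma converges_pow S0 Om L k : converges_to S0 Om L ->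
  converges_to S0 (fun n x y => Om n x y ^ k) (fun x y => L x y ^ k).
Proof.
  intros C. induction k as [|k IH].
  - exact (converges_const S0 (fun _ => 1) 1 (is_lim_seq_const 1)).
  - exact (converges_mult _ _ _ _ _ C IH).
Qed.

Lemma average_limit S0 Tm (x y : nat -> R -> R) (T : nat -> R) Om L : 1 < S0 -> 0 < Tm ->
  (forall n, 0 < T n <= Tm) ->
  (forall n t, 0 <= t <= T n -> continuous (x n) t /\ continuous (y n) t) ->
  (forall eta, 0 < eta -> exists N, forall n, (N <= n)%nat -> follows_oval S0 eta (T n) (x n) (y n)) ->
  converges_to S0 Om L ->
  is_lim_seq (fun n => RInt (fun t => Om n (x n t) (y n t)) 0 (T n))
    (avg S0 (fun u => L (xh S0 u) (yh S0 u))).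
Proof.
  intros HS HTm HT Cxy Fol (C & Rg & _ & Cv).
  apply is_lim_seq_spec. unfold is_lim_seq'. intros eps.
  destruct (average_along S0 Tm L HS HTm Rg (eps / 2)) as (eta & Heta & A).
  { pose proof (cond_pos eps). lra. }
  destruct (Cv eta Heta) as [N1 H1].
  set (eta' := Rmin eta ((S0 - 1) / 2)).
  destruct (Fol eta' ltac:(apply Rmin_glb_lt; lra)) as [N2 H2].
  exists (max N1 N2). intros n Hn. specialize (H1 n ltac:(lia)). specialize (H2 n ltac:(lia)).
  apply Rle_lt_trans with (eps / 2); [|pose proof (cond_pos eps); lra].
  assert (E1 : eta' <= eta) by apply Rmin_l. assert (E2 : eta' <= (S0 - 1) / 2) by apply Rmin_r.
  apply A.
  - apply HT.
  - destruct H2 as (th & w & Th0 & ThT & Hth). exists th, w. split; [exact Th0|]. split; [exact ThT|].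
    intros t Ht. destruct (Hth t Ht) as (S1 & NS & D & CW & NW & EX & EY).
    split; [exact S1|]. split; [lra|]. split; [exact D|]. split; [exact CW|]. split; [lra|]. split; assumption.
  - intros t Ht. apply (Cxy n t Ht).
  - intros t Ht. apply (Cxy n t Ht).
  - apply C.
  - intros t Ht. apply H1. destruct H2 as (th & w & Th0 & ThT & Hth).
    destruct (Hth t Ht) as (S1 & NS & _). split; [apply rootH_gt1_inv, S1|lra].
Qed.

(** * The form g dx - f dy near the ovals *)

Definition cubic (c : nat -> nat -> R) (x y : R) : R :=
  sum_n (fun i => sum_n (fun j => c i j * x ^ i * y ^ j) (3 - i)) 3.

Lemma cubic_expand c x y : cubic c x y =
  c 0%nat 0%nat + c 0%nat 1%nat * y + c 0%nat 2%nat * y ^ 2 + c 0%nat 3%nat * y ^ 3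
  + c 1%nat 0%nat * x + c 1%nat 1%nat * (x * y) + c 1%nat 2%nat * (x * y ^ 2)
  + c 2%nat 0%nat * x ^ 2 + c 2%nat 1%nat * (x ^ 2 * y) + c 3%nat 0%nat * x ^ 3.
Proof. unfold cubic. rewrite !sum_Sn, !sum_O. unfold plus. simpl. rewrite ?sum_Sn, ?sum_O. unfold plus. simpl. ring. Qed.

Lemma cubic_growth_of_bound c K : 0 <= K ->
  (forall i j, (i + j <= 3)%nat -> Rabs (c i j) <= K) -> cubic_growth (10 * K) (cubic c).
Proof.
  intros HK Hc x y. rewrite cubic_expand.
  destruct (radius_bounds x y) as (R1 & Rx & Ry). set (r := sqrt (1 + x ^ 2 + y ^ 2)) in *.
  assert (P : forall n z, (n <= 3)%nat -> Rabs z <= r -> Rabs (z ^ n) <= r ^ n).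
  { intros n z _ Hz. rewrite <- RPow_abs. apply pow_incr. split; [apply Rabs_pos|exact Hz]. }
  assert (Q : forall n, (n <= 3)%nat -> r ^ n <= r ^ 3) by (intros n Hn; apply Rle_pow; assumption).
  assert (Mn : forall i j, (i + j <= 3)%nat -> Rabs (c i j * (x ^ i * y ^ j)) <= K * r ^ 3).
  { intros i j Hij. rewrite !Rabs_mult. apply Rmult_le_compat; [apply Rabs_pos| |apply Hc, Hij|].
    - apply Rmult_le_pos; apply Rabs_pos.
    - apply Rle_trans with (r ^ i * r ^ j).
      + apply Rmult_le_compat; try apply Rabs_pos; apply P; (lia || assumption).
      + rewrite <- pow_add. apply Q, Hij. }
  pose proof (Mn 0%nat 0%nat ltac:(lia)) as A00. pose proof (Mn 0%nat 1%nat ltac:(lia)) as A01.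
  pose proof (Mn 0%nat 2%nat ltac:(lia)) as A02. pose proof (Mn 0%nat 3%nat ltac:(lia)) as A03.
  pose proof (Mn 1%nat 0%nat ltac:(lia)) as A10. pose proof (Mn 1%nat 1%nat ltac:(lia)) as A11.
  pose proof (Mn 1%nat 2%nat ltac:(lia)) as A12. pose proof (Mn 2%nat 0%nat ltac:(lia)) as A20.
  pose proof (Mn 2%nat 1%nat ltac:(lia)) as A21. pose proof (Mn 3%nat 0%nat ltac:(lia)) as A30.
  rewrite ?pow_O, ?pow_1, ?Rmult_1_l, ?Rmult_1_r in *.
  repeat (eapply Rle_trans; [apply Rabs_triang|];
    match goal with |- _ <= ?B => idtac end;
    match goal with |- Rabs ?a + Rabs ?b <= _ =>
      apply Rle_trans with (Rabs a + K * r ^ 3); [apply Rplus_le_compat_l; assumption|] end;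
    apply (Rplus_le_reg_r (- (K * r ^ 3)));
    match goal with |- ?a + ?b + - ?b <= _ => replace (a + b + - b) with a by ring end).
  lra.
Qed.

Lemma path_continuous_cubic c : path_continuous (cubic c).
Proof.
  intros x y t Hx Hy HH.
  apply (continuous_ext (fun u =>
    (fun x y => c 0%nat 0%nat + c 0%nat 1%nat * y + c 0%nat 2%nat * y ^ 2 + c 0%nat 3%nat * y ^ 3
    + c 1%nat 0%nat * x + c 1%nat 1%nat * (x * y) + c 1%nat 2%nat * (x * y ^ 2)
    + c 2%nat 0%nat * x ^ 2 + c 2%nat 1%nat * (x ^ 2 * y) + c 3%nat 0%nat * x ^ 3) (x u) (y u))).
  - intros u. symmetry. apply cubic_expand.
  - revert x y t Hx Hy HH. change (path_continuous (fun x y => c 0%nat 0%nat + c 0%nat 1%nat * y + c 0%nat 2%nat * y ^ 2 + c 0%nat 3%nat * y ^ 3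
    + c 1%nat 0%nat * x + c 1%nat 1%nat * (x * y) + c 1%nat 2%nat * (x * y ^ 2)
    + c 2%nat 0%nat * x ^ 2 + c 2%nat 1%nat * (x ^ 2 * y) + c 3%nat 0%nat * x ^ 3)).
    path_cont.
Qed.

Lemma converges_cubic S0 (c : nat -> nat -> nat -> R) (l : nat -> nat -> R) : 1 < S0 ->
  (forall i j, (i + j <= 3)%nat -> is_lim_seq (fun n => c n i j) (l i j)) ->
  converges_to S0 (fun n => cubic (c n)) (cubic l).
Proof.
  intros HS Hc.
  pose proof (converges_x S0 HS) as X. pose proof (converges_y S0 HS) as Y.
  assert (Mn : forall i j, (i + j <= 3)%nat ->
    converges_to S0 (fun n x y => c n i j * x ^ i * y ^ j) (fun x y => l i j * x ^ i * y ^ j)).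
  { intros i j Hij.
    apply (converges_mult S0 (fun n x y => c n i j * x ^ i) _ (fun n x y => y ^ j)).
    - apply (converges_mult S0 (fun n x y => c n i j) _ (fun n x y => x ^ i)).
      + apply (converges_const S0 (fun n => c n i j)), Hc, Hij.
      + exact (converges_pow _ _ _ i X).
    - exact (converges_pow _ _ _ j Y). }
  assert (Sum : forall (F : nat -> nat -> R -> R -> R) (G : nat -> R -> R -> R) N,
    (forall i, (i <= N)%nat -> converges_to S0 (fun n => F i n) (G i)) ->
    converges_to S0 (fun n x y => sum_n (fun i => F i n x y) N) (fun x y => sum_n (fun i => G i x y) N)).
  { intros F G N. induction N as [|N IH]; intros HF.
    - replace (fun (n : nat) (x y : R) => sum_n (fun i => F i n x y) 0) with (F 0%nat)
        by (do 3 (apply functional_extensionality; intro); rewrite sum_O; reflexivity).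
      replace (fun x y : R => sum_n (fun i => G i x y) 0) with (G 0%nat)
        by (do 2 (apply functional_extensionality; intro); rewrite sum_O; reflexivity).
      apply HF. lia.
    - replace (fun (n : nat) (x y : R) => sum_n (fun i => F i n x y) (S N))
        with (fun (n : nat) (x y : R) => sum_n (fun i => F i n x y) N + F (S N) n x y)
        by (do 3 (apply functional_extensionality; intro); rewrite sum_Sn; reflexivity).
      replace (fun x y : R => sum_n (fun i => G i x y) (S N))
        with (fun x y : R => sum_n (fun i => G i x y) N + G (S N) x y)
        by (do 2 (apply functional_extensionality; intro); rewrite sum_Sn; reflexivity).
      apply converges_plus; [apply IH; intros; apply HF; lia|apply HF; lia]. }
  unfold cubic.
  apply (Sum (fun i n x y => sum_n (fun j => c n i j * x ^ i * y ^ j) (3 - i))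
    (fun i x y => sum_n (fun j => l i j * x ^ i * y ^ j) (3 - i))).
  intros i Hi.
  apply (Sum (fun j n x y => c n i j * x ^ i * y ^ j) (fun j x y => l i j * x ^ i * y ^ j)).
  intros j Hj. apply Mn. lia.
Qed.

(** Minus the exterior derivative of [g dx - f dy] contains [x ^ a y ^ (b - 1)] with [b] times this coefficient. So, up to an exact form, [g dx - f dy] is the sum of the [curl f g a b x ^ a y ^ b dx], [b >= 1]. *)
Definition curl (f g : nat -> nat -> R) (a b : nat) : R :=
  g a b + f (S a) (b - 1)%nat * INR (S a) / INR b.

(** The factor of [dH] that remains when [y ^ 2 dx], [x y ^ 2 dx] and [x y dx] are written as exact forms plus multiples of [dH]. *)
Definition weight (f g : nat -> nat -> R) (x y : R) : R :=
  2 * curl f g 0 2 * x + curl f g 1 2 * x ^ 2 - curl f g 1 1 / sqrt 2 * phase x y.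

(** The remaining monomials [y dx], [x ^ 2 y dx] and [y ^ 3 dx], divided by [y dx]. *)
Definition essential (f g : nat -> nat -> R) (x y : R) : R :=
  curl f g 0 1 + curl f g 2 1 * x ^ 2 + curl f g 0 3 * y ^ 2.

(** The terms in the coefficients of [f] and [g] come from integration of the monomials; the others from [y ^ 2 = 2 H + x ^ 2 - x ^ 4 / 2] and, for [x y dx], from the polar angle in the plane of [(x ^ 2 - 1, sqrt 2 y)]. *)
Definition primitive (f g : nat -> nat -> R) (x y : R) : R :=
  - (f 0%nat 0%nat * y + f 0%nat 1%nat * y ^ 2 / 2 + f 0%nat 2%nat * y ^ 3 / 3 + f 0%nat 3%nat * y ^ 4 / 4)
  - x * (f 1%nat 0%nat * y + f 1%nat 1%nat * y ^ 2 / 2 + f 1%nat 2%nat * y ^ 3 / 3)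
  - x ^ 2 * (f 2%nat 0%nat * y + f 2%nat 1%nat * y ^ 2 / 2) - x ^ 3 * (f 3%nat 0%nat * y)
  + (g 0%nat 0%nat * x + g 1%nat 0%nat * x ^ 2 / 2 + g 2%nat 0%nat * x ^ 3 / 3 + g 3%nat 0%nat * x ^ 4 / 4)
  + curl f g 0 2 * (2 * H x y * x + x ^ 3 / 3 - x ^ 5 / 10)
  + curl f g 1 2 * (H x y * x ^ 2 + x ^ 4 / 4 - x ^ 6 / 12)
  + curl f g 1 1 * ((x ^ 2 - 1) * y / 4 - (1 + 4 * H x y) * phase x y / (4 * sqrt 2)).

(** The polar angle: [S ^ 2 d phase = X dY - Y dX] for [X = x ^ 2 - 1], [Y = sqrt 2 y], [S ^ 2 = X ^ 2 + Y ^ 2]. *)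
Lemma is_derive_phase (x y : R -> R) (t X Y : R) : is_derive x t X -> is_derive y t Y ->
  0 < H (x t) (y t) ->
  is_derive (fun u => phase (x u) (y u)) t
    (sqrt 2 * ((x t ^ 2 - 1) * Y - 2 * x t * y t * X) / (1 + 4 * H (x t) (y t))).
Proof.
  intros Dx Dy HH. pose proof (is_derive_rootH x y t X Y Dx Dy HH) as DS.
  pose proof (rootH_gt1 _ _ HH) as S1. pose proof (phase_denominator _ _ HH) as D0.
  fold (rootH (x t) (y t)) in D0. rewrite <- (rootH_sqr _ _ HH).
  set (Z := 2 * ((x t ^ 3 - x t) * X + y t * Y) / rootH (x t) (y t)) in *.
  assert (EZ : Z * rootH (x t) (y t) = 2 * ((x t ^ 3 - x t) * X + y t * Y)) by (unfold Z; field; lra).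
  assert (E2 : rootH (x t) (y t) ^ 2 = (x t ^ 2 - 1) ^ 2 + 2 * y t ^ 2)
    by (rewrite rootH_sqr by exact HH; unfold H; field).
  pose proof sqrt2_sqr as Q2.
  unfold phase. set (S := fun u => rootH (x u) (y u)) in *.
  change (fun u => 2 * atan (sqrt 2 * y u / (sqrt (1 + 4 * H (x u) (y u)) + x u ^ 2 - 1)))
    with (fun u => 2 * atan (sqrt 2 * y u / (S u + x u ^ 2 - 1))).
  change (rootH (x t) (y t)) with (S t) in *. set (s2 := sqrt 2) in *.
  set (q := s2 * y t / (S t + x t ^ 2 - 1)).
  assert (Dq : is_derive (fun u => s2 * y u / (S u + x u ^ 2 - 1)) t
    (s2 * Y / (S t + x t ^ 2 - 1) - s2 * y t * (Z + 2 * x t * X) / (S t + x t ^ 2 - 1) ^ 2)).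
  { clearbody Z. auto_derive.
    - split; [eexists; exact Dy|]. split; [eexists; exact DS|]. split; [eexists; exact Dx|].
      split; [|exact I]. simpl in D0 |- *. lra.
    - replace (Derive (fun u => S u) t) with Z by (symmetry; apply is_derive_unique, DS).
      replace (Derive (fun u => x u) t) with X by (symmetry; apply is_derive_unique, Dx).
      replace (Derive (fun u => y u) t) with Y by (symmetry; apply is_derive_unique, Dy).
      field. simpl in D0 |- *. lra. }
  assert (Q1 : 1 + q ^ 2 = 2 * S t / (S t + x t ^ 2 - 1)).
  { unfold q. replace (1 + (s2 * y t / (S t + x t ^ 2 - 1)) ^ 2) with
      (((S t + x t ^ 2 - 1) ^ 2 + s2 ^ 2 * y t ^ 2) / (S t + x t ^ 2 - 1) ^ 2) by (field; lra).
    rewrite Q2.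
    replace ((S t + x t ^ 2 - 1) ^ 2 + 2 * y t ^ 2) with (2 * S t * (S t + x t ^ 2 - 1))
      by (replace (2 * y t ^ 2) with (S t ^ 2 - (x t ^ 2 - 1) ^ 2) by lra; ring).
    field. lra. }
  assert (Da : is_derive (fun u => 2 * atan (s2 * y u / (S u + x u ^ 2 - 1))) t
    (2 * ((s2 * Y / (S t + x t ^ 2 - 1) - s2 * y t * (Z + 2 * x t * X) / (S t + x t ^ 2 - 1) ^ 2)
      / (1 + q ^ 2)))).
  { apply (is_derive_scal (fun u => atan (s2 * y u / (S u + x u ^ 2 - 1)))).
    apply (is_derive_comp (K := R_AbsRing) (V := R_NormedModule) atan (fun u => s2 * y u / (S u + x u ^ 2 - 1)));
      [|exact Dq].
    auto_derive; [exact I|]. fold q. field. nra. }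
  rewrite Q1 in Da.
  replace (s2 * ((x t ^ 2 - 1) * Y - 2 * x t * y t * X) / S t ^ 2) with
    (2 * ((s2 * Y / (S t + x t ^ 2 - 1) - s2 * y t * (Z + 2 * x t * X) / (S t + x t ^ 2 - 1) ^ 2)
      / (2 * S t / (S t + x t ^ 2 - 1)))); [exact Da|].
  assert (W : S t * ((S t + x t ^ 2 - 1) * Y - y t * (Z + 2 * x t * X))
    = (S t + x t ^ 2 - 1) * ((x t ^ 2 - 1) * Y - 2 * x t * y t * X)).
  { replace (S t * ((S t + x t ^ 2 - 1) * Y - y t * (Z + 2 * x t * X))) with
      (S t ^ 2 * Y + S t * ((x t ^ 2 - 1) * Y - 2 * x t * y t * X) - y t * (Z * S t)) by ring.
    rewrite EZ, E2. ring. }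
  replace (2 * ((s2 * Y / (S t + x t ^ 2 - 1) - s2 * y t * (Z + 2 * x t * X) / (S t + x t ^ 2 - 1) ^ 2)
      / (2 * S t / (S t + x t ^ 2 - 1)))) with
    (s2 * (S t * ((S t + x t ^ 2 - 1) * Y - y t * (Z + 2 * x t * X))) / (S t ^ 2 * (S t + x t ^ 2 - 1)))
    by (field; lra).
  rewrite W. field. lra.
Qed.

(** The form [g dx - f dy] is a total differential up to the essential monomials and a multiple of [dH]. *)
Lemma is_derive_primitive f g (x y : R -> R) (t X Y : R) : is_derive x t X -> is_derive y t Y ->
  0 < H (x t) (y t) ->
  is_derive (fun u => primitive f g (x u) (y u)) t
    (cubic g (x t) (y t) * X - cubic f (x t) (y t) * Y
     - essential f g (x t) (y t) * (y t * X)
     + ((x t ^ 3 - x t) * X + y t * Y) * weight f g (x t) (y t)).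
Proof.
  intros Dx Dy HH. pose proof (is_derive_phase x y t X Y Dx Dy HH) as Dp.
  pose proof (is_derive_H x y t X Y Dx Dy) as DH.
  rewrite !cubic_expand.
  assert (HE : H (x t) (y t) = y t ^ 2 / 2 - x t ^ 2 / 2 + x t ^ 4 / 4) by reflexivity.
  set (Hf := fun u => H (x u) (y u)) in *. set (ph := fun u => phase (x u) (y u)) in *.
  change (H (x t) (y t)) with (Hf t) in *.
  set (k02 := curl f g 0 2). set (k12 := curl f g 1 2). set (k11 := curl f g 1 1).
  unfold primitive. fold k02 k12 k11.
  apply (is_derive_ext (fun u =>
    - (f 0%nat 0%nat * y u + f 0%nat 1%nat * y u ^ 2 / 2 + f 0%nat 2%nat * y u ^ 3 / 3 + f 0%nat 3%nat * y u ^ 4 / 4)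
  - x u * (f 1%nat 0%nat * y u + f 1%nat 1%nat * y u ^ 2 / 2 + f 1%nat 2%nat * y u ^ 3 / 3)
  - x u ^ 2 * (f 2%nat 0%nat * y u + f 2%nat 1%nat * y u ^ 2 / 2) - x u ^ 3 * (f 3%nat 0%nat * y u)
  + (g 0%nat 0%nat * x u + g 1%nat 0%nat * x u ^ 2 / 2 + g 2%nat 0%nat * x u ^ 3 / 3 + g 3%nat 0%nat * x u ^ 4 / 4)
  + k02 * (2 * Hf u * x u + x u ^ 3 / 3 - x u ^ 5 / 10)
  + k12 * (Hf u * x u ^ 2 + x u ^ 4 / 4 - x u ^ 6 / 12)
  + k11 * ((x u ^ 2 - 1) * y u / 4 - (1 + 4 * Hf u) * ph u / (4 * sqrt 2)))); [reflexivity|].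
  pose proof sqrt2_pos as P2. pose proof sqrt2_sqr as Q2.
  set (s2 := sqrt 2) in *.
  set (H' := (x t ^ 3 - x t) * X + y t * Y) in *.
  set (p' := s2 * ((x t ^ 2 - 1) * Y - 2 * x t * y t * X) / (1 + 4 * Hf t)) in *.
  assert (EP : (1 + 4 * Hf t) * p' = s2 * ((x t ^ 2 - 1) * Y - 2 * x t * y t * X))
    by (unfold p'; field; lra).
  unfold essential, weight. fold k02 k12 k11. change (phase (x t) (y t)) with (ph t). fold s2.
  assert (E11 : f 2%nat 0%nat = (k11 - g 1%nat 1%nat) / 2) by (unfold k11, curl; simpl; field).
  assert (E02 : f 1%nat 1%nat = (k02 - g 0%nat 2%nat) * 2) by (unfold k02, curl; simpl; field).
  assert (E12 : f 2%nat 1%nat = k12 - g 1%nat 2%nat) by (unfold k12, curl; simpl; field).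
  unfold curl. simpl (INR _). simpl (_ - 1)%nat.
  clearbody k11 k02 k12. assert (N : 1 + 4 * Hf t <> 0) by lra. rewrite HE in N.
  set (p1 := p') in Dp.
  auto_derive.
  - repeat match goal with |- _ /\ _ => split | |- True => exact I end;
    first [eexists; exact Dx | eexists; exact Dy | eexists; exact DH | eexists; exact Dp].
  - replace (Derive (fun u => x u) t) with X by (symmetry; apply is_derive_unique, Dx).
    replace (Derive (fun u => y u) t) with Y by (symmetry; apply is_derive_unique, Dy).
    replace (Derive (fun u => Hf u) t) with H' by (symmetry; apply is_derive_unique, DH).
    replace (Derive (fun u => ph u) t) with p1 by (symmetry; apply is_derive_unique, Dp).
    unfold p1, p', H'. rewrite E11, E02, E12, HE. field. split; lra.
Qed.

(** * The displacement over a return *)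

Definition flow_essential (f g : nat -> nat -> R) (e x y : R) : R :=
  essential f g x y * (y * (y + e * cubic f x y)).
Definition weighted_rate (f g : nat -> nat -> R) (x y : R) : R :=
  energy_rate (cubic f) (cubic g) x y * weight f g x y.

Lemma path_continuous_phase : path_continuous phase.
Proof. exact (proj2 (proj2 (regular_phase 2 ltac:(lra)))). Qed.

Lemma path_continuous_rate f g : path_continuous (energy_rate (cubic f) (cubic g)).
Proof.
  pose proof (path_continuous_cubic f) as Cf. pose proof (path_continuous_cubic g) as Cg.
  unfold energy_rate.
  apply (path_continuous_plus (fun x y => (x ^ 3 - x) * cubic f x y) (fun x y => y * cubic g x y)).
  - apply (path_continuous_mult (fun x y => x ^ 3 - x) (cubic f)); [path_cont|exact Cf].
  - apply (path_continuous_mult (fun x y => y) (cubic g)); [path_cont|exact Cg].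
Qed.

Lemma path_continuous_weight f g : path_continuous (weight f g).
Proof.
  unfold weight.
  apply (path_continuous_minus (fun x y => 2 * curl f g 0 2 * x + curl f g 1 2 * x ^ 2)
    (fun x y => curl f g 1 1 / sqrt 2 * phase x y)).
  - path_cont.
  - apply (path_continuous_mult (fun x y => curl f g 1 1 / sqrt 2) phase);
    [apply path_continuous_const|exact path_continuous_phase].
Qed.

Lemma path_continuous_flow_essential f g e : path_continuous (flow_essential f g e).
Proof.
  pose proof (path_continuous_cubic f) as Cf. unfold flow_essential, essential.
  apply (path_continuous_mult (fun x y => curl f g 0 1 + curl f g 2 1 * x ^ 2 + curl f g 0 3 * y ^ 2)
    (fun x y => y * (y + e * cubic f x y))); [path_cont|].
  apply (path_continuous_mult (fun x y => y) (fun x y => y + e * cubic f x y)); [path_cont|].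
  apply (path_continuous_plus (fun x y => y) (fun x y => e * cubic f x y)); [path_cont|].
  apply (path_continuous_mult (fun x y => e) (cubic f)); [path_cont|exact Cf].
Qed.

Lemma path_continuous_weighted_rate f g : path_continuous (weighted_rate f g).
Proof.
  apply (path_continuous_mult (energy_rate (cubic f) (cubic g)) (weight f g));
  [apply path_continuous_rate|apply path_continuous_weight].
Qed.

Section Displacement.
Variables (f g : nat -> nat -> R) (e T : R) (x y : R -> R).
Hypothesis HT : 0 <= T.
Hypothesis Sol : perturbed_solution (cubic f) (cubic g) e x y T.
Hypothesis Pos : forall t, 0 <= t <= T -> 0 < H (x t) (y t).

Lemma solution_continuous t : 0 <= t <= T -> continuous x t /\ continuous y t.
Proof.
  intros Ht. destruct (Sol t Ht) as [Dx Dy].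
  split; apply derivable_continuous_R; eexists; eassumption.
Qed.

Lemma is_RInt_along Om : path_continuous Om ->
  is_RInt (fun t => Om (x t) (y t)) 0 T (RInt (fun t => Om (x t) (y t)) 0 T).
Proof.
  intros C. apply (RInt_correct (V := R_CompleteNormedModule)).
  apply ex_RInt_continuous_R. intros t Ht.
  rewrite Rmin_left, Rmax_right in Ht by exact HT.
  apply C; [apply solution_continuous, Ht..|apply Pos, Ht].
Qed.

Lemma total_along (B Om : R -> R -> R) : path_continuous Om ->
  (forall t, 0 <= t <= T -> is_derive (fun u => B (x u) (y u)) t (Om (x t) (y t))) ->
  RInt (fun t => Om (x t) (y t)) 0 T = B (x T) (y T) - B (x 0) (y 0).
Proof.
  intros C D. apply (is_RInt_unique (V := R_CompleteNormedModule)).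
  apply (is_RInt_derive (V := R_CompleteNormedModule) (fun t => B (x t) (y t))).
  - intros t Ht. rewrite Rmin_left, Rmax_right in Ht by exact HT. apply D, Ht.
  - intros t Ht. rewrite Rmin_left, Rmax_right in Ht by exact HT.
    apply C; [apply solution_continuous, Ht..|apply Pos, Ht].
Qed.

Lemma displacement_rate :
  H (x T) (y T) - H (x 0) (y 0) = e * RInt (fun t => energy_rate (cubic f) (cubic g) (x t) (y t)) 0 T.
Proof.
  rewrite <- (total_along H (fun x y => e * energy_rate (cubic f) (cubic g) x y)).
  - apply (is_RInt_unique (V := R_CompleteNormedModule)).
    apply (is_RInt_scal (V := R_NormedModule)), is_RInt_along, path_continuous_rate.
  - apply (path_continuous_mult (fun _ _ => e)); [apply path_continuous_const|apply path_continuous_rate].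
  - intros t Ht. apply (is_derive_energy _ _ _ _ _ T); assumption.
Qed.

(** [is_derive_primitive] along the solution, where [g dx - f dy] is [energy_rate dt] and [dH] is [e * energy_rate dt]. The identity is exact in [e], and this is what makes second order accessible without expanding the solution. *)
Lemma rate_decomposition :
  RInt (fun t => energy_rate (cubic f) (cubic g) (x t) (y t)) 0 T =
  (primitive f g (x T) (y T) - primitive f g (x 0) (y 0))
  + RInt (fun t => flow_essential f g e (x t) (y t)) 0 T
  - e * RInt (fun t => weighted_rate f g (x t) (y t)) 0 T.
Proof.
  set (Om := fun x y => energy_rate (cubic f) (cubic g) x y - flow_essential f g e x y
    + e * weighted_rate f g x y).
  assert (C1 : path_continuous (fun x y => energy_rate (cubic f) (cubic g) x y - flow_essential f g e x y)).
  { apply (path_continuous_minus (energy_rate (cubic f) (cubic g)) (flow_essential f g e));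
    [apply path_continuous_rate|apply path_continuous_flow_essential]. }
  assert (C2 : path_continuous (fun x y => e * weighted_rate f g x y)).
  { apply (path_continuous_mult (fun _ _ => e) (weighted_rate f g));
    [apply path_continuous_const|apply path_continuous_weighted_rate]. }
  assert (C : path_continuous Om) by exact (path_continuous_plus _ _ C1 C2).
  rewrite <- (total_along (primitive f g) Om C).
  - pose proof (is_RInt_along _ (path_continuous_rate f g)) as I1.
    pose proof (is_RInt_along _ (path_continuous_flow_essential f g e)) as I2.
    pose proof (is_RInt_along _ (path_continuous_weighted_rate f g)) as I3.
    set (J1 := RInt (fun t => energy_rate (cubic f) (cubic g) (x t) (y t)) 0 T) in *.
    set (J2 := RInt (fun t => flow_essential f g e (x t) (y t)) 0 T) in *.
    set (J3 := RInt (fun t => weighted_rate f g (x t) (y t)) 0 T) in *.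
    assert (EQ : RInt (fun t => Om (x t) (y t)) 0 T = J1 - J2 + e * J3).
    { apply (is_RInt_unique (V := R_CompleteNormedModule)).
      apply (is_RInt_plus (V := R_NormedModule) _ _ 0 T (J1 - J2) (e * J3)).
      - apply (is_RInt_minus (V := R_NormedModule) _ _ 0 T J1 J2); assumption.
      - apply (is_RInt_scal (V := R_NormedModule) _ 0 T e J3); assumption. }
    assert (Solve : forall a b c d : R, d = a - b + c -> a = d + b - c) by (intros; lra).
    apply Solve, EQ.
  - intros t Ht. destruct (Sol t Ht) as [Dx Dy].
    pose proof (is_derive_primitive f g x y t _ _ Dx Dy (Pos t Ht)) as D.
    match type of D with is_derive _ _ ?l => replace (Om (x t) (y t)) with l; [exact D|] end.
    unfold Om, weighted_rate, flow_essential, energy_rate. ring.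
Qed.
End Displacement.

(** ** Boundary term on the section *)

(** The part of [primitive] multiplied by [curl f g 1 1], on the section, where [1 + 4 H = 1 + 2 y ^ 2]. *)
Definition section_phase (y : R) : R := - y / 4 - (1 + 2 * y ^ 2) * phase 0 y / (4 * sqrt 2).

Lemma primitive_on_section f g y : primitive f g 0 y =
  - f 0%nat 0%nat * y + - (f 0%nat 1%nat / 2) * y ^ 2 + - (f 0%nat 2%nat / 3) * y ^ 3
  + - (f 0%nat 3%nat / 4) * y ^ 4 + curl f g 1 1 * section_phase y.
Proof.
  unfold primitive, section_phase, H. pose proof sqrt2_pos. field. lra.
Qed.

Lemma ex_derive_section_phase y : 0 < y -> ex_derive section_phase y.
Proof.
  intros Hy. unfold section_phase.
  assert (HP : 0 < H 0 y) by (unfold H; nra).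
  pose proof (is_derive_phase (fun _ => 0) (fun u => u) y 0 1
    (is_derive_const (K := R_AbsRing) (V := R_NormedModule) 0 y) (is_derive_id y) HP) as D.
  set (ph := fun u => phase 0 u) in *. change (fun u => phase 0 u) with ph in D.
  change (ex_derive (fun y => - y / 4 - (1 + 2 * y ^ 2) * ph y / (4 * sqrt 2)) y).
  auto_derive. eexists. exact D.
Qed.

Lemma differentiable_increment (b : R -> R) (y0 : R) (eta r : nat -> R) : ex_derive b y0 ->
  is_lim_seq eta y0 -> is_lim_seq (fun n => (eta n - y0) / r n) 0 ->
  is_lim_seq (fun n => (b (eta n) - b y0) / r n) 0.
Proof.
  intros [l Hl] He Hr.
  apply is_derive_Reals in Hl. destruct (Hl 1 Rlt_0_1) as [d Hd].
  apply (is_lim_seq_abs_0). 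
  apply (is_lim_seq_le_le_loc (fun _ => 0) _ (fun n => (Rabs l + 1) * Rabs ((eta n - y0) / r n))).
  - apply is_lim_seq_spec in He. destruct (He d) as [N HN]. exists N. intros n Hn.
    specialize (HN n Hn). split; [apply Rabs_pos|].
    unfold Rdiv. rewrite !Rabs_mult, <- Rmult_assoc.
    apply Rmult_le_compat_r; [apply Rabs_pos|].
    destruct (Req_dec (eta n - y0) 0) as [E|E].
    + replace (eta n) with y0 by lra. rewrite !Rminus_diag_eq, Rabs_R0 by reflexivity. lra.
    + specialize (Hd (eta n - y0) E HN).
      replace (y0 + (eta n - y0)) with (eta n) in Hd by ring.
      replace (b (eta n) - b y0) with ((b (eta n) - b y0) / (eta n - y0) * (eta n - y0)) by (field; exact E).
      rewrite Rabs_mult. apply Rmult_le_compat_r; [apply Rabs_pos|].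
      replace ((b (eta n) - b y0) / (eta n - y0)) with
        (((b (eta n) - b y0) / (eta n - y0) - l) + l) by ring.
      eapply Rle_trans; [apply Rabs_triang|]. lra.
  - apply is_lim_seq_const.
  - replace (Finite 0) with (Rbar_mult (Rabs l + 1) (Rbar_abs 0)).
    + apply is_lim_seq_scal_l, is_lim_seq_abs, Hr.
    + simpl. f_equal. rewrite Rabs_R0. ring.
Qed.

(** The primitive is differentiable in the coordinate of the section, so its increment over a return is at most of the order of the displacement. *)
Lemma primitive_increment (f g : nat -> nat -> nat -> R) (f0 g0 : nat -> nat -> R) (y0 : R) (eta r : nat -> R) :
  0 < y0 ->
  (forall i j, (i + j <= 3)%nat -> is_lim_seq (fun n => f n i j) (f0 i j)) ->
  (forall i j, (i + j <= 3)%nat -> is_lim_seq (fun n => g n i j) (g0 i j)) ->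
  is_lim_seq eta y0 -> is_lim_seq (fun n => (eta n - y0) / r n) 0 ->
  is_lim_seq (fun n => (primitive (f n) (g n) 0 (eta n) - primitive (f n) (g n) 0 y0) / r n) 0.
Proof.
  intros Hy Hf Hg He Hr.
  assert (Term : forall (c : nat -> R) (l : R) b, is_lim_seq c l -> ex_derive b y0 ->
    is_lim_seq (fun n => c n * ((b (eta n) - b y0) / r n)) 0).
  { intros c l b Hc Hb. replace (Finite 0) with (Rbar_mult l 0) by (simpl; f_equal; ring).
    apply is_lim_seq_mult'; [exact Hc|apply differentiable_increment; assumption]. }
  assert (Pw : forall k, ex_derive (fun y => y ^ k) y0) by (intros k; auto_derive; exact I).
  assert (Scal : forall (c : nat -> R) (l k : R), is_lim_seq c l -> is_lim_seq (fun n => - (c n / k)) (- (l / k))).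
  { intros c l k Hc. apply (is_lim_seq_opp (fun n => c n / k) (l / k)).
    unfold Rdiv. apply (is_lim_seq_scal_r c (/ k) l), Hc. }
  apply (is_lim_seq_ext (fun n =>
    - (f n 0%nat 0%nat / 1) * ((eta n ^ 1 - y0 ^ 1) / r n)
    + - (f n 0%nat 1%nat / 2) * ((eta n ^ 2 - y0 ^ 2) / r n)
    + - (f n 0%nat 2%nat / 3) * ((eta n ^ 3 - y0 ^ 3) / r n)
    + - (f n 0%nat 3%nat / 4) * ((eta n ^ 4 - y0 ^ 4) / r n)
    + curl (f n) (g n) 1 1 * ((section_phase (eta n) - section_phase y0) / r n))).
  { intros n. rewrite !primitive_on_section. unfold Rdiv. rewrite Rinv_1. ring. }
  replace (Finite 0) with (Finite (0 + 0 + 0 + 0 + 0)) by (f_equal; ring).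
  repeat apply is_lim_seq_plus'.
  - apply (Term (fun n => - (f n 0%nat 0%nat / 1)) _ (fun y => y ^ 1) (Scal _ _ 1 (Hf 0%nat 0%nat ltac:(lia))) (Pw 1%nat)).
  - apply (Term (fun n => - (f n 0%nat 1%nat / 2)) _ (fun y => y ^ 2) (Scal _ _ 2 (Hf 0%nat 1%nat ltac:(lia))) (Pw 2%nat)).
  - apply (Term (fun n => - (f n 0%nat 2%nat / 3)) _ (fun y => y ^ 3) (Scal _ _ 3 (Hf 0%nat 2%nat ltac:(lia))) (Pw 3%nat)).
  - apply (Term (fun n => - (f n 0%nat 3%nat / 4)) _ (fun y => y ^ 4) (Scal _ _ 4 (Hf 0%nat 3%nat ltac:(lia))) (Pw 4%nat)).
  - apply (Term (fun n => curl (f n) (g n) 1 1) (curl f0 g0 1 1)); [|apply ex_derive_section_phase, Hy].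
    unfold curl. apply is_lim_seq_plus'; [apply Hg; lia|].
    unfold Rdiv.
    apply (is_lim_seq_mult' (fun n => f n 2%nat (1 - 1)%nat * INR 2) (fun n => / INR 1)); [|apply is_lim_seq_const].
    apply is_lim_seq_mult'; [apply Hf; simpl; lia|apply is_lim_seq_const].
Qed.

(** * Expansions in the parameter *)

Lemma CV_radius_pos (a : nat -> R) x : x <> 0 -> ex_pseries a x -> Rbar_lt 0 (CV_radius a).
Proof.
  intros Hx Ha. apply Rbar_lt_le_trans with (Rabs x); [apply Rabs_pos_lt, Hx|].
  apply Rbar_not_lt_le. intros L. apply (CV_disk_outside a x L).
  apply ex_series_lim_0, ex_pseries_R, Ha.
Qed.

Lemma is_derive_PSeries_0 a : Rbar_lt 0 (CV_radius a) -> is_derive (PSeries a) 0 (a 1%nat).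
Proof.
  intros Ha. pose proof (is_derive_PSeries a 0) as D. rewrite Rabs_R0 in D. specialize (D Ha).
  rewrite PSeries_0 in D. unfold PS_derive in D. simpl in D. rewrite Rmult_1_l in D. exact D.
Qed.

Lemma analytic_ex_derive c : analytic_at_0 c -> ex_derive c 0.
Proof.
  intros (u & r & Hr & Hu). exists (u 1%nat).
  assert (P : Rbar_lt 0 (CV_radius u)).
  { apply (CV_radius_pos u (r / 2)); [lra|]. exists (c (r / 2)). apply Hu. rewrite Rabs_right; lra. }
  apply (is_derive_ext_loc (PSeries u)); [|apply is_derive_PSeries_0, P].
  exists (mkposreal r Hr). intros z Hz. apply is_pseries_unique, Hu.
  unfold ball in Hz. simpl in Hz. unfold AbsRing_ball, abs, minus, plus, opp in Hz. simpl in Hz.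
  rewrite Ropp_0, Rplus_0_r in Hz. exact Hz.
Qed.

Lemma difference_quotient (f : R -> R) (l : R) (e : nat -> R) : is_derive f 0 l ->
  is_lim_seq e 0 -> (forall n, e n <> 0) -> is_lim_seq (fun n => (f (e n) - f 0) / e n) l.
Proof.
  intros D He Hn. apply is_derive_Reals in D. apply is_lim_seq_spec. intros eps.
  destruct (D eps (cond_pos eps)) as [d Hd]. apply is_lim_seq_spec in He.
  destruct (He d) as [N HN]. exists N. intros n Hn'. specialize (HN n Hn'). rewrite Rminus_0_r in HN.
  specialize (Hd (e n) (Hn n) HN). rewrite Rplus_0_l in Hd. exact Hd.
Qed.

Lemma lim_of_ex_derive (f : R -> R) (e : nat -> R) : ex_derive f 0 -> is_lim_seq e 0 ->
  is_lim_seq (fun n => f (e n)) (f 0).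
Proof.
  intros D He. apply is_lim_seq_continuous; [|exact He].
  apply continuity_pt_filterlim, derivable_continuous_R, D.
Qed.

Lemma pseries_limits (a : nat -> R) (e c : nat -> R) : is_lim_seq e 0 -> (forall n, e n <> 0) ->
  (forall n, is_pseries a (e n) (c n)) ->
  is_lim_seq c (a 0%nat) /\ is_lim_seq (fun n => (c n - a 0%nat) / e n) (a 1%nat).
Proof.
  intros He Hn Hc.
  assert (P : is_derive (PSeries a) 0 (a 1%nat)).
  { apply is_derive_PSeries_0, (CV_radius_pos a (e 0%nat)); [apply Hn|]. eexists. apply Hc. }
  split.
  - rewrite <- (PSeries_0 a). apply (is_lim_seq_ext (fun n => PSeries a (e n))).
    + intros n. apply is_pseries_unique, Hc.
    + apply lim_of_ex_derive; [eexists; exact P|exact He].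
  - apply (is_lim_seq_ext (fun n => (PSeries a (e n) - PSeries a 0) / e n)).
    + intros n. rewrite PSeries_0, (is_pseries_unique _ _ _ (Hc n)). reflexivity.
    + apply difference_quotient; assumption.
Qed.

(** Finitely many bounds near zero combine into one; [Q i K e] stands for a bound by [K], which may be increased. *)
Lemma uniform_bound (Q : nat -> R -> R -> Prop) N :
  (forall i K K' e, K <= K' -> Q i K e -> Q i K' e) ->
  (forall i, (i <= N)%nat -> exists K d, 0 < d /\ forall e, Rabs e < d -> Q i K e) ->
  exists K d, 0 < d /\ forall i e, (i <= N)%nat -> Rabs e < d -> Q i K e.
Proof.
  intros Mono. induction N as [|N IH]; intros HQ.
  - destruct (HQ 0%nat (le_n _)) as (K & d & Hd & H1). exists K, d. split; [exact Hd|].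
    intros i e Hi He. replace i with 0%nat by lia. apply H1, He.
  - destruct IH as (K & d & Hd & H1); [intros; apply HQ; lia|].
    destruct (HQ (S N) (le_n _)) as (K' & d' & Hd' & H2).
    exists (Rmax K K'), (Rmin d d'). split; [apply Rmin_glb_lt; assumption|].
    intros i e Hi He. pose proof (Rmin_l d d'). pose proof (Rmin_r d d').
    destruct (Nat.eq_dec i (S N)) as [->|E].
    + apply (Mono _ K'); [apply Rmax_r|apply H2; lra].
    + apply (Mono _ K); [apply Rmax_l|apply H1; [lia|lra]].
Qed.

Lemma coefficients_bounded (c : nat -> nat -> R -> R) :
  (forall i j, (i + j <= 3)%nat -> ex_derive (c i j) 0) ->
  exists K d, 0 < d /\ forall e, Rabs e < d -> forall i j, (i + j <= 3)%nat -> Rabs (c i j e) <= K.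
Proof.
  intros Hc.
  destruct (uniform_bound (fun i K e => forall j, (i + j <= 3)%nat -> Rabs (c i j e) <= K) 3)
    as (K & d & Hd & H1).
  - intros i K K' e HK Hi j Hj. specialize (Hi j Hj). lra.
  - intros i Hi.
    destruct (uniform_bound (fun j K e => Rabs (c i j e) <= K) (3 - i)) as (K & d & Hd & H1).
    + intros; lra.
    + intros j Hj.
      assert (C : continuous (c i j) 0)
        by (apply derivable_continuous_R, Hc; lia).
      destruct (continuous_del _ _ C 1 Rlt_0_1) as (d & Hd & H1).
      exists (Rabs (c i j 0) + 1), d. split; [exact Hd|]. intros e He.
      specialize (H1 e ltac:(rewrite Rminus_0_r; exact He)).
      replace (c i j e) with (c i j 0 + (c i j e - c i j 0)) by ring.
      eapply Rle_trans; [apply Rabs_triang|]. lra.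
    + exists K, d. split; [exact Hd|]. intros e He j Hj. apply H1; [lia|exact He].
  - exists K, d. split; [exact Hd|]. intros e He i j Hij. apply H1; [lia|exact He|exact Hij].
Qed.

(** ** Observables whose averages lie in the period module *)

(** Observables whose averages are in the module, with the continuity that makes averaging linear. *)
Definition period_observable (Om : R -> R -> R) : Prop :=
  (forall h t, 0 < h -> continuous (fun t => Om (xh (energyS h) t) (yh (energyS h) t)) t) /\
  in_period_module (fun h => avg (energyS h) (fun t => Om (xh (energyS h) t) (yh (energyS h) t))).

Lemma period_observable_comb p q Om Om' : period_observable Om -> period_observable Om' ->
  period_observable (fun x y => p * Om x y + q * Om' x y).
Proof.
  intros [C P] [C' P']. split.
  - intros h t Hh.
    apply (continuous_plus (fun t => p * Om (xh (energyS h) t) (yh (energyS h) t))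
      (fun t => q * Om' (xh (energyS h) t) (yh (energyS h) t)));
    apply continuous_scal_R; [apply C, Hh|apply C', Hh].
  - refine (in_module_ext _ _ _ (in_module_plus _ _ (in_module_scal p _ P) (in_module_scal q _ P'))).
    intros h Hh. symmetry.
    apply (avg_lin2 (energyS h) (fun t => Om (xh (energyS h) t) (yh (energyS h) t))
      (fun t => Om' (xh (energyS h) t) (yh (energyS h) t)) p q (energyS_gt1 h Hh));
    intros t; [apply C, Hh|apply C', Hh].
Qed.

Lemma period_observable_ext Om Om' : (forall x y, Om x y = Om' x y) ->
  period_observable Om -> period_observable Om'.
Proof.
  intros E. replace Om' with Om; [exact (fun H => H)|].
  do 2 (apply functional_extensionality; intro). apply E.
Qed.

Lemma period_observable_mu i j : in_period_module (fun h => mu (energyS h) i j) ->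
  period_observable (fun x y => x ^ i * y ^ j).
Proof.
  intros P. split; [|exact P]. intros h t Hh. apply continuous_monomial, energyS_gt1, Hh.
Qed.

Lemma period_observable_nu i j : in_period_module (fun h => nu (energyS h) i j) ->
  period_observable (fun x y => phase x y * (x ^ i * y ^ j)).
Proof.
  intros P.
  assert (E : forall h, 0 < h -> forall t,
    phase_hat (energyS h) t * (xh (energyS h) t ^ i * yh (energyS h) t ^ j)
    = phase (xh (energyS h) t) (yh (energyS h) t) * (xh (energyS h) t ^ i * yh (energyS h) t ^ j)).
  { intros h Hh t. rewrite phase_eq by (apply energyS_gt1, Hh). reflexivity. }
  split.
  - intros h t Hh. eapply continuous_ext; [apply (E h Hh)|].
    apply continuous_phase_monomial, energyS_gt1, Hh.
  - refine (in_module_ext _ _ _ P). intros h Hh. apply avg_ext, E, Hh.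
Qed.

Ltac solve_moment :=
  lazymatch goal with
  | |- in_period_module (fun h => mu _ 2 0) => exact in_module_mu20
  | |- in_period_module (fun h => mu _ 4 0) => exact in_module_mu40
  | |- in_period_module (fun h => mu _ 2 2) => exact in_module_mu22
  | |- in_period_module (fun h => mu _ 6 0) => exact in_module_mu60
  | |- in_period_module (fun h => mu _ 4 2) => exact in_module_mu42
  | |- in_period_module (fun h => mu _ 8 0) => exact in_module_mu80
  | |- in_period_module (fun h => mu _ 6 2) => exact in_module_mu62
  | |- in_period_module (fun h => mu _ 2 4) => exact in_module_mu24
  | |- in_period_module (fun h => nu _ 0 1) => exact in_module_nu01
  | |- in_period_module (fun h => nu _ 2 1) => exact in_module_nu21
  | |- in_period_module (fun h => nu _ 4 1) => exact in_module_nu41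
  | |- in_period_module (fun h => nu _ 0 3) => exact in_module_nu03
  | |- in_period_module (fun h => mu _ _ _) => apply in_module_mu_odd;
      (left; apply Nat.odd_spec; reflexivity) || (right; apply Nat.odd_spec; reflexivity)
  | |- in_period_module (fun h => nu _ _ _) => apply in_module_nu_odd;
      (left; apply Nat.odd_spec; reflexivity) || (right; apply Nat.even_spec; reflexivity)
  end.

(** These are the monomials of [weighted_rate], where a monomial [x ^ i y ^ j] of [f] is multiplied by [x ^ 3 - x], one of [g] by [y], and both by the terms [x], [x ^ 2] and [phase] of [weight]. *)
Lemma second_order_moments i j : (i + j <= 3)%nat ->
  (in_period_module (fun h => mu (energyS h) (i + 4) j) /\
   in_period_module (fun h => mu (energyS h) (i + 2) j) /\
   in_period_module (fun h => mu (energyS h) (i + 5) j) /\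
   in_period_module (fun h => mu (energyS h) (i + 3) j) /\
   in_period_module (fun h => nu (energyS h) (i + 3) j) /\
   in_period_module (fun h => nu (energyS h) (i + 1) j) /\
   in_period_module (fun h => mu (energyS h) (i + 1) (j + 1)) /\
   in_period_module (fun h => mu (energyS h) (i + 2) (j + 1)) /\
   in_period_module (fun h => nu (energyS h) i (j + 1)))%nat.
Proof.
  intros Hij.
  destruct i as [|[|[|[|i]]]]; [..|lia]; destruct j as [|[|[|[|j]]]]; try lia; simpl Nat.add;
  repeat match goal with |- _ /\ _ => split end; solve_moment.
Qed.

Lemma period_observable_cubic (A : R -> R -> R) c :
  (forall i j, (i + j <= 3)%nat -> period_observable (fun x y => A x y * (x ^ i * y ^ j))) ->
  period_observable (fun x y => cubic c x y * A x y).
Proof.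
  intros HA.
  pose proof (HA 0%nat 0%nat ltac:(lia)) as A00. pose proof (HA 0%nat 1%nat ltac:(lia)) as A01.
  pose proof (HA 0%nat 2%nat ltac:(lia)) as A02. pose proof (HA 0%nat 3%nat ltac:(lia)) as A03.
  pose proof (HA 1%nat 0%nat ltac:(lia)) as A10. pose proof (HA 1%nat 1%nat ltac:(lia)) as A11.
  pose proof (HA 1%nat 2%nat ltac:(lia)) as A12. pose proof (HA 2%nat 0%nat ltac:(lia)) as A20.
  pose proof (HA 2%nat 1%nat ltac:(lia)) as A21. pose proof (HA 3%nat 0%nat ltac:(lia)) as A30.
  pose proof (period_observable_comb (c 0%nat 0%nat) (c 0%nat 1%nat) _ _ A00 A01) as B1.
  pose proof (period_observable_comb 1 (c 0%nat 2%nat) _ _ B1 A02) as B2.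
  pose proof (period_observable_comb 1 (c 0%nat 3%nat) _ _ B2 A03) as B3.
  pose proof (period_observable_comb 1 (c 1%nat 0%nat) _ _ B3 A10) as B4.
  pose proof (period_observable_comb 1 (c 1%nat 1%nat) _ _ B4 A11) as B5.
  pose proof (period_observable_comb 1 (c 1%nat 2%nat) _ _ B5 A12) as B6.
  pose proof (period_observable_comb 1 (c 2%nat 0%nat) _ _ B6 A20) as B7.
  pose proof (period_observable_comb 1 (c 2%nat 1%nat) _ _ B7 A21) as B8.
  pose proof (period_observable_comb 1 (c 3%nat 0%nat) _ _ B8 A30) as B9.
  refine (period_observable_ext _ _ _ B9). intros x y. rewrite cubic_expand. simpl. ring.
Qed.

Lemma period_observable_weighted_rate f g : period_observable (weighted_rate f g).
Proof.
  set (a := 2 * curl f g 0 2). set (b := curl f g 1 2). set (c := - (curl f g 1 1 / sqrt 2)).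
  assert (P1 : period_observable (fun x y => cubic f x y * ((x ^ 3 - x) * weight f g x y))).
  { apply (period_observable_cubic (fun x y => (x ^ 3 - x) * weight f g x y)). intros i j Hij.
    destruct (second_order_moments i j Hij) as (M1 & M2 & M3 & M4 & N1 & N2 & _).
    apply period_observable_mu in M1, M2, M3, M4. apply period_observable_nu in N1, N2.
    refine (period_observable_ext _ _ _ (period_observable_comb 1 1 _ _
      (period_observable_comb a (- a) _ _ M1 M2) (period_observable_comb 1 1 _ _
      (period_observable_comb b (- b) _ _ M3 M4) (period_observable_comb c (- c) _ _ N1 N2)))).
    intros x y. unfold weight. fold a b.
    replace (curl f g 1 1 / sqrt 2) with (- c) by (unfold c; ring). rewrite !pow_add. ring. }
  assert (P2 : period_observable (fun x y => cubic g x y * (y * weight f g x y))).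
  { apply (period_observable_cubic (fun x y => y * weight f g x y)). intros i j Hij.
    destruct (second_order_moments i j Hij) as (_ & _ & _ & _ & _ & _ & M1 & M2 & N1).
    apply period_observable_mu in M1, M2. apply period_observable_nu in N1.
    refine (period_observable_ext _ _ _ (period_observable_comb 1 1 _ _
      (period_observable_comb a b _ _ M1 M2) (period_observable_comb c 0 _ _ N1 N1))).
    intros x y. unfold weight. fold a b.
    replace (curl f g 1 1 / sqrt 2) with (- c) by (unfold c; ring). rewrite !pow_add. ring. }
  refine (period_observable_ext _ _ _ (period_observable_comb 1 1 _ _ P1 P2)).
  intros x y. unfold weighted_rate, energy_rate. ring.
Qed.

(** * The second Melnikov function *)

Lemma H_y_eq x y : H_y x y = y.
Proof. apply is_derive_unique. unfold H. auto_derive; [exact I|]. field. Qed.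
Lemma H_x_eq x y : H_x x y = x ^ 3 - x.
Proof. apply is_derive_unique. unfold H. auto_derive; [exact I|]. field. Qed.

Definition at_parameter (c : nat -> nat -> R -> R) (e : R) : nat -> nat -> R := fun i j => c i j e.

Definition cubic_family (c : nat -> nat -> R -> R) (f : R -> R -> R -> R) : Prop :=
  (forall i j, (i + j <= 3)%nat -> ex_derive (c i j) 0) /\
  forall x y e, f x y e = cubic (at_parameter c e) x y.

Lemma cubic_family_exists f : cubic_perturbation f -> exists c, cubic_family c f.
Proof.
  intros (c & Hc & E). exists c. split; [|exact E].
  intros i j Hij. apply analytic_ex_derive, Hc, Hij.
Qed.

Lemma first_return_path cf cg f g e h p : cubic_family cf f -> cubic_family cg g ->
  first_return f g e h p -> exists x y T,
    returning_path (cubic (at_parameter cf e)) (cubic (at_parameter cg e)) e h x y T /\ H (x T) (y T) = p.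
Proof.
  intros [_ Ef] [_ Eg] (x & y & T & HT & Hp & S0 & E0 & ST & ET & No).
  exists x, y, T. split; [|exact ET]. split; [exact HT|]. split; [|split; [exact S0|split; [exact E0|split; [exact ST|exact No]]]].
  intros t Ht. destruct (Hp t Ht) as [Dx Dy]. rewrite H_y_eq, Ef in Dx. rewrite H_x_eq, Eg in Dy.
  split; [exact Dx|]. replace (x t - x t ^ 3) with (- (x t ^ 3 - x t)) by ring. exact Dy.
Qed.

(** First returns for a sequence of parameters tending to zero, all from the level [h]; [a] lists the Melnikov functions at [h]. *)
Record return_sequence (cf cg : nat -> nat -> R -> R) (a : nat -> R) (h : R)
  (e p : nat -> R) (x y : nat -> R -> R) (T : nat -> R) (Tm : R) : Prop := {
  rs_nonzero : forall n, e n <> 0;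
  rs_small : is_lim_seq e 0;
  rs_path : forall n, returning_path (cubic (at_parameter cf (e n))) (cubic (at_parameter cg (e n)))
    (e n) h (x n) (y n) (T n);
  rs_end : forall n, H (x n (T n)) (y n (T n)) = p n;
  rs_time : forall n, T n <= Tm;
  rs_near : forall eta, 0 < eta -> exists N, forall n, (N <= n)%nat ->
    follows_oval (energyS h) eta (T n) (x n) (y n);
  rs_level : forall n t, 0 <= t <= T n -> 0 < H (x n t) (y n t);
  rs_series : forall n, is_pseries a (e n) ((p n - h) / e n) }.

Arguments rs_nonzero {cf cg a h e p x y T Tm}.
Arguments rs_small {cf cg a h e p x y T Tm}.
Arguments rs_path {cf cg a h e p x y T Tm}.
Arguments rs_end {cf cg a h e p x y T Tm}.
Arguments rs_time {cf cg a h e p x y T Tm}.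
Arguments rs_near {cf cg a h e p x y T Tm}.
Arguments rs_level {cf cg a h e p x y T Tm}.
Arguments rs_series {cf cg a h e p x y T Tm}.

Lemma return_sequence_exists cf cg f g M h : cubic_family cf f -> cubic_family cg g ->
  melnikov_functions f g M -> 0 < h ->
  exists e p x y T Tm, return_sequence cf cg (fun k => M (S k) h) h e p x y T Tm.
Proof.
  intros Ff Fg HM Hh.
  destruct (coefficients_bounded cf (proj1 Ff)) as (K1 & d1 & Hd1 & B1).
  destruct (coefficients_bounded cg (proj1 Fg)) as (K2 & d2 & Hd2 & B2).
  set (K := Rabs K1 + Rabs K2).
  assert (K0 : 0 <= K) by (unfold K; pose proof (Rabs_pos K1); pose proof (Rabs_pos K2); lra).
  destruct (return_follows_oval h (10 * K) Hh ltac:(lra)) as (Tm & HTm & Fol).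
  destruct (HM h Hh) as (d3 & Hd3 & Hret).
  destruct (Fol 1 Rlt_0_1) as (d4 & Hd4 & Fol1).
  set (r := Rmin (Rmin d1 d2) (Rmin d3 d4)).
  assert (R0 : 0 < r) by (repeat apply Rmin_glb_lt; assumption).
  assert (Rr : r <= d1 /\ r <= d2 /\ r <= d3 /\ r <= d4).
  { unfold r. pose proof (Rmin_l (Rmin d1 d2) (Rmin d3 d4)). pose proof (Rmin_r (Rmin d1 d2) (Rmin d3 d4)).
    pose proof (Rmin_l d1 d2). pose proof (Rmin_r d1 d2). pose proof (Rmin_l d3 d4). pose proof (Rmin_r d3 d4).
    lra. }
  set (e := fun n => r * (/ 2) ^ S n).
  assert (Pw : forall n, 0 < (/ 2) ^ S n <= / 2).
  { intros n. split; [apply pow_lt; lra|]. simpl.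
    assert ((/ 2) ^ n <= 1) by (rewrite <- (pow1 n); apply pow_incr; lra). lra. }
  assert (E0 : forall n, 0 < e n < r) by (intros n; specialize (Pw n); unfold e; nra).
  assert (Ea : forall n, Rabs (e n) < r) by (intros n; specialize (E0 n); rewrite Rabs_right; lra).
  assert (El : is_lim_seq e 0).
  { unfold e. replace (Finite 0) with (Rbar_mult r 0) by (simpl; f_equal; ring).
    apply is_lim_seq_scal_l. apply (is_lim_seq_incr_1 (fun n => (/ 2) ^ n)).
    apply is_lim_seq_geom. rewrite Rabs_right; lra. }
  assert (Ex : forall n, exists c : R * (R -> R) * (R -> R) * R,
    let '(p, x, y, T) := c in
    returning_path (cubic (at_parameter cf (e n))) (cubic (at_parameter cg (e n))) (e n) h x y T /\
    H (x T) (y T) = p /\ is_series (fun k => e n ^ S k * M (S k) h) (p - h)).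
  { intros n. destruct (Hret (e n)) as (p & Hp & Ser); [specialize (Ea n); lra|].
    destruct (first_return_path cf cg f g (e n) h p Ff Fg Hp) as (x & y & T & HP & HE).
    exists (p, x, y, T). split; [exact HP|split; [exact HE|exact Ser]]. }
  set (c := fun n => proj1_sig (constructive_indefinite_description _ (Ex n))).
  assert (Hc : forall n, let '(p, x, y, T) := c n in
    returning_path (cubic (at_parameter cf (e n))) (cubic (at_parameter cg (e n))) (e n) h x y T /\
    H (x T) (y T) = p /\ is_series (fun k => e n ^ S k * M (S k) h) (p - h)).
  { intros n. exact (proj2_sig (constructive_indefinite_description _ (Ex n))). }
  clearbody c.
  set (p := fun n => fst (fst (fst (c n)))). set (x := fun n => snd (fst (fst (c n)))).
  set (y := fun n => snd (fst (c n))). set (T := fun n => snd (c n)).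
  assert (Hc' : forall n,
    returning_path (cubic (at_parameter cf (e n))) (cubic (at_parameter cg (e n))) (e n) h (x n) (y n) (T n) /\
    H (x n (T n)) (y n (T n)) = p n /\ is_series (fun k => e n ^ S k * M (S k) h) (p n - h)).
  { intros n. specialize (Hc n). unfold p, x, y, T. destruct (c n) as [[[p' x'] y'] T']. exact Hc. }
  assert (Gf : forall n, cubic_growth (10 * K) (cubic (at_parameter cf (e n)))).
  { intros n. apply cubic_growth_of_bound; [exact K0|]. intros i j Hij.
    eapply Rle_trans; [apply (B1 (e n)); [specialize (Ea n); lra|exact Hij]|].
    unfold K. pose proof (Rle_abs K1). pose proof (Rabs_pos K2). lra. }
  assert (Gg : forall n, cubic_growth (10 * K) (cubic (at_parameter cg (e n)))).
  { intros n. apply cubic_growth_of_bound; [exact K0|]. intros i j Hij.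
    eapply Rle_trans; [apply (B2 (e n)); [specialize (Ea n); lra|exact Hij]|].
    unfold K. pose proof (Rle_abs K2). pose proof (Rabs_pos K1). lra. }
  assert (F1 : forall n, T n <= Tm /\ follows_oval (energyS h) 1 (T n) (x n) (y n)).
  { intros n. apply (Fol1 (cubic (at_parameter cf (e n))) (cubic (at_parameter cg (e n))) (e n));
      [apply path_continuous_cubic|apply path_continuous_cubic|apply Gf|apply Gg| |apply Hc'].
    specialize (Ea n). lra. }
  exists e, p, x, y, T, Tm. constructor.
  - intros n. specialize (E0 n). lra.
  - exact El.
  - intros n. apply Hc'.
  - intros n. apply Hc'.
  - intros n. apply F1.
  - intros eta Heta. destruct (Fol eta Heta) as (d & Hd & Fe).
    pose proof El as El'. apply is_lim_seq_spec in El'. destruct (El' (mkposreal d Hd)) as [N HN].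
    exists N. intros n Hn. specialize (HN n Hn). simpl in HN. rewrite Rminus_0_r in HN.
    apply (Fe (cubic (at_parameter cf (e n))) (cubic (at_parameter cg (e n))) (e n));
      [apply path_continuous_cubic|apply path_continuous_cubic|apply Gf|apply Gg|exact HN|apply Hc'].
  - intros n t Ht. destruct (F1 n) as [_ (th & w & _ & _ & Hth)]. apply rootH_gt1_inv, (Hth t Ht).
  - intros n. apply is_pseries_R. destruct (Hc' n) as (_ & _ & Ser).
    pose proof (is_series_scal (V := R_NormedModule) (/ e n) _ _ Ser) as S1.
    replace ((p n - h) / e n) with (scal (/ e n) (p n - h)) by (unfold scal; simpl; unfold mult; simpl; unfold Rdiv; ring).
    refine (is_series_ext _ _ _ _ S1). intros k. unfold scal. simpl. unfold mult. simpl.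
    field. specialize (E0 n). lra.
Qed.

Definition quadric (a b c x y : R) : R := a + b * x ^ 2 + c * y ^ 2.

Lemma avg_quadric h a b c : 0 < h ->
  avg (energyS h) (fun u => quadric a b c (xh (energyS h) u) (yh (energyS h) u) * yh (energyS h) u ^ 2)
  = a * mu (energyS h) 0 2 + b * mu (energyS h) 2 2 + c * mu (energyS h) 0 4.
Proof.
  intros Hh. pose proof (energyS_gt1 h Hh) as HS. set (S := energyS h) in *. unfold mu.
  assert (E1 : avg S (fun t => a * (xh S t ^ 0 * yh S t ^ 2) + b * (xh S t ^ 2 * yh S t ^ 2))
    = a * avg S (fun t => xh S t ^ 0 * yh S t ^ 2) + b * avg S (fun t => xh S t ^ 2 * yh S t ^ 2))
    by (apply (avg_lin2 S _ _ a b HS); intros t; apply continuous_monomial, HS).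
  rewrite <- E1.
  assert (E2 : avg S (fun t => 1 * (a * (xh S t ^ 0 * yh S t ^ 2) + b * (xh S t ^ 2 * yh S t ^ 2))
      + c * (xh S t ^ 0 * yh S t ^ 4))
    = 1 * avg S (fun t => a * (xh S t ^ 0 * yh S t ^ 2) + b * (xh S t ^ 2 * yh S t ^ 2))
      + c * avg S (fun t => xh S t ^ 0 * yh S t ^ 4)).
  { apply (avg_lin2 S (fun t => a * (xh S t ^ 0 * yh S t ^ 2) + b * (xh S t ^ 2 * yh S t ^ 2)) _ 1 c HS);
      intros t; [|apply continuous_monomial, HS].
    apply (continuous_plus (fun t => a * (xh S t ^ 0 * yh S t ^ 2)) (fun t => b * (xh S t ^ 2 * yh S t ^ 2)));
    apply continuous_scal_R, continuous_monomial, HS. }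
  rewrite Rmult_1_l in E2. rewrite <- E2.
  apply avg_ext. intros t. unfold quadric. ring.
Qed.

Section Expansion.
Variables (cf cg : nat -> nat -> R -> R) (a : nat -> R) (h : R).
Variables (e p : nat -> R) (x y : nat -> R -> R) (T : nat -> R) (Tm : R).
Hypothesis Hh : 0 < h.
Hypothesis Df : forall i j, (i + j <= 3)%nat -> ex_derive (cf i j) 0.
Hypothesis Dg : forall i j, (i + j <= 3)%nat -> ex_derive (cg i j) 0.
Hypothesis RS : return_sequence cf cg a h e p x y T Tm.

Let S0 := energyS h.
Let HS : 1 < S0 := energyS_gt1 h Hh.
Let f n := at_parameter cf (e n).
Let g n := at_parameter cg (e n).
Let f0 := at_parameter cf 0.
Let g0 := at_parameter cg 0.

Lemma coefficient_limit c : (forall i j, (i + j <= 3)%nat -> ex_derive (c i j) 0) ->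
  forall i j, (i + j <= 3)%nat -> is_lim_seq (fun n => at_parameter c (e n) i j) (at_parameter c 0 i j).
Proof.
  intros Dc i j Hij. apply (lim_of_ex_derive (c i j)); [apply Dc, Hij|apply (rs_small RS)].
Qed.

Lemma curl_ex_derive k l : (1 <= l)%nat -> (k + l <= 3)%nat ->
  ex_derive (fun e => curl (at_parameter cf e) (at_parameter cg e) k l) 0.
Proof.
  intros Hl Hkl. unfold curl, at_parameter.
  apply (ex_derive_plus (K := R_AbsRing) (V := R_NormedModule) (fun e => cg k l e)
    (fun e => cf (S k) (l - 1)%nat e * INR (S k) / INR l)); [apply Dg, Hkl|].
  apply (ex_derive_ext (fun e => (INR (S k) / INR l) * cf (S k) (l - 1)%nat e)).
  - intros t. as_R. unfold Rdiv. ring.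
  - apply ex_derive_scal. apply Df. lia.
Qed.

Lemma curl_limit k l : (1 <= l)%nat -> (k + l <= 3)%nat -> is_lim_seq (fun n => curl (f n) (g n) k l) (curl f0 g0 k l).
Proof.
  intros Hl Hkl. apply (lim_of_ex_derive (fun e => curl (at_parameter cf e) (at_parameter cg e) k l));
  [apply curl_ex_derive; assumption|apply (rs_small RS)].
Qed.

Lemma path_time n : 0 < T n <= Tm.
Proof. split; [apply (rs_path RS n)|apply (rs_time RS)]. Qed.

Lemma path_solution n : perturbed_solution (cubic (f n)) (cubic (g n)) (e n) (x n) (y n) (T n).
Proof. apply (rs_path RS n). Qed.

Lemma limit_average Om L : converges_to S0 Om L ->
  is_lim_seq (fun n => RInt (fun t => Om n (x n t) (y n t)) 0 (T n))
    (avg S0 (fun u => L (xh S0 u) (yh S0 u))).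
Proof.
  apply (average_limit S0 Tm x y T Om L HS).
  - pose proof (path_time 0). lra.
  - exact path_time.
  - intros n t Ht. exact (solution_continuous _ _ _ _ _ _ (path_solution n) t Ht).
  - exact (rs_near RS).
Qed.

Lemma converges_quadric (k0 k1 k2 : nat -> R) (l0 l1 l2 : R) :
  is_lim_seq k0 l0 -> is_lim_seq k1 l1 -> is_lim_seq k2 l2 ->
  converges_to S0 (fun n x y => quadric (k0 n) (k1 n) (k2 n) x y * (y * (y + e n * cubic (f n) x y)))
    (fun x y => quadric l0 l1 l2 x y * y ^ 2).
Proof.
  intros H0 H1 H2.
  pose proof (converges_x S0 HS) as X. pose proof (converges_y S0 HS) as Y.
  pose proof (converges_cubic S0 f f0 HS (coefficient_limit cf Df)) as F.
  assert (L : converges_to S0 (fun n x y => quadric (k0 n) (k1 n) (k2 n) x y) (quadric l0 l1 l2)).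
  { exact (converges_plus _ _ _ _ _ (converges_plus _ _ _ _ _ (converges_const S0 k0 l0 H0)
      (converges_mult _ _ _ _ _ (converges_const S0 k1 l1 H1) (converges_pow _ _ _ 2 X)))
      (converges_mult _ _ _ _ _ (converges_const S0 k2 l2 H2) (converges_pow _ _ _ 2 Y))). }
  replace (fun x y => quadric l0 l1 l2 x y * y ^ 2) with
    (fun x y => quadric l0 l1 l2 x y * (y * (y + 0 * cubic f0 x y)))
    by (do 2 (apply functional_extensionality; intro); ring).
  exact (converges_mult _ _ _ _ _ L (converges_mult _ _ _ _ _ Y (converges_plus _ _ _ _ _ Y
    (converges_mult _ _ _ _ _ (converges_const S0 e 0 (rs_small RS)) F)))).
Qed.

Lemma converges_weighted_rate :
  converges_to S0 (fun n => weighted_rate (f n) (g n)) (weighted_rate f0 g0).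
Proof.
  pose proof (converges_x S0 HS) as X. pose proof (converges_y S0 HS) as Y.
  pose proof (converges_phase S0 HS) as P.
  pose proof (converges_cubic S0 f f0 HS (coefficient_limit cf Df)) as F.
  pose proof (converges_cubic S0 g g0 HS (coefficient_limit cg Dg)) as G.
  pose proof (converges_const S0 _ _ (curl_limit 0 2 ltac:(lia) ltac:(lia))) as K02.
  pose proof (converges_const S0 _ _ (curl_limit 1 2 ltac:(lia) ltac:(lia))) as K12.
  assert (K11 : converges_to S0 (fun n _ _ => curl (f n) (g n) 1 1 / sqrt 2) (fun _ _ => curl f0 g0 1 1 / sqrt 2)).
  { apply (converges_const S0 (fun n => curl (f n) (g n) 1 1 / sqrt 2)).
    apply (is_lim_seq_scal_r _ (/ sqrt 2) (curl f0 g0 1 1)), curl_limit; lia. }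
  apply (converges_mult S0 (fun n => energy_rate (cubic (f n)) (cubic (g n))) _ (fun n => weight (f n) (g n))).
  - exact (converges_plus _ _ _ _ _ (converges_mult _ _ _ _ _
      (converges_minus _ _ _ _ _ (converges_pow _ _ _ 3 X) X) F) (converges_mult _ _ _ _ _ Y G)).
  - exact (converges_minus _ _ _ _ _ (converges_plus _ _ _ _ _
      (converges_mult _ _ _ _ _ (converges_scal _ 2 _ _ K02) X)
      (converges_mult _ _ _ _ _ K12 (converges_pow _ _ _ 2 X))) (converges_mult _ _ _ _ _ K11 P)).
Qed.

Let quotient n := (p n - h) / e n.
Let boundary n := primitive (f n) (g n) (x n (T n)) (y n (T n)) - primitive (f n) (g n) (x n 0) (y n 0).
Let essential_part n := RInt (fun t => flow_essential (f n) (g n) (e n) (x n t) (y n t)) 0 (T n).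
Let weighted_part n := RInt (fun t => weighted_rate (f n) (g n) (x n t) (y n t)) 0 (T n).

Lemma quotient_decomposition n : quotient n = boundary n + essential_part n - e n * weighted_part n.
Proof.
  pose proof (rs_nonzero RS n) as En. pose proof (path_time n) as Tn.
  pose proof (rs_level RS n) as Pos.
  destruct (rs_path RS n) as (_ & Sol & _ & E0 & _).
  unfold boundary, essential_part, weighted_part.
  rewrite <- (rate_decomposition (f n) (g n) (e n) (T n) (x n) (y n) ltac:(lra) Sol Pos).
  pose proof (displacement_rate (f n) (g n) (e n) (T n) (x n) (y n) ltac:(lra) Sol Pos) as D.
  rewrite E0, (rs_end RS n) in D. unfold quotient. rewrite D. field. exact En.
Qed.

Lemma quotient_limits :
  is_lim_seq quotient (a 0%nat) /\ is_lim_seq (fun n => (quotient n - a 0%nat) / e n) (a 1%nat).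
Proof.
  apply pseries_limits.
  - apply (rs_small RS).
  - apply (rs_nonzero RS).
  - apply (rs_series RS).
Qed.

(** The end points lie on the section, where the displacement controls the increment of [primitive]. *)
Lemma boundary_negligible r : is_lim_seq (fun n => (p n - h) / r n) 0 -> is_lim_seq (fun n => p n - h) 0 ->
  is_lim_seq (fun n => boundary n / r n) 0.
Proof.
  intros Hr Hp. set (y0 := sqrt (2 * h)).
  assert (Y0 : 0 < y0) by (apply sqrt_lt_R0; lra).
  assert (Start : forall n, x n 0 = 0 /\ y n 0 = y0 /\ x n (T n) = 0 /\ 0 < y n (T n) /\
    y n (T n) ^ 2 = 2 * p n).
  { intros n. pose proof (rs_end RS n) as E1.
    destruct (rs_path RS n) as (_ & _ & [X0 P0] & E0 & [XT PT] & _).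
    rewrite X0 in E0. rewrite XT in E1. unfold H in E0, E1. split; [exact X0|]. split; [|split; [exact XT|split; [exact PT|lra]]].
    unfold y0. rewrite <- E0. replace (2 * (y n 0 ^ 2 / 2 - 0 ^ 2 / 2 + 0 ^ 4 / 4)) with (y n 0 ^ 2) by field.
    rewrite sqrt_pow2; lra. }
  assert (Sq : y0 ^ 2 = 2 * h) by (apply pow2_sqrt; lra).
  assert (Bd : forall n, Rabs (y n (T n) - y0) <= 2 / y0 * Rabs (p n - h)).
  { intros n. destruct (Start n) as (_ & _ & _ & P & Q).
    assert (E : (y n (T n) - y0) * (y n (T n) + y0) = 2 * (p n - h)) by nra.
    apply (Rmult_le_reg_r y0); [exact Y0|].
    replace (2 / y0 * Rabs (p n - h) * y0) with (Rabs (2 * (p n - h)))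
      by (rewrite Rabs_mult, (Rabs_right 2) by lra; field; lra).
    rewrite <- E, Rabs_mult, (Rabs_right (y n (T n) + y0)) by lra.
    apply Rmult_le_compat_l; [apply Rabs_pos|lra]. }
  assert (Squeeze : forall s, is_lim_seq (fun n => (p n - h) / s n) 0 -> is_lim_seq (fun n => (y n (T n) - y0) / s n) 0).
  { intros s Hs. apply is_lim_seq_abs_0.
    apply (is_lim_seq_le_le (fun _ => 0) _ (fun n => 2 / y0 * Rabs ((p n - h) / s n))).
    - intros n. split; [apply Rabs_pos|]. unfold Rdiv at 1 3. rewrite !Rabs_mult, <- Rmult_assoc.
      apply Rmult_le_compat_r; [apply Rabs_pos|apply Bd].
    - apply is_lim_seq_const.
    - replace (Finite 0) with (Rbar_mult (2 / y0) (Rbar_abs 0)) by (simpl; f_equal; rewrite Rabs_R0; ring).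
      apply is_lim_seq_scal_l, is_lim_seq_abs, Hs. }
  assert (Ly : is_lim_seq (fun n => y n (T n)) y0).
  { apply (is_lim_seq_ext (fun n => (y n (T n) - y0) / 1 + y0)); [intros n; field|].
    replace (Finite y0) with (Finite (0 + y0)) by (f_equal; ring).
    apply is_lim_seq_plus'; [|apply is_lim_seq_const].
    apply (Squeeze (fun _ => 1)). apply (is_lim_seq_ext (fun n => p n - h)); [intros n; field|exact Hp]. }
  apply (is_lim_seq_ext (fun n => (primitive (f n) (g n) 0 (y n (T n)) - primitive (f n) (g n) 0 y0) / r n)).
  - intros n. destruct (Start n) as (X0 & E0 & XT & _). unfold boundary. rewrite X0, XT, E0. reflexivity.
  - apply (primitive_increment f g f0 g0 y0 (fun n => y n (T n)) r Y0
      (coefficient_limit cf Df) (coefficient_limit cg Dg) Ly), Squeeze, Hr.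
Qed.

Lemma displacement_small : is_lim_seq (fun n => p n - h) 0.
Proof.
  apply (is_lim_seq_ext (fun n => e n * quotient n)).
  - intros n. unfold quotient. field. apply (rs_nonzero RS).
  - replace (Finite 0) with (Finite (0 * a 0%nat)) by (f_equal; ring).
    apply is_lim_seq_mult'; [apply (rs_small RS)|apply quotient_limits].
Qed.

(** As the displacement tends to zero, so does the increment of [primitive]. *)
Lemma first_order_term :
  a 0%nat = curl f0 g0 0 1 * mu S0 0 2 + curl f0 g0 2 1 * mu S0 2 2 + curl f0 g0 0 3 * mu S0 0 4.
Proof.
  assert (L : is_lim_seq quotient (0 + avg S0 (fun u =>
    quadric (curl f0 g0 0 1) (curl f0 g0 2 1) (curl f0 g0 0 3) (xh S0 u) (yh S0 u) * yh S0 u ^ 2)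
    - 0 * avg S0 (fun u => weighted_rate f0 g0 (xh S0 u) (yh S0 u)))).
  { apply (is_lim_seq_ext (fun n => boundary n + essential_part n - e n * weighted_part n));
      [intros n; symmetry; apply quotient_decomposition|].
    apply is_lim_seq_minus'; [apply is_lim_seq_plus'|apply is_lim_seq_mult'].
    - apply (is_lim_seq_ext (fun n => boundary n / 1)); [intros n; field|].
      apply (boundary_negligible (fun _ => 1)); [|apply displacement_small].
      apply (is_lim_seq_ext (fun n => p n - h)); [intros n; field|apply displacement_small].
    - apply (limit_average _ _ (converges_quadric _ _ _ _ _ _ (curl_limit 0 1 ltac:(lia) ltac:(lia))
        (curl_limit 2 1 ltac:(lia) ltac:(lia)) (curl_limit 0 3 ltac:(lia) ltac:(lia)))).
    - apply (rs_small RS).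
    - apply (limit_average _ _ converges_weighted_rate). }
  pose proof (is_lim_seq_unique _ _ L) as U. rewrite (is_lim_seq_unique _ _ (proj1 quotient_limits)) in U.
  injection U as U. rewrite U. unfold S0. rewrite avg_quadric by exact Hh. ring.
Qed.

Let slope k l := Derive (fun e => curl (at_parameter cf e) (at_parameter cg e) k l) 0.

(** When the first order vanishes, the displacement is [O (e ^ 2)] and the increment of [primitive] does not contribute; the essential coefficients, zero at [e = 0], contribute their derivatives. *)
Lemma second_order_term : a 0%nat = 0 ->
  curl f0 g0 0 1 = 0 -> curl f0 g0 2 1 = 0 -> curl f0 g0 0 3 = 0 ->
  a 1%nat = slope 0 1 * mu S0 0 2 + slope 2 1 * mu S0 2 2 + slope 0 3 * mu S0 0 4
    - avg S0 (fun u => weighted_rate f0 g0 (xh S0 u) (yh S0 u)).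
Proof.
  intros A0 K01 K21 K03.
  assert (Quot : is_lim_seq (fun n => quotient n / e n) (a 1%nat)).
  { apply (is_lim_seq_ext (fun n => (quotient n - a 0%nat) / e n)); [|apply quotient_limits].
    intros n. rewrite A0, Rminus_0_r. reflexivity. }
  assert (Slope : forall k l, (1 <= l)%nat -> (k + l <= 3)%nat -> curl f0 g0 k l = 0 ->
    is_lim_seq (fun n => curl (f n) (g n) k l / e n) (slope k l)).
  { intros k l Hl Hkl Z.
    apply (is_lim_seq_ext (fun n => (curl (f n) (g n) k l - curl f0 g0 k l) / e n)).
    - intros n. rewrite Z, Rminus_0_r. reflexivity.
    - apply (difference_quotient (fun e => curl (at_parameter cf e) (at_parameter cg e) k l));
      [apply Derive_correct, curl_ex_derive; assumption|apply (rs_small RS)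
      |apply (rs_nonzero RS)]. }
  assert (L : is_lim_seq (fun n => quotient n / e n) (0 + avg S0 (fun u =>
    quadric (slope 0 1) (slope 2 1) (slope 0 3) (xh S0 u) (yh S0 u) * yh S0 u ^ 2)
    - avg S0 (fun u => weighted_rate f0 g0 (xh S0 u) (yh S0 u)))).
  { set (part := fun n => RInt (fun t =>
      quadric (curl (f n) (g n) 0 1 / e n) (curl (f n) (g n) 2 1 / e n) (curl (f n) (g n) 0 3 / e n)
        (x n t) (y n t) * (y n t * (y n t + e n * cubic (f n) (x n t) (y n t)))) 0 (T n)).
    apply (is_lim_seq_ext (fun n => boundary n / e n + part n - weighted_part n)).
    - intros n. rewrite quotient_decomposition.
      pose proof (rs_nonzero RS n) as En.
      assert (P : part n = / e n * essential_part n).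
      { pose proof (path_time n) as Tn.
        pose proof (is_RInt_along (f n) (g n) (e n) (T n) (x n) (y n) ltac:(lra) (path_solution n)
          (rs_level RS n) _ (path_continuous_flow_essential (f n) (g n) (e n))) as J.
        apply (is_RInt_unique (V := R_CompleteNormedModule)).
        refine (is_RInt_ext _ _ _ _ _ _ (is_RInt_scal (V := R_NormedModule) _ _ _ (/ e n) _ J)).
        intros t _. unfold scal, flow_essential, essential, quadric. simpl. unfold mult. simpl.
        field. exact En. }
      rewrite P. field. exact En.
    - apply is_lim_seq_minus'; [apply is_lim_seq_plus'|].
      + apply boundary_negligible; [|apply displacement_small].
        rewrite <- A0. apply quotient_limits.
      + apply (limit_average _ _ (converges_quadric _ _ _ _ _ _ (Slope 0%nat 1%nat ltac:(lia) ltac:(lia) K01)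
          (Slope 2%nat 1%nat ltac:(lia) ltac:(lia) K21) (Slope 0%nat 3%nat ltac:(lia) ltac:(lia) K03))).
      + apply (limit_average _ _ converges_weighted_rate). }
  pose proof (is_lim_seq_unique _ _ L) as U. rewrite (is_lim_seq_unique _ _ Quot) in U.
  injection U as U. rewrite U. unfold S0. rewrite avg_quadric by exact Hh. ring.
Qed.
End Expansion.

(** The vanishing of the first Melnikov function at all levels forces the three essential coefficients to vanish at [e = 0], by independence of their integrals; then [second_order_term] gives a sum of averages of monomials. *)
Lemma second_melnikov_in_module f g M : cubic_perturbation f -> cubic_perturbation g ->
  melnikov_functions f g M -> (forall h, 0 < h -> M 1%nat h = 0) -> in_period_module (M 2%nat).
Proof.
  intros Hf Hg HM HM1.
  destruct (cubic_family_exists f Hf) as [cf Ff]. destruct (cubic_family_exists g Hg) as [cg Fg].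
  set (f0 := at_parameter cf 0). set (g0 := at_parameter cg 0).
  destruct (first_order_independent (curl f0 g0 0 1) (curl f0 g0 2 1) (curl f0 g0 0 3)) as (K01 & K21 & K03).
  { intros h Hh.
    destruct (return_sequence_exists cf cg f g M h Ff Fg HM Hh) as (e & p & x & y & T & Tm & RS).
    rewrite <- (HM1 h Hh). symmetry.
    exact (first_order_term cf cg _ h e p x y T Tm Hh (proj1 Ff) (proj1 Fg) RS). }
  set (slope := fun k l => Derive (fun e => curl (at_parameter cf e) (at_parameter cg e) k l) 0).
  apply (in_module_ext (fun h => (slope 0%nat 1%nat * mu (energyS h) 0 2 + slope 2%nat 1%nat * mu (energyS h) 2 2)
    + (slope 0%nat 3%nat * mu (energyS h) 0 4
       + -1 * avg (energyS h) (fun u => weighted_rate f0 g0 (xh (energyS h) u) (yh (energyS h) u))))).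
  - intros h Hh.
    destruct (return_sequence_exists cf cg f g M h Ff Fg HM Hh) as (e & p & x & y & T & Tm & RS).
    rewrite (second_order_term cf cg _ h e p x y T Tm Hh (proj1 Ff) (proj1 Fg) RS (HM1 h Hh) K01 K21 K03).
    unfold slope, f0, g0. ring.
  - apply in_module_plus; apply in_module_plus; apply in_module_scal.
    + exact in_module_mu02.
    + exact in_module_mu22.
    + exact in_module_mu04.
    + apply (period_observable_weighted_rate f0 g0).
Qed.

Theorem lemma6
  (f g : R -> R -> R -> R)
  (Hf : cubic_perturbation f) (Hg : cubic_perturbation g)
  (M : nat -> R -> R) (HM : melnikov_functions f g M)
  (HM1 : forall h : R, 0 < h -> M 1%nat h = 0)
  (I : nat -> R -> R)
  (HI : forall (i : nat) (h : R), 0 < h -> is_oval_integral i h (I i h))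
  (alpha0 alpha1 alpha2 beta0 beta1 : R)
  (HM2 : forall h : R, 0 < h ->
     M 2%nat h =
       / (4 * h + 1) *
         ((alpha0 + 4 * alpha1 * h + alpha2 * h ^ 2) * I 0%nat h
          + (beta0 + 4 * h * beta1) * I 2%nat h))
  (HM2nz : exists h : R, 0 < h /\ M 2%nat h <> 0)
  (F : C -> C) (HF : analytic_continuation (M 2%nat) F) :
  at_most_zeros 4 slit_plane F.
Proof.
  destruct (in_period_module_form (M 2%nat)) as (p0 & p1 & v0 & v1 & v2 & Form).
  - apply (second_melnikov_in_module f g M); assumption.
  - exact (period_form_zeros p0 p1 v0 v1 v2 (M 2%nat) F Form HM2nz HF).
Qed.
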